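(* Let $f\in H_{3/2-k,\overline\rho}$, let $W_1,W_2$ be two adjacent Weyl chambers (connected components of $\mathbb{H}\setminus Z'_{\Delta,r}(f)$ sharing a wall), put $W_{12}=\overline{W_1}\cap\overline{W_2}$, and let $\Phi_{W_1}(z)$, $\Phi_{W_2}(z)$ denote the restrictions of $\Phi_{\Delta,r,k}(z,f)$ to $W_1$, $W_2$, each extended to a real analytic function on $\overline{W_1}\cup\overline{W_2}$. Then $$\Phi_{W_1}(z)-\Phi_{W_2}(z)=2\sqrt{2|\Delta|}\sum_{h\in L'/L}\ \sum_{\substack{m\in\mathbb{Z}-\mathrm{sgn}(\Delta)Q(h)\\ m<0}}c^+(m,h)\sum_{\substack{\lambda\in L+rh,\ Q(\lambda)=-|\Delta|m\\ \lambda\perp W_{12},\ (\lambda,W_1)<0}}\chi_\Delta(\lambda)\,q_z(\lambda)^{k-1}.$$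
   Context: **Lattice.** $e(x)=e^{2\pi i x}$; $\tau=u+iv$, $z=x+iy$ in the upper half plane $\mathbb{H}$; $N\ge1$, $k\ge1$ integers. $V=\{\lambda\in M_2(\mathbb{Q}):\mathrm{tr}\,\lambda=0\}$, $Q(\lambda)=-N\det\lambda$, $(\lambda,\mu)=N\,\mathrm{tr}(\lambda\mu)$ (signature $(2,1)$). $L=\left\{\begin{pmatrix}b&-a/N\\c&-b\end{pmatrix}:a,b,c\in\mathbb{Z}\right\}$, $L'=\left\{\begin{pmatrix}b/2N&-a/N\\c&-b/2N\end{pmatrix}:a,b,c\in\mathbb{Z}\right\}$, $L'/L\cong\mathbb{Z}/2N\mathbb{Z}$. $\mathfrak{e}_h$ is the standard basis of $\mathbb{C}[L'/L]$, with Hermitian product $\langle\cdot,\cdot\rangle$ (linear in the first slot) making it orthonormal. A point $z\in\mathbb{H}$ is identified with the negative vector $\lambda(z)=\frac1{\sqrt{2N}\,y}\begin{pmatrix}-x&x^2+y^2\\-1&x\end{pmatrix}$, $(\lambda(z),\lambda(z))=-1$; ''$\lambda\perp W_{12}$'' means $(\lambda,\lambda(w))=0$ for all $w\in W_{12}$ and ''$(\lambda,W_1)<0$'' means $(\lambda,\lambda(w))<0$ for all $w\in W_1$. **Genus character.** $\Delta$ is a fundamental discriminant ($\Delta=1$ allowed), $r\in\mathbb{Z}$ with $\Delta\equiv r^2\pmod{4N}$. For $\lambda=\begin{pmatrix}b/2N&-a/N\\c&-b/2N\end{pmatrix}\in L'$, $\chi_\Delta(\lambda)=\left(\frac{\Delta}{n}\right)$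 if $4NQ(\lambda)/\Delta$ is an integer congruent to a square mod $4N$ and $\gcd(a,b,c,\Delta)=1$, where $n$ is any integer coprime to $\Delta$ represented by a form $N_1aX^2+bXY+N_2cY^2$ with $N_1N_2=N$, $N_1,N_2>0$; otherwise $\chi_\Delta(\lambda)=0$. **Weil representation and harmonic Maass forms.** $\mathrm{Mp}_2(\mathbb{R})$ consists of pairs $(\gamma,\phi)$, $\gamma=\begin{pmatrix}a&b\\c&d\end{pmatrix}\in\mathrm{SL}_2(\mathbb{R})$, $\phi$ holomorphic on $\mathbb{H}$ with $\phi(\tau)^2=c\tau+d$; $\tilde\Gamma$ is the preimage of $\mathrm{SL}_2(\mathbb{Z})$. $\rho_L$ is the representation of $\tilde\Gamma$ on $\mathbb{C}[L'/L]$ with $\rho_L(T)\mathfrak{e}_h=e(Q(h))\mathfrak{e}_h$, $\rho_L(S)\mathfrak{e}_h=\frac{e(-1/8)}{\sqrt{2N}}\sum_{h'}e(-(h,h'))\mathfrak{e}_{h'}$, $T=\left(\begin{pmatrix}1&1\\0&1\end{pmatrix},1\right)$, $S=\left(\begin{pmatrix}0&-1\\1&0\end{pmatrix},\sqrt\tau\right)$. $\rho=\rho_L$ if $\Delta>0$, $\rho=\overline{\rho}_L$ if $\Delta<0$. With $\Delta_\kappa=-v^2(\partial_u^2+\partial_v^2)+i\kappa v(\partial_u+i\partial_v)$, $H_{\kappa,\overline\rho}$ is the space of smooth $f:\mathbb{H}\to\mathbb{C}[L'/L]$ with $f(\gamma\tau)=\phi(\tau)^{2\kappa}\overline\rho(\gamma,\phi)f(\tau)$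 for $(\gamma,\phi)\in\tilde\Gamma$, $\Delta_\kappa f=0$, $f=O(e^{Cv})$ as $v\to\infty$, and $f-P_f=O(e^{-\epsilon v})$ for some $\epsilon>0$ and a finite sum $P_f=\sum_h\sum_{m\le0}c^+(m,h)e(m\tau)\mathfrak{e}_h$ (with $m\in\mathbb{Z}-\mathrm{sgn}(\Delta)Q(h)$). **Kernel and lift.** $p_z(\lambda)=-(\lambda,\lambda(z))=\frac{-1}{\sqrt{2N}\,y}(cN|z|^2-bx+a)$, $q_z(\lambda)=\frac{-1}{\sqrt{2N}}(cNz^2-bz+a)$, $Q_z(\lambda)=Q(\lambda)+p_z(\lambda)^2$, $$\Theta_{\Delta,r,k}(\tau,z)=v^{3/2}\sum_{h}\ \sum_{\substack{\lambda\in L+rh\\ Q(\lambda)\equiv\Delta Q(h)\,(\Delta)}}\chi_\Delta(\lambda)p_z(\lambda)q_z(\lambda)^{k-1}e\left(\tfrac{Q(\lambda)}{|\Delta|}u+\tfrac{Q_z(\lambda)}{|\Delta|}iv\right)\mathfrak{e}_h,$$ $\Phi_{\Delta,r,k}(z,f)=\lim_{t\to\infty}\int_{\mathcal{F}_t}\langle f(\tau),\overline{\Theta_{\Delta,r,k}(\tau,z)}\rangle\frac{du\,dv}{v^2}$, $\mathcal{F}_t=\{\tau:|u|\le\frac12,|\tau|\ge1,v\le t\}$. **Exceptional set.** $D_\lambda=\{z\in\mathbb{H}:cN|z|^2-bx+a=0\}$ for $Q(\lambda)>0$; $Z'_{\Delta,r}(f)$ is the union of all $D_\lambda$ with $\lambda\in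 L+rh$, $Q(\lambda)=-|\Delta|m$, $h\in L'/L$, $m\in\mathbb{Z}-\mathrm{sgn}(\Delta)Q(h)$, $m<0$, $c^+(m,h)\ne0$, $\chi_\Delta(\lambda)\ne0$. *)

(* Defs.v *)
From HB Require Import structures.
From mathcomp Require Import all_boot all_order all_algebra.
From mathcomp Require Import complex.
From mathcomp Require Import all_classical all_reals all_analysis.
From mathcomp.analysis.showcase Require summability.
Set Implicit Arguments.
Unset Strict Implicit.
Unset Printing Implicit Defensive.
Import Order.TTheory GRing.Theory Num.Theory.
Import numFieldNormedType.Exports.
Local Open Scope classical_set_scope.
Local Open Scope ring_scope.
Local Open Scope complex_scope.

(* The modulus topology on R[i]. *)
HB.instance Definition _ (R : realType) := NormedModule.copy R[i] R[i]^o.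

Definition mx2 {A : Type} (a b c d : A) : 'M[A]_2 :=
  \matrix_(i < 2, j < 2)
    if i == 0 then (if j == 0 then a else b) else (if j == 0 then c else d).

Definition kronecker_prime (a : int) (p : nat) : int :=
  if p == 2%N then
    if (2 %| a)%Z then 0
    else if ((a %% 8)%Z == 1) || ((a %% 8)%Z == 7) then 1 else -1
  else
    if (p%:Z %| a)%Z then 0
    else if [exists x : 'I_p, (x%:Z ^+ 2 == a %[mod p%:Z])%Z] then 1 else -1.

Definition kronecker (a n : int) : int :=
  if n == 0 then (if `|a|%N == 1%N then 1 else 0)
  else (if (n < 0) && (a < 0) then -1 else 1)
       * \prod_(p <- primes `|n|%N) kronecker_prime a p ^+ logn p `|n|%N.

Definition squarefree (m : int) : Prop :=
  forall d : nat, ((d ^ 2)%N%:Z %| m)%Z -> d = 1%N.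

(* 1 is included. *)
Definition fundamental_discriminant (Delta : int) : Prop :=
  ((Delta = 1 %[mod 4])%Z /\ squarefree Delta) \/
  (exists m : int, [/\ Delta = 4 * m,
     (m = 2 %[mod 4])%Z \/ (m = 3 %[mod 4])%Z & squarefree m]).

Section Lattice.
Variable N : nat.

(* (lambda, mu), over any commutative ring: used on M_2(Q) and M_2(R). *)
Definition bil {F : comNzRingType} (A B : 'M[F]_2) : F := N%:R * \tr (A *m B).

Definition Q (l : 'M[rat]_2) : rat := - N%:R * \det l.

Definition lattice_L : set 'M[rat]_2 :=
  [set l | exists a b c : int,
     l = mx2 b%:~R (- a%:~R / N%:R) c%:~R (- b%:~R)].

(* L'/L is indexed by 'I_(2 * N): h stands for the class of
   diag(h/2N, -h/2N), of which [rep h] is the chosen representative.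
   The functions of h below that need it depend only on this class. *)
Definition rep (h : 'I_(2 * N)) : 'M[rat]_2 :=
  mx2 (h%:R / (2 * N)%:R) 0 0 (- (h%:R / (2 * N)%:R)).

(* L + rh *)
Definition lattice_coset (r : int) (h : 'I_(2 * N)) : set 'M[rat]_2 :=
  [set l | lattice_L (l - r%:~R *: rep h)].

(* The coordinates of lambda = (b/2N, -a/N; c, -b/2N); integers on L'. *)
Definition coef_a (l : 'M[rat]_2) : rat := - N%:R * l 0 1.
Definition coef_b (l : 'M[rat]_2) : rat := (2 * N)%:R * l 0 0.
Definition coef_c (l : 'M[rat]_2) : rat := l 1 0.

Definition genus_represented (a b c n : int) : Prop :=
  exists N1 N2 : nat, exists X Y : int,
    [/\ (0 < N1)%N, (0 < N2)%N, (N1 * N2)%N = N &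
        n = N1%:Z * a * X ^+ 2 + b * X * Y + N2%:Z * c * Y ^+ 2].

(* The genus character, for l in L'; [xget] picks one admissible n (the symbol
   does not depend on the choice). *)
Definition genus_character (Delta : int) (l : 'M[rat]_2) : int :=
  let a := numq (coef_a l) in
  let b := numq (coef_b l) in
  let c := numq (coef_c l) in
  if `[< (exists m s : int, (4 * N)%:R * Q l / Delta%:~R = m%:~R /\
                            (m = s ^+ 2 %[mod (4 * N)%:Z])%Z) /\
         gcdz (gcdz (gcdz a b) c) Delta = 1 >]
  then kronecker Delta
         (xget 0 [set n | coprimez n Delta /\ genus_represented a b c n])
  else 0.

(* Z - sgn(Delta) Q(h) *)
Definition exponents (Delta : int) (h : 'I_(2 * N)) : set rat :=
  [set m | m + (sgz Delta)%:~R * Q (rep h) \is a Num.int].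

End Lattice.

Section ComplexAnalysis.
Variable R : realType.
Local Notation C := R[i].

Definition upper_half_plane : set C := [set z | 0 < complex.Im z].

(* e(x) = exp(2 pi i x) *)
Definition ec (x : C) : C :=
  (expR (- (2 * pi * complex.Im x)))%:C
  * (cos (2 * pi * complex.Re x) +i* sin (2 * pi * complex.Re x)).

Definition partial_u (g : C -> C) (tau : C) : C :=
  derive1 (fun s : R => complex.Re (g (s +i* complex.Im tau))) (complex.Re tau)
  +i* derive1 (fun s : R => complex.Im (g (s +i* complex.Im tau))) (complex.Re tau).

Definition partial_v (g : C -> C) (tau : C) : C :=
  derive1 (fun s : R => complex.Re (g (complex.Re tau +i* s))) (complex.Im tau)
  +i* derive1 (fun s : R => complex.Im (g (complex.Re tau +i* s))) (complex.Im tau).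

Definition has_partials (g : C -> C) (tau : C) : Prop :=
  [/\ derivable (fun s : R => complex.Re (g (s +i* complex.Im tau))) (complex.Re tau) 1,
      derivable (fun s : R => complex.Im (g (s +i* complex.Im tau))) (complex.Re tau) 1,
      derivable (fun s : R => complex.Re (g (complex.Re tau +i* s))) (complex.Im tau) 1 &
      derivable (fun s : R => complex.Im (g (complex.Re tau +i* s))) (complex.Im tau) 1].

(* Class C^n on H, as a function of the two real variables u, v. *)
Fixpoint class_C (n : nat) (g : C -> C) : Prop :=
  (forall tau, upper_half_plane tau -> {for tau, continuous g}) /\
  (if n is m.+1 then
     [/\ forall tau, upper_half_plane tau -> has_partials g tau,
         class_C m (partial_u g) & class_C m (partial_v g)]
   else True).

Definition smooth (g : C -> C) : Prop := forall n, class_C n g.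

(* Delta_kappa = -v^2 (d_u^2 + d_v^2) + i kappa v (d_u + i d_v) *)
Definition laplacian (kappa : R) (g : C -> C) (tau : C) : C :=
  - (complex.Im tau ^+ 2)%:C
    * (partial_u (partial_u g) tau + partial_v (partial_v g) tau)
  + 'i * kappa%:C * (complex.Im tau)%:C
    * (partial_u g tau + 'i * partial_v g tau).

(* g has an (unconditionally, hence absolutely) convergent power series
   expansion in x, y on a full neighbourhood of z0 = x0 + i y0. *)
Definition real_analytic_at (g : C -> C) (z0 : C) : Prop :=
  exists a : nat * nat -> C, \forall z \near z0,
    summability.partial_sum
      (fun ij : nat * nat => a ij
         * ((complex.Re z - complex.Re z0) ^+ ij.1
            * (complex.Im z - complex.Im z0) ^+ ij.2)%:C)
      @ summability.totally --> g z.

Definition real_analytic_on (A : set C) (g : C -> C) : Prop :=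
  forall z, A z -> real_analytic_at g z.

Definition cintegral (A : set (R * R)) (g : R * R -> C) : C :=
  (\int[(lebesgue_measure \x lebesgue_measure)%E]_(x in A) complex.Re (g x))%R
  +i* (\int[(lebesgue_measure \x lebesgue_measure)%E]_(x in A) complex.Im (g x))%R.

(* The Hermitian product on C[L'/L], linear in the first slot. *)
Definition herm (n : nat) (x y : 'cV[C]_n) : C :=
  \sum_(h < n) x h 0 * (y h 0)^*.

Definition automorphy (g : 'M[int]_2) (tau : C) : C :=
  (g 1 0)%:~R * tau + (g 1 1)%:~R.

Definition moebius (g : 'M[int]_2) (tau : C) : C :=
  ((g 0 0)%:~R * tau + (g 0 1)%:~R) / automorphy g tau.

(* (g, phi) belongs to the preimage of SL_2(Z) in Mp_2(R); only the values of
   phi on the upper half plane are relevant. *)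
Definition metaplectic (g : 'M[int]_2) (phi : C -> C) : Prop :=
  [/\ \det g = 1,
      forall tau, upper_half_plane tau -> derivable phi tau 1 &
      forall tau, upper_half_plane tau -> phi tau ^+ 2 = automorphy g tau].

Section Forms.
Variable N : nat.

Definition basis_vector (h : 'I_(2 * N)) : 'cV[C]_(2 * N) := delta_mx h 0.

(* rho is the representation rho_L; it is determined by these properties, as
   S and T generate. [sqrtC] is the principal root on the upper half plane. *)
Definition weil_representation
    (rho : 'M[int]_2 -> (C -> C) -> 'M[C]_(2 * N)) : Prop :=
  [/\ forall g phi1 phi2, metaplectic g phi1 -> metaplectic g phi2 ->
        {in upper_half_plane, phi1 =1 phi2} -> rho g phi1 = rho g phi2,
      forall g1 phi1 g2 phi2, metaplectic g1 phi1 -> metaplectic g2 phi2 ->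
        rho (g1 *m g2) (fun tau => phi1 (moebius g2 tau) * phi2 tau)
        = rho g1 phi1 *m rho g2 phi2,
      forall h, rho (mx2 1 1 0 1) (fun=> 1) *m basis_vector h
        = ec (ratr (Q N (rep h))) *: basis_vector h &
      forall h, rho (mx2 0 (-1) 1 0) (fun tau => sqrtC tau) *m basis_vector h
        = (ec (- (1 / 8)) / (Num.sqrt (2 * N)%:R : R)%:C)
          *: \sum_(h' < 2 * N)
               ec (- ratr (bil N (rep h) (rep h'))) *: basis_vector h'].

(* rho = rho_L if Delta > 0, the complex conjugate of rho_L if Delta < 0. *)
Definition rho_Delta (Delta : int)
    (rhoL : 'M[int]_2 -> (C -> C) -> 'M[C]_(2 * N)) g phi : 'M[C]_(2 * N) :=
  if 0 < Delta then rhoL g phi else map_mx Num.conj (rhoL g phi).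

(* c m h are the coefficients c^+(m, h) of P_f. The bound is uniform in u. *)
Definition principal_part (Delta : int) (f : C -> 'cV[C]_(2 * N))
    (c : rat -> 'I_(2 * N) -> C) : Prop :=
  (forall h, finite_set [set m | [/\ exponents Delta h m, m <= 0 & c m h != 0]]) /\
  (exists eps A B : R, 0 < eps /\
     forall tau, upper_half_plane tau -> B <= complex.Im tau -> forall h,
       `| f tau h 0
          - \sum_(m \in [set m | exponents Delta h m /\ m <= 0])
              c m h * ec (ratr m * tau) |
       <= (A * expR (- (eps * complex.Im tau)))%:C).

(* f belongs to H_{kappa, conj rho}, where twokappa = 2 kappa. *)
Definition harmonic_maass_form (Delta : int)
    (rhoL : 'M[int]_2 -> (C -> C) -> 'M[C]_(2 * N)) (twokappa : int)
    (f : C -> 'cV[C]_(2 * N)) : Prop :=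
  [/\ forall h, smooth (fun tau => f tau h 0),
      forall g phi, metaplectic g phi -> forall tau, upper_half_plane tau ->
        f (moebius g tau)
        = phi tau ^ twokappa
          *: (map_mx Num.conj (rho_Delta Delta rhoL g phi) *m f tau),
      forall h tau, upper_half_plane tau ->
        laplacian (twokappa%:~R / 2) (fun tau => f tau h 0) tau = 0,
      exists K A B : R, forall tau, upper_half_plane tau ->
        B <= complex.Im tau -> forall h,
          `| f tau h 0 | <= (A * expR (K * complex.Im tau))%:C &
      exists c, principal_part Delta f c].

Definition embed (l : 'M[rat]_2) : 'M[R]_2 := map_mx ratr l.

(* The negative vector lambda(z). *)
Definition lambda_of (z : C) : 'M[R]_2 :=
  let x := complex.Re z in
  let y := complex.Im z in
  (Num.sqrt (2 * N)%:R * y)^-1 *: mx2 (- x) (x ^+ 2 + y ^+ 2) (-1) x.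

Definition p_z (z : C) (l : 'M[rat]_2) : R := - bil N (embed l) (lambda_of z).

Definition q_z (z : C) (l : 'M[rat]_2) : C :=
  - ((Num.sqrt (2 * N)%:R : R)%:C)^-1
  * (ratr (coef_c l) * N%:R * z ^+ 2 - ratr (coef_b N l) * z + ratr (coef_a N l)).

Definition Q_z (z : C) (l : 'M[rat]_2) : R := ratr (Q N l) + p_z z l ^+ 2.

(* [summability.sum] is the limit over finite subsets; the family is extended
   by 0 outside of the index set. *)
Definition theta_kernel (Delta r : int) (k : nat) (tau z : C) : 'cV[C]_(2 * N) :=
  \col_h ((complex.Im tau `^ (3 / 2))%:C
    * summability.sum
        ((fun l : 'M[rat]_2 =>
            (genus_character N Delta l)%:~R * (p_z z l)%:C * q_z z l ^+ k.-1
            * ec ((ratr (Q N l) / `|Delta|%:~R * complex.Re tau)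
                  +i* (Q_z z l / `|Delta|%:~R * complex.Im tau)))
         \_ [set l | lattice_coset r h l /\
               exists n : int, Q N l - Delta%:~R * Q N (rep h) = (Delta * n)%:~R])).

Definition truncated_domain (t : R) : set (R * R) :=
  [set w | [/\ `|w.1| <= 1 / 2, 1 <= w.1 ^+ 2 + w.2 ^+ 2, 0 < w.2 & w.2 <= t]].

Definition theta_lift (Delta r : int) (k : nat) (f : C -> 'cV[C]_(2 * N)) (z : C) : C :=
  lim (cintegral (truncated_domain t)
         (fun w => let tau := w.1 +i* w.2 in
            herm (f tau) (map_mx Num.conj (theta_kernel Delta r k tau z))
            * (w.2 ^- 2)%:C)
       @[t --> +oo]).

Definition geodesic (l : 'M[rat]_2) : set C :=
  [set z | upper_half_plane z /\
     ratr (coef_c l) * N%:R * (complex.Re z ^+ 2 + complex.Im z ^+ 2)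
     - ratr (coef_b N l) * complex.Re z + ratr (coef_a N l) = 0 :> R].

(* The vectors lambda whose geodesics make up Z'_{Delta,r}(f). *)
Definition wall_vectors (Delta r : int) (c : rat -> 'I_(2 * N) -> C) :
    set 'M[rat]_2 :=
  [set l | exists (h : 'I_(2 * N)) (m : rat),
     [/\ lattice_coset r h l, Q N l = - (`|Delta|%:~R * m), exponents Delta h m, m < 0 &
         (c m h != 0) && (genus_character N Delta l != 0)]].

Definition exceptional_set (Delta r : int) (c : rat -> 'I_(2 * N) -> C) : set C :=
  \bigcup_(l in wall_vectors Delta r c) geodesic l.

Definition weyl_chamber (Delta r : int) (c : rat -> 'I_(2 * N) -> C)
    (W : set C) : Prop :=
  exists2 z, (upper_half_plane `\` exceptional_set Delta r c) z &
    W = connected_component (upper_half_plane `\` exceptional_set Delta r c) z.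

(* Closure in H, so real boundary points are excluded. *)
Definition closure_H (W : set C) : set C := closure W `&` upper_half_plane.

(* Distinct chambers sharing a wall: their closures have a nondegenerate arc of
   some D_lambda in Z'_{Delta,r}(f) in common (meeting in a vertex is not
   enough). *)
Definition adjacent_chambers (Delta r : int) (c : rat -> 'I_(2 * N) -> C)
    (W1 W2 : set C) : Prop :=
  W1 <> W2 /\
  exists2 l, wall_vectors Delta r c l &
    exists2 z0, geodesic l z0 &
      \forall z \near z0, geodesic l z -> (closure_H W1 `&` closure_H W2) z.

Definition orthogonal_to (l : 'M[rat]_2) (W : set C) : Prop :=
  forall w, W w -> bil N (embed l) (lambda_of w) = 0.

Definition negative_on (l : 'M[rat]_2) (W : set C) : Prop :=
  forall w, W w -> bil N (embed l) (lambda_of w) < 0.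

Definition real_analytic_extension (Phi : C -> C) (W A : set C) (G : C -> C) : Prop :=
  (forall z, W z -> G z = Phi z) /\ real_analytic_on A G.

End Forms.
End ComplexAnalysis.

(* Main.v *)
Require Import Defs.
From mathcomp Require Import all_boot all_order all_algebra.
From mathcomp Require Import fingroup cyclic finfield finmap.
From mathcomp Require Import complex ring lra zify.
From mathcomp Require Import all_classical all_reals all_analysis measurable_realfun.

(** Why the formula holds.

    Near any point of the upper half plane the regularized lift is a real
    analytic function plus a finite sum of explicit jumps. To see this, cut the
    part v > 1 off the fundamental domain and, for the finitely many lambda whose
    majorant at the point is small, subtract the principal part of f there. What
    is left decays exponentially in v and in lambda, and so do the terms of its
    Taylor expansion in x and y, in a norm that controls all of them on a small
    box; its integral is therefore a convergent double power series in x and y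
    [smooth_part]. In the subtracted terms the integral over u keeps only the
    exponents m = -Q(lambda)/|Delta|, and the integral over v is a Gaussian
    primitive: with p = p_z(lambda) it tends to
    sgn(p) sqrt(|Delta|/2) minus an odd entire function of p [Jint_cvg]. Hence
      Phi(z) = analytic + sqrt(|Delta|/2) sum C(h,lambda) q_z(lambda)^(k-1) sgn p_z(lambda)
    locally, with C(h,lambda) = c(-Q(lambda)/|Delta|, h) chi_Delta(lambda)
    [component_local_form, theta_lift_local_form].

    For a chamber W replace every sgn p_z(lambda) by its constant value on W. This
    changes the sum by finitely many terms near each point, leaves Phi unchanged
    on W, and gives a function that is analytic on both closures, because only
    multiples of the wall vector separate W1 from W2 [chamber_ext, sgn_near]. By
    the identity theorem it is the only analytic extension [ext_unique]. The
    difference of the two extensions is therefore sqrt(|Delta|/2) times the sum,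
    over the vectors that span the wall, of 2 C(h,lambda) q_z(lambda)^(k-1)
    sgn p_W1(lambda). The geometric input is that (x, |z|^2) are affine
    coordinates in which geodesics are straight lines, so that chambers are
    convex and determined by signs [chamber_conv, chamber_sign].

    The formula counts only the vectors with (lambda,W1) < 0, whereas both signs
    occur in the sum. The terms of lambda at h and of -lambda at -h agree because
    C(-h,-lambda) = (-1)^k C(h,lambda) [Ch_symmetry], and this doubles the constant
    to 2 sqrt(2|Delta|) [extension_jump]. The symmetry has two sources. The
    square of S acts on f by e_h -> e_(-h) up to the sign sgn(Delta)(-1)^k, and the
    principal part of f is unique, so its coefficients have the same symmetry
    [form_symmetry, coef_symmetry]. And chi_Delta(-lambda) =
    sgn(Delta) chi_Delta(lambda) [genus_character_opp]: the form of -lambda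
    represents -n when that of lambda represents n, and the symbol (Delta/n) is
    the same for all represented n. The latter is genus theory: two represented
    integers n, n' satisfy 4 M n n' = x^2 - Delta D' y^2 for a divisor M of N, and
    this norm equation forces (Delta/nn') = 1 by quadratic reciprocity
    [kronecker_norm_eq1, genus_value_uniq], which is proved with Gauss sums in
    finite fields [quadratic_reciprocity, second_supplement]. *)

Set Implicit Arguments.
Unset Strict Implicit.
Unset Printing Implicit Defensive.
Import Order.TTheory GRing.Theory Num.Theory.
Import numFieldNormedType.Exports.
Local Open Scope ring_scope.

(** * Kronecker symbols and the Euler criterion *)

Section KRON.
(** The completely multiplicative extension of the values F p at primes.
    Kronecker symbols have this form up to a sign, so that identities between
    them reduce to prime moduli. *)
Definition mulext (F : nat -> int) (n : nat) : int := \prod_(p <- primes n) F p ^+ logn p n.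

(** Enlarging the set of primes only adds factors with exponent 0; this puts two
    arguments over one common set of primes. *)
Lemma mulext_dvd F n m : (0 < m)%N -> (n %| m)%N -> mulext F n = \prod_(p <- primes m) F p ^+ logn p n.
Proof.
move=> m0 nm; have n0 : (0 < n)%N := dvdn_gt0 m0 nm.
rewrite [RHS](bigID (mem (primes n))) /= [X in _ * X]big1_seq; last first.
  by move=> p /andP[pn _]; rewrite -logn_gt0 lt0n negbK in pn; rewrite (eqP pn) expr0.
rewrite mulr1 -big_filter /mulext; apply: perm_big; apply: uniq_perm; rewrite ?filter_uniq ?primes_uniq //.
move=> p; rewrite mem_filter /=; case: (boolP (p \in primes n)) => //= pn.
by move: pn; rewrite !mem_primes => /and3P[-> _ pn]; rewrite m0 (dvdn_trans pn nm).
Qed.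

Lemma mulextM F m n : (0 < m)%N -> (0 < n)%N -> mulext F (m * n) = mulext F m * mulext F n.
Proof.
move=> m0 n0; have mn : (0 < m * n)%N by rewrite muln_gt0 m0.
rewrite (@mulext_dvd F m (m * n)) ?dvdn_mulr // (@mulext_dvd F n (m * n)) ?dvdn_mull // -big_split /=.
by apply: eq_bigr => p _; rewrite lognM // exprD.
Qed.

Lemma mulext_prime F p : prime p -> mulext F p = F p.
Proof. by move=> pp; rewrite /mulext primes_prime // big_seq1 logn_prime // eqxx expr1. Qed.

Lemma mulext1 F : mulext F 1 = 1.
Proof. by rewrite /mulext big_nil. Qed.

Lemma eq_mulext F G n : (forall p, prime p -> (p %| n)%N -> F p = G p) -> mulext F n = mulext G n.
Proof. by move=> h; apply: eq_big_seq => p; rewrite mem_primes => /and3P[pp _ pn]; rewrite h. Qed.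

Lemma mulext_split F G n : mulext (fun p => F p * G p) n = mulext F n * mulext G n.
Proof. by rewrite /mulext -big_split; apply: eq_bigr => p _; rewrite exprMn. Qed.

Local Notation K := kronecker.
Local Notation kp := kronecker_prime.

Definition kronecker_sign (a n : int) : int := if (n < 0) && (a < 0) then -1 else 1.

Lemma kroneckerE a n : n != 0 -> K a n = kronecker_sign a n * mulext (kp a) `|n|%N.
Proof. by move=> n0; rewrite /kronecker (negPf n0). Qed.

(** The sign factor is multiplicative too, since it counts the negative
    arguments modulo 2. *)
Lemma kroneckerMr a m n : m != 0 -> n != 0 -> K a (m * n) = K a m * K a n.
Proof.
move=> m0 n0; rewrite !kroneckerE ?mulf_neq0 // abszM mulextM ?absz_gt0 // mulrACA; congr (_ * _).
rewrite /kronecker_sign; case: (ltP a 0) => a0; rewrite ?andbF ?andbT ?mulr1 //.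
have [m1|m1|m1] := ltgtP m 0; last by rewrite m1 eqxx in m0.
  have [n1|n1|n1] := ltgtP n 0; last by rewrite n1 eqxx in n0.
    by rewrite ltNge ltW ?nmulr_rgt0.
  by rewrite nmulr_rlt0 // n1 mulr1.
have [n1|n1|n1] := ltgtP n 0; last by rewrite n1 eqxx in n0.
  by rewrite pmulr_rlt0 // n1 mul1r.
by rewrite ltNge ltW ?mulr_gt0.
Qed.

Lemma kronecker_nat a (n : nat) : (0 < n)%N -> K a n%:Z = mulext (kp a) n.
Proof. by move=> n0; rewrite kroneckerE ?absz_nat ?mul1r // eqz_nat -lt0n. Qed.

Lemma kronecker_r1 a : K a 1 = 1.
Proof. by rewrite (@kronecker_nat a 1) // mulext1. Qed.

Lemma kronecker_rN1 a : K a (-1) = if a < 0 then -1 else 1.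
Proof. by rewrite kroneckerE // mulext1 mulr1. Qed.

Lemma kronecker_at_prime a p : prime p -> K a p%:Z = kp a p.
Proof. by move=> pp; rewrite kronecker_nat ?prime_gt0 // mulext_prime. Qed.

Lemma kp_2E (a : int) : kp a 2 = if (2 %| a)%Z then 0 else if ((a %% 8)%Z == 1) || ((a %% 8)%Z == 7) then 1 else -1.
Proof. by []. Qed.

Lemma modz_nat_ex (a : int) m : (0 < m)%N -> exists2 i : nat, (i < m)%N & (a %% m)%Z = i%:Z.
Proof. by move=> m0; exists `|(a %% m)%Z|%N; lia. Qed.

(** Both sides depend on the residues modulo 8 only, so that the identity is a finite check. *)
Lemma kp_2M a b : kp (a * b) 2 = kp a 2 * kp b 2.
Proof.
have red x : kp x 2 = kp (x %% 8)%Z 2.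
  rewrite !kp_2E modz_mod; congr (if _ then _ else _).
  by rewrite !dvdzE; apply/idP/idP; lia.
rewrite [LHS]red -modzMm [kp a 2]red [kp b 2]red.
have [i i8 ->] := modz_nat_ex a (isT : (0 < 8)%N); have [j j8 ->] := modz_nat_ex b (isT : (0 < 8)%N).
have H : all (fun i : nat => all (fun j : nat => kp ((i%:Z * j%:Z) %% 8)%Z 2 == kp i 2 * kp j 2) (iota 0 8)) (iota 0 8) by vm_compute.
by move/allP: H => /(_ i); rewrite mem_iota => /(_ i8)/allP/(_ j); rewrite mem_iota => /(_ j8)/eqP.
Qed.

Section PRIME.
Variable p : nat.
Hypotheses (pp : prime p) (p2 : (2 < p)%N).

Let pN2 : (p == 2%N) = false. Proof. by apply/eqP => e; move: p2; rewrite e. Qed.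
Let podd : odd p. Proof. by case: (even_prime pp) p2 => // ->. Qed.
Let half : (p.-1./2.*2 = p.-1)%N.
Proof. by rewrite -[RHS]odd_double_half; case: p pp podd => //= q _; case: (odd q). Qed.
Let charFp : p \in [pchar 'F_p]. Proof. exact: pchar_Fp. Qed.

Lemma Fp_eq0 (a : int) : ((a%:~R : 'F_p) == 0) = (p%:Z %| a)%Z.
Proof. by rewrite -(dvdz_pcharf charFp). Qed.

Lemma Fp_eq (a b : int) : ((a%:~R : 'F_p) == b%:~R) = (p%:Z %| a - b)%Z.
Proof. by rewrite -Fp_eq0 rmorphB /= subr_eq0. Qed.

Lemma kp_odd a : kp a p = if (p%:Z %| a)%Z then 0 else if [exists x : 'I_p, (x%:Z ^+ 2 == a %[mod p%:Z])%Z] then 1 else -1.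
Proof. by rewrite /kronecker_prime pN2. Qed.

Lemma Fp_nat (x : 'F_p) : x = (nat_of_ord x)%:R.
Proof. by rewrite natr_Zp. Qed.

Lemma square_mod a : [exists x : 'I_p, (x%:Z ^+ 2 == a %[mod p%:Z])%Z] = [exists x : 'F_p, x ^+ 2 == a%:~R].
Proof.
apply/existsP/existsP => -[x hx].
  by exists (nat_of_ord x)%:R; rewrite pmulrn -rmorphXn /= Fp_eq -eqz_mod_dvd.
have xp : (nat_of_ord x < p)%N by have := ltn_ord x; rewrite {2}(Fp_cast pp).
exists (Ordinal xp) => /=; rewrite eqz_mod_dvd -Fp_eq rmorphXn /= -pmulrn -Fp_nat //.
Qed.

(** The squares are roots of X^((p-1)/2) - 1, and at least (p-1)/2 of them are
    distinct because a square has at most two roots. Any further root would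
    exceed the degree. *)
Lemma euler_field (u : 'F_p) : u != 0 -> u ^+ p.-1./2 = (if [exists x : 'F_p, x ^+ 2 == u] then 1 else -1).
Proof.
move=> u0; have fermat (v : 'F_p) : v != 0 -> v ^+ p.-1 = 1.
  move=> v0; apply: (mulfI v0); rewrite -exprS mulr1 prednK ?prime_gt0 //.
  by have := expf_card v; rewrite card_Fp.
have pm1 : u ^+ p.-1./2 = 1 \/ u ^+ p.-1./2 = -1.
  have : (u ^+ p.-1./2 == 1) || (u ^+ p.-1./2 == -1) by rewrite -eqf_sqr expr1n -exprM muln2 half fermat.
  by move=> /orP[/eqP ->|/eqP ->]; [left|right].
case: ifPn => [/existsP[x /eqP e]|/existsPn nsq].
  by rewrite -e -exprM mul2n half fermat //; apply: contraNneq u0 => x0; rewrite -e x0 expr0n.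
case: pm1 => // u1; exfalso.
pose Sq := [seq x ^+ 2 | x <- enum [pred x : 'F_p | x != 0]].
pose P : {poly 'F_p} := 'X^(p.-1./2) - 1.
have h0 : (0 < p.-1./2)%N by rewrite half_gt0 -ltnS prednK ?prime_gt0.
have Pn : P != 0 by rewrite -size_poly_eq0 size_XnsubC.
have rP : all (root P) (u :: undup Sq).
  rewrite /= rootE !hornerE ?hornerXn u1 subrr eqxx /=; apply/allP => y; rewrite mem_undup => /mapP[x].
  by rewrite mem_enum inE => x0 ->; rewrite rootE !hornerE ?hornerXn -exprM mul2n half fermat // subrr.
have uP : uniq (u :: undup Sq).
  rewrite /= undup_uniq andbT mem_undup; apply/negP => /mapP[x _ e]; by move: (nsq x); rewrite e eqxx.
have := max_poly_roots Pn rP uP; rewrite size_XnsubC //= ltnS => hs.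
have cnt : (p.-1 <= 2 * size (undup Sq))%N.
  have <- : size Sq = p.-1.
    rewrite size_map -cardE; have := cardC1 (0 : 'F_p); rewrite card_Fp // => <-; apply: eq_card => x; by rewrite !inE.
  have cmax y : (count_mem y Sq <= 2)%N.
    rewrite count_map -size_filter.
    pose Py : {poly 'F_p} := 'X^2 - y%:P.
    have Pyn : Py != 0 by rewrite -size_poly_eq0 size_XnsubC.
    have := @max_poly_roots _ Py [seq x <- enum [pred x : 'F_p | x != 0] | preim (fun x => x ^+ 2) (pred1 y) x] Pyn.
    rewrite size_XnsubC // ltnS; apply; last by rewrite filter_uniq ?enum_uniq.
    by apply/allP => x; rewrite mem_filter /= => /andP[/eqP e _]; rewrite rootE /Py !hornerE ?hornerXn e subrr.
  have -> : size Sq = (\sum_(y <- undup Sq) count_mem y Sq)%N by rewrite -sum1_size -big_undup_iterop_count /=; apply: eq_bigr => y _; rewrite Monoid.iteropE iter_addn_0 mul1n.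
  apply: (@leq_trans (\sum_(y <- undup Sq) 2)%N); first by apply: leq_sum => y _; exact: cmax.
  by rewrite big_const_seq count_predT iter_addn_0.
by move: cnt; rewrite -{1}half -mul2n leq_pmul2l // => cnt; move: (leq_trans hs cnt); rewrite ltnn.
Qed.

Lemma euler a : (p%:Z %| a ^+ p.-1./2 - kp a p)%Z.
Proof.
rewrite -Fp_eq rmorphXn /= kp_odd; case: ifPn => pa.
  have /eqP -> : (a%:~R : 'F_p) == 0 by rewrite Fp_eq0.
  by rewrite expr0n gtn_eqF // half_gt0 -ltnS prednK ?prime_gt0.
by rewrite euler_field ?Fp_eq0 // square_mod; case: ifP; rewrite ?rmorph1 ?rmorphN1.
Qed.

Lemma kp_vals a : [\/ kp a p = 0, kp a p = 1 | kp a p = -1].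
Proof. by rewrite kp_odd; case: ifP => _; [apply: Or31|case: ifP => _; [apply: Or32|apply: Or33]]. Qed.

(** The values 0, 1 and -1 of a symbol are distinct modulo p > 2; this lifts
    congruences, such as the Euler criterion, to equalities. *)
Lemma sign_eq_mod (x y : int) : -1 <= x <= 1 -> -1 <= y <= 1 -> (p%:Z %| x - y)%Z -> x = y.
Proof.
move=> hx hy /dvdzP[q hq]; have [q0|q0] := eqVneq q 0; first by move: hq; rewrite q0 mul0r; lia.
by exfalso; nia.
Qed.

Lemma kp_range a : -1 <= kp a p <= 1.
Proof. by case: (kp_vals a) => ->. Qed.

Lemma kpM a b : kp (a * b) p = kp a p * kp b p.
Proof.
apply: sign_eq_mod; first exact: kp_range.
  by case: (kp_vals a) => ->; case: (kp_vals b) => ->.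
have h1 := euler (a * b); have h2 := euler a; have h3 := euler b.
rewrite -Fp_eq in h1; rewrite -Fp_eq in h2; rewrite -Fp_eq in h3.
by rewrite -Fp_eq rmorphM /= -(eqP h1) -(eqP h2) -(eqP h3) exprMn rmorphM.
Qed.

Lemma kp_mod a b : (p%:Z %| a - b)%Z -> kp a p = kp b p.
Proof.
move=> h; apply: sign_eq_mod; try exact: kp_range.
have h2 := euler a; have h3 := euler b; rewrite -Fp_eq in h2; rewrite -Fp_eq in h3.
rewrite -Fp_eq -(eqP h2) -(eqP h3) !rmorphXn /=; rewrite -Fp_eq in h; by rewrite (eqP h).
Qed.

Lemma kp_N1 : kp (-1) p = (-1) ^+ p.-1./2.
Proof.
have := euler (-1) => h; apply/esym; apply: sign_eq_mod => //; last exact: kp_range.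
by rewrite -signr_odd; case: (odd _).
Qed.

Lemma kp_sqr a : ~~ (p%:Z %| a)%Z -> kp a p * kp a p = 1.
Proof. by move=> h; rewrite kp_odd (negPf h); case: ifP. Qed.

End PRIME.
End KRON.

(** * Gauss sums and quadratic reciprocity *)

Section GAUSS.
Local Notation K := kronecker.
Local Notation kp := kronecker_prime.

(** The unit group of a field with q^k elements is cyclic of order q^k - 1, so
    that it contains an element of each order dividing q^k - 1. Gauss sums are
    formed with this root of unity. *)
Lemma finField_unity_root q k n : prime q -> (0 < k)%N -> (n %| (q ^ k).-1)%N -> exists (F : finFieldType) (z : F),
  q \in [pchar F] /\ forall m, (z ^+ m == 1) = (n %| m)%N.
Proof.
move=> pq k0 hn; have [F cF oF] := PrimePowerField pq k0.
have q1 : (1 < q ^ k)%N by rewrite -(expn0 q) ltn_exp2l // prime_gt1.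
have /cyclicP[x ex] : cyclic [set: {unit F}] by exact: field_unit_group_cyclic.
have ox : #[x]%g = (q ^ k).-1 by rewrite orderE -ex card_finField_unit oF.
have n0 : (0 < n)%N by apply: dvdn_gt0 hn; rewrite -ltnS prednK // ltnW.
exists F, (FinRing.uval (x ^+ ((q ^ k).-1 %/ n))%g); split => // m.
have oy : #[(x ^+ ((q ^ k).-1 %/ n))%g]%g = n.
  rewrite orderXdiv ox; last by apply/dvdnP; exists n; rewrite mulnC divnK.
  by rewrite divnA // ?dvdn_div // mulKn // -ltnS prednK // ltnW.
have val1 (u : {unit F}) : (FinRing.uval u == 1) = (u == 1%g).
  by apply/eqP/eqP => [h|->]; [apply: val_inj; rewrite /= h|rewrite FinRing.val_unit1].
by have := val1 ((x ^+ ((q ^ k).-1 %/ n)) ^+ m)%g; rewrite FinRing.val_unitX -order_dvdn oy.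
Qed.

Lemma intr_eq0_pchar (F : fieldType) q (a : int) : q \in [pchar F] -> ((a%:~R : F) == 0) = (q%:Z %| a)%Z.
Proof. by move=> cF; rewrite -(dvdz_pcharf cF). Qed.

Lemma odd_half n : odd n -> (n.-1./2.*2 = n.-1)%N.
Proof. by move=> o; lia. Qed.

Lemma odd_half_succ n : odd n -> (n.-1./2.*2.+1 = n)%N.
Proof. by move=> o; lia. Qed.

(** The prime discriminant (-1)^((p-1)/2) p, written as the square of the Gauss sum produces it. *)
Definition pstar (p : nat) : int := (-1) ^+ p.-1./2 * p%:Z.

Section QR.
Variables p q : nat.
Hypotheses (pp : prime p) (p2 : (2 < p)%N) (pq : prime q) (q2 : (2 < q)%N) (pnq : p != q).

(** Otherwise all p - 1 units would be roots of X^((p-1)/2) - 1. *)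
Lemma nonresidue : exists u : 'F_p, u != 0 /\ kp (nat_of_ord u)%:Z p = -1.
Proof.
case: (boolP [exists u : 'F_p, (u != 0) && (kp (nat_of_ord u)%:Z p == -1)]) => [/existsP[u /andP[u0 /eqP e]]|/existsPn hn]; first by exists u.
exfalso; have half : (p.-1./2.*2 = p.-1)%N by apply: odd_half; case: (even_prime pp) p2 => // ->.
have all1 (u : 'F_p) : u != 0 -> u ^+ p.-1./2 = 1.
  move=> u0; rewrite (euler_field pp p2 u0); case: ifP => // hs; exfalso; apply: (negP (hn u)); rewrite u0 /=; apply/eqP.
  have nu : ~~ (p%:Z %| (nat_of_ord u)%:Z)%Z by rewrite -(Fp_eq0 pp) -pmulrn natr_Zp.
  by rewrite (kp_odd p2) (negPf nu) (square_mod pp) -pmulrn natr_Zp hs.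
have h0 : (0 < p.-1./2)%N by rewrite half_gt0 -ltnS prednK ?prime_gt0.
pose P : {poly 'F_p} := 'X^(p.-1./2) - 1.
have Pn : P != 0 by rewrite -size_poly_eq0 size_XnsubC.
have := @max_poly_roots _ P (enum [pred x : 'F_p | x != 0]) Pn; rewrite size_XnsubC // ltnS enum_uniq.
have -> : all (root P) (enum [pred x : 'F_p | x != 0]).
  by apply/allP => x; rewrite mem_enum inE => x0; rewrite rootE /P !hornerE ?hornerXn all1 // subrr.
move=> /(_ isT isT); rewrite -cardE.
have -> : #|[pred x : 'F_p | x != 0]| = p.-1 by have := cardC1 (0 : 'F_p); rewrite card_Fp // => <-; apply: eq_card => x; rewrite !inE.
by move=> h; move: h0 half; lia.
Qed.

Variables (F : finFieldType) (z : F).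
Hypotheses (cF : q \in [pchar F]) (hz : forall m, (z ^+ m == 1) = (p %| m)%N).

Let e (a : 'F_p) : F := z ^+ a.
Let chi (a : 'F_p) : int := kp (nat_of_ord a)%:Z p.

Let zp : z ^+ p = 1. Proof. by apply/eqP; rewrite hz. Qed.

Lemma e_nat n : e n%:R = z ^+ n.
Proof. by rewrite /e val_Fp_nat // expr_mod. Qed.

Lemma e_add a b : e (a + b) = e a * e b.
Proof. by rewrite -[a]natr_Zp -[b]natr_Zp -natrD !e_nat exprD. Qed.

Lemma chi_int (a : int) : chi a%:~R = kp a p.
Proof. by apply: (kp_mod pp p2); rewrite -(Fp_eq pp) -pmulrn natr_Zp. Qed.

Lemma chi_M a b : chi (a * b) = chi a * chi b.
Proof.
rewrite -[a]natr_Zp -[b]natr_Zp !pmulrn -rmorphM /= !chi_int; exact: kpM.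
Qed.

Lemma chi_sqr a : a != 0 -> chi a * chi a = 1.
Proof. by move=> a0; apply: (kp_sqr p2); rewrite -(Fp_eq0 pp) -pmulrn natr_Zp. Qed.

Lemma chi_0 : chi 0 = 0.
Proof. by have := chi_int 0; rewrite rmorph0 => ->; rewrite (kp_odd p2) dvdz0. Qed.

(** Additive characters are orthogonal: translation by 1 multiplies the sum
    by z, which is not 1. *)
Lemma sum_e (t : 'F_p) : \sum_(a : 'F_p) e (a * t) = (if t == 0 then p%:R else 0).
Proof.
case: eqVneq => [->|t0].
  rewrite (eq_bigr (fun=> 1)); last by move=> a _; rewrite mulr0 /e expr0.
  by rewrite sumr_const card_Fp.
rewrite (reindex_inj (mulIf (invr_neq0 t0))) /=; under eq_bigr do rewrite mulfVK //.
have e1 : e 1 != 1 by have := e_nat 1; rewrite expr1 => ->; rewrite -(expr1 z) hz; have := prime_gt1 pp; case: p => // -[|m].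
have sh : e 1 * (\sum_(a : 'F_p) e a) = \sum_(a : 'F_p) e a.
  rewrite [RHS](reindex_inj (addrI 1)) /= mulr_sumr; apply: eq_bigr => a _; by rewrite e_add.
apply/eqP; have : (e 1 - 1) * (\sum_(a : 'F_p) e a) == 0 by rewrite mulrBl mul1r sh subrr.
by rewrite mulf_eq0 subr_eq0 (negPf e1).
Qed.

(** Multiplication by a nonresidue permutes the terms and changes the sign. *)
Lemma sum_chi : \sum_(a : 'F_p) chi a = 0.
Proof.
have [u [u0 cu]] := nonresidue.
have : \sum_(a : 'F_p) chi a = - \sum_(a : 'F_p) chi a.
  rewrite {1}(reindex_inj (mulfI u0)) /= -sumrN; apply: eq_bigr => a _; by rewrite chi_M /chi cu mulN1r.
by move: (\sum_(a : 'F_p) chi a) => x; lia.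
Qed.

Definition gauss : F := \sum_(a : 'F_p) (chi a)%:~R * e a.

(** After the substitution b = ac the double sum becomes a sum over c of
    chi(c) times an additive character sum, in which only c = -1 contributes. *)
Lemma gauss_sqr : gauss ^+ 2 = (pstar p)%:~R.
Proof.
rewrite expr2 {1}/gauss mulr_suml.
transitivity (\sum_(a : 'F_p | a != 0) \sum_(c : 'F_p) (chi c)%:~R * e (a * (1 + c))).
  rewrite (bigD1 0) //= chi_0 mul0r mul0r add0r; apply: eq_bigr => a a0.
  rewrite /gauss (reindex_inj (mulfI a0)) /= mulr_sumr; apply: eq_bigr => c _.
  rewrite chi_M mulrDr mulr1 e_add rmorphM /=.
  have := congr1 (fun x : int => (x%:~R : F)) (chi_sqr a0); rewrite rmorphM rmorph1 /= => h.
  transitivity ((chi a)%:~R * (chi a)%:~R * ((chi c)%:~R * (e a * e (a * c)))); first by ring.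
  by rewrite h mul1r.
rewrite exchange_big /=.
transitivity (\sum_(c : 'F_p) (chi c)%:~R * ((if c == -1 then p%:R else 0) - 1 : F)).
  apply: eq_bigr => c _; rewrite -mulr_sumr; congr (_ * _).
  have := sum_e (1 + c); rewrite (bigD1 0) //= mul0r; have -> : e 0 = 1 by rewrite /e expr0.
  have -> : (1 + c == 0) = (c == -1) by rewrite addrC addr_eq0.
  by move=> <-; rewrite [1 + \sum_(i | _) _]addrC addrK.
under eq_bigr do rewrite mulrBr mulr1.
rewrite sumrB -rmorph_sum /= sum_chi rmorph0 subr0 (bigD1 (-1)) //= eqxx big1 ?addr0; last first.
  by move=> c c1; rewrite (negPf c1) mulr0.
have := chi_int (-1); rewrite rmorphN1 => ->; rewrite (kp_N1 pp p2) /pstar rmorphM /= -pmulrn //.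
Qed.

(** The Frobenius map raises the root of unity to the power q; reindexing by q
    takes out the factor chi(q). *)
Lemma gauss_frob : gauss ^+ q = (kp q%:Z p)%:~R * gauss.
Proof.
have q0 : (q%:R : 'F_p) != 0.
  rewrite pmulrn (Fp_eq0 pp) dvdzE /= dvdn_prime2 //.
rewrite -[LHS](pFrobenius_autE cF) /gauss rmorph_sum mulr_sumr /=.
rewrite [RHS](reindex_inj (mulIf q0)) /=; apply: eq_bigr => a _.
rewrite rmorphM /= rmorph_int pFrobenius_autE chi_M.
have -> : chi q%:R = kp q p by rewrite pmulrn chi_int.
have -> : e a ^+ q = e (a * q%:R) by rewrite /e -exprM -e_nat natrM natr_Zp.
have h : kp q p * kp q p = 1 by have := chi_sqr q0; rewrite pmulrn chi_int.
rewrite mulrA -rmorphM /=; congr (_%:~R * _).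
by rewrite mulrCA h mulr1.
Qed.

(** The q-th power of the Gauss sum is computed twice: by the Frobenius map, and
    as an odd power of its square p*, to which the Euler criterion modulo q applies. *)
Lemma quadratic_reciprocity_in : kp (pstar p) q = kp q%:Z p.
Proof.
have qN : (q%:Z %| pstar p)%Z = false.
  rewrite /pstar dvdzE abszM abszX /= exp1n mul1n dvdn_prime2 //; by apply/negbTE; rewrite eq_sym.
have g0 : gauss != 0.
  apply/eqP => g0; have := gauss_sqr; rewrite g0 expr0n /= => /esym/eqP; by rewrite (intr_eq0_pchar _ cF) qN.
have halfq : (q.-1./2.*2.+1 = q)%N.
  by apply: odd_half_succ; case: (even_prime pq) q2 => // ->.
have E : ((pstar p) ^+ q.-1./2)%:~R = (kp q p)%:~R :> F.
  apply: (mulIf g0); rewrite -gauss_frob -{2}halfq exprSr -mul2n exprM gauss_sqr rmorphXn //.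
apply: (sign_eq_mod pq q2); [exact: kp_range|exact: kp_range|].
rewrite -(intr_eq0_pchar _ cF) rmorphB /= subr_eq0 -E -subr_eq0 -rmorphB /= (intr_eq0_pchar _ cF).
by rewrite -opprB rpredN; exact: euler.
Qed.
End QR.

(** The auxiliary field has q^(p-1) elements, so that p divides the order of its
    unit group by Fermat. *)
Lemma quadratic_reciprocity p q : prime p -> (2 < p)%N -> prime q -> (2 < q)%N -> p != q -> kp (pstar p) q = kp q%:Z p.
Proof.
move=> pp p2 pq q2 pnq.
have p0 : (0 < p.-1)%N by rewrite -ltnS prednK ?prime_gt0 // ltnW.
have hd : (p %| (q ^ p.-1).-1)%N.
  have cpq : coprime q p by rewrite prime_coprime // dvdn_prime2 // eq_sym.
  have := Euler_exp_totient cpq; rewrite totient_prime // => h.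
  have q1 : (0 < q ^ p.-1)%N by rewrite expn_gt0 prime_gt0.
  by rewrite -subn1 -eqn_mod_dvd //; apply/eqP.
have [F [z [cF hz]]] := finField_unity_root pq p0 hd.
exact: (quadratic_reciprocity_in pp p2 pq q2 pnq cF hz).
Qed.

(** The analogue of the Gauss sum is t = z + 1/z for a primitive 8th root of
    unity z: t^2 = 2, and t^p = z^p + z^(-p) is t or -t according to p modulo 8. *)
Lemma second_supplement p : prime p -> (2 < p)%N -> kp 2 p = if (p %% 8 \in [:: 1; 7])%N then 1 else -1.
Proof.
move=> pp p2.
have po : odd p by case: (even_prime pp) p2 => // ->.
have hd : (8 %| (p ^ 2).-1)%N.
  have : (p %% 8 < 8)%N by rewrite ltn_pmod.
  have e := divn_eq p 8; have o8 : odd (p %% 8) by move: po; rewrite {1}e oddD oddM andbF.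
  have p1 : (0 < p ^ 2)%N by rewrite expn_gt0 prime_gt0.
  rewrite -subn1 -eqn_mod_dvd // -modnXm.
  by move: (p %% 8)%N o8; do 8 (case=> //).
(* p^2 is 1 modulo 8, so the field with p^2 elements contains the 8th roots of unity *)
have [F [z [cF hz]]] := finField_unity_root pp (isT : (0 < 2)%N) hd.
have z8 : z ^+ 8 = 1 by apply/eqP; rewrite hz.
have z4 : z ^+ 4 = -1.
  have : (z ^+ 4) ^+ 2 == 1 ^+ 2 by rewrite -exprM z8 expr1n.
  by rewrite eqf_sqr hz /= => /eqP.
pose t := z + z ^+ 7.
have t2 : t ^+ 2 = 2.
  rewrite /t sqrrD -exprS z8 -exprM (_ : (7 * 2 = 8 + 4 + 2)%N) // !exprD z8 z4 mul1r mulN1r.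
  by rewrite -mulr_natr; ring.
have two : (2 : F) != 0 by have := intr_eq0_pchar 2 cF; rewrite -pmulrn => ->; rewrite dvdzE /= dvdn_prime2 // gtn_eqF.
have t0 : t != 0 by apply/eqP => t0; move: t2; rewrite t0 expr0n /= => /esym/eqP; rewrite (negPf two).
have halfp : (p.-1./2.*2.+1 = p)%N.
  exact: odd_half_succ.
have tp : t ^+ p = (if (p %% 8 \in [:: 1; 7])%N then 1 else -1) * t.
  rewrite -(pFrobenius_autE cF) /t rmorphD rmorphXn /= !pFrobenius_autE.
  rewrite -(expr_mod p z8); have : (p %% 8 < 8)%N by rewrite ltn_pmod.
  have o8 : odd (p %% 8) by move: po; rewrite {1}(divn_eq p 8) oddD oddM andbF.
  move: (p %% 8)%N o8 => i o8 i8; rewrite -exprM.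
  have z3 : z ^+ 3 = - z ^+ 7 by rewrite (_ : 7 = 4 + 3)%N // exprD z4 mulN1r opprK.
  have z5 : z ^+ 5 = - z by rewrite (_ : 5 = 4 + 1)%N // exprD z4 mulN1r.
  case: i o8 i8 => [|[|[|[|[|[|[|[|i]]]]]]]] //= _ _.
  - by rewrite mul1r.
  - by rewrite -[z ^+ (3 * 7)](expr_mod _ z8) z3 [z ^+ (3 * 7 %% 8)]z5; ring.
  - by rewrite -[z ^+ (5 * 7)](expr_mod _ z8) [z ^+ (5 * 7 %% 8)]z3 z5; ring.
  - by rewrite -[z ^+ (7 * 7)](expr_mod _ z8) [z ^+ (7 * 7 %% 8)]expr1; ring.
have E : (2 ^+ p.-1./2 : int)%:~R = ((if (p %% 8 \in [:: 1; 7])%N then 1 else -1) : int)%:~R :> F.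
  apply: (mulIf t0); rewrite rmorphXn /= -pmulrn -t2 -exprM mul2n -exprSr halfp tp; by case: ifP; rewrite ?rmorphN ?rmorph1.
apply: (sign_eq_mod pp p2); [exact: kp_range|by case: ifP|].
rewrite -(intr_eq0_pchar _ cF) rmorphB /= subr_eq0 -E -subr_eq0 -rmorphB /= (intr_eq0_pchar _ cF).
by rewrite -opprB rpredN; exact: euler.
Qed.

End GAUSS.

(** * Reciprocity for Kronecker symbols *)

Section LAWS.
Local Notation K := kronecker.
Local Notation kp := kronecker_prime.

Lemma mul_ind (P : nat -> Prop) : P 1%N -> (forall p, prime p -> P p) ->
  (forall m n, (0 < m)%N -> (0 < n)%N -> P m -> P n -> P (m * n)%N) -> forall n, (0 < n)%N -> P n.
Proof.
move=> P1 Pp PM; elim/ltn_ind => n IH n0; have [->//|n1] := eqVneq n 1%N.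
have n2 : (1 < n)%N by rewrite ltn_neqAle eq_sym n1.
have pn := pdiv_prime n2; have dn := pdiv_dvd n.
have q0 : (0 < n %/ pdiv n)%N by rewrite divn_gt0 ?pdiv_gt0 // dvdn_leq.
have Pq : P (n %/ pdiv n)%N.
  by apply: IH => //; rewrite ltn_Pdiv // prime_gt1.
by rewrite -(divnK dn); apply: PM; rewrite ?pdiv_gt0 //; exact: Pp.
Qed.

Lemma kpM_prime p a b : prime p -> kp (a * b) p = kp a p * kp b p.
Proof.
move=> pp; have := prime_gt1 pp; rewrite leq_eqVlt => /orP[/eqP <-|p2]; [exact: kp_2M|exact: kpM].
Qed.

Lemma kp_sqr_prime p a : prime p -> ~~ (p%:Z %| a)%Z -> kp a p * kp a p = 1.
Proof.
move=> pp; have := prime_gt1 pp; rewrite leq_eqVlt => /orP[/eqP <-|p2]; last exact: kp_sqr.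
by move=> h; rewrite kp_2E (negPf h); case: ifP.
Qed.

Lemma kroneckerMl a b n : a != 0 -> b != 0 -> n != 0 -> K (a * b) n = K a n * K b n.
Proof.
move=> a0 b0 n0; rewrite !kroneckerE //.
have -> : mulext (kp (a * b)) `|n|%N = mulext (kp a) `|n|%N * mulext (kp b) `|n|%N.
  by rewrite -mulext_split; apply: eq_mulext => p pp _; exact: kpM_prime.
rewrite mulrACA; congr (_ * _); rewrite /kronecker_sign; case: (n < 0) => //=.
have [a1|a1|a1] := ltgtP a 0; last by rewrite a1 eqxx in a0.
  have [b1|b1|b1] := ltgtP b 0; last by rewrite b1 eqxx in b0.
    by rewrite ltNge ltW ?nmulr_rgt0.
  by rewrite nmulr_rlt0 // b1 mulr1.
have [b1|b1|b1] := ltgtP b 0; last by rewrite b1 eqxx in b0.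
  by rewrite pmulr_rlt0 // b1 mul1r.
by rewrite ltNge ltW ?mulr_gt0.
Qed.

Lemma mulext_cst1 n : mulext (fun=> 1) n = 1.
Proof. by rewrite /mulext big1 // => i _; rewrite expr1n. Qed.

Lemma kronecker_l1 n : K 1 n = 1.
Proof.
have [->|n0] := eqVneq n 0; first by [].
rewrite kroneckerE // /kronecker_sign andbF mul1r -[RHS](mulext_cst1 `|n|%N); apply: eq_mulext => p pp _.
have n1 : ~~ (p%:Z %| 1)%Z by rewrite dvdzE /= dvdn1 neq_ltn prime_gt1 // orbT.
by have := kp_sqr_prime pp n1; rewrite -kpM_prime // mulr1.
Qed.

Lemma coprimez_prime a (g p : nat) : coprimez a g%:Z -> prime p -> (p %| g)%N -> ~~ (p%:Z %| a)%Z.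
Proof.
move=> c pp pg; apply/negP => pa; have : (p%:Z %| gcdz a g%:Z)%Z by rewrite dvdz_gcd pa.
by rewrite (eqP c) dvdzE /= dvdn1 => /eqP p1; move: pp; rewrite p1.
Qed.

Lemma coprimez_nprime a (g : nat) : (0 < g)%N -> (forall p, prime p -> (p %| g)%N -> ~~ (p%:Z %| a)%Z) -> coprimez a g%:Z.
Proof.
move=> g0 h; rewrite /coprimez /gcdz absz_nat eqz_nat; apply: contraT => n1.
have n2 : (1 < gcdn `|a| g)%N by rewrite ltn_neqAle eq_sym n1 gcdn_gt0 g0 orbT.
have := h _ (pdiv_prime n2); have := pdiv_dvd (gcdn `|a| g); rewrite dvdn_gcd => /andP[h1 h2] /(_ h2).
by rewrite dvdzE /= h1.
Qed.

Lemma kronecker_sqr1 a (g : nat) : (0 < g)%N -> coprimez a g%:Z -> K a g * K a g = 1.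
Proof.
move=> g0 c; rewrite kronecker_nat // -mulext_split -[RHS](mulext_cst1 g); apply: eq_mulext => p pp pg.
by apply: kp_sqr_prime => //; exact: coprimez_prime pg.
Qed.

Lemma kronecker_mod a b (g : nat) : odd g -> (g%:Z %| a - b)%Z -> K a g = K b g.
Proof.
move=> og h; have g0 := odd_gt0 og; rewrite !kronecker_nat //; apply: eq_mulext => p pp pg; apply: kp_mod => //.
  have := prime_gt1 pp; rewrite leq_eqVlt => /orP[/eqP e2|//].
  by move: pg; rewrite -e2 dvdn2 og.
by apply: dvdz_trans h; rewrite dvdzE.
Qed.

(** The integer congruent to 1 modulo 4 with absolute value m (for odd m); for
    these the reciprocity law has no sign. *)
Definition star (m : nat) : int := if (m %% 4 == 1)%N then m%:Z else - m%:Z.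

Lemma star_mod m : odd m -> (star m %% 4)%Z = 1.
Proof. by rewrite /star => o; case: ifP => h; lia. Qed.

Lemma abs_star m : `|star m|%N = m.
Proof. by rewrite /star; case: ifP => _; rewrite ?abszN absz_nat. Qed.

Lemma star_uniq (E : int) : (E %% 4)%Z = 1 -> E = star `|E|%N.
Proof. by rewrite /star; case: ifP => h; lia. Qed.

Lemma starM m n : odd m -> odd n -> star (m * n) = star m * star n.
Proof.
move=> om on; rewrite -[m in LHS]abs_star -[n in LHS]abs_star -abszM -star_uniq //.
by rewrite -modzMm !star_mod.
Qed.

Lemma star_neq0 m : odd m -> star m != 0.
Proof. by move=> o; rewrite -absz_gt0 abs_star odd_gt0. Qed.

Lemma pstarE p : odd p -> pstar p = star p.
Proof.
move=> po; rewrite /pstar /star -signr_odd.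
have -> : (p %% 4 == 1)%N = ~~ odd p.-1./2 by lia.
by case: (odd _); rewrite ?mulN1r ?mul1r.
Qed.

(** Both sides are multiplicative in n; for prime n this is quadratic
    reciprocity or its second supplement, and both sides vanish at n = p. *)
Lemma reciprocity_prime p n : prime p -> (2 < p)%N -> (0 < n)%N -> mulext (kp (star p)) n = kp n%:Z p.
Proof.
move=> pp p2; have po : odd p by case: (even_prime pp) p2 => // ->.
move: n; apply: mul_ind => [|q pq|m n m0 n0 IHm IHn].
- by rewrite mulext1 -(kronecker_at_prime 1 pp) kronecker_l1.
- rewrite mulext_prime //; have [->|npq] := eqVneq p q.
    have q0 : (q%:Z %| star q)%Z by rewrite dvdzE /= abs_star.
    rewrite /kronecker_prime q0 dvdzz; case: eqVneq => // e2; by move: q0; rewrite e2 => ->.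
  have := prime_gt1 pq; rewrite leq_eqVlt => /orP[/eqP <-|q2].
    have E2 : (2 %| star p)%Z = false by rewrite dvdzE /= abs_star dvdn2 po.
    rewrite kp_2E E2 second_supplement // !inE; have h : ((star p %% 8)%Z == 1) || ((star p %% 8)%Z == 7) = ((p %% 8 == 1) || (p %% 8 == 7))%N.
      by rewrite /star; case: ifP => h; lia.
    by rewrite h.
  by rewrite -pstarE // quadratic_reciprocity.
- by rewrite mulextM // IHm IHn PoszM kpM.
Qed.

(** The sign of the discriminant m* is the value of (-1/m), which matches the
    sign convention of the Kronecker symbol at negative n. *)
Lemma reciprocity m n : odd m -> n != 0 -> K (star m) n = K n m%:Z.
Proof.
move=> om n0; have m0 := odd_gt0 om; move: m m0 om; apply: mul_ind => [_|p pp po|m1 m2 m10 m20 IH1 IH2].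
- by rewrite kronecker_r1 kronecker_l1.
- have p2 : (2 < p)%N by have := prime_gt1 pp; rewrite leq_eqVlt => /orP[/eqP e|//]; move: po; rewrite -e.
  rewrite kronecker_at_prime // kroneckerE // reciprocity_prime ?absz_gt0 // /kronecker_sign.
  have [n1|n1] := ltP n 0; last by rewrite mul1r gez0_abs.
  rewrite /= [in RHS](_ : n = -1 * `|n|%N%:Z); last by lia.
  rewrite kpM // kp_N1 //; congr (_ * _); rewrite -pstarE // /pstar -signr_odd; case: (odd _) => /=.
    by rewrite mulN1r oppr_lt0 ltz_nat prime_gt0.
  by [].
- rewrite oddM => /andP[odd1 odd2]; rewrite starM // kroneckerMl ?star_neq0 // IH1 // IH2 //.
  by rewrite PoszM kroneckerMr // eqz_nat -lt0n.
Qed.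

Lemma kronecker_4 V : ~~ (2 %| V)%Z -> K 4 V = 1.
Proof.
move=> V2; have V0 : V != 0 by apply: contraNneq V2 => ->.
rewrite kroneckerE // /kronecker_sign andbF mul1r -[RHS](mulext_cst1 `|V|%N); apply: eq_mulext => p pp pV.
rewrite (_ : 4 = 2 * 2) // kpM_prime // kp_sqr_prime // dvdzE /=; apply/negP => p2.
have p2' : p = 2%N by apply/eqP; rewrite -dvdn_prime2.
by move: V2; rewrite p2' in pV; rewrite dvdzE /= pV.
Qed.

(** Reciprocity at n = -1, where the symbol is the sign of m*. *)
Lemma kronecker_N1_odd V : ~~ (2 %| V)%Z -> K (-1) V = if (V %% 4)%Z == 1 then 1 else -1.
Proof.
have pos (v : nat) : odd v -> K (-1) v%:Z = if (v %% 4 == 1)%N then 1 else -1.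
  move=> ov; rewrite -reciprocity // kronecker_rN1 /star; have v0 := odd_gt0 ov.
  have p0 : (v%:Z < 0) = false by lia.
  have m0 : (- v%:Z < 0) = true by lia.
  by case: (v %% 4 == 1)%N; rewrite ?p0 ?m0.
move=> V2; have [V0|V0] := leP 0 V.
  have -> : V = `|V|%N by lia.
  by rewrite pos; [|lia]; have -> : (`|V|%N %% 4)%Z == 1 = (`|V| %% 4 == 1)%N by lia.
have -> : V = -1 * `|V|%N%:Z by lia.
have v0 : `|V|%N%:Z != 0 by lia.
rewrite kroneckerMr // pos; last by lia.
rewrite kronecker_rN1 /=; case: ifP => h; case: ifP => h' //; lia.
Qed.

(** Reciprocity at n = 2, where the symbol reads m* modulo 8. *)
Lemma kronecker_2_odd V : ~~ (2 %| V)%Z -> K 2 V = if ((V %% 8)%Z == 1) || ((V %% 8)%Z == 7) then 1 else -1.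
Proof.
have pos (v : nat) : odd v -> K 2 v%:Z = if (v %% 8 == 1)%N || (v %% 8 == 7)%N then 1 else -1.
  move=> ov; rewrite -reciprocity // (@kronecker_at_prime _ 2) // kp_2E.
  have -> : (2 %| star v)%Z = false by rewrite dvdzE /= abs_star dvdn2 ov.
  have -> : ((star v %% 8)%Z == 1) || ((star v %% 8)%Z == 7) = ((v %% 8 == 1) || (v %% 8 == 7))%N.
    by rewrite /star; case: ifP => h; lia.
  by [].
move=> V2; have [V0|V0] := leP 0 V.
  have -> : V = `|V|%N by lia.
  rewrite pos; [|lia]; by have -> : ((`|V|%N %% 8)%Z == 1) || ((`|V|%N %% 8)%Z == 7) = ((`|V| %% 8 == 1) || (`|V| %% 8 == 7))%N by lia.
have -> : V = -1 * `|V|%N%:Z by lia.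
have v0 : `|V|%N%:Z != 0 by lia.
rewrite kroneckerMr // pos; last by lia.
rewrite kronecker_rN1 /= mul1r; case: ifP => h; case: ifP => h' //; lia.
Qed.

Lemma kroneckerMl_nat a b (g : nat) : (0 < g)%N -> K (a * b) g = K a g * K b g.
Proof. by move=> g0; rewrite !kronecker_nat // -mulext_split; apply: eq_mulext => p pp _; exact: kpM_prime. Qed.

(** The argument is -1 for g congruent to 1 modulo 4 and 1 otherwise. It appears
    when g is exchanged with g* in the norm equation. *)
Lemma kronecker_N_star_sign (g : nat) : odd g -> K (- (if (g %% 4 == 1)%N then 1 else -1)) g = 1.
Proof.
move=> og; case: ifP => h; last by rewrite opprK kronecker_l1.
have o2 : ~~ (2 %| g%:Z)%Z by lia.
rewrite kronecker_N1_odd //; case: ifP => //; lia.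
Qed.

Lemma cancel2 (a b t : int) : a * a = 1 -> b * b = 1 -> a * b * t = 1 -> t = a * b.
Proof.
move=> ha hb h; transitivity ((a * a) * (b * b) * t); first by rewrite ha hb !mul1r.
by transitivity (a * b * (a * b * t)); [ring|rewrite h mulr1].
Qed.

Lemma kronecker_4_nat (h : nat) : odd h -> K 4 h = 1.
Proof. by move=> oh; apply: kronecker_4; lia. Qed.

Lemma coprimez4 (h : nat) : odd h -> coprimez 4 h%:Z.
Proof. by move=> oh; change (coprime (2 ^ 2) h); rewrite coprimeXl // coprime2n. Qed.

(** The odd part of a discriminant is split as g* g'*, where g collects the
    primes that divide the multiplier of the norm equation. Modulo g' the
    equation says that 4egT is a square. As g divides x, the equation can be divided by g,
    and modulo g it then says that T equals e delta g'* up to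
    squares. Reciprocity cancels the symbols between g and g', and what remains
    concerns the prime 2 only. *)
Lemma kronecker_norm_form (delta T x y s D' : int) (e g g' : nat) : odd g -> odd g' -> coprime g g' -> (0 < e)%N ->
  delta != 0 -> T != 0 -> coprimez (e%:Z * T) (g * g')%N -> coprimez delta g%:Z ->
  (g%:Z %| x)%Z -> (g%:Z %| D' - s ^+ 2)%Z ->
  4 * (e%:Z * g%:Z * T) = x ^+ 2 - delta * (star g * star g') * D' * y ^+ 2 ->
  K (delta * (star g * star g')) T = K delta (g%:Z * T) * K (star g * star g') e%:Z.
Proof.
move=> og og' cgg e0 d0 T0 ceT cd /dvdzP[x1 ex] hD H.
have g0 := odd_gt0 og; have g'0 := odd_gt0 og'.
have gz : g%:Z != 0 by lia.
have g'z : g'%:Z != 0 by lia.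
have ez : e%:Z != 0 by lia.
have sg0 := star_neq0 og; have sg'0 := star_neq0 og'.
have ceTg : coprimez (e%:Z * T) g%:Z by move: ceT; rewrite PoszM coprimezMr => /andP[].
have ceTg' : coprimez (e%:Z * T) g'%:Z by move: ceT; rewrite PoszM coprimezMr => /andP[].
have [ceg cTg] : coprimez e g%:Z /\ coprimez T g%:Z by move: ceTg; rewrite coprimezMl => /andP[].
have [ceg' cTg'] : coprimez e g'%:Z /\ coprimez T g'%:Z by move: ceTg'; rewrite coprimezMl => /andP[].
have cg'g : coprimez g%:Z g'%:Z by rewrite coprimezE.
have I1 : K T g' = K e g' * K g g'.
  have c1 : coprimez (4 * (e%:Z * g%:Z * T)) g'%:Z by rewrite !coprimezMl coprimez4 // ceg' cg'g cTg'.
  have dv : (g'%:Z %| delta * (star g * star g') * D' * y ^+ 2)%Z.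
    by rewrite -!mulrA dvdz_mull // dvdz_mull // dvdz_mulr // dvdzE abs_star absz_nat.
  have cx : coprimez x g'%:Z.
    apply: coprimez_nprime => // p pp pg'; apply/negP => px; move/negP: (coprimez_prime c1 pp pg'); apply.
    rewrite H rpredB //; first by rewrite expr2 dvdz_mulr.
    by apply: dvdz_trans dv; rewrite dvdzE.
  apply: cancel2; [exact: kronecker_sqr1|exact: kronecker_sqr1|].
  have -> : K e g' * K g g' * K T g' = K (4 * (e%:Z * g%:Z * T)) g'.
    by rewrite !kroneckerMl_nat // kronecker_4_nat // mul1r.
  rewrite -[RHS](kronecker_sqr1 g'0 cx) -kroneckerMl_nat //; apply: kronecker_mod => //.
  by rewrite H expr2 addrAC subrr add0r rpredN.
set sg := (if (g %% 4 == 1)%N then 1 else -1 : int).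
have esg : star g = g%:Z * sg by rewrite /star /sg; case: ifP => _; rewrite ?mulr1 ?mulrN1.
have H2 : 4 * (e%:Z * T) = g%:Z * x1 ^+ 2 - delta * sg * star g' * D' * y ^+ 2.
  apply: (mulfI gz); transitivity (4 * (e%:Z * g%:Z * T)); first by ring.
  by rewrite H ex esg; ring.
have /dvdzP[d1 ed1] := hD.
have I2 : K T g = K e g * (K delta g * K g g').
  have c1 : coprimez (4 * (e%:Z * T)) g%:Z by rewrite !coprimezMl coprimez4 // ceg cTg.
  have dv : (g%:Z %| 4 * (e%:Z * T) - (- sg) * (delta * star g') * ((s * y) * (s * y)))%Z.
    apply/dvdzP; exists (x1 ^+ 2 - delta * sg * star g' * d1 * y ^+ 2).
    have eD : D' = s ^+ 2 + d1 * g%:Z by rewrite -ed1; ring.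
    by rewrite H2 eD; ring.
  have cx : coprimez (s * y) g%:Z.
    apply: coprimez_nprime => // p pp pg'; apply/negP => px; move/negP: (coprimez_prime c1 pp pg'); apply.
    have pg2 : (p%:Z %| g%:Z)%Z by rewrite dvdzE.
    have := rpredD (dvdz_trans pg2 dv) (dvdz_mull (- sg * (delta * star g')) (dvdz_mulr (s * y) px)).
    by rewrite subrK.
  move: (s * y) cx dv => t cx dv; have := kronecker_mod og dv; rewrite !kroneckerMl_nat // kronecker_4_nat // mul1r.
  have -> : K (- sg) g = 1 by exact: kronecker_N_star_sign.
  rewrite (kronecker_sqr1 g0 cx) mulr1 mul1r (reciprocity og' gz) => h.
  transitivity (K e g * K e g * K T g); first by rewrite (kronecker_sqr1 g0 ceg) mul1r.
  by rewrite -mulrA h.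
rewrite kroneckerMl ?mulf_neq0 // kroneckerMl // kroneckerMr // kroneckerMl // !reciprocity // I1 I2.
have cc := kronecker_sqr1 g'0 cg'g.
transitivity (K g g' * K g g' * (K delta T * K e g * K delta g * K e g')); first by ring.
by rewrite cc; ring.
Qed.

Lemma parity (z : int) : exists k, z = 2 * k \/ z = 2 * k + 1.
Proof. by exists (z %/ 2)%Z; lia. Qed.

Lemma sqr_mod8 (z : int) : (exists k, z ^+ 2 = 4 * k) \/ (exists k, z ^+ 2 = 8 * k + 1).
Proof.
have [j [->|->]] := parity z; first by left; exists (j ^+ 2); ring.
right; have [i [->|->]] := parity j.
  by exists (i * (2 * i + 1)); ring.
by exists ((2 * i + 1) * (i + 1)); ring.
Qed.

Lemma even_sq (z k : int) : z ^+ 2 = 2 * k -> exists z', z = 2 * z'.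
Proof.
have [j [->|->]] := parity z; first by exists j.
rewrite (_ : (2 * j + 1) ^+ 2 = 2 * (2 * j ^+ 2 + 2 * j) + 1); last by ring.
by move: (2 * j ^+ 2 + 2 * j) => t h; lia.
Qed.

(** -4 is -1 times a square. *)
Lemma kronecker_N4 V : ~~ (2 %| V)%Z -> K (-4) V = if (V %% 4)%Z == 1 then 1 else -1.
Proof.
move=> h; have V0 : V != 0 by apply: contraNneq h => ->.
by rewrite (_ : -4 = -1 * 4) // kroneckerMl // kronecker_4 // mulr1 kronecker_N1_odd.
Qed.

Lemma kronecker_8 V : ~~ (2 %| V)%Z -> K 8 V = if ((V %% 8)%Z == 1) || ((V %% 8)%Z == 7) then 1 else -1.
Proof.
move=> h; have V0 : V != 0 by apply: contraNneq h => ->.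
by rewrite (_ : 8 = 2 * 4) // kroneckerMl // kronecker_4 // mulr1 kronecker_2_odd.
Qed.

Lemma kronecker_N8 V : ~~ (2 %| V)%Z -> K (-8) V = if ((V %% 8)%Z == 1) || ((V %% 8)%Z == 3) then 1 else -1.
Proof.
move=> h; have V0 : V != 0 by apply: contraNneq h => ->.
rewrite (_ : -8 = -1 * 8) // kroneckerMl // kronecker_8 // kronecker_N1_odd //.
have hV : (V %% 4)%Z = ((V %% 8)%Z %% 4)%Z by lia.
have h8 : (V %% 8)%Z = 1 \/ (V %% 8)%Z = 3 \/ (V %% 8)%Z = 5 \/ (V %% 8)%Z = 7 by lia.
by rewrite hV; case: h8 => [->|[->|[->|->]]].
Qed.

Lemma kp_2_mod4 E : (E %% 4)%Z = 1 -> kp E 2 = if (E %% 8)%Z == 1 then 1 else -1.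
Proof.
move=> h; rewrite kp_2E; have -> : (2 %| E)%Z = false by lia.
have -> : ((E %% 8)%Z == 7) = false by lia.
by rewrite orbF.
Qed.

(** The 2-adic condition left over for delta = -4: reduce the norm equation
    modulo 4 (e = 1) or modulo 8 (e = 2), using that an odd square is 1 modulo 8. *)
Lemma two_part_N4 (V x y s d E : int) (e : nat) : (e == 1)%N || (e == 2)%N -> ~~ (2 %| V)%Z -> (E %% 4)%Z = 1 ->
  4 * (e%:Z * V) = x ^+ 2 + 4 * E * (s ^+ 2 + 4 * e%:Z * d) * y ^+ 2 -> K (-4) V * K E e%:Z = 1.
Proof.
move=> he oV oE H; rewrite kronecker_N4 //.
have [x1 ex] : exists x1, x = 2 * x1.
  apply: (@even_sq _ (2 * (e%:Z * V) - 2 * E * (s ^+ 2 + 4 * e%:Z * d) * y ^+ 2)).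
  by apply: (addIr (4 * E * (s ^+ 2 + 4 * e%:Z * d) * y ^+ 2)); rewrite -H; ring.
have H2 : e%:Z * V = x1 ^+ 2 + E * (s * y) ^+ 2 + 4 * e%:Z * (E * d * y ^+ 2).
  by apply: (@mulfI _ (4 : int)) => //; rewrite H ex; ring.
have [Y eY hY] : exists2 Y, E * (s * y) ^+ 2 = Y & (exists k, Y = 4 * k) \/ (exists k, Y = 8 * k + E).
  by have [[k ->]|[k ->]] := sqr_mod8 (s * y); eexists; [reflexivity| | reflexivity|];
    [left; exists (E * k); ring | right; exists (E * k); ring].
rewrite eY in H2; move: (E * d * y ^+ 2) H2 => Z; clear H ex eY => H2; move: H2.
case/orP: he => /eqP ->; rewrite ?kronecker_r1 ?(@kronecker_at_prime _ 2) // ?kp_2_mod4 // => H2.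
  by have [[a ea]|[a ea]] := sqr_mod8 x1; rewrite ea in H2; clear ea; case: hY => -[b eb]; rewrite eb in H2; clear eb;
   case: ifP => h; rewrite ?mulr1 //; lia.
by have [[a ea]|[a ea]] := sqr_mod8 x1; rewrite ea in H2; clear ea; case: hY => -[b eb]; rewrite eb in H2; clear eb;
   case: ifP => h; case: ifP => h' //; lia.
Qed.

(** The 2-adic condition left over for delta = 8 and delta = -8, where ep is the
    sign of delta: reduce the norm equation modulo 8, after dividing x by 2
    (e = 1) or by 4 (e = 2). *)
Lemma two_part_8 (V x y s d E ep : int) (e : nat) : (e == 1)%N || (e == 2)%N -> (ep == 1) || (ep == -1) ->
  ~~ (2 %| V)%Z -> (E %% 4)%Z = 1 ->
  4 * (e%:Z * V) = x ^+ 2 - 8 * ep * E * (s ^+ 2 + 4 * e%:Z * d) * y ^+ 2 -> K (8 * ep) V * K E e%:Z = 1.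
Proof.
move=> he hep oV oE H.
have [x1 ex] : exists x1, x = 2 * x1.
  apply: (@even_sq _ (2 * (e%:Z * V) + 4 * ep * E * (s ^+ 2 + 4 * e%:Z * d) * y ^+ 2)).
  by apply: (addIr (- (8 * ep * E * (s ^+ 2 + 4 * e%:Z * d) * y ^+ 2))); rewrite -H; ring.
have H2 : e%:Z * V = x1 ^+ 2 - 2 * ep * (E * (s * y) ^+ 2) - 8 * e%:Z * ep * (E * d * y ^+ 2).
  by apply: (@mulfI _ (4 : int)) => //; rewrite H ex; ring.
have [Y eY hY] : exists2 Y, E * (s * y) ^+ 2 = Y & (exists k, Y = 4 * k) \/ (exists k, Y = 8 * k + E).
  by have [[k ->]|[k ->]] := sqr_mod8 (s * y); eexists; [reflexivity| | reflexivity|];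
    [left; exists (E * k); ring | right; exists (E * k); ring].
rewrite eY in H2; move: (E * d * y ^+ 2) H2 => Z; clear H ex eY => H2; move: H2.
case/orP: he => /eqP ->; rewrite ?kronecker_r1 ?(@kronecker_at_prime _ 2) // ?kp_2_mod4 // => H2.
  have [[a ea]|[a ea]] := sqr_mod8 x1; rewrite ea in H2; clear ea; case: hY => -[b eb]; rewrite eb in H2; clear eb;
   case/orP: hep H2 => /eqP -> H2; rewrite ?mulr1 ?mulrN1 ?kronecker_8 ?kronecker_N8 //; case: ifP => h //; lia.
have [x2 ex2] : exists x2, x1 = 2 * x2.
  apply: (@even_sq _ (V + ep * Y + 8 * ep * Z)).
  by apply: (addIr (- (2 * ep * Y + 8 * 2 * ep * Z))); transitivity (2 * V); [rewrite H2; ring|ring].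
have H3 : V = 2 * x2 ^+ 2 - ep * Y - 8 * ep * Z.
  by apply: (@mulfI _ (2 : int)) => //; rewrite H2 ex2; ring.
have [[a ea]|[a ea]] := sqr_mod8 x2; rewrite ea in H3; clear ea ex2 H2; case: hY => -[b eb]; rewrite eb in H3; clear eb;
   case/orP: hep H3 => /eqP -> H3; rewrite ?mulr1 ?mulrN1 ?kronecker_8 ?kronecker_N8 //; case: ifP => h; case: ifP => h' //; lia.
Qed.

Definition sqfree (m : nat) := forall d : nat, (d ^ 2 %| m)%N -> d = 1%N.

(** A fundamental discriminant is the product of a prime discriminant at 2 (or
    1) and an odd squarefree number congruent to 1 modulo 4. *)
Lemma fund_decomp Delta : fundamental_discriminant Delta -> exists2 m, odd m /\ sqfree m &
  exists2 delta, [|| delta == 1, delta == -4, delta == 8 | delta == -8] & Delta = delta * star m.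
Proof.
case=> [[h sq]|[m [-> h sq]]].
  exists `|Delta|%N; first by split; [move: h; lia|move=> d hd; apply: sq; rewrite dvdzE absz_nat].
  by exists 1 => //; rewrite mul1r; apply: star_uniq; rewrite h.
case: h => h.
  have [m' em] : exists m', m = 2 * m' by exists (m %/ 2)%Z; lia.
  exists `|m'|%N.
    split; [lia|move=> d hd; apply: sq; rewrite em dvdzE abszM absz_nat; exact: dvdn_mull].
  have [h1|h1] : (m' %% 4)%Z = 1 \/ (- m' %% 4)%Z = 1 by lia.
    by exists 8 => //; rewrite -star_uniq // em mulrA.
  by exists (-8) => //; rewrite -abszN -star_uniq // em; ring.
exists `|m|%N.
  by split; [lia|move=> d hd; apply: sq; rewrite dvdzE absz_nat].
by exists (-4) => //; rewrite -abszN -star_uniq; [ring|lia].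
Qed.

Lemma sqfree_dvd m (x : int) : (0 < m)%N -> sqfree m -> (forall p, prime p -> (p %| m)%N -> (p%:Z %| x)%Z) -> (m%:Z %| x)%Z.
Proof.
move=> m0 sq h; rewrite dvdzE absz_nat; have /dvdnP[k ek] := dvdn_gcdl m `|x|.
suff k1 : k = 1%N by rewrite ek k1 mul1n dvdn_gcdr.
have k0 : (0 < k)%N by move: m0; rewrite ek muln_gt0 => /andP[].
apply/eqP; apply: contraT => kn1; have k2 : (1 < k)%N by rewrite ltn_neqAle eq_sym kn1.
have pp := pdiv_prime k2; have pk := pdiv_dvd k.
have pm : (pdiv k %| m)%N by rewrite ek dvdn_mulr.
have px := h _ pp pm; rewrite dvdzE absz_nat in px.
have : (pdiv k ^ 2 %| m)%N by rewrite ek expnS expn1 dvdn_mul // dvdn_gcd pm px.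
by move=> /sq p1; move: pp; rewrite p1.
Qed.

Lemma Euclid_sq p (x : int) : prime p -> (p%:Z %| x ^+ 2)%Z = (p%:Z %| x)%Z.
Proof. by move=> pp; rewrite !dvdzE abszX Euclid_dvdX // andbT. Qed.

Lemma coprime_nprime (a b : nat) : (0 < b)%N -> (forall p, prime p -> (p %| a)%N -> (p %| b)%N -> False) -> coprime a b.
Proof.
move=> b0 h; have := @coprimez_nprime a%:Z b b0; rewrite coprimezE !absz_nat; apply => p pp pb; rewrite dvdzE.
by apply/negP => pa; exact: (h p pp pa pb).
Qed.

End LAWS.

(** * Values of a genus character *)

Section GENUS.
Local Notation K := kronecker.
Local Notation kp := kronecker_prime.

Lemma dvdz_modE (d a b : int) : (a = b %[mod d])%Z -> (d %| a - b)%Z.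
Proof. by move=> h; rewrite -eqz_mod_dvd; apply/eqP. Qed.

Lemma delta_prime delta p : [|| delta == 1, delta == -4, delta == 8 | delta == -8] -> prime p -> odd p ->
  ~~ (p%:Z %| delta)%Z.
Proof.
move=> hd pp po; apply/negP; rewrite dvdzE absz_nat => pd.
have : (p %| 2 ^ 3)%N by case/or4P: hd pd => /eqP -> pd; apply: dvdn_trans pd _.
by rewrite Euclid_dvdX //= andbT dvdn_prime2 // => /eqP e; move: po; rewrite e.
Qed.

Lemma odd_square_mod8 (D t : int) : (8 %| D - t ^+ 2)%Z -> ~~ (2 %| D)%Z -> (D %% 8)%Z = 1.
Proof. by have [[k ->]|[k ->]] := sqr_mod8 t => h8 h; lia. Qed.

(** An even fundamental discriminant is not a square modulo 16; hence 4 does not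
    divide the level N when Delta is even. *)
Lemma not_square_mod16 (q t : int) : ((q %% 4)%Z == 2) || ((q %% 4)%Z == 3) -> ~~ (16 %| 4 * q - t ^+ 2)%Z.
Proof.
move=> hq; apply/negP => h16.
have [t1 et] : exists t1, t = 2 * t1.
  apply: (@even_sq _ (2 * q - 8 * ((4 * q - t ^+ 2) %/ 16)%Z)).
  by move: (divzK h16); move: (_ %/ _)%Z => k; move: (t ^+ 2) => u; clear; lia.
have h4 : t ^+ 2 = 4 * (t1 ^+ 2) by rewrite et; ring.
rewrite h4 in h16; have [[k ek]|[k ek]] := sqr_mod8 t1; rewrite ek in h16; move: h16 hq; clear; lia.
Qed.

Lemma odd_part M1 : (0 < M1)%N -> ~~ (4 %| M1)%N -> exists e M2, [/\ (e == 1)%N || (e == 2)%N, M1 = (e * M2)%N & odd M2].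
Proof.
move=> M0 h4; have [oM1|eM] := boolP (odd M1); first by exists 1%N, M1; rewrite mul1n.
by exists 2%N, M1./2; split => //; lia.
Qed.

Section MAIN.
Variables (N M m : nat) (r s D' w x y delta : int).
Hypotheses (N0 : (0 < N)%N) (MN : (M %| N)%N) (om : odd m) (sqm : sqfree m)
  (hd : [|| delta == 1, delta == -4, delta == 8 | delta == -8]).
Let Delta := delta * star m.
Hypotheses (fund4 : delta != 1 -> exists2 q, Delta = 4 * q & ((q %% 4)%Z == 2) || ((q %% 4)%Z == 3))
  (hr : ((4 * N)%:Z %| Delta - r ^+ 2)%Z)
  (hs : ((4 * N)%:Z %| D' - s ^+ 2)%Z) (cw : coprimez w Delta) (w0 : w != 0)
  (H : 4 * (M%:Z * w) = x ^+ 2 - Delta * D' * y ^+ 2).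

(** If p^2 divided N, then p would divide r and p^2 would divide the
    squarefree odd part of Delta. *)
Lemma sqr_prime_ndvd_level p : prime p -> odd p -> (p %| m)%N -> (p ^ 2 %| N)%N -> False.
Proof.
move=> pp po pm p2N.
have p2Z : ((p ^ 2)%N%:Z %| Delta - r ^+ 2)%Z.
  by apply: dvdz_trans hr; rewrite dvdzE !absz_nat dvdn_mull.
have pD : (p%:Z %| Delta)%Z by rewrite /Delta dvdz_mull // dvdzE abs_star.
have pr : (p%:Z %| r)%Z.
  rewrite -Euclid_sq // -[r ^+ 2](subKr Delta) rpredB //; apply: dvdz_trans p2Z; by rewrite dvdzE !absz_nat dvdn_exp.
have : ((p ^ 2)%N%:Z %| Delta)%Z.
  rewrite -[Delta](subrK (r ^+ 2)) rpredD //; case/dvdzP: pr => k ->; apply/dvdzP; exists (k ^+ 2).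
  by rewrite exprMn -(natz (p ^ 2)) natrX natz.
rewrite dvdzE abszM abs_star absz_nat Gauss_dvdr; first by move=> /sqm p1; move: pp; rewrite p1.
by rewrite coprimeXl // prime_coprime //; have := delta_prime hd pp po; rewrite dvdzE absz_nat.
Qed.

(** Delta is congruent to r^2 modulo 4N, so it is a nonzero square modulo each
    prime that divides n, and modulo 8 if n is even. *)
Lemma kronecker_dvd_level n : (0 < n)%N -> (n %| N)%N -> coprime n m -> (delta != 1 -> odd n) -> K Delta n = 1.
Proof.
move=> n0 nN cnm hodd; rewrite kronecker_nat // -[RHS](mulext_cst1 n); apply: eq_mulext => q pq qn.
have qN := dvdn_trans qn nN.
have qm : ~~ (q %| m)%N.
  apply/negP => qm; have : (q %| gcdn n m)%N by rewrite dvdn_gcd qn.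
  by rewrite (eqP cnm) dvdn1 => /eqP q1; move: pq; rewrite q1.
have [oq|eq] := boolP (odd q).
  have q2 : (2 < q)%N by have := prime_gt1 pq; rewrite leq_eqVlt => /orP[/eqP e|//]; move: oq; rewrite -e.
  have qr : (q%:Z %| Delta - r ^+ 2)%Z by apply: dvdz_trans hr; rewrite dvdzE !absz_nat dvdn_mull.
  have qD : ~~ (q%:Z %| Delta)%Z.
    rewrite dvdzE absz_nat /Delta abszM Euclid_dvdM // abs_star (negPf qm) orbF.
    by have := delta_prime hd pq oq; rewrite dvdzE absz_nat.
  have nr : ~~ (q%:Z %| r)%Z.
    by apply: contra qD => qr'; rewrite -[Delta](subrK (r ^+ 2)) rpredD // Euclid_sq.
  by rewrite (kp_mod pq q2 qr) expr2 kpM // kp_sqr.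
have e2 : q = 2%N by case: (even_prime pq) => // oq; rewrite oq in eq.
have dl : delta = 1.
  apply/eqP; apply: contraT => /hodd on; move: qn; rewrite e2 dvdn2 on //.
have h8 : (8 %| Delta - r ^+ 2)%Z.
  have h8N : ((4 * 2)%N%:Z %| (4 * N)%N%:Z)%Z by rewrite dvdzE !absz_nat dvdn_pmul2l // -e2.
  exact: dvdz_trans h8N hr.
have oD : ~~ (2 %| Delta)%Z by rewrite /Delta dl mul1r dvdzE abs_star dvdn2 om.
rewrite e2 kp_2E (negPf oD).
by rewrite (odd_square_mod8 h8 oD).
Qed.

(** Write M = g e M2 with g the part of M in common with Delta and e its factor at
    2 (e = 1 if Delta is odd). Then (Delta/M2) = 1 because M2 divides the level, and the equation for
    T = M2 w has multiplier e g, which is the situation of kronecker_norm_form. *)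
Lemma kronecker_norm_eq1 : K Delta w = 1.
Proof.
set g := gcdn M m.
have m0 := odd_gt0 om.
have M0 : (0 < M)%N := dvdn_gt0 N0 MN.
have g0 : (0 < g)%N by rewrite gcdn_gt0 M0.
have /dvdnP[g' eg'] : (g %| m)%N := dvdn_gcdr M m.
have /dvdnP[M1 eM1] : (g %| M)%N := dvdn_gcdl M m.
have [og' og] : odd g' /\ odd g by move: om; rewrite {1}eg' oddM => /andP[].
have gN : (g %| N)%N := dvdn_trans (dvdn_gcdl M m) MN.
have cgg : coprime g g'.
  apply: coprime_nprime (odd_gt0 og') _ => p pp pg pg'.
  by move: (pp); rewrite (sqm (_ : p ^ 2 %| m)%N) // eg' expnS expn1 dvdn_mul.
have cM1m : coprime M1 m.
  apply: coprime_nprime => // p pp pM1 pm.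
  have po : odd p by have /dvdnP[k ek] := pm; move: om; rewrite ek oddM => /andP[].
  apply: (sqr_prime_ndvd_level pp po pm); apply: dvdn_trans MN; rewrite eM1 expnS expn1 dvdn_mul // dvdn_gcd pm andbT.
  by rewrite eM1 dvdn_mulr.
have [e [M2 [he eM2 oM2]]] : exists e M2, [/\ (e == 1)%N || (e == 2)%N, M1 = (e * M2)%N & if delta == 1 then e = 1%N else odd M2].
  case: eqP => [d1|/eqP d1]; first by exists 1%N, M1; rewrite mul1n.
  have [q Dq hq] := fund4 d1.
  have N4 : ~~ (4 %| M1)%N.
    apply/negP => h4; have N4 : (4 %| N)%N by apply: dvdn_trans MN; rewrite eM1 dvdn_mulr.
    have h16N : ((4 * 4)%N%:Z %| (4 * N)%N%:Z)%Z by rewrite dvdzE !absz_nat dvdn_pmul2l.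
    by have := dvdz_trans h16N hr; rewrite Dq; apply/negP; exact: not_square_mod16.
  by apply: odd_part => //; move: M0; rewrite eM1 muln_gt0 => /andP[].
have cM2m : coprime M2 m by move: cM1m; rewrite eM2 coprimeMl => /andP[].
have M20 : (0 < M2)%N by move: M0; rewrite eM1 eM2 !muln_gt0 -andbA => /and3P[_ -> _].
have M2N : (M2 %| N)%N.
  by apply: dvdn_trans MN; rewrite eM1 eM2 -mulnA dvdn_mull // dvdn_mulr.
have KM2 : K Delta M2 = 1.
  by apply: kronecker_dvd_level => // d1; move: oM2; rewrite (negPf d1).
have d0 : delta != 0 by case/or4P: hd => /eqP ->.
have sE : star m = star g * star g' by rewrite {1}eg' starM // mulrC.
have T0 : M2%:Z * w != 0 by rewrite mulf_neq0 // eqz_nat -lt0n.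
have cwm : coprimez w m by move: cw; rewrite /Delta coprimezMr => /andP[_]; rewrite !coprimezE abs_star.
have ceT : coprimez (e%:Z * (M2%:Z * w)) (g * g')%N.
  rewrite mulnC -eg' !coprimezMl cwm andbT [coprimez _ _]coprimezE [coprimez M2 _]coprimezE cM2m andbT.
  by case/orP: he => /eqP ->; rewrite ?coprime1n ?coprime2n.
have cd : coprimez delta g%:Z.
  apply: coprimez_nprime => // p pp pg; apply: delta_prime => //.
  by have /dvdnP[k ek] := pg; move: og; rewrite ek oddM => /andP[].
have sqg : sqfree g by move=> d hdg; apply: sqm; apply: dvdn_trans hdg _; exact: dvdn_gcdr.
have gx : (g%:Z %| x)%Z.
  apply: sqfree_dvd => // p pp pg; rewrite -Euclid_sq //.
  have -> : x ^+ 2 = 4 * (M%:Z * w) + Delta * D' * y ^+ 2 by rewrite H subrK.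
  rewrite rpredD //; first by rewrite dvdz_mull // dvdz_mulr // dvdzE !absz_nat; apply: dvdn_trans pg (dvdn_gcdl _ _).
  by rewrite -mulrA dvdz_mulr // /Delta dvdz_mull // dvdzE abs_star absz_nat; apply: dvdn_trans pg (dvdn_gcdr _ _).
have gD : (g%:Z %| D' - s ^+ 2)%Z by apply: dvdz_trans hs; rewrite dvdzE !absz_nat dvdn_mull.
have H' : 4 * (e%:Z * g%:Z * (M2%:Z * w)) = x ^+ 2 - delta * (star g * star g') * D' * y ^+ 2.
  by rewrite -sE -/Delta -H eM1 eM2 !PoszM; ring.
have e0 : (0 < e)%N by case/orP: he => /eqP ->.
have := kronecker_norm_form og og' cgg e0 d0 T0 ceT cd gx gD H'.
rewrite -sE -/Delta kroneckerMr ?KM2 ?mul1r => [->||//]; last by rewrite eqz_nat -lt0n.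
have [d1|d1] := eqVneq delta 1.
  by move: oM2; rewrite d1 eqxx => ->; rewrite kronecker_l1 kronecker_r1 mulr1.
rewrite (negPf d1) in oM2.
have ow : ~~ (2 %| w)%Z.
  have [q eq _] := fund4 d1.
  apply: (@coprimez_prime _ 2 2) => //; move: cw; rewrite eq coprimezMr => /andP[h _].
  by move: h; rewrite (_ : 4 = 2%N%:Z * 2%N%:Z) // coprimezMr => /andP[].
have oV : ~~ (2 %| g%:Z * (M2%:Z * w))%Z.
  by move: ow; rewrite !dvdzE !abszM !absz_nat !dvdn2 !oddM og oM2 !negbK.
have sm := star_mod om.
have eN : (e %| N)%N by apply: dvdn_trans MN; rewrite eM1 eM2 -mulnA dvdn_mulr.
have /dvdzP[d ed] : ((4 * e)%N%:Z %| D' - s ^+ 2)%Z by apply: dvdz_trans hs; rewrite dvdzE !absz_nat dvdn_pmul2l.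
have eD : D' = s ^+ 2 + 4 * e%:Z * d by rewrite -[D'](subrK (s ^+ 2)) ed PoszM; ring.
have H3 : 4 * (e%:Z * (g%:Z * (M2%:Z * w))) = x ^+ 2 - delta * star m * (s ^+ 2 + 4 * e%:Z * d) * y ^+ 2.
  by rewrite -eD sE -H'; ring.
case/or4P: hd => /eqP ed'; first by rewrite ed' eqxx in d1.
- rewrite ed'; apply: (@two_part_N4 _ x y s d) => //; rewrite H3 ed'; ring.
- rewrite ed' (_ : 8 = 8 * 1) //; apply: (@two_part_8 _ x y s d) => //; rewrite H3 ed'; ring.
- rewrite ed' (_ : -8 = 8 * -1) //; apply: (@two_part_8 _ x y s d) => //; rewrite H3 ed'; ring.
Qed.
End MAIN.

Lemma fund_even Delta delta m : odd m -> fundamental_discriminant Delta -> Delta = delta * star m ->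
  [|| delta == 1, delta == -4, delta == 8 | delta == -8] -> delta != 1 ->
  exists2 q, Delta = 4 * q & ((q %% 4)%Z == 2) || ((q %% 4)%Z == 3).
Proof.
move=> om [[h _]|[q [Dq hq _]]] Dd hd d1; last by exists q => //; case: hq => ->.
by have sm := star_mod om; exfalso; move: hd d1 h; rewrite Dd => /or4P[] /eqP ->; lia.
Qed.

Lemma kronecker_coprime_sqr a (n : int) : n != 0 -> coprimez n a -> K a n * K a n = 1.
Proof.
move=> n0 c; rewrite kroneckerE // mulrACA -mulext_split.
have -> : kronecker_sign a n * kronecker_sign a n = 1 by rewrite /kronecker_sign; case: ifP.
rewrite mul1r -[RHS](mulext_cst1 `|n|%N); apply: eq_mulext => p pp pn; apply: kp_sqr_prime => //.
apply: coprimez_prime pp pn; rewrite coprimez_sym; move: c; by rewrite !coprimezE absz_nat.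
Qed.

Lemma fund_unit Delta : fundamental_discriminant Delta -> `|Delta|%N%:Z = 1 -> Delta = 1.
Proof. by case=> [[h _]|[q [Dq _ _]]] h1; lia. Qed.

(** The two forms N1 a X^2 + b XY + N2 c Y^2 attached to two factorizations of N
    are, up to the factors beta = N1/alpha and gamma = N1'/alpha with
    alpha = gcd(N1, N1'), values of one form of discriminant Delta D'. Multiplying
    two values of one form gives the norm equation with multiplier
    beta gamma, which divides N. *)
Lemma genus_value_uniq (N : nat) (Delta r s D' a b c n n' : int) : (0 < N)%N -> fundamental_discriminant Delta ->
  ((4 * N)%N%:Z %| Delta - r ^+ 2)%Z -> ((4 * N)%N%:Z %| D' - s ^+ 2)%Z ->
  b ^+ 2 - 4 * N%:Z * a * c = Delta * D' ->
  coprimez n Delta -> coprimez n' Delta ->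
  genus_represented N a b c n -> genus_represented N a b c n' -> K Delta n = K Delta n'.
Proof.
move=> N0 fD hr hs hdisc cn cn' [N1 [N2 [X [Y [N10 N20 eN en]]]]] [N1' [N2' [X' [Y' [N10' N20' eN' en']]]]].
have [D1|D1] := eqVneq Delta 1; first by rewrite D1 !kronecker_l1.
have [m [om sqm] [delta hd eD]] := fund_decomp fD.
have nz k : coprimez k Delta -> k != 0.
  apply: contraTneq => ->; rewrite /coprimez gcd0z; apply/eqP => h; move/eqP: D1; apply.
  exact: fund_unit.
have n0 := nz _ cn; have n0' := nz _ cn'.
pose al := gcdn N1 N1'.
have al0 : (0 < al)%N by rewrite gcdn_gt0 N10.
have /dvdnP[be ebe] : (al %| N1)%N := dvdn_gcdl _ _.
have /dvdnP[ga ega] : (al %| N1')%N := dvdn_gcdr _ _.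
(* N1 = be * al and N1' = ga * al; then N2 = de * ga and N2' = de * be *)
have cbg : coprime be ga.
  have : gcdn (be * al) (ga * al) = al by rewrite -ebe -ega.
  by rewrite -muln_gcdl => /eqP; rewrite -{2}[al]mul1n eqn_pmul2r.
have bg : (be * N2 = ga * N2')%N.
  by apply/eqP; rewrite -(eqn_pmul2l al0) !mulnA ![(al * _)%N]mulnC -ebe -ega eN eN'.
have be0 : (0 < be)%N by move: N10; rewrite ebe muln_gt0 => /andP[].
have ga0 : (0 < ga)%N by move: N10'; rewrite ega muln_gt0 => /andP[].
have /dvdnP[de ede] : (ga %| N2)%N by rewrite -(@Gauss_dvdr ga be) 1?coprime_sym // bg dvdn_mulr.
have ede' : (N2' = de * be)%N.
  by apply/eqP; rewrite -(eqn_pmul2l ga0) -bg ede; apply/eqP; ring.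
have MN : (be * ga %| N)%N by rewrite -eN ebe ede; apply/dvdnP; exists (al * de)%N; ring.
have H : 4 * ((be * ga)%N%:Z * (n * n')) =
  (2 * al%:Z * a * (be%:Z * X) * (ga%:Z * X') + b * (be%:Z * X * Y' + ga%:Z * X' * Y) + 2 * be%:Z * ga%:Z * de%:Z * c * Y * Y') ^+ 2
  - Delta * D' * (be%:Z * X * Y' - ga%:Z * X' * Y) ^+ 2.
  by rewrite -hdisc en en' -eN ede' ede ega ebe !PoszM; ring.
rewrite eD in H hr cn cn' *.
have cnn : coprimez (n * n') (delta * star m) by rewrite coprimezMl cn.
have f4 := fund_even om fD eD hd; rewrite eD in f4.
have := kronecker_norm_eq1 N0 MN om sqm hd f4 hr hs cnn (mulf_neq0 n0 n0') H.
rewrite kroneckerMr // => h1; have h2 := kronecker_coprime_sqr n0' cn'.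
transitivity (K (delta * star m) n * (K (delta * star m) n' * K (delta * star m) n')); first by rewrite h2 mulr1.
by rewrite mulrA h1 mul1r.
Qed.

End GENUS.

Local Open Scope classical_set_scope.
Local Open Scope ring_scope.
Local Open Scope complex_scope.

(** * Unconditional complex sums *)

Section S.
Variable R : realType.
Local Notation C := R[i].
(** The modulus as a real number; the library norm of a complex number is
    again complex. *)
Definition cabs (z : C) : R := complex.Re `|z|.
Lemma cabsE z : `|z| = (cabs z)%:C.
Proof. by rewrite /cabs (normc_def z). Qed.

Lemma cabs_ge0 z : 0 <= cabs z.
Proof. by rewrite -lecR -cabsE normr_ge0. Qed.

Lemma cabs0 : cabs 0 = 0.
Proof. by rewrite /cabs normr0. Qed.

Lemma cabsM x y : cabs (x * y) = cabs x * cabs y.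
Proof. by apply: (@complexI R); rewrite rmorphM -!cabsE normrM. Qed.

Lemma cabsD x y : cabs (x + y) <= cabs x + cabs y.
Proof. by rewrite -lecR rmorphD -!cabsE ler_normD. Qed.

Lemma cabsN x : cabs (- x) = cabs x.
Proof. by rewrite /cabs normrN. Qed.

Lemma cabsC (x : R) : cabs x%:C = `|x|.
Proof. by apply: (@complexI R); rewrite -cabsE normc_def /= expr0n addr0 sqrtr_sqr. Qed.

Lemma cabs_eq0 x : (cabs x == 0) = (x == 0).
Proof. by rewrite -(inj_eq (@complexI R)) -cabsE normr_eq0. Qed.

Lemma Re_le_cabs z : `|complex.Re z| <= cabs z.
Proof. by rewrite -lecR -cabsE normc_ge_Re. Qed.

Lemma Im_le_cabs z : `|complex.Im z| <= cabs z.
Proof.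
by rewrite -lecR -cabsE normc_def lecR /= -sqrtr_sqr ler_sqrt ?lerDr ?sqr_ge0 // addr_ge0 ?sqr_ge0.
Qed.

Lemma cabs_le_ReIm z : cabs z <= `|complex.Re z| + `|complex.Im z|.
Proof.
rewrite {1}(complexE z) (le_trans (cabsD _ _)) // cabsC lerD2l cabsM cabsC.
suff -> : cabs 'i = 1 by rewrite mul1r.
by rewrite /cabs normc_def /= expr0n expr1n add0r sqrtr1.
Qed.

Lemma cReD (x y : C) : complex.Re (x + y) = complex.Re x + complex.Re y. Proof. by case: x y => ? ? []. Qed.

Lemma cImD (x y : C) : complex.Im (x + y) = complex.Im x + complex.Im y. Proof. by case: x y => ? ? []. Qed.

Lemma cReN (x : C) : complex.Re (- x) = - complex.Re x. Proof. by case: x. Qed.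

Lemma cImN (x : C) : complex.Im (- x) = - complex.Im x. Proof. by case: x. Qed.

Lemma cReB (x y : C) : complex.Re (x - y) = complex.Re x - complex.Re y. Proof. by rewrite cReD cReN. Qed.

Lemma cImB (x y : C) : complex.Im (x - y) = complex.Im x - complex.Im y. Proof. by rewrite cImD cImN. Qed.

Lemma cReM (x y : C) : complex.Re (x * y) = complex.Re x * complex.Re y - complex.Im x * complex.Im y. Proof. by case: x y => ? ? []. Qed.

Lemma cImM (x y : C) : complex.Im (x * y) = complex.Re x * complex.Im y + complex.Im x * complex.Re y. Proof. by case: x y => ? ? []. Qed.

Lemma cabs_sum (I : Type) (s : seq I) (P : pred I) (F : I -> C) : cabs (\sum_(i <- s | P i) F i) <= \sum_(i <- s | P i) cabs (F i).
Proof. elim/big_ind2: _ => //=; first by rewrite cabs0. move=> a b c d h1 h2; exact: le_trans (cabsD _ _) (lerD h1 h2). Qed.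

Lemma cabsX x n : cabs (x ^+ n) = cabs x ^+ n.
Proof. elim: n => [|n IH]; first by rewrite !expr0 cabsC normr1. by rewrite !exprS cabsM IH. Qed.

(** Unconditional summation: convergence of the finite partial sums along the
    directed set of finite sets of indices. *)
Definition hasS (I : choiceType) (a : I -> C) (s : C) : Prop :=
  forall e : R, 0 < e -> exists F0 : {fset I}, forall F : {fset I}, (F0 `<=` F)%fset ->
   cabs (\sum_(i <- F) a i - s) < e.

Lemma hasS_cvg (I : choiceType) (a : I -> C) (s : C) : hasS a s <-> summability.partial_sum a @ summability.totally --> s.
Proof.
have PF := @summability.totally_filter I.
have FF : Filter (@summability.totally I) by exact _.
have E F : summability.partial_sum a F = \sum_(i <- F) a i.
  by rewrite /summability.partial_sum; rewrite big_seq_fsetE.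
split.
  move=> h; apply/cvgrPdist_lt => e e0.
  have [e0' ee] : 0 < complex.Re e /\ e = (complex.Re e)%:C.
    by move: e0; case: e => x y; rewrite ltcE /= => /andP[/eqP -> ->].
  have [F0 hF] := h _ e0'; exists F0 => //= F /= hh.
  by rewrite distrC E cabsE ee ltcR hF.
move/cvgrPdist_lt => h e e0; have e0c : 0 < e%:C by rewrite ltcR.
have [F0 _ hF] := h _ e0c. exists F0 => F /hF /=.
by rewrite distrC E cabsE ltcR.
Qed.

Lemma fsum_split (V : nmodType) (I : choiceType) (A B : {fset I}) (f : I -> V) : (A `<=` B)%fset ->
  \sum_(i <- B) f i = \sum_(i <- A) f i + \sum_(i <- (B `\` A)%fset) f i.
Proof.
move=> AB; rewrite -big_cat /=; apply: perm_big; apply: uniq_perm; rewrite ?fset_uniq //.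
  rewrite cat_uniq !fset_uniq /= andbT; apply/hasPn => x /=; by rewrite in_fsetD => /andP[].
move=> x; rewrite mem_cat in_fsetD; case xA: (x \in A) => //=; exact: (fsubsetP AB).
Qed.

Lemma fsum_le (I : choiceType) (A B : {fset I}) (f : I -> R) : (A `<=` B)%fset -> (forall i, 0 <= f i) ->
  \sum_(i <- A) f i <= \sum_(i <- B) f i.
Proof. by move=> AB f0; rewrite (fsum_split _ AB) lerDl sumr_ge0. Qed.

(** Finite rectangles are cofinal among the finite subsets of a product, so that
    double sums need only this case of the finite Fubini identity. *)
Lemma fsum_prod (V : nmodType) (I K : choiceType) (G : {fset I}) (H : {fset K}) (f : I * K -> V) :
  \sum_(x <- (G `*` H)%fset) f x = \sum_(i <- G) \sum_(k <- H) f (i, k).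
Proof.
transitivity (\sum_(x <- [seq (i, k) | i <- enum_fset G, k <- enum_fset H]) f x); last by rewrite big_allpairs.
apply: perm_big; apply: uniq_perm; rewrite ?fset_uniq //.
  by rewrite allpairs_uniq // => -[a b] [c d].
move=> [i k]; rewrite in_fsetM; apply/idP/idP => [/andP[/= iG kH]|].
  by apply/allpairsP; exists (i, k).
by case/allpairsP => -[a b] /= [aG bH [-> ->]]; rewrite aG bH.
Qed.

(** Absolute summability with an explicit bound, which makes estimates uniform
    in parameters. *)
Definition absle (I : choiceType) (a : I -> C) (M : R) : Prop :=
  forall F : {fset I}, \sum_(i <- F) cabs (a i) <= M.

Lemma absle_ge0 (I : choiceType) (a : I -> C) M : absle a M -> 0 <= M.
Proof. by move=> /(_ fset0); rewrite big_seq_fset0. Qed.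

Lemma absle_le (I : choiceType) (a b : I -> C) M M' : absle a M -> (forall i, cabs (b i) <= cabs (a i)) -> M <= M' -> absle b M'.
Proof. by move=> h ba MM F; apply: le_trans MM; apply: le_trans (h F); apply: ler_sum. Qed.

Lemma absle1 (I : choiceType) (a : I -> C) M i : absle a M -> cabs (a i) <= M.
Proof. by move=> /(_ [fset i]%fset); rewrite big_seq_fset1. Qed.

Lemma absleD (I : choiceType) (a b : I -> C) M M' : absle a M -> absle b M' -> absle (fun i => a i + b i) (M + M').
Proof.
move=> h1 h2 F; apply: le_trans (lerD (h1 F) (h2 F)); rewrite -big_split /=; apply: ler_sum => i _; exact: cabsD.
Qed.

Lemma absleZ (I : choiceType) (a : I -> C) M x : absle a M -> absle (fun i => x * a i) (cabs x * M).
Proof. by move=> h1 F; under eq_bigr do rewrite cabsM; rewrite -mulr_sumr ler_wpM2l // cabs_ge0. Qed.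

Lemma hasS_uniq (I : choiceType) (a : I -> C) s t : hasS a s -> hasS a t -> s = t.
Proof.
move=> h1 h2; apply/eqP; rewrite -subr_eq0 -cabs_eq0 eq_le cabs_ge0 andbT.
apply/ler_addgt0Pl => e e0; rewrite addr0.
have e2 : 0 < e / 2 by rewrite divr_gt0.
have [F0 /(_ (F0 `|` _)%fset) hF] := h1 _ e2; have [F1 /(_ (_ `|` F1)%fset) hG] := h2 _ e2.
have {}hF := hF F1 (fsubsetUl _ _); have {}hG := hG F0 (fsubsetUr _ _).
set x := \sum_(i <- _) _ in hF hG.
rewrite (_ : s - t = (x - t) - (x - s)); last by ring.
by rewrite (le_trans (cabsD _ _)) // cabsN [e]splitr lerD // ltW.
Qed.

Lemma hasS_ext (I : choiceType) (a b : I -> C) s : (forall i, a i = b i) -> hasS a s -> hasS b s.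
Proof. by move=> h; have -> : b = a by apply/funext => i. Qed.

Lemma hasSD (I : choiceType) (a b : I -> C) s t : hasS a s -> hasS b t -> hasS (fun i => a i + b i) (s + t).
Proof.
move=> h1 h2 e e0; have e2 : 0 < e / 2 by rewrite divr_gt0.
have [F0 hF] := h1 _ e2; have [F1 hG] := h2 _ e2.
exists (F0 `|` F1)%fset => F; rewrite fsubUset => /andP[/hF {}hF /hG {}hG].
by rewrite big_split /= opprD addrACA (le_lt_trans (cabsD _ _)) // [e]splitr ltrD.
Qed.

Lemma hasS0 (I : choiceType) : hasS (fun _ : I => 0) 0.
Proof. by move=> e e0; exists fset0 => F _; rewrite big1 // subr0 cabs0. Qed.

Lemma hasSZ (I : choiceType) (a : I -> C) s x : hasS a s -> hasS (fun i => x * a i) (x * s).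
Proof.
move=> h; have [->|x0] := eqVneq x 0.
  by rewrite mul0r; apply: hasS_ext (hasS0 _) => i; rewrite mul0r.
have cx : 0 < cabs x by rewrite lt_def cabs_ge0 cabs_eq0 x0.
move=> e e0; have [F0 hF] := h (e / cabs x) (divr_gt0 e0 cx).
exists F0 => F /hF; rewrite ltr_pdivlMr // => h'.
by rewrite -mulr_sumr -mulrBr cabsM mulrC.
Qed.

Lemma hasSN (I : choiceType) (a : I -> C) s : hasS a s -> hasS (fun i => - a i) (- s).
Proof. by move=> /(hasSZ (-1)); rewrite mulN1r; apply: hasS_ext => i; rewrite mulN1r. Qed.

Lemma hasSB (I : choiceType) (a b : I -> C) s t : hasS a s -> hasS b t -> hasS (fun i => a i - b i) (s - t).
Proof. by move=> h /hasSN h2; exact: hasSD. Qed.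

Lemma hasS_fin (I : choiceType) (a : I -> C) (F0 : {fset I}) : (forall i, i \notin F0 -> a i = 0) -> hasS a (\sum_(i <- F0) a i).
Proof.
move=> h e e0; exists F0 => F FF; rewrite (fsum_split _ FF) [X in _ + X - _]big_seq [X in _ + X - _]big1; first by rewrite addr0 subrr cabs0.
by move=> i; rewrite in_fsetD => /andP[/h].
Qed.

Lemma hasS_le (I : choiceType) (a : I -> C) s M : hasS a s -> absle a M -> cabs s <= M.
Proof.
move=> h b; apply/ler_addgt0Pl => e e0; have [F0 /(_ F0 (fsubset_refl _)) hF] := h _ e0.
rewrite -(subrK (\sum_(i <- F0) a i) s) (le_trans (cabsD _ _)) // lerD //.
  by rewrite -cabsN opprB ltW.
exact: le_trans (cabs_sum _ _ _) (b F0).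
Qed.

(** For nonnegative terms the sum is the supremum of the finite partial sums. *)
Lemma absle_nneg_ex (I : choiceType) (x : I -> R) M : (forall i, 0 <= x i) -> absle (fun i => (x i)%:C) M ->
  exists s : R, hasS (fun i => (x i)%:C) s%:C.
Proof.
move=> x0 h; pose A := [set y | exists F : {fset I}, y = \sum_(i <- F) x i].
have hA : has_sup A.
  split; first by exists (\sum_(i <- (fset0 : {fset I})) x i), fset0.
  exists M => y [F ->]; apply: le_trans (h F); apply: ler_sum => i _; by rewrite cabsC ger0_norm.
exists (sup A) => e e0.
have [y [F0 ->] hy] := sup_adherent e0 hA; exists F0 => F FF.
rewrite -rmorph_sum -rmorphB cabsC /= ler0_norm.
  rewrite opprB ltrBlDr -ltrBlDl; apply: lt_le_trans hy _; exact: fsum_le.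
by rewrite subr_le0; apply: ub_le_sup; [case: hA|exists F].
Qed.

Lemma absle_real_ex (I : choiceType) (x : I -> R) M : absle (fun i => (x i)%:C) M ->
  exists s : R, hasS (fun i => (x i)%:C) s%:C.
Proof.
move=> h.
have [s hs] : exists s : R, hasS (fun i => ((`|x i| + x i)/2)%:C) s%:C.
  apply: (@absle_nneg_ex _ _ M).
    by move=> i; rewrite divr_ge0 // -lerBlDr sub0r -normrN ler_norm.
  apply: absle_le h _ (lexx _) => i; rewrite !cabsC ger0_norm; first by have := ler_norm (x i); lra.
  by rewrite divr_ge0 // -lerBlDr sub0r -normrN ler_norm.
have [t ht] : exists s : R, hasS (fun i => ((`|x i| - x i)/2)%:C) s%:C.
  apply: (@absle_nneg_ex _ _ M).
    by move=> i; rewrite divr_ge0 // subr_ge0 ler_norm.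
  apply: absle_le h _ (lexx _) => i; rewrite !cabsC ger0_norm; first by have := ler_norm (- x i); rewrite normrN; lra.
  by rewrite divr_ge0 // subr_ge0 ler_norm.
exists (s - t); rewrite rmorphB; apply: hasS_ext (hasSB hs ht) => i; rewrite -rmorphB /=; congr (_ %:C); lra.
Qed.

Lemma absle_hasS (I : choiceType) (a : I -> C) M : absle a M -> exists s, hasS a s.
Proof.
move=> h.
have [s hs] : exists s : R, hasS (fun i => (complex.Re (a i))%:C) s%:C.
  by apply: (@absle_real_ex _ _ M); apply: absle_le h _ (lexx _) => i; rewrite cabsC Re_le_cabs.
have [t ht] : exists s : R, hasS (fun i => (complex.Im (a i))%:C) s%:C.
  by apply: (@absle_real_ex _ _ M); apply: absle_le h _ (lexx _) => i; rewrite cabsC Im_le_cabs.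
exists (s%:C + 'i * t%:C); apply: hasS_ext (hasSD hs (hasSZ 'i ht)) => i.
by rewrite -complexE.
Qed.

(** Finitely many slices converge simultaneously. *)
Lemma slices_uniform (I K : choiceType) (a : I * K -> C) (t : I -> C) (G : {fset I}) e : 0 < e ->
  (forall i, hasS (fun k => a (i, k)) (t i)) ->
  exists K0 : {fset K}, forall H : {fset K}, (K0 `<=` H)%fset -> forall i, i \in G -> cabs (\sum_(k <- H) a (i, k) - t i) < e.
Proof.
move=> e0 h; have /choice[Ki hK] i := h i e e0.
exists (\bigcup_(i <- G) Ki i)%fset => H KH i iG; apply: hK.
apply: fsubset_trans KH; exact: (@bigfcup_sup _ _ (enum_fset G) i xpredT Ki iG isT).
Qed.

(** Fubini for unconditional sums: if the double sum and all slice sums exist, the slice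
    sums add up to the double sum. *)
Lemma hasS_pair (I K : choiceType) (a : I * K -> C) (t : I -> C) s :
  (forall i, hasS (fun k => a (i, k)) (t i)) -> hasS a s -> hasS t s.
Proof.
move=> ht hs e e0; have e2 : 0 < e / 2 by rewrite divr_gt0.
have [F0 hF] := hs _ e2; exists [fset x.1 | x in F0]%fset => G FG.
have e3 : 0 < e / 2 / (size G).+1%:R by rewrite divr_gt0 // ltr0n.
have [K0 hK] := slices_uniform G e3 ht.
pose H := (K0 `|` [fset x.2 | x in F0])%fset.
have hGH : (F0 `<=` G `*` H)%fset.
  apply/fsubsetP => x xF; rewrite in_fsetM; apply/andP; split.
    by apply: (fsubsetP FG); exact: in_imfset.
  by rewrite in_fsetU; apply/orP; right; exact: in_imfset.
have := hF _ hGH; rewrite fsum_prod => h1.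
rewrite -[X in X - s](subrK (\sum_(i <- G) \sum_(k <- H) a (i, k))) -addrA (le_lt_trans (cabsD _ _)) // [e]splitr ler_ltD //.
rewrite -sumrB (le_trans (cabs_sum _ _ _)) //.
rewrite (@le_trans _ _ (\sum_(i <- G) (e / 2 / (size G).+1%:R))) //.
  rewrite !big_seq; apply: ler_sum => i iG; rewrite -cabsN opprB ltW //.
  apply: hK => //; exact: fsubsetUl.
rewrite big_const_seq count_predT iter_addr_0 -[_ *+ size G]mulr_natr -mulrA ler_piMr //; first exact: ltW.
by rewrite mulrC ler_pdivrMr ?ltr0n // mul1r ler_nat.
Qed.

Lemma absle_pair (I K : choiceType) (a : I * K -> C) (t : I -> C) M :
  (forall i, hasS (fun k => a (i, k)) (t i)) -> absle a M -> absle t M.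
Proof.
move=> ht b G; apply/ler_addgt0Pl => e e0.
have e3 : 0 < e / (size G).+1%:R by rewrite divr_gt0 // ltr0n.
have [K0 hK] := slices_uniform G e3 ht.
rewrite (@le_trans _ _ (\sum_(i <- G) (e / (size G).+1%:R + \sum_(k <- K0) cabs (a (i, k))))) //.
  rewrite !big_seq; apply: ler_sum => i iG.
  rewrite -(subrK (\sum_(k <- K0) a (i, k)) (t i)) (le_trans (cabsD _ _)) // lerD ?cabs_sum //.
  by rewrite -cabsN opprB ltW // hK.
rewrite big_split /= lerD //; last by rewrite -(fsum_prod _ _ (fun x => cabs (a x))); exact: b.
rewrite big_const_seq count_predT iter_addr_0 -[_ *+ size G]mulr_natr -mulrA ler_piMr //; first exact: ltW.
by rewrite mulrC ler_pdivrMr ?ltr0n // mul1r ler_nat.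
Qed.

Lemma absle_slices (I K : choiceType) (a : I * K -> C) (m : I -> R) M :
  (forall i, absle (fun k => a (i, k)) (m i)) -> (forall G : {fset I}, \sum_(i <- G) m i <= M) -> absle a M.
Proof.
move=> h b F; pose G := [fset x.1 | x in F]%fset; pose H := [fset x.2 | x in F]%fset.
rewrite (@le_trans _ _ (\sum_(x <- (G `*` H)%fset) cabs (a x))) //.
  apply: fsum_le => [|i]; last exact: cabs_ge0.
  by apply/fsubsetP => x xF; rewrite in_fsetM !in_imfset.
by rewrite fsum_prod (le_trans _ (b G)) //; apply: ler_sum => i _; exact: h.
Qed.

(** A finite set of indices is pulled back along an injection; sums of
    families supported on the image are unchanged. *)
Lemma fset_pmap_ex (I J : choiceType) (phi : J -> I) (F : {fset I}) : injective phi ->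
  exists F' : {fset J}, (forall j, (j \in F') = (phi j \in F)) /\
   forall (V : nmodType) (f : I -> V), (forall i, (forall j, phi j <> i) -> f i = 0) ->
     \sum_(i <- F) f i = \sum_(j <- F') f (phi j).
Proof.
move=> phiI.
pose psi i := if pselect (exists j, phi j = i) is left e then Some (projT1 (cid e)) else None.
have psiK : ocancel psi phi.
  by move=> i; rewrite /psi; case: pselect => //= e; case: cid.
have phiK : pcancel phi psi.
  move=> j; rewrite /psi; case: pselect => [e|[]]; last by exists j.
  by congr Some; apply: phiI; case: cid.
exists [fset j | j in pmap psi F]%fset; split.
  move=> j; rewrite in_fset /= mem_pmap; apply/mapP/idP => [[i iF]|jF].
    by rewrite /psi; case: pselect => // e [->]; case: cid => /= ? ->.
  by exists (phi j) => //; rewrite phiK.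
move=> V f f0.
transitivity (\sum_(j <- pmap psi F) f (phi j)).
  elim: (enum_fset F) => [|i s IH]; first by rewrite !big_nil.
  rewrite big_cons /= IH; case E: (psi i) => [j|] /=.
    by rewrite big_cons; congr (f _ + _); have := psiK i; rewrite E.
  rewrite f0 ?add0r // => j ji; by move: E; rewrite -ji phiK.
apply: perm_big; apply: uniq_perm; rewrite ?fset_uniq ?(pmap_uniq psiK) ?fset_uniq //.
by move=> j; rewrite in_fset.
Qed.

Lemma absle_inj (I J : choiceType) (phi : J -> I) (a : I -> C) M : injective phi ->
  (forall i, (forall j, phi j <> i) -> a i = 0) -> absle (fun j => a (phi j)) M -> absle a M.
Proof.
move=> phiI a0 h F; have [F' [_ e]] := fset_pmap_ex F phiI.
rewrite (e _ (fun i => cabs (a i))); first exact: h.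
by move=> i /a0 ->; rewrite cabs0.
Qed.

Lemma absle_comp (I J : choiceType) (phi : J -> I) (a : I -> C) M : injective phi ->
  absle a M -> absle (fun j => a (phi j)) M.
Proof.
move=> phiI h F; apply: le_trans (h [fset phi j | j in F]%fset).
by rewrite big_imfset //= => x y _ _; exact: phiI.
Qed.

Lemma hasS_inj (I J : choiceType) (phi : J -> I) (a : I -> C) s : injective phi ->
  (forall i, (forall j, phi j <> i) -> a i = 0) -> hasS (fun j => a (phi j)) s -> hasS a s.
Proof.
move=> phiI a0 h e e0; have [F0 hF] := h _ e0.
exists [fset phi j | j in F0]%fset => F FF; have [F' [iF ee]] := fset_pmap_ex F phiI.
rewrite (ee _ _ a0); apply: hF; apply/fsubsetP => j jF; rewrite iF; apply: (fsubsetP FF).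
exact: in_imfset.
Qed.

Lemma hasS_swap (I K : choiceType) (a : I * K -> C) s : hasS a s -> hasS (fun x : K * I => a (x.2, x.1)) s.
Proof.
move=> h; apply: (@hasS_inj _ _ (fun x : I * K => (x.2, x.1))) => //=.
- by move=> [? ?] [? ?] [-> ->].
- by move=> [x y] /(_ (y, x)).
- by apply: hasS_ext h => -[].
Qed.

Lemma hasS_cols (I K : choiceType) (a : I * K -> C) (t : K -> C) s :
  (forall k, hasS (fun i => a (i, k)) (t k)) -> hasS a s -> hasS t s.
Proof. by move=> h /hasS_swap; exact: hasS_pair. Qed.

Lemma leq_fmax (F : {fset nat}) i : i \in F -> (i <= \max_(j <- F) j)%N.
Proof. by move=> iF; rewrite (big_rem i iF) /= leq_maxl. Qed.

Lemma absle_nat (a : nat -> C) M : (forall n, \sum_(i < n) cabs (a i) <= M) -> absle a M.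
Proof.
move=> h F; pose n := (\max_(i <- F) i).+1; apply: le_trans (h n).
rewrite -(big_mkord xpredT (fun i => cabs (a i))) /index_iota subn0.
rewrite (_ : \sum_(i <- iota 0 n) _ = \sum_(i <- [fset i | i in iota 0 n]%fset) cabs (a i)); last first.
  apply: perm_big; apply: uniq_perm; rewrite ?iota_uniq ?fset_uniq // => i; by rewrite in_fset.
apply: fsum_le => [|i]; last exact: cabs_ge0.
apply/fsubsetP => i iF; rewrite in_fset mem_iota /= add0n ltnS.
exact: leq_fmax.
Qed.

(** An unconditional sum over the naturals is also the limit of the sequential partial
    sums; this imports the values of classical series. *)
Lemma hasS_series (x : nat -> R) (s : C) (l : R) : hasS (fun n => (x n)%:C) s -> series x @ \oo --> l -> s = l%:C.
Proof.
move=> h hl.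
have E : series x @ \oo --> complex.Re s.
  apply/cvgrPdist_lt => e e0; have [F0 hF] := h _ e0.
  exists (\max_(i <- F0) i).+1 => //= n /= hn.
  have := hF [fset i | i in iota 0 n]%fset.
  rewrite seriesEnat /=; set X := \sum_(i <- _) _.
  have -> : X = (\sum_(0 <= k < n) x k)%:C.
    rewrite rmorph_sum /index_iota subn0; apply: perm_big; apply: uniq_perm; rewrite ?iota_uniq ?fset_uniq // => i.
    by rewrite in_fset.
  move=> H; apply: le_lt_trans (H _); last first.
    apply/fsubsetP => i iF; rewrite in_fset mem_iota /= add0n; apply: leq_trans hn.
    rewrite ltnS; exact: leq_fmax.
  by rewrite -cabsN opprB; apply: le_trans (Re_le_cabs _); rewrite cReB.
have El : complex.Re s = l by apply: cvg_unique E hl.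
have I0 : complex.Im s = 0.
  apply/eqP; rewrite -normr_eq0 eq_le normr_ge0 andbT; apply/ler_addgt0Pl => e e0; rewrite addr0.
  have [F0 /(_ F0 (fsubset_refl _)) hF] := h _ e0; apply/ltW; apply: le_lt_trans hF.
  rewrite -rmorph_sum -cabsN opprB; apply: le_trans (Im_le_cabs _).
  by rewrite cImB /= subr0.
by move: El I0; case: (s) => /= ? ? -> ->.
Qed.

Lemma absle_geom (x : R) : 0 <= x < 1 -> absle (fun n => (x ^+ n)%:C) (1 - x)^-1.
Proof.
move=> /andP[x0 x1]; apply: absle_nat => n.
under eq_bigr do rewrite cabsC ger0_norm ?exprn_ge0 //.
have x10 : 0 < 1 - x by lra.
rewrite -(ler_pM2l x10) divff ?gt_eqF // -opprB mulNr -subrX1 opprB lerBlDr lerDl exprn_ge0 //.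
Qed.

Lemma hasS_exp (x : R) : hasS (fun n => (x ^+ n / n`!%:R)%:C) (expR x)%:C /\ absle (fun n => (x ^+ n / n`!%:R)%:C) (expR `|x|).
Proof.
have E y : exp_coeff y = (fun n => y ^+ n / n`!%:R :> R) by rewrite exp_coeffE; apply/funext => n; rewrite mulrC.
have b : absle (fun n => (x ^+ n / n`!%:R)%:C) (expR `|x|).
  apply: absle_nat => n; rewrite /expR.
  have nd : {homo series (exp_coeff `|x|) : m n / (m <= n)%N >-> m <= n}.
    apply/nondecreasing_seqP => k; rewrite /series /= big_nat_recr //= lerDl E divr_ge0 // exprn_ge0 //.
  have := nondecreasing_cvgn_le nd (is_cvg_series_exp_coeff _) n.
  rewrite seriesEnat E /= big_mkord; apply: le_trans; apply: ler_sum => i _.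
  by rewrite cabsC normrM normrX (@ger0_norm _ (_^-1)).
split=> //; have [s hs] := absle_hasS b; suff <- : s = (expR x)%:C by [].
apply: hasS_series hs _; rewrite -E; exact: is_cvg_series_exp_coeff.
Qed.

End S.

(** * Absolutely convergent double power series *)

Section AN.
Variable R : realType.
Local Notation C := R[i].

Definition mono (ij : nat * nat) (X Y : R) : R := X ^+ ij.1 * Y ^+ ij.2.

Lemma mono_ge0 ij r : 0 <= r -> 0 <= mono ij r r.
Proof. by move=> h; rewrite mulr_ge0 // exprn_ge0. Qed.

Lemma mono_le ij X Y r : `|X| <= r -> `|Y| <= r -> `|mono ij X Y| <= mono ij r r.
Proof.
move=> h1 h2; have r0 : 0 <= r := le_trans (normr_ge0 _) h1.
by rewrite normrM !normrX ler_pM ?exprn_ge0 // lerXn2r // ?nnegrE.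
Qed.

(** An absolutely convergent double power series on the real box of
    half-width r. The bound M is a Banach algebra norm of g: it is submultiplicative,
    which makes infinite sums and compositions of such functions manageable
    without holomorphic extension to two complex variables. *)
Definition AN (r M : R) (g : R -> R -> C) : Prop :=
  exists a : nat * nat -> C, absle (fun ij => a ij * (mono ij r r)%:C) M /\
   forall X Y, `|X| <= r -> `|Y| <= r -> hasS (fun ij => a ij * (mono ij X Y)%:C) (g X Y).

Lemma absle_mono (a : nat * nat -> C) r M X Y : absle (fun ij => a ij * (mono ij r r)%:C) M -> `|X| <= r -> `|Y| <= r ->
  absle (fun ij => a ij * (mono ij X Y)%:C) M.
Proof.
move=> h hX hY; apply: absle_le h _ (lexx _) => ij; rewrite !cabsM ler_wpM2l ?cabs_ge0 // !cabsC.
by rewrite [leRHS]ger0_norm ?mono_le // mono_ge0 // (le_trans _ hX).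
Qed.

Lemma AN_bound r M g X Y : AN r M g -> `|X| <= r -> `|Y| <= r -> cabs (g X Y) <= M.
Proof. by move=> [a [h s]] hX hY; apply: hasS_le (s _ _ hX hY) _; exact: absle_mono h hX hY. Qed.

Lemma AN_ge0 r M g : AN r M g -> 0 <= M.
Proof. by move=> [a [/absle_ge0]]. Qed.

Lemma AN_ext r M g g' : (forall X Y, `|X| <= r -> `|Y| <= r -> g X Y = g' X Y) -> AN r M g -> AN r M g'.
Proof. by move=> e [a [h s]]; exists a; split=> // X Y hX hY; rewrite -e //; exact: s. Qed.

Lemma AN_le r M M' g : M <= M' -> AN r M g -> AN r M' g.
Proof. by move=> e [a [h s]]; exists a; split=> //; exact: absle_le h _ e. Qed.

Lemma AN_shrink r r' M g : 0 <= r' <= r -> AN r M g -> AN r' M g.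
Proof.
move=> /andP[r0 rr] [a [h s]]; exists a; split.
  by apply: absle_mono h _ _; rewrite ger0_norm.
by move=> X Y hX hY; apply: s; exact: le_trans rr.
Qed.

Lemma absle_single (I : choiceType) (a : I -> C) (i0 : I) : (forall i, i != i0 -> a i = 0) -> absle a (cabs (a i0)).
Proof.
move=> h F; have [iF|iF] := boolP (i0 \in F).
  rewrite (big_rem i0 iF) /= [X in _ + X]big_seq [X in _ + X]big1 ?addr0 // => i.
  by rewrite mem_rem_uniq ?fset_uniq // inE => /andP[/h -> _]; rewrite cabs0.
rewrite big_seq big1 ?cabs_ge0 // => i iF'; rewrite h ?cabs0 //.
by apply: contraNneq iF => <-.
Qed.

Lemma hasS_single (I : choiceType) (a : I -> C) (i0 : I) : (forall i, i != i0 -> a i = 0) -> hasS a (a i0).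
Proof.
move=> h; have := @hasS_fin R I a [fset i0]%fset; rewrite big_seq_fset1; apply=> i.
by rewrite in_fset1; exact: h.
Qed.

Lemma AN_cst r c : AN r (cabs c) (fun _ _ => c).
Proof.
pose a (ij : nat * nat) : C := if ij == (0, 0)%N then c else 0.
have a0 X Y : c = a (0, 0)%N * (mono (0, 0)%N X Y)%:C by rewrite /a /mono /= !expr0 !mulr1.
exists a; split.
  have -> : cabs c = cabs (a (0, 0)%N * (mono (0, 0)%N r r)%:C) by rewrite -a0.
  apply: (@absle_single _ (fun ij : nat * nat => a ij * (mono ij r r)%:C) (0, 0)%N).
  by move=> i /negPf i0; rewrite /a i0 mul0r.
move=> X Y _ _; rewrite [X in hasS _ X](a0 X Y); apply: (@hasS_single _ (fun ij : nat * nat => a ij * (mono ij X Y)%:C) (0, 0)%N).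
by move=> i /negPf i0; rewrite /a i0 mul0r.
Qed.

Lemma AN_mono r M g p : 0 <= r -> AN r M g -> AN r (mono p r r * M) (fun X Y => (mono p X Y)%:C * g X Y).
Proof.
move=> r0 [a [h s]].
pose phi (ij : nat * nat) := (ij.1 + p.1, ij.2 + p.2)%N.
pose b (ij : nat * nat) : C := if (p.1 <= ij.1)%N && (p.2 <= ij.2)%N then a (ij.1 - p.1, ij.2 - p.2)%N else 0.
have phiI : injective phi by move=> [i j] [i' j'] [/addIn -> /addIn ->].
have b0 ij : (forall j, phi j <> ij) -> b ij = 0.
  move=> hh; rewrite /b; case: andP => // -[h1 h2]; case: (hh (ij.1 - p.1, ij.2 - p.2)%N).
  by rewrite /phi /= !subnK //; case: (ij).
have bphi X Y j : b (phi j) * (mono (phi j) X Y)%:C = (mono p X Y)%:C * (a j * (mono j X Y)%:C).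
  rewrite mulrCA -rmorphM /b /phi /= !leq_addl /= !addnK /mono /= !exprD.
  by case: j => i j /=; congr (_ * _%:C); ring.
exists b; split.
  apply: (@absle_inj _ _ _ phi) => //; first by move=> i /b0 ->; rewrite mul0r.
  rewrite -(ger0_norm (mono_ge0 p r0)) -cabsC; apply: absle_le (absleZ _ h) _ (lexx _) => j.
  by rewrite bphi.
move=> X Y hX hY; apply: (@hasS_inj _ _ _ phi) => //; first by move=> i /b0 ->; rewrite mul0r.
by apply: hasS_ext (hasSZ _ (s X Y hX hY)) => j; rewrite bphi.
Qed.

Lemma AN_Z r M g c : AN r M g -> AN r (cabs c * M) (fun X Y => c * g X Y).
Proof.
move=> [a [h s]]; exists (fun i => c * a i); split.
  by apply: absle_le (absleZ c h) _ (lexx _) => i; rewrite mulrA.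
by move=> X Y hX hY; apply: hasS_ext (hasSZ c (s X Y hX hY)) => i; rewrite mulrA.
Qed.

Lemma AN_D r M M' g g' : AN r M g -> AN r M' g' -> AN r (M + M') (fun X Y => g X Y + g' X Y).
Proof.
move=> [a [h s]] [b [h' s']]; exists (fun i => a i + b i); split.
  by apply: absle_le (absleD h h') _ (lexx _) => i; rewrite mulrDl.
by move=> X Y hX hY; apply: hasS_ext (hasSD (s X Y hX hY) (s' X Y hX hY)) => i; rewrite mulrDl.
Qed.

(** An absolutely convergent sum of power series is a power series; the
    coefficients are summed by Fubini. *)
Lemma AN_infsum (I : choiceType) r M (m : I -> R) (g : I -> R -> R -> C) (G : R -> R -> C) : 0 < r ->
  (forall i, AN r (m i) (g i)) -> (forall F : {fset I}, \sum_(i <- F) m i <= M) ->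
  (forall X Y, `|X| <= r -> `|Y| <= r -> hasS (fun i => g i X Y) (G X Y)) -> AN r M G.
Proof.
move=> r0 /choice[a ha] hm hG.
pose A (x : I * (nat * nat)) := a x.1 x.2 * (mono x.2 r r)%:C.
have bA : absle A M by apply: (@absle_slices _ _ _ A m) => // i; case: (ha i).
have m0 ij : 0 < mono ij r r by rewrite mulr_gt0 // exprn_gt0.
have /choice[b hb] (ij : nat * nat) : exists s, hasS (fun i => a i ij) s.
  apply: (@absle_hasS _ _ _ (M / mono ij r r)).
  move=> F; rewrite ler_pdivlMr // mulr_suml.
  have h := absle_comp (phi := fun i => (i, ij)) _ bA.
  apply: le_trans (h _ F) => [|x y []//].
  by apply: ler_sum => i _; rewrite cabsM cabsC /= (ger0_norm (ltW (m0 _))).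
exists b; split.
  apply: (@absle_pair _ _ _ (fun x : (nat * nat) * I => A (x.2, x.1))).
    by move=> ij; rewrite mulrC; apply: hasS_ext (hasSZ _ (hb ij)) => i; rewrite /A /= mulrC.
  by apply: (absle_comp (phi := fun x : (nat * nat) * I => (x.2, x.1))) bA => -[? ?] [? ?] [-> ->].
move=> X Y hX hY.
pose B (x : I * (nat * nat)) := a x.1 x.2 * (mono x.2 X Y)%:C.
have bB : absle B M.
  apply: absle_le bA _ (lexx _) => x; rewrite /A /B !cabsM ler_wpM2l ?cabs_ge0 // !cabsC.
  by rewrite [leRHS]ger0_norm ?mono_le // mono_ge0 // ltW.
have [S hS] := absle_hasS bB.
have <- : S = G X Y.
  apply: hasS_uniq (hG X Y hX hY); apply: hasS_pair hS => i; by case: (ha i) => _; apply.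
apply: hasS_cols hS => ij; rewrite mulrC; apply: hasS_ext (hasSZ _ (hb ij)) => i; by rewrite /B /= mulrC.
Qed.

Lemma AN_M r M M' g g' : 0 < r -> AN r M g -> AN r M' g' -> AN r (M * M') (fun X Y => g X Y * g' X Y).
Proof.
move=> r0 [a [h s]] hg'; have M'0 := AN_ge0 hg'.
apply: (@AN_infsum _ r _ (fun ij => cabs (a ij) * (mono ij r r * M')) (fun ij X Y => a ij * ((mono ij X Y)%:C * g' X Y))) => //.
- by move=> ij; apply: AN_Z; apply: AN_mono => //; exact: ltW.
- move=> F; apply: le_trans (ler_wpM2r M'0 (h F)); rewrite mulr_suml; apply: ler_sum => i _.
  by rewrite cabsM cabsC (ger0_norm (mono_ge0 _ (ltW r0))) mulrA.
- move=> X Y hX hY; rewrite mulrC; apply: hasS_ext (hasSZ _ (s X Y hX hY)) => i; ring.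
Qed.

Lemma AN_exp r M g n : 0 < r -> AN r M g -> AN r (M ^+ n) (fun X Y => g X Y ^+ n).
Proof.
move=> r0 h; elim: n => [|n IH].
  by rewrite expr0 -(_ : cabs (1 : C) = 1); [exact: AN_cst|rewrite (cabsC (1 : R)) normr1].
rewrite exprS; have := AN_M r0 h IH; apply: AN_ext => X Y _ _; by rewrite exprS.
Qed.

Lemma AN_sum r (J : Type) (s : seq J) (P : pred J) (M : J -> R) (g : J -> R -> R -> C) :
  (forall j, P j -> AN r (M j) (g j)) -> AN r (\sum_(j <- s | P j) M j) (fun X Y => \sum_(j <- s | P j) g j X Y).
Proof.
move=> h; elim: s => [|j s IH].
  rewrite big_nil -[X in AN _ X](@cabs0 R); apply: AN_ext (AN_cst r 0) => X Y _ _; by rewrite big_nil.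
rewrite big_cons; case: ifP => Pj.
  apply: AN_ext (AN_D (h j Pj) IH) => X Y _ _; by rewrite big_cons Pj.
by apply: AN_ext IH => X Y _ _; rewrite big_cons Pj.
Qed.

Lemma AN_X r : 0 <= r -> AN r r (fun X Y => X%:C).
Proof.
move=> r0; have := AN_mono (1, 0)%N r0 (AN_cst r 1).
rewrite (cabsC (1 : R)) normr1 mulr1 /mono /= expr1 expr0 mulr1.
by apply: AN_ext => X Y _ _; rewrite expr1 expr0 !mulr1.
Qed.

Lemma AN_Y r : 0 <= r -> AN r r (fun X Y => Y%:C).
Proof.
move=> r0; have := AN_mono (0, 1)%N r0 (AN_cst r 1).
rewrite (cabsC (1 : R)) normr1 mulr1 /mono /= expr1 expr0 mul1r.
by apply: AN_ext => X Y _ _; rewrite expr1 expr0 mul1r !mulr1.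
Qed.

(** Recentering expands (X1 + X)^i (Y1 + Y)^j by the binomial theorem; halving the
    radius keeps |X1| + |X| within the original box. *)
Lemma AN_shift r M g X1 Y1 : 0 < r -> AN r M g -> `|X1| <= r / 2 -> `|Y1| <= r / 2 ->
  AN (r / 2) M (fun X Y => g (X1 + X) (Y1 + Y)).
Proof.
move=> r0 [a [h s]] hX1 hY1; have r2 : 0 < r / 2 by rewrite divr_gt0.
have hX : AN (r / 2) r (fun X Y => (X1 + X)%:C).
  apply: (@AN_le _ (cabs X1%:C + r / 2)); first by rewrite cabsC; lra.
  by apply: AN_ext (AN_D (AN_cst _ X1%:C) (AN_X (ltW r2))) => X Y _ _; rewrite rmorphD.
have hY : AN (r / 2) r (fun X Y => (Y1 + Y)%:C).
  apply: (@AN_le _ (cabs Y1%:C + r / 2)); first by rewrite cabsC; lra.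
  by apply: AN_ext (AN_D (AN_cst _ Y1%:C) (AN_Y (ltW r2))) => X Y _ _; rewrite rmorphD.
apply: (@AN_infsum _ _ _ (fun ij => cabs (a ij) * mono ij r r) (fun ij X Y => a ij * (mono ij (X1 + X) (Y1 + Y))%:C)) => //.
- move=> ij; apply: AN_Z; have := AN_M r2 (AN_exp ij.1 r2 hX) (AN_exp ij.2 r2 hY).
  by apply: AN_ext => X Y _ _; rewrite /mono rmorphM !rmorphXn.
- by move=> F; apply: le_trans (h F); apply: ler_sum => ij _; rewrite cabsM cabsC ger0_norm // mono_ge0 // ltW.
- move=> X Y hX' hY'; apply: s; rewrite (le_trans (ler_normD _ _)) //; lra.
Qed.

(** By induction the first n coefficients vanish; dividing by x^n and letting x
    tend to 0 isolates the next one. *)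
Lemma ser1_zero (b : nat -> C) (d M : R) : 0 < d -> absle (fun n => b n * (d ^+ n)%:C) M ->
  (forall x, 0 < x <= d -> hasS (fun n => b n * (x ^+ n)%:C) 0) -> forall n, b n = 0.
Proof.
move=> d0 hb h n; elim/ltn_ind: n => i IH.
have M0 := absle_ge0 hb.
have key x : 0 < x <= d -> cabs (b i) <= x * (M / d ^+ i.+1).
  move=> hx; have /andP[x0 xd] := hx.
  pose b' j : C := if j == i then 0 else b j * (x ^+ j)%:C.
  have hs : hasS b' (- (b i * (x ^+ i)%:C)).
    have := hasSB (h x hx) (@hasS_single _ (fun j => if j == i then b i * (x ^+ i)%:C else 0) i _).
    rewrite eqxx sub0r => H; apply: hasS_ext (H _) => [j|j /negPf ->//].
    by rewrite /b'; case: eqP => [->|_]; rewrite ?subrr ?subr0.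
  have hl : absle b' ((x / d) ^+ i.+1 * M).
    have xd0 : 0 <= (x / d) ^+ i.+1 by rewrite exprn_ge0 // divr_ge0 // ltW.
    rewrite -(ger0_norm xd0) -cabsC; apply: absle_le (absleZ _ hb) _ (lexx _) => j.
    rewrite /b' !cabsM !cabsC (ger0_norm xd0); case: (ltngtP j i) => [ji|ij|->].
    - rewrite IH // mul0r cabs0 !mul0r mulr0 //.
    - rewrite cabsM mulrCA ler_wpM2l ?cabs_ge0 // cabsC !ger0_norm ?exprn_ge0 ?(ltW x0) ?(ltW d0) //.
      rewrite -[x in x ^+ j](divfK (negbT (gt_eqF d0))) exprMn ler_wpM2r ?exprn_ge0 ?(ltW d0) //.
      rewrite -(subnKC ij) exprD ler_piMr // exprn_ile1 ?divr_ge0 ?(ltW x0) ?(ltW d0) // ler_pdivrMr // mul1r //.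
    - by rewrite cabs0 mulr_ge0 // mulr_ge0 ?cabs_ge0.
  have := hasS_le hs hl; rewrite cabsN cabsM cabsC ger0_norm ?exprn_ge0 ?(ltW x0) // expr_div_n.
  rewrite -ler_pdivlMr ?exprn_gt0 // => /le_trans; apply.
  rewrite le_eqVlt; apply/orP; left; apply/eqP; rewrite exprS; field.
  by rewrite !gt_eqF ?exprn_gt0.
apply/eqP; rewrite -cabs_eq0 eq_le cabs_ge0 andbT.
apply/ler_addgt0Pl => e e0; rewrite addr0.
pose K := M / d ^+ i.+1; have K0 : 0 <= K by rewrite divr_ge0 // exprn_ge0 // ltW.
have x0 : 0 < Num.min d (e / (K + 1)) by rewrite lt_min d0 divr_gt0 //; lra.
apply: le_trans (key (Num.min d (e / (K + 1))) _) _; first by rewrite x0 ge_min lexx.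
rewrite -/K (@le_trans _ _ (e / (K + 1) * K)) ?ler_wpM2r ?ge_min ?lexx ?orbT //.
rewrite mulrAC ler_pdivrMr ?ler_pM2l //; lra.
Qed.

(** The identity theorem on a box, one variable at a time: vanishing near the
    centre forces all coefficients to be 0. *)
Lemma AN_zero r M g d : 0 < d <= r -> AN r M g -> (forall X Y, `|X| <= d -> `|Y| <= d -> g X Y = 0) ->
  forall X Y, `|X| <= r -> `|Y| <= r -> g X Y = 0.
Proof.
move=> /andP[d0 dr] [a [h s]] g0; have r0 : 0 < r := lt_le_trans d0 dr.
suff a0 ij : a ij = 0.
  move=> X Y hX hY; apply: hasS_uniq (s _ _ hX hY) _.
  by apply: hasS_ext (@hasS0 R _) => ij; rewrite a0 mul0r.
case: ij => i j.
have hd : absle (fun ij => a ij * (mono ij d d)%:C) M by apply: absle_mono h _ _; rewrite ger0_norm // ltW.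
have hij x y : 0 < x <= d -> 0 < y <= d -> absle (fun ij => a ij * (mono ij x y)%:C) M.
  by move=> /andP[x0 xd] /andP[y0 yd]; apply: absle_mono hd _ _; rewrite ger0_norm // ltW.
have dd : 0 < d <= d by rewrite d0 lexx.
have row y : 0 < y <= d -> forall i, exists t, hasS (fun j => a (i, j) * (y ^+ j)%:C) t.
  move=> hy i'; apply: (@absle_hasS _ _ _ (M / d ^+ i')).
  have h1 := absleZ ((d ^+ i')^-1)%:C (absle_comp (phi := fun j => (i', j)) _ (hij d y dd hy)).
  have {}h1 := h1 (fun x y => fun e => f_equal snd e).
  apply: (absle_le h1) => [k|].
    rewrite mulrCA -rmorphM /mono /= mulrA mulVf ?mul1r ?lexx // expf_neq0 // gt_eqF //.
  rewrite cabsC ger0_norm ?invr_ge0 ?exprn_ge0 ?(ltW d0) // mulrC //.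
have B0 y : 0 < y <= d -> hasS (fun j => a (i, j) * (y ^+ j)%:C) 0.
  move=> hy; have /choice[t ht] := row y hy.
  suff <- : t i = 0 by [].
  have hsx x : 0 < x <= d -> hasS (fun i => t i * (x ^+ i)%:C) 0.
    move=> hx; have /andP[x0 xd] := hx; have /andP[y0 yd] := hy.
    rewrite -(g0 x y); [|by rewrite ger0_norm // ltW|by rewrite ger0_norm // ltW].
    apply: (@hasS_pair _ _ _ (fun ij => a ij * (mono ij x y)%:C)).
      move=> i'; rewrite mulrC; apply: hasS_ext (hasSZ _ (ht i')) => k.
      by rewrite /mono /= rmorphM /=; ring.
    by apply: s; rewrite ger0_norm ?(ltW x0) ?(ltW y0) // (le_trans _ dr).
  apply: (@ser1_zero t d M) => //.
  apply: (@absle_pair _ _ _ (fun ij => a ij * (mono ij d y)%:C)); last exact: hij.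
  move=> i'; rewrite mulrC; apply: hasS_ext (hasSZ _ (ht i')) => k.
  by rewrite /mono /= rmorphM /=; ring.
apply: (@ser1_zero (fun j => a (i, j)) d (M / d ^+ i)) => //.
have h1 := absleZ ((d ^+ i)^-1)%:C (absle_comp (phi := fun j => (i, j)) _ (hij d d dd dd)).
have {}h1 := h1 (fun x y => fun e => f_equal snd e).
apply: (absle_le h1) => [k|].
  rewrite mulrCA -rmorphM /mono /= mulrA mulVf ?mul1r ?lexx // expf_neq0 // gt_eqF //.
rewrite cabsC ger0_norm ?invr_ge0 ?exprn_ge0 ?(ltW d0) // mulrC //.
Qed.

Lemma nbhsC_box (z0 : C) (P : C -> Prop) : (\forall z \near z0, P z) <->
  exists2 d : R, 0 < d & forall X Y, `|X| <= d -> `|Y| <= d -> P ((complex.Re z0 + X) +i* (complex.Im z0 + Y)).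
Proof.
split.
  move=> /nbhs_ballP[e e0 he].
  have [e1 ee] : 0 < complex.Re e /\ e = (complex.Re e)%:C.
    by move: e0; case: (e) => x y; rewrite /= ltcE /= => /andP[/eqP -> ->].
  exists (complex.Re e / 3); first by rewrite divr_gt0.
  move=> X Y hX hY; apply: he; rewrite -ball_normE /= ee cabsE ltcR.
  apply: le_lt_trans (cabs_le_ReIm _) _.
  have -> : complex.Re (z0 - ((complex.Re z0 + X) +i* (complex.Im z0 + Y))) = - X by case: (z0) => a b /=; ring.
  have -> : complex.Im (z0 - ((complex.Re z0 + X) +i* (complex.Im z0 + Y))) = - Y by case: (z0) => a b /=; ring.
  rewrite !normrN; lra.
move=> [d d0 hd]; apply/nbhs_ballP; exists d%:C; first by rewrite /= ltcR.
move=> z; rewrite -ball_normE /= cabsE ltcR => hz.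
have -> : z = (complex.Re z0 + (complex.Re z - complex.Re z0)) +i* (complex.Im z0 + (complex.Im z - complex.Im z0)).
  by case: (z) => a b /=; congr Complex; ring.
have h1 := Re_le_cabs (z0 - z); have h2 := Im_le_cabs (z0 - z).
apply: hd; rewrite distrC; apply: le_trans (ltW hz).
  by apply: le_trans h1; case: (z0) (z) => ? ? [? ?] /=.
by apply: le_trans h2; case: (z0) (z) => ? ? [? ?] /=.
Qed.

(** The sum with explicit radius and bound is in particular a locally convergent power series. *)
Lemma AN_real_analytic (g : C -> C) (z0 : C) r M : 0 < r ->
  AN r M (fun X Y => g ((complex.Re z0 + X) +i* (complex.Im z0 + Y))) -> real_analytic_at g z0.
Proof.
move=> r0 [a [h s]]; exists a; apply/nbhsC_box; exists r => // X Y hX hY.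
apply/hasS_cvg; apply: hasS_ext (s X Y hX hY) => ij; rewrite /mono /=; congr (_ * (_ * _)%:C); congr (_ ^+ _); ring.
Qed.

(** Convergence at one point off the axes bounds the coefficients geometrically,
    which gives absolute convergence with a bound on a smaller box. *)
Lemma real_analytic_AN (g : C -> C) (z0 : C) : real_analytic_at g z0 ->
  exists r M, 0 < r /\ AN r M (fun X Y => g ((complex.Re z0 + X) +i* (complex.Im z0 + Y))).
Proof.
move=> [a /nbhsC_box[d d0 hd]].
have hs X Y : `|X| <= d -> `|Y| <= d -> hasS (fun ij => a ij * (mono ij X Y)%:C) (g ((complex.Re z0 + X) +i* (complex.Im z0 + Y))).
  move=> hX hY; have /hasS_cvg := hd X Y hX hY; apply: hasS_ext => ij.
  rewrite /mono /=; congr (_ * (_ * _)%:C); congr (_ ^+ _); ring.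
have dn : `|d| <= d by rewrite ger0_norm // ltW.
have [K hK] : exists K, forall ij, cabs (a ij * (mono ij d d)%:C) <= K.
  have [F0 hF] := hs d d dn dn 1 ltr01.
  exists (2 + \sum_(i <- F0) cabs (a i * (mono i d d)%:C)) => ij.
  have [iF|iF] := boolP (ij \in F0).
    rewrite (big_rem ij iF) /= addrCA lerDl addr_ge0 // sumr_ge0 // => i _; exact: cabs_ge0.
  have := hF (ij |` F0)%fset (fsubsetUr _ _); have := hF F0 (fsubset_refl _).
  rewrite big_fsetU1 //=; set x := a ij * _; set S := \sum_(_ <- _) _; set G := g _ => h1 h2.
  have -> : x = (x + S - G) - (S - G) by ring.
  apply: le_trans (cabsD _ _) _; rewrite cabsN.
  have : 0 <= \sum_(i <- F0) cabs (a i * (mono i d d)%:C) by apply: sumr_ge0 => i _; exact: cabs_ge0.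
  lra.
have K0 : 0 <= K := le_trans (cabs_ge0 _) (hK (0, 0)%N).
have d2 : 0 < d / 2 by rewrite divr_gt0.
exists (d / 2), (K * 4); split=> //; exists a; split; last first.
  by move=> X Y hX hY; apply: hs; lra.
have g1 := @absle_geom R (1/2) _; have {}g1 := g1 ltac:(lra).
have e2 : (1 - 1 / 2)^-1 = 2 :> R by field.
apply: (@absle_slices _ _ _ _ (fun i => K * (1/2) ^+ i * 2)).
  move=> i; have hh := absleZ (K * (1/2) ^+ i)%:C g1.
  apply: (absle_le hh) => [j|]; last first.
    by rewrite cabsC ger0_norm ?mulr_ge0 ?exprn_ge0 // e2.
  rewrite -rmorphM cabsC ger0_norm ?mulr_ge0 ?exprn_ge0 //.
  have := hK (i, j); rewrite !cabsM !cabsC /mono /=.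
  rewrite !ger0_norm ?mulr_ge0 ?exprn_ge0 ?(ltW d0) ?(ltW d2) // => h'.
  have -> : K * (1 / 2) ^+ i * (1 / 2) ^+ j = ((1 / 2) ^+ i * (1 / 2) ^+ j) * K by ring.
  have -> : cabs (a (i, j)) * ((d / 2) ^+ i * (d / 2) ^+ j) = ((1 / 2) ^+ i * (1 / 2) ^+ j) * (cabs (a (i, j)) * (d ^+ i * d ^+ j)).
    by rewrite -[d / 2]mulr1 -mulrA [2^-1 * 1]mulrC !exprMn; ring.
  by rewrite ler_wpM2l // mulr_ge0 // exprn_ge0.
move=> F; have := g1 F; under eq_bigr do rewrite cabsC ger0_norm ?exprn_ge0 //.
move=> h; rewrite -mulr_suml -mulr_sumr -mulrA ler_wpM2l //.
have -> : 4 = (1 - 1 / 2)^-1 * 2 :> R by field.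
by rewrite ler_wpM2r.
Qed.

End AN.

(** * Complex integrals and termwise integration *)

Section CI.
Variable R : realType.
Local Notation C := R[i].
Variables (d : measure_display) (T : measurableType d) (mu : {measure set T -> \bar R}).

(** Complex integrals are taken componentwise, as in the definition of the lift. *)
Definition cint (D : set T) (g : T -> C) : C :=
  (\int[mu]_(x in D) complex.Re (g x))%R +i* (\int[mu]_(x in D) complex.Im (g x))%R.
Definition cmeas (D : set T) (g : T -> C) : Prop :=
  measurable_fun D (fun x => complex.Re (g x)) /\ measurable_fun D (fun x => complex.Im (g x)).
Definition cintble (D : set T) (g : T -> C) : Prop :=
  mu.-integrable D (EFin \o (fun x => complex.Re (g x))) /\ mu.-integrable D (EFin \o (fun x => complex.Im (g x))).

Variables (D : set T) (mD : measurable D).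

Lemma dom_integrable (g w : T -> R) : measurable_fun D g -> mu.-integrable D (EFin \o w) ->
  (forall x, D x -> `|g x| <= w x) -> mu.-integrable D (EFin \o g).
Proof.
move=> mg iw h; apply: (le_integrable mD) iw => [|x Dx /=]; first exact/measurable_EFinP.
by rewrite lee_fin (le_trans (h x Dx)) // ler_norm.
Qed.

Lemma dom_cintble (g : T -> C) (w : T -> R) : cmeas D g -> mu.-integrable D (EFin \o w) ->
  (forall x, D x -> cabs (g x) <= w x) -> cintble D g.
Proof.
move=> [m1 m2] iw h; split; apply: dom_integrable iw _ => // x Dx; apply: le_trans (h x Dx).
  exact: Re_le_cabs.
exact: Im_le_cabs.
Qed.

Lemma Rint_bound (g w : T -> R) : mu.-integrable D (EFin \o g) -> mu.-integrable D (EFin \o w) ->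
  (forall x, D x -> `|g x| <= w x) -> `|\int[mu]_(x in D) g x| <= \int[mu]_(x in D) w x.
Proof.
move=> ig iw h; apply: le_trans (le_normr_Rintegral mD ig) _; apply: le_Rintegral => //.
exact: integrable_norm.
Qed.

(** The factor 2 comes from estimating real and imaginary part separately. *)
Lemma cint_bound (g : T -> C) (w : T -> R) : cintble D g -> mu.-integrable D (EFin \o w) ->
  (forall x, D x -> cabs (g x) <= w x) -> cabs (cint D g) <= 2 * \int[mu]_(x in D) w x.
Proof.
move=> [i1 i2] iw h; apply: le_trans (cabs_le_ReIm _) _ => /=.
rewrite [2](_ : _ = 1 + 1) // mulrDl !mul1r; apply: lerD; apply: Rint_bound => // x Dx; apply: le_trans (h x Dx).
  exact: Re_le_cabs.
exact: Im_le_cabs.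
Qed.

Lemma eq_cint (g g' : T -> C) : (forall x, D x -> g x = g' x) -> cint D g = cint D g'.
Proof. by move=> h; rewrite /cint; congr Complex; apply: eq_Rintegral => x /set_mem Dx; rewrite h. Qed.

Lemma eq_cmeas (g g' : T -> C) : (forall x, D x -> g x = g' x) -> cmeas D g -> cmeas D g'.
Proof. move=> h [a b]; split; [apply: eq_measurable_fun a|apply: eq_measurable_fun b] => x /set_mem Dx /=; by rewrite h. Qed.

Lemma cmeasD (g g' : T -> C) : cmeas D g -> cmeas D g' -> cmeas D (fun x => g x + g' x).
Proof.
move=> [a b] [a' b']; split.
  by under eq_fun do rewrite cReD; exact: measurable_funD.
by under eq_fun do rewrite cImD; exact: measurable_funD.
Qed.

Lemma cmeasM (g g' : T -> C) : cmeas D g -> cmeas D g' -> cmeas D (fun x => g x * g' x).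
Proof.
move=> [a b] [a' b']; split.
  by under eq_fun do rewrite cReM; apply: measurable_funB; exact: measurable_funM.
by under eq_fun do rewrite cImM; apply: measurable_funD; exact: measurable_funM.
Qed.

Lemma cmeas_real (g : T -> R) : measurable_fun D g -> cmeas D (fun x => (g x)%:C).
Proof. by move=> h; split => //=; exact: measurable_cst. Qed.

Lemma cmeas_cst c : cmeas D (fun=> c).
Proof. by split; exact: measurable_cst. Qed.

Lemma cmeas_sum (I : Type) (s : seq I) (g : I -> T -> C) : (forall i, cmeas D (g i)) -> cmeas D (fun x => \sum_(i <- s) g i x).
Proof.
move=> h; elim: s => [|i s IH].
  by apply: eq_cmeas (cmeas_cst 0) => x _; rewrite big_nil.
by apply: eq_cmeas (cmeasD (h i) IH) => x _; rewrite big_cons.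
Qed.

Lemma cintbleD (g g' : T -> C) : cintble D g -> cintble D g' -> cintble D (fun x => g x + g' x).
Proof.
move=> [a b] [a' b']; split.
  by under eq_fun do rewrite cReD; exact: (integrableD mD a a').
by under eq_fun do rewrite cImD; exact: (integrableD mD b b').
Qed.

Lemma cintD (g g' : T -> C) : cintble D g -> cintble D g' -> cint D (fun x => g x + g' x) = cint D g + cint D g'.
Proof.
move=> [a b] [a' b']; rewrite /cint; congr Complex.
  by rewrite -RintegralD //; apply: eq_Rintegral => x _; rewrite cReD.
by rewrite -RintegralD //; apply: eq_Rintegral => x _; rewrite cImD.
Qed.

Lemma eq_cintble (g g' : T -> C) : (forall x, D x -> g x = g' x) -> cintble D g -> cintble D g'.
Proof. move=> h [a b]; split; [apply: eq_integrable a => //|apply: eq_integrable b => //] => x /set_mem Dx /=; by rewrite h. Qed.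

Lemma cintbleZ (g : T -> C) c : cintble D g -> cintble D (fun x => c * g x).
Proof.
move=> [a b]; split.
  under eq_fun do rewrite cReM; exact: (integrableB mD (integrableZl mD (complex.Re c) a) (integrableZl mD (complex.Im c) b)).
under eq_fun do rewrite cImM; exact: (integrableD mD (integrableZl mD (complex.Re c) b) (integrableZl mD (complex.Im c) a)).
Qed.

Lemma cintZ (g : T -> C) c : cintble D g -> cint D (fun x => c * g x) = c * cint D g.
Proof.
move=> [a b]; rewrite /cint; apply/eqP; rewrite eq_complex; apply/andP; split; apply/eqP.
  rewrite cReM /= -!RintegralZl // -RintegralB //; [|exact: (integrableZl mD _ a)|exact: (integrableZl mD _ b)].
  by apply: eq_Rintegral => x _; rewrite cReM.
rewrite cImM /= -!RintegralZl // -RintegralD //; [|exact: (integrableZl mD _ b)|exact: (integrableZl mD _ a)].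
by apply: eq_Rintegral => x _; rewrite cImM.
Qed.

Lemma cintble0 : cintble D (fun=> 0).
Proof. split; exact: integrable0. Qed.

Lemma cintble_sum (I : Type) (s : seq I) (g : I -> T -> C) : (forall i, cintble D (g i)) -> cintble D (fun x => \sum_(i <- s) g i x).
Proof.
move=> h; elim: s => [|i s IH].
  by apply: eq_cintble cintble0 => x _; rewrite big_nil.
by apply: eq_cintble (cintbleD (h i) IH) => x _; rewrite big_cons.
Qed.

Lemma cint_sum (I : Type) (s : seq I) (g : I -> T -> C) : (forall i, cintble D (g i)) ->
  cint D (fun x => \sum_(i <- s) g i x) = \sum_(i <- s) cint D (g i).
Proof.
move=> h; elim: s => [|i s IH].
  rewrite big_nil; transitivity (cint D (fun=> 0)); first by apply: eq_cint => x _; rewrite big_nil.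
  by rewrite /cint /= !Rintegral_cst // !mul0r.
rewrite big_cons -IH -cintD //; last exact: cintble_sum.
by apply: eq_cint => x _; rewrite big_cons.
Qed.

(** A common majorant B i * w gives a tail estimate that is uniform in w; this is
    the Weierstrass test behind termwise integration. *)
Lemma hasS_tail (I : choiceType) (B : I -> R) M : (forall i, 0 <= B i) -> absle (fun i => (B i)%:C) M ->
  forall e, 0 < e -> exists F0 : {fset I}, forall F : {fset I}, (F0 `<=` F)%fset -> forall (phi : I -> C) (g : C) (w : R),
    0 <= w -> (forall i, cabs (phi i) <= B i * w) -> hasS phi g -> cabs (\sum_(i <- F) phi i - g) <= e * w.
Proof.
move=> B0 hB e e0; have [s hs] := absle_hasS hB.
have e2 : 0 < e / 2 by rewrite divr_gt0.
have [F0 hF] := hs _ e2; exists F0 => F FF phi g w w0 hphi hg.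
have tl (G : {fset I}) : (F `<=` G)%fset -> \sum_(i <- (G `\` F)%fset) B i <= e.
  move=> FG; have := hF G (fsubset_trans FF FG); have := hF F FF.
  rewrite (fsum_split _ FG); set x := \sum_(i <- F) _; set y := \sum_(i <- _) _ => h1 h2.
  have : cabs y <= e.
    rewrite (_ : y = (x + y - s) - (x - s)); last by ring.
    by rewrite (le_trans (cabsD _ _)) // cabsN [e]splitr lerD // ltW.
  by rewrite /y -rmorph_sum cabsC ger0_norm //; apply: sumr_ge0.
apply/ler_addgt0Pl => e' e'0; have [G hG] := hg e' e'0.
have {}hG := hG (F `|` G)%fset (fsubsetUr _ _); have FG := fsubsetUl F G.
move: hG; rewrite (fsum_split _ FG); set x := \sum_(i <- F) _; set y := \sum_(i <- _) _ => hG.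
rewrite (_ : x - g = (x + y - g) - y); last by ring.
rewrite (le_trans (cabsD _ _)) // cabsN lerD //; first exact: ltW.
rewrite (le_trans (cabs_sum _ _ _)) //; apply: le_trans (ler_wpM2r w0 (tl _ FG)).
by rewrite mulr_suml; apply: ler_sum.
Qed.

(** The family is summable with a majorant, hence is the pointwise limit of a
    sequence of finite partial sums chosen independently of the point. *)
Lemma cmeas_infsum (I : choiceType) (B : I -> R) M (phi : I -> T -> C) (g : T -> C) (w : T -> R) :
  (forall i, 0 <= B i) -> absle (fun i => (B i)%:C) M -> (forall x, D x -> 0 <= w x) ->
  (forall i, cmeas D (phi i)) -> (forall i x, D x -> cabs (phi i x) <= B i * w x) ->
  (forall x, D x -> hasS (fun i => phi i x) (g x)) -> cmeas D g.
Proof.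
move=> B0 hB w0 mphi hphi hg.
have /choice[F hF] (n : nat) : exists F0 : {fset I}, forall F : {fset I}, (F0 `<=` F)%fset -> forall (phi : I -> C) (g : C) (w : R),
    0 <= w -> (forall i, cabs (phi i) <= B i * w) -> hasS phi g -> cabs (\sum_(i <- F) phi i - g) <= n.+1%:R^-1 * w.
  by apply: hasS_tail hB _ _ => //; rewrite invr_gt0 ltr0n.
have cv x : D x -> forall e, 0 < e -> \forall n \near \oo, cabs (g x - \sum_(i <- F n) phi i x) < e.
  move=> Dx e e0; have hw : 0 < w x + 1 by rewrite ltr_wpDl // w0.
  have : (fun n => n.+1%:R^-1 : R) @ \oo --> (0 : R) by exact: cvg_harmonic.
  move=> /cvgrPdist_lt /(_ (e / (w x + 1)) (divr_gt0 e0 hw)); apply: filterS => n /=.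
  rewrite sub0r normrN ger0_norm // => hn.
  have := hF n (F n) (fsubset_refl _) (fun i => phi i x) (g x) (w x) (w0 _ Dx) (fun i => hphi i x Dx) (hg x Dx).
  rewrite -cabsN opprB => /le_lt_trans; apply.
  move: hn; rewrite ltr_pdivlMr // => /(le_lt_trans _); apply; rewrite ler_wpM2l //; lra.
split.
  apply: (@measurable_fun_cvg _ _ _ _ (fun n x => complex.Re (\sum_(i <- F n) phi i x))).
    by move=> n; case: (cmeas_sum (F n) mphi).
  move=> x Dx; apply/cvgrPdist_lt => e e0; apply: filterS (cv x Dx e e0) => n.
  by rewrite -cReB; apply: le_lt_trans; exact: Re_le_cabs.
apply: (@measurable_fun_cvg _ _ _ _ (fun n x => complex.Im (\sum_(i <- F n) phi i x))).
  by move=> n; case: (cmeas_sum (F n) mphi).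
move=> x Dx; apply/cvgrPdist_lt => e e0; apply: filterS (cv x Dx e e0) => n.
by rewrite -cImB; apply: le_lt_trans; exact: Im_le_cabs.
Qed.

Lemma absle_B_le (I : choiceType) (B : I -> R) M (phi : I -> C) w : 0 <= w ->
 (forall i, 0 <= B i) -> absle (fun i => (B i)%:C) M -> (forall i, cabs (phi i) <= B i * w) -> absle phi (M * w).
Proof.
move=> w0 B0 hB h F; apply: le_trans (ler_wpM2r w0 (hB F)); rewrite mulr_suml.
by apply: ler_sum => i _; rewrite cabsC ger0_norm.
Qed.

(** Termwise integration over an arbitrary index set. *)
Lemma cint_infsum (I : choiceType) (B : I -> R) M (phi : I -> T -> C) (g : T -> C) (w : T -> R) :
  (forall i, 0 <= B i) -> absle (fun i => (B i)%:C) M -> (forall x, D x -> 0 <= w x) ->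
  mu.-integrable D (EFin \o w) ->
  (forall i, cmeas D (phi i)) -> (forall i x, D x -> cabs (phi i x) <= B i * w x) ->
  (forall x, D x -> hasS (fun i => phi i x) (g x)) ->
  [/\ cintble D g, (forall x, D x -> cabs (g x) <= M * w x) & hasS (fun i => cint D (phi i)) (cint D g)].
Proof.
move=> B0 hB w0 iw mphi hphi hg.
have mg := cmeas_infsum B0 hB w0 mphi hphi hg.
have bg x : D x -> cabs (g x) <= M * w x.
  move=> Dx; apply: hasS_le (hg x Dx) _; apply: absle_B_le hB _ => //; first exact: w0.
  by move=> i; exact: hphi.
have iZ c : mu.-integrable D (EFin \o (fun x => c * w x)) by exact: (integrableZl mD _ iw).
have ig : cintble D g by apply: dom_cintble (iZ M) bg.
have iphi i : cintble D (phi i) by apply: dom_cintble (iZ (B i)) _ => // x; exact: hphi.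
split=> // e e0; set W := \int[mu]_(x in D) w x.
have W0 : 0 <= W by apply: Rintegral_ge0.
have e1 : 0 < e / (2 * W + 1) by rewrite divr_gt0 //; lra.
have [F0 hF] := hasS_tail B0 hB e1; exists F0 => F FF.
have -> : \sum_(i <- F) cint D (phi i) - cint D g = cint D (fun x => \sum_(i <- F) phi i x + (-1) * g x).
  rewrite cintD ?cint_sum ?cintZ ?mulN1r //; [exact: cintble_sum|exact: cintbleZ].
have := @cint_bound (fun x => \sum_(i <- F) phi i x + (-1) * g x) (fun x => e / (2 * W + 1) * w x) _ (iZ _) _.
move=> H; apply: le_lt_trans (H _ _) _.
- by apply: cintbleD; [exact: cintble_sum|exact: cintbleZ].
- by move=> x Dx; rewrite mulN1r; apply: (hF F FF _ _ _ (w0 _ Dx) _ (hg x Dx)) => i; exact: hphi.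
rewrite RintegralZl // mulrCA -/W mulrAC ltr_pdivrMr; last by lra.
rewrite ltr_pM2l //; lra.
Qed.

End CI.

(** * The fundamental domain and the strip *)

Section PL.
Variable R : realType.
Local Notation C := R[i].
Local Notation mu := (@lebesgue_measure R).
Local Notation mu2 := ((@lebesgue_measure R \x @lebesgue_measure R)%E : {measure set _ -> \bar R}).

Lemma cintegralE (A : set (R * R)) (g : R * R -> C) : cintegral A g = cint mu2 A g.
Proof. by []. Qed.

(** Openness for the product topology, phrased so that measurability for the
    product sigma-algebra can be shown by covering with rational boxes. *)
Definition boxopen (O : set (R * R)) : Prop :=
  forall x, O x -> exists2 e : R, 0 < e & forall y, `|y.1 - x.1| < e -> `|y.2 - x.2| < e -> O y.

Lemma boxopen_measurable (O : set (measurableTypeR R * measurableTypeR R)) : boxopen O -> measurable O.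
Proof.
move=> bO.
pose box (t : rat * rat * rat) : set (R * R) :=
  `]ratr t.1.1 - ratr t.2, ratr t.1.1 + ratr t.2[ `*` `]ratr t.1.2 - ratr t.2, ratr t.1.2 + ratr t.2[.
pose F t : set (R * R) := if `[< box t `<=` O >] then box t else set0.
have -> : O = \bigcup_t F t.
  apply/seteqP; split => [[x y] Oxy|xy [t _]]; last by rewrite /F; case: asboolP => // h /h.
  have [e e0 he] := bO _ Oxy.
  have e4 : 0 < e / 4 by rewrite divr_gt0.
  have [q0] := rat_in_itvoo e4; rewrite in_itv /= => /andP[q00 q01].
  have [q1] : exists q : rat, ratr q \in `]x - ratr q0, x + ratr q0[ by apply: rat_in_itvoo; lra.
  rewrite in_itv /= => /andP[q10 q11].
  have [q2] : exists q : rat, ratr q \in `]y - ratr q0, y + ratr q0[ by apply: rat_in_itvoo; lra.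
  rewrite in_itv /= => /andP[q20 q21].
  exists (q1, q2, q0) => //; rewrite /F; case: asboolP => [_|[]].
    by split; rewrite /= in_itv /=; apply/andP; split; lra.
  move=> [a b] [] /=; rewrite !in_itv /= => /andP[a1 a2] /andP[b1 b2].
  by apply: he => /=; rewrite ltr_norml; apply/andP; split; lra.
apply: countable_bigcupT_measurable => [|t]; first exact: countableP.
by rewrite /F; case: asboolP => // _; apply: measurableX; exact: measurable_itv.
Qed.

Lemma cont_cmeas (D : set (measurableTypeR R * measurableTypeR R)) (g : C -> C) : measurable D ->
  (forall w, D w -> 0 < w.2) -> (forall z, 0 < complex.Im z -> {for z, continuous g}) ->
  cmeas D (fun w => g (w.1 +i* w.2)).
Proof.
move=> mD D0 cg.
have cf (z : C) (e : R) : 0 < complex.Im z -> 0 < e -> exists2 d : R, 0 < d & forall z', `|complex.Re z' - complex.Re z| < d -> `|complex.Im z' - complex.Im z| < d -> cabs (g z' - g z) < e.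
  move=> z0 e0; have /cvgrPdist_lt /(_ e%:C) H := cg z z0.
  have /H /nbhsC_box[d d0 hd] : 0 < e%:C by rewrite ltcR.
  exists d => // z' h1 h2; have := hd (complex.Re z' - complex.Re z) (complex.Im z' - complex.Im z) (ltW h1) (ltW h2).
  by rewrite !(addrC _ (_ - _)) !subrK cabsE ltcR -cabsN opprB; case: (z').
have key (r : C -> R) : (forall x y, `|r x - r y| <= cabs (x - y)) -> measurable_fun D (fun w => r (g (w.1 +i* w.2))).
  move=> hr; apply: (measurability _ (RGenOInfty.measurableE R)) => // _ [_ [a ->] <-].
  rewrite (_ : D `&` _ = D `&` [set w | 0 < w.2 /\ a < r (g (w.1 +i* w.2))]).
    apply: measurableI => //; apply: boxopen_measurable => -[x y] /= [y0 ha].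
    have e0 : 0 < r (g (x +i* y)) - a by rewrite subr_gt0.
    have [d d0 hd] := @cf (x +i* y) _ y0 e0.
    exists (Num.min d y) => [|[x' y'] /=]; first by rewrite lt_min d0.
    rewrite !lt_min => /andP[h1 _] /andP[h2 h3]; split; first by move: h3; rewrite ltr_norml; lra.
    by have := le_lt_trans (hr _ _) (hd (x' +i* y') h1 h2); rewrite ltr_norml; lra.
  apply/seteqP; split => w [Dw] /=; rewrite in_itv /= andbT; first by split=> //; split=> //; exact: D0.
  by move=> [_ h]; split=> //; rewrite in_itv /= andbT.
split; apply: key => x y.
  by rewrite -cReB Re_le_cabs.
by rewrite -cImB Im_le_cabs.
Qed.

(** Fubini for a product of functions of one variable. *)
Lemma prod_Rint (a b : R -> R) : mu.-integrable setT (EFin \o a) -> mu.-integrable setT (EFin \o b) ->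
  mu2.-integrable setT (EFin \o (fun w => a w.1 * b w.2)) /\
  (\int[mu2]_w (a w.1 * b w.2) = (\int[mu]_x a x) * (\int[mu]_x b x))%R.
Proof.
move=> ia ib.
have ma : measurable_fun setT a by move: ia => /measurable_int/measurable_EFinP.
have mb : measurable_fun setT b by move: ib => /measurable_int/measurable_EFinP.
have mf : measurable_fun [set: measurableTypeR R * measurableTypeR R] (EFin \o (fun w : R * R => a w.1 * b w.2)).
  apply/measurable_EFinP; apply: measurable_funM.
    exact: (measurableT_comp ma measurable_fst).
  exact: (measurableT_comp mb measurable_snd).
have I1 x : (\int[mu]_y `|(a x * b y)%:E| = `|a x|%:E * \int[mu]_y `|(b y)%:E|)%E.
  under eq_integral do rewrite /= normrM EFinM.
  rewrite ge0_integralZl //; last by apply/measurable_EFinP; exact: measurableT_comp.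
have fb : (\int[mu]_y `|(b y)%:E| < +oo)%E by case/integrableP: ib.
have fb0 : (0 <= \int[mu]_y `|(b y)%:E|)%E by apply: integral_ge0.
have fbN : (\int[mu]_y `|(b y)%:E| \is a fin_num)%E by rewrite ge0_fin_numE.
have H : mu2.-integrable setT (EFin \o (fun w => a w.1 * b w.2)).
  apply/(integrable12ltyP _ _ mf) => /=.
  under eq_integral do rewrite I1.
  rewrite ge0_integralZr //; [|by apply/measurable_EFinP; exact: measurableT_comp].
  rewrite -(fineK fbN) lte_mul_pinfty ?ltry //.
    exact: integral_ge0.
  rewrite ge0_fin_numE; [by case/integrableP: ia|exact: integral_ge0].
split=> //.
rewrite /Rintegral -(integral12_prod_meas1 H) /fubini_F /=.
have E x : (\int[mu]_y (a x * b y)%:E = (a x * (\int[mu]_y b y)%R)%:E)%E.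
  under eq_integral do rewrite EFinM.
  by rewrite (integralZl measurableT ib) EFinM fineK // integrable_fin_num.
under eq_integral do rewrite E.
under eq_integral do rewrite EFinM.
by rewrite (integralZr measurableT ia) -[X in (X * _)%E]fineK ?integrable_fin_num // -EFinM.
Qed.

Lemma prod_Rint_set (A B : set (measurableTypeR R)) (a b : R -> R) : measurable A -> measurable B ->
  mu.-integrable A (EFin \o a) -> mu.-integrable B (EFin \o b) ->
  mu2.-integrable (A `*` B) (EFin \o (fun w => a w.1 * b w.2)) /\
  (\int[mu2]_(w in A `*` B) (a w.1 * b w.2) = (\int[mu]_(x in A) a x) * (\int[mu]_(x in B) b x))%R.
Proof.
move=> mA mB ia ib.
have ia' : mu.-integrable setT (EFin \o (a \_ A)).
  by rewrite -restrict_EFin; exact: ((integrable_mkcond _ mA).1 ia).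
have ib' : mu.-integrable setT (EFin \o (b \_ B)).
  by rewrite -restrict_EFin; exact: ((integrable_mkcond _ mB).1 ib).
have [h1 h2] := prod_Rint ia' ib'.
have E : (fun w : R * R => (a \_ A) w.1 * (b \_ B) w.2) = (fun w => a w.1 * b w.2) \_ (A `*` B).
  apply/funext => -[x y]; rewrite !patchE /= in_setX /=.
  by case: (x \in A); case: (y \in B); rewrite ?mul0r ?mulr0.
split.
  by apply: (integrable_mkcond _ (measurableX mA mB)).2; rewrite restrict_EFin -E.
by rewrite Rintegral_mkcond -E h2 -!Rintegral_mkcond.
Qed.

Lemma prod_cint_set (A B : set (measurableTypeR R)) (a : R -> C) (b : R -> R) : measurable A -> measurable B ->
  cintble mu A a -> mu.-integrable B (EFin \o b) ->
  cintble mu2 (A `*` B) (fun w => a w.1 * (b w.2)%:C) /\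
  cint mu2 (A `*` B) (fun w => a w.1 * (b w.2)%:C) = cint mu A a * (\int[mu]_(x in B) b x)%:C.
Proof.
move=> mA mB [ia1 ia2] ib.
have [h1 e1] := prod_Rint_set mA mB ia1 ib; have [h2 e2] := prod_Rint_set mA mB ia2 ib.
have E1 : (fun w : R * R => complex.Re (a w.1 * (b w.2)%:C)) = (fun w => complex.Re (a w.1) * b w.2).
  by apply/funext => w; rewrite cReM /= mulr0 subr0.
have E2 : (fun w : R * R => complex.Im (a w.1 * (b w.2)%:C)) = (fun w => complex.Im (a w.1) * b w.2).
  by apply/funext => w; rewrite cImM /= mulr0 add0r.
split; first by rewrite /cintble E1 E2.
rewrite /cint E1 E2 e1 e2; apply/eqP; rewrite eq_complex cReM cImM /= !mulr0 subr0 add0r.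
by rewrite !eqxx.
Qed.

Lemma expR_integrable (e : R) : 0 < e -> mu.-integrable `[0, +oo[ (EFin \o (fun v => expR (- (e * v)))).
Proof.
move=> e0; have := integrable_exponential_pdf e0.
rewrite /exponential_pdf -restrict_EFin => h0; have mI : measurable (`[0, +oo[ : set (measurableTypeR R)) by exact: measurable_itv.
have h := (@integrable_mkcond _ (measurableTypeR R) _ mu _ _ mI).2 h0.
have := integrableZl mI e^-1 h; apply: eq_integrable => // x _ /=.
by rewrite -EFinM mulNr mulKf // gt_eqF.
Qed.

Definition fundF : set (R * R) := [set w | [/\ `|w.1| <= 1 / 2, 1 <= w.1 ^+ 2 + w.2 ^+ 2 & 0 < w.2]].
(** The part v > 1 of the truncated fundamental domain, a rectangle. *)
Definition strip (t : R) : set (R * R) := `[- (1 / 2), 1 / 2] `*` `]1, t].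

(** In fact v >= sqrt(3)/2 on the fundamental domain. *)
Lemma fundF_ge w : fundF w -> 1 / 2 <= w.2.
Proof.
move=> [h1 h2 h3]; rewrite leNgt; apply/negP => h4.
have : w.1 ^+ 2 <= (1/2) ^+ 2 by rewrite -(real_normK (num_real w.1)) lerXn2r // nnegrE.
have : w.2 ^+ 2 <= (1/2) ^+ 2 by rewrite lerXn2r ?nnegrE // ltW.
rewrite (_ : (1/2 : R) ^+ 2 = 1/4); [lra|by field].
Qed.

Lemma measurable_fundF : measurable (fundF : set (measurableTypeR R * measurableTypeR R)).
Proof.
have mf : measurable_fun [set: measurableTypeR R * measurableTypeR R] (fst : R * R -> R) := measurable_fst.
have ms : measurable_fun [set: measurableTypeR R * measurableTypeR R] (snd : R * R -> R) := measurable_snd.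
have mq : measurable_fun [set: measurableTypeR R * measurableTypeR R] (fun w : R * R => w.1 ^+ 2 + w.2 ^+ 2).
  by apply: measurable_funD; apply: measurable_funX.
have -> : fundF = (fst @^-1` `[- (1/2), 1/2]) `&` ((fun w : R * R => w.1 ^+ 2 + w.2 ^+ 2) @^-1` `[1, +oo[) `&` (snd @^-1` `]0, +oo[).
  apply/seteqP; split=> w /=; rewrite !in_itv /= !andbT -ler_norml.
    by move=> [].
  by move=> [[]].
apply: measurableI; first apply: measurableI.
- by rewrite -[X in measurable X]setTI; apply: mf => //; exact: measurable_itv.
- by rewrite -[X in measurable X]setTI; apply: mq => //; exact: measurable_itv.
- by rewrite -[X in measurable X]setTI; apply: ms => //; exact: measurable_itv.
Qed.

Lemma measurable_snd_le t : measurable ([set w | w.2 <= t] : set (measurableTypeR R * measurableTypeR R)).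
Proof.
have ms : measurable_fun [set: measurableTypeR R * measurableTypeR R] (snd : R * R -> R) := measurable_snd.
rewrite (_ : [set w | _] = setT `&` (snd @^-1` `]-oo, t])); last by rewrite setTI; apply/seteqP; split=> w /=; rewrite in_itv.
by apply: ms => //; exact: measurable_itv.
Qed.

Lemma truncated_fundF t : truncated_domain t = fundF `&` [set w | w.2 <= t].
Proof. by apply/seteqP; split=> w /=; [move=> []|move=> [[]]]. Qed.

Lemma measurable_truncated t : measurable (truncated_domain t : set (measurableTypeR R * measurableTypeR R)).
Proof. by rewrite truncated_fundF; apply: measurableI; [exact: measurable_fundF|exact: measurable_snd_le]. Qed.

Lemma measurable_strip t : measurable (strip t : set (measurableTypeR R * measurableTypeR R)).
Proof. by apply: measurableX; exact: measurable_itv. Qed.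

(** Above height 1 the condition |tau| >= 1 is automatic. *)
Lemma truncated_strip t : truncated_domain t `&` [set w | 1 < w.2] = strip t.
Proof.
apply/seteqP; split=> [w [[h1 h2 h3 h4] h5]|w [/= h1 h2]].
  by split; rewrite /= in_itv /= -?ler_norml // h5.
move: h1 h2; rewrite !in_itv /= -ler_norml => h1 /andP[h2 h3]; split=> //.
split=> //; last by rewrite (lt_trans _ h2).
have : 1 <= w.2 ^+ 2 by rewrite expr_ge1 // ?ltW // (lt_trans _ h2).
have := sqr_ge0 w.1; lra.
Qed.

Lemma integrable_expF (e : R) : 0 < e -> mu2.-integrable fundF (EFin \o (fun w : R * R => expR (- (e * w.2)))).
Proof.
move=> e0.
have i1 : mu.-integrable `[- (1/2), 1/2 : R] (EFin \o (fun=> 1 : R)).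
  by apply: continuous_compact_integrable; [exact: segment_compact|move=> x; exact: cst_continuous].
have [h _] := prod_Rint_set (measurable_itv _) (measurable_itv _) i1 (expR_integrable e0).
have {}h := integrableS _ measurable_fundF _ h.
apply: eq_integrable (h _ _) => //; first exact: measurable_fundF.
- by move=> w _ /=; rewrite mul1r.
- by apply: measurableX; exact: measurable_itv.
- by move=> w [h1 h2 h3]; split; rewrite /= in_itv /= -?ler_norml ?andbT // ltW.
Qed.

End PL.

(** * Gaussian primitives and the strip integral *)

Section EX.
Variable R : realType.
Local Notation C := R[i].
Local Notation mu := (@lebesgue_measure R).

(** The primitive of exp(-t^2) vanishing at 0, on the positive half-line. *)
Definition gauss_prim (x : R) : R := \int[mu]_(t in `[0, x]) gauss_fun t.

Lemma gauss_prim_cvg : gauss_prim x @[x --> +oo] --> Num.sqrt pi / 2.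
Proof.
have : Num.sqrt (@gauss_integral_proof.integral0_gauss R x ^+ 2) @[x --> +oo] --> Num.sqrt (pi / 4).
  apply: continuous_cvg; [exact: sqrt_continuous|exact: gauss_integral_proof.cvg_integral0_gauss_sqr].
rewrite sqrtrM ?pi_ge0// sqrtrV// (_ : 4 = 2 ^+ 2); last by rewrite expr2 -natrM.
rewrite sqrtr_sqr ger0_norm// (_ : (fun _ => Num.sqrt _) = gauss_prim)//.
by apply/funext => r; rewrite sqrtr_sqr// ger0_norm//; exact: gauss_integral_proof.integral0_gauss_ge0.
Qed.

Lemma cont_integrable (f : R -> R) a b : continuous f -> mu.-integrable (`[a, b] : set (measurableTypeR R)) (EFin \o f).
Proof.
move=> cf; apply: continuous_compact_integrable; first exact: segment_compact.
by apply: continuous_subspaceT => x; exact: cf.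
Qed.

Lemma FTC_all (F f : R -> R) (a b : R) : a < b -> (forall x : R, is_derive x (1 : R) F (f x)) -> continuous f ->
  \int[mu]_(t in `[a, b]) f t = F b - F a.
Proof.
move=> ab dF cf.
have cF (x : R) : {for x, continuous F}.
  by apply: differentiable_continuous; apply/derivable1_diffP; have [] := dF x.
rewrite /Rintegral (@continuous_FTC2 _ f F) //.
- by apply: continuous_subspaceT => t; exact: cf.
- split; first by move=> x _; have [] := dF x.
    by apply: cvg_at_right_filter; exact: cF.
  by apply: cvg_at_left_filter; exact: cF.
- by move=> t _; rewrite derive1E; exact: derive_val.
Qed.

Lemma is_derive_powc (c t : R) n : is_derive t 1 (fun s : R => c * s ^+ n.+1) (c * (n.+1%:R * t ^+ n)).
Proof.
have h := is_deriveZ c (is_deriveX n.+1 (is_derive_id t (1 : R))).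
rewrite (_ : (fun s : R => c * s ^+ n.+1) = c \*: (id ^+ n.+1)); last first.
  by apply/funext => s; rewrite /= exprfctE.
by apply: is_derive_eq; rewrite /= /GRing.scale /= mulr1.
Qed.

Lemma Rint_exprn (x : R) n : 0 <= x -> \int[mu]_(t in `[0, x]) (t ^+ n) = x ^+ n.+1 / n.+1%:R.
Proof.
rewrite le_eqVlt => /predU1P[<-|x0].
  by rewrite set_itv1 Rintegral_set1 exprS mul0r mul0r.
have dF (s : R) : is_derive s (1 : R) (fun s : R => n.+1%:R^-1 * s ^+ n.+1) (s ^+ n).
  by have := is_derive_powc n.+1%:R^-1 s n; rewrite mulKf // pnatr_eq0.
by rewrite (FTC_all x0 dF (@exprn_continuous _ n)) expr0n mulr0 subr0 mulrC.
Qed.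

(** The substitution s = k sqrt(v). *)
Lemma subst_int (k t : R) : 0 < k -> 1 < t ->
  mu.-integrable (`]1, t] : set (measurableTypeR R)) (EFin \o (fun v => (Num.sqrt v)^-1 * expR (- (k ^+ 2 * v)))) /\
  \int[mu]_(v in `]1, t]) ((Num.sqrt v)^-1 * expR (- (k ^+ 2 * v))) = 2 / k * (gauss_prim (k * Num.sqrt t) - gauss_prim k).
Proof.
move=> k0 t1; have k1 : k != 0 by rewrite gt_eqF.
pose F (s : R) : R := k ^- 2 * s ^+ 2.
pose G (v : R) : R := (Num.sqrt v)^-1 * expR (- (k ^+ 2 * v)).
have dF (s : R) : is_derive s 1 F (k ^- 2 * (2 * s)) by exact: (is_derive_powc _ s 1).
have F'E : F^`()%classic = fun s => k ^- 2 * (2 * s).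
  by apply/funext => s; rewrite derive1E; exact: derive_val.
have cF (x : R) : {for x, continuous F}.
  by apply: differentiable_continuous; apply/derivable1_diffP; have [] := dF x.
have cF' : continuous (F^`()%classic).
  move=> x; rewrite F'E; apply: cvgM; first exact: cvg_cst.
  by apply: cvgM; [exact: cvg_cst|exact: cvg_id].
have cG : {within `[1, t], continuous G}.
  apply: continuous_in_subspaceT => x /set_mem; rewrite /= in_itv /= => /andP[x1 _].
  have x0 : 0 < x by rewrite (lt_le_trans _ x1).
  apply: cvgM.
    by apply: cvgV; [rewrite gt_eqF // sqrtr_gt0|exact: sqrt_continuous].
  apply: (@continuous_comp _ _ _ (fun v : R => - (k ^+ 2 * v)) expR); last exact: continuous_expR.
  by apply: cvgN; apply: cvgM; [exact: cvg_cst|exact: cvg_id].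
have t0 : 0 < t by rewrite (lt_trans _ t1).
have iG : mu.-integrable (`[1, t] : set (measurableTypeR R)) (EFin \o G).
  by apply: continuous_compact_integrable => //; exact: segment_compact.
have iG' : mu.-integrable (`]1, t] : set (measurableTypeR R)) (EFin \o G).
  apply: integrableS iG => //; exact: subset_itv_oc_cc.
split=> //; rewrite Rintegral_itv_obnd_cbnd //.
have F1 : F k = 1 by rewrite /F mulVf // expf_neq0.
have Ft : F (k * Num.sqrt t) = t by rewrite /F exprMn sqr_sqrtr ?(ltW t0) // mulKf // expf_neq0.
have st1 : 1 < Num.sqrt t by rewrite -[1]sqrtr1 ltr_sqrt.
have kk : k < k * Num.sqrt t by rewrite ltr_pMr.
have := @integration_by_substitution_increasing R F G k (k * Num.sqrt t) (ltW kk).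
rewrite F1 Ft => H.
have -> : \int[mu]_(v in `[1, t]) ((Num.sqrt v)^-1 * expR (- (k ^+ 2 * v))) = \int[mu]_(s in `[k, k * Num.sqrt t]) (2 / k * gauss_fun s).
  rewrite /Rintegral; congr fine; rewrite H //.
  - apply: eq_integral => s /set_mem; rewrite /= in_itv /= => /andP[ks _]; congr EFin.
    have s0 : 0 < s by rewrite (lt_le_trans k0).
    change (G (F s) * F^`()%classic s = 2 / k * gauss_fun s).
    rewrite F'E /G /F /gauss_fun (mulVKf (expf_neq0 2 k1)).
    have -> : Num.sqrt (k ^- 2 * s ^+ 2) = s / k.
      by rewrite mulrC -expr_div_n sqrtr_sqr ger0_norm // divr_ge0 // ltW.
    by set e := expR _; field; rewrite k1 gt_eqF.
  - move=> a b; rewrite !in_itv /= => /andP[ka _] /andP[kb _] ab.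
    have a0 := lt_le_trans k0 ka; have b0 := lt_le_trans k0 kb.
    by rewrite /F ltr_pM2l ?invr_gt0 ?exprn_gt0 // ltrXn2r ?nnegrE ?(ltW a0) ?(ltW b0).
  - by apply/cvg_ex; exists (F^`()%classic k); apply: cvg_at_right_filter; exact: cF'.
  - by apply/cvg_ex; exists (F^`()%classic (k * Num.sqrt t)); apply: cvg_at_left_filter; exact: cF'.
  - split; first by move=> x _; have [] := dF x.
      by apply: cvg_at_right_filter; exact: cF.
    by apply: cvg_at_left_filter; exact: cF.
have ig a b := @cont_integrable gauss_fun a b continuous_gauss_fun.
rewrite RintegralZl //; congr (_ * _).
rewrite /gauss_prim (@Rintegral_itvB _ _ (BLeft 0) (BRight (k * Num.sqrt t)) k) //.
- rewrite Rintegral_itv_obnd_cbnd //; apply: integrableS (ig k (k * Num.sqrt t)) => //; exact: subset_itv_oc_cc.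
- by rewrite bnd_simp ltW.
- by rewrite bnd_simp ltW.
Qed.

Definition erf_coef n : R := (-1) ^+ n / (n`!%:R * n.*2.+1%:R).

Lemma gauss_prim_series (x : R) : 0 <= x -> hasS (fun n => (erf_coef n * x ^+ n.*2.+1)%:C) (gauss_prim x)%:C.
Proof.
move=> x0.
pose phi (n : nat) (s : R) : C := ((- (s ^+ 2)) ^+ n / n`!%:R)%:C.
have [_ hB] := hasS_exp (x ^+ 2).
have mI : measurable (`[0, x] : set (measurableTypeR R)) by exact: measurable_itv.
have iphi n : mu.-integrable (`[0, x] : set (measurableTypeR R)) (EFin \o (fun s => (- (s ^+ 2)) ^+ n / n`!%:R)).
  apply: cont_integrable => s; apply: cvgM; last exact: cvg_cst.
  apply: (@continuous_comp _ _ _ (fun s : R => - s ^+ 2) (fun s => s ^+ n)); last exact: exprn_continuous.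
  by apply: cvgN; exact: exprn_continuous.
have [||||||_ _] := @cint_infsum R _ (measurableTypeR R) mu _ mI nat (fun n => (x ^+ 2) ^+ n / n`!%:R) _ phi (fun s => (gauss_fun s)%:C) (fun=> 1) _ hB.
- by move=> n; rewrite divr_ge0 // exprn_ge0 // sqr_ge0.
- by [].
- apply: cont_integrable => s; exact: cvg_cst.
- move=> n; apply: cmeas_real; by have /measurable_int/measurable_EFinP := iphi n.
- move=> n s; rewrite /= in_itv /= => /andP[s0 sx]; rewrite mulr1 /phi cabsC normrM [X in _ * X]ger0_norm ?invr_ge0 //.
  by rewrite ler_wpM2r ?invr_ge0 // normrX normrN normrX lerXn2r ?nnegrE ?exprn_ge0 // lerXn2r ?nnegrE // ger0_norm.
- by move=> s _; have [h _] := hasS_exp (- (s ^+ 2)).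
rewrite [cint _ _ _](_ : _ = (gauss_prim x)%:C); last first.
  by rewrite /cint /= Rintegral_cst // mul0r.
apply: hasS_ext => n; rewrite /cint /phi /= Rintegral_cst // mul0r.
congr Complex; rewrite RintegralZr //; last first.
  apply: cont_integrable => s.
  apply: (@continuous_comp _ _ _ (fun s : R => - s ^+ 2) (fun s => s ^+ n)); last exact: exprn_continuous.
  by apply: cvgN; exact: exprn_continuous.
transitivity (\int[mu]_(s in `[0, x]) ((-1) ^+ n * s ^+ n.*2) / n`!%:R).
  by congr (_ * _); apply: eq_Rintegral => s _ /=; rewrite (exprNn (s ^+ 2)) -exprM mul2n.
rewrite RintegralZl //; last by apply: cont_integrable; exact: exprn_continuous.
by rewrite Rint_exprn // /erf_coef invfM; ring.
Qed.

(** The odd extension of the Gaussian primitive; unlike gauss_prim it is given by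
    its entire power series on the whole line. *)
Definition erf_odd (x : R) : R := if 0 <= x then gauss_prim x else - gauss_prim (- x).

Lemma erf_odd_series (x : R) : hasS (fun n => (erf_coef n * x ^+ n.*2.+1)%:C) (erf_odd x)%:C.
Proof.
rewrite /erf_odd; case: leP => x0; first exact: gauss_prim_series.
have := gauss_prim_series (x := - x); rewrite oppr_ge0 => /(_ (ltW x0)) /hasSN; rewrite -rmorphN; apply: hasS_ext => n.
by rewrite -rmorphN exprNn /= exprS -mul2n exprM sqrrN expr1n expr1n; congr (_%:C); ring.
Qed.

(** Compose the power series; its coefficients are those of an entire function,
    so that no smallness of g is required. *)
Lemma AN_erf_odd r M (g : R -> R -> R) : 0 < r -> AN r M (fun X Y => (g X Y)%:C) ->
  exists M', AN r M' (fun X Y => (erf_odd (g X Y))%:C).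
Proof.
move=> r0 h; have M0 := AN_ge0 h; exists (M * expR `|M ^+ 2|).
apply: (@AN_infsum R nat r _ (fun n => cabs (erf_coef n)%:C * M ^+ n.*2.+1) (fun n X Y => (erf_coef n)%:C * (g X Y)%:C ^+ n.*2.+1)) => //.
- by move=> n; apply: AN_Z; exact: AN_exp.
- move=> F; have [_ b] := hasS_exp (M ^+ 2).
  apply: le_trans (ler_wpM2l M0 (b F)); rewrite mulr_sumr; apply: ler_sum => n _.
  rewrite !cabsC exprS -mul2n exprM mulrCA ler_wpM2l // (normrM (M ^+ 2 ^+ n)) (ger0_norm (exprn_ge0 _ (sqr_ge0 _))).
  rewrite mulrC ler_wpM2l ?exprn_ge0 ?sqr_ge0 // /erf_coef normrM normrX normrN1 expr1n mul1r !ger0_norm ?invr_ge0 //.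
  rewrite lef_pV2 ?posrE ?mulr_gt0 ?ltr0n ?fact_gt0 // ler_peMr // ler1n //.
- by move=> X Y _ _; apply: hasS_ext (erf_odd_series (g X Y)) => n; rewrite rmorphM rmorphXn.
Qed.

Lemma sin_natpi (m : nat) : sin (m%:R * pi) = 0 :> R.
Proof. by elim: m => [|m IH]; rewrite ?mul0r ?sin0 // -addn1 natrD mulrDl mul1r sinDpi IH oppr0. Qed.

Lemma sin_intpi (n : int) : sin (n%:~R * pi) = 0 :> R.
Proof.
case: n => m; first exact: sin_natpi.
by rewrite NegzE mulrNz mulNr sinN -[_%:~R]/(m.+1%:R) sin_natpi oppr0.
Qed.

Lemma is_derive_lin (K u : R) : is_derive u (1 : R) (fun u : R => K * u) K.
Proof.
have := is_derive_powc K u 0; rewrite expr0 !mulr1 (_ : (fun s : R => K * s ^+ 1) = (fun u => K * u)) //.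
Qed.

Lemma continuous_lin (K : R) : continuous (fun u : R => K * u).
Proof. by move=> x; apply: cvgM; [exact: cvg_cst|exact: cvg_id]. Qed.

Lemma continuous_cosK (K : R) : continuous (fun u : R => cos (K * u)).
Proof. by move=> x; apply: (@continuous_comp _ _ _ (fun u : R => K * u) cos); [exact: continuous_lin|exact: continuous_cos]. Qed.

Lemma continuous_sinK (K : R) : continuous (fun u : R => sin (K * u)).
Proof. by move=> x; apply: (@continuous_comp _ _ _ (fun u : R => K * u) sin); [exact: continuous_lin|exact: continuous_sin]. Qed.

Lemma int_cosK (K : R) : K != 0 -> sin (K * (1 / 2)) = 0 -> \int[mu]_(u in `[- (1 / 2), 1 / 2]) cos (K * u) = 0.
Proof.
move=> K0 sK; have h12 : - (1 / 2) < 1 / 2 :> R by lra.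
have dF (u : R) : is_derive u (1 : R) (fun u => K^-1 * sin (K * u)) (cos (K * u)).
  have h := is_deriveZ K^-1 (is_derive1_comp (is_derive_sin (K * u)) (is_derive_lin K u)).
  by apply: is_derive_eq; rewrite /GRing.scale /= mulrC mulfK.
by rewrite (FTC_all h12 dF (@continuous_cosK K)) mulrN sinN sK oppr0 mulr0 subr0.
Qed.

Lemma int_sinK (K : R) : K != 0 -> \int[mu]_(u in `[- (1 / 2), 1 / 2]) sin (K * u) = 0.
Proof.
move=> K0; have h12 : - (1 / 2) < 1 / 2 :> R by lra.
have dF (u : R) : is_derive u (1 : R) (fun u => - K^-1 * cos (K * u)) (sin (K * u)).
  have h := is_deriveZ (- K^-1) (is_derive1_comp (is_derive_cos (K * u)) (is_derive_lin K u)).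
  by apply: is_derive_eq; rewrite /GRing.scale /=; field.
by rewrite (FTC_all h12 dF (@continuous_sinK K)) mulrN cosN subrr.
Qed.

Lemma ec_real (x : R) : ec x%:C = cos (2 * pi * x) +i* sin (2 * pi * x).
Proof. by rewrite /ec /= mulr0 oppr0 expR0 mul1r. Qed.

Lemma ec_cintble (x : R) : cintble mu (`[- (1 / 2), 1 / 2] : set (measurableTypeR R)) (fun u => ec (x * u)%:C).
Proof.
have E : (fun u => ec (x * u)%:C) = (fun u : R => cos (2 * pi * x * u) +i* sin (2 * pi * x * u)).
  by apply/funext => u; rewrite ec_real !mulrA.
rewrite E; split; apply: cont_integrable; [exact: continuous_cosK|exact: continuous_sinK].
Qed.

(** Orthogonality of the characters of R/Z. *)
Lemma ec_u (n : int) : cint mu (`[- (1 / 2), 1 / 2] : set (measurableTypeR R)) (fun u => ec (n%:~R * u)%:C) = (n == 0)%:R.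
Proof.
have E x : (fun u => ec (x * u)%:C) = (fun u : R => cos (2 * pi * x * u) +i* sin (2 * pi * x * u)).
  by apply/funext => u; rewrite ec_real !mulrA.
rewrite E /cint /=; case: eqP => [->|/eqP n0].
  rewrite !mulr0; under eq_Rintegral do rewrite mul0r cos0.
  under [X in _ +i* X]eq_Rintegral do rewrite mul0r sin0.
  rewrite !Rintegral_cst //= mul0r lebesgue_measure_itv /= lte_fin ifT; last by lra.
  rewrite /= mul1r; congr Complex; lra.
have pn : 2 * pi * n%:~R != 0 :> R by rewrite !mulf_neq0 ?intr_eq0 // gt_eqF // pi_gt0.
rewrite int_sinK // int_cosK //.
by rewrite (_ : 2 * pi * n%:~R * (1 / 2) = n%:~R * pi) ?sin_intpi //; field.
Qed.

(** The integral over 1 < v <= t of p v^(-1/2) exp(-alpha p^2 v), in terms of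
    the Gaussian primitive. The factor sgn p is the source of the jumps. *)
Definition Jint (alpha p t : R) : R :=
  Num.sg p * (2 / Num.sqrt alpha) * (gauss_prim (`|p| * Num.sqrt alpha * Num.sqrt t) - gauss_prim (`|p| * Num.sqrt alpha)).

Lemma Jint_subst (alpha p t : R) : 0 < alpha -> 1 < t ->
  mu.-integrable (`]1, t] : set (measurableTypeR R)) (EFin \o (fun v => p * ((Num.sqrt v)^-1 * expR (- (alpha * p ^+ 2 * v))))) /\
  \int[mu]_(v in `]1, t]) (p * ((Num.sqrt v)^-1 * expR (- (alpha * p ^+ 2 * v)))) = Jint alpha p t.
Proof.
move=> a0 t1; have mI : measurable (`]1, t] : set (measurableTypeR R)) by exact: measurable_itv.
have [->|p0] := eqVneq p 0.
  have -> : (fun v : R => 0 * ((Num.sqrt v)^-1 * expR (- (alpha * 0 ^+ 2 * v)))) = fun=> 0 by apply/funext => v; rewrite mul0r.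
  split; first exact: integrable0.
  by rewrite Rintegral_cst // /Jint sgr0 !mul0r.
have k0 : 0 < `|p| * Num.sqrt alpha by rewrite mulr_gt0 ?normr_gt0 // sqrtr_gt0.
have [i1 i2] := subst_int k0 t1.
have kk : (`|p| * Num.sqrt alpha) ^+ 2 = alpha * p ^+ 2.
  by rewrite exprMn sqr_sqrtr ?(ltW a0) // real_normK ?num_real // mulrC.
rewrite kk in i1 i2; split; first exact: (integrableZl mI p i1).
rewrite RintegralZl // i2 mulrA /Jint; congr (_ * _).
rewrite {1}(numEsg p); field.
by rewrite normr_eq0 p0 gt_eqF // sqrtr_gt0.
Qed.

(** The limit splits into a sign and an odd entire function of p: only the sign fails to
    be analytic in p. *)
Lemma Jint_cvg (alpha p : R) : 0 < alpha ->
  Jint alpha p t @[t --> +oo] --> Num.sg p * Num.sqrt (pi / alpha) - 2 / Num.sqrt alpha * erf_odd (p * Num.sqrt alpha).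
Proof.
move=> a0; have sa : 0 < Num.sqrt alpha by rewrite sqrtr_gt0.
have [->|p0] := eqVneq p 0.
  rewrite /erf_odd mul0r lexx /gauss_prim set_itv1 Rintegral_set1 sgr0 mul0r mulr0 subr0.
  by rewrite (_ : Jint alpha 0 = fun=> 0); [exact: cvg_cst|apply/funext => t; rewrite /Jint sgr0 !mul0r].
have k0 : 0 < `|p| * Num.sqrt alpha by rewrite mulr_gt0 ?normr_gt0.
have -> : Num.sg p * Num.sqrt (pi / alpha) - 2 / Num.sqrt alpha * erf_odd (p * Num.sqrt alpha) =
   Num.sg p * (2 / Num.sqrt alpha) * (Num.sqrt pi / 2 - gauss_prim (`|p| * Num.sqrt alpha)).
  have -> : erf_odd (p * Num.sqrt alpha) = Num.sg p * gauss_prim (`|p| * Num.sqrt alpha).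
    rewrite /erf_odd pmulr_lge0 //; case: ltgtP p0 => // p0 _.
      by rewrite gtr0_sg // mul1r gtr0_norm.
    by rewrite ltr0_sg // mulN1r ltr0_norm // mulNr.
  rewrite sqrtrM ?pi_ge0 // sqrtrV ?(ltW a0) //; field; rewrite gt_eqF //.
apply: cvgM; first exact: cvg_cst.
apply: cvgB; last exact: cvg_cst.
apply: (cvg_comp (fun t => `|p| * Num.sqrt alpha * Num.sqrt t) gauss_prim); last exact: gauss_prim_cvg.
apply/cvgryPge => A; near=> t.
rewrite mulrC -ler_pdivrMr //.
apply: le_trans (ler_norm _) _; rewrite -sqrtr_sqr; apply: ler_wsqrtr; near: t.
by apply: nbhs_pinfty_ge; exact: num_real.
Unshelve. all: by end_near. Qed.

(** The integral over u selects n = 0, the integral over v is Jint. *)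
Lemma strip_term (n : int) (alpha p t : R) : 0 < alpha -> 1 < t ->
  let g (w : R * R) : C := ec (n%:~R * w.1)%:C * (p * ((Num.sqrt w.2)^-1 * expR (- (alpha * p ^+ 2 * w.2))))%:C in
  cintble (mu \x mu)%E (strip t) g /\
  cint (mu \x mu)%E (strip t) g = (n == 0)%:R * (Jint alpha p t)%:C.
Proof.
move=> a0 t1 g; have [i1 i2] := Jint_subst p a0 t1.
have mA : measurable (`[- (1 / 2), 1 / 2] : set (measurableTypeR R)) by exact: measurable_itv.
have mB : measurable (`]1, t] : set (measurableTypeR R)) by exact: measurable_itv.
have [h1 h2] := prod_cint_set mA mB (ec_cintble n%:~R) i1.
by split=> //; rewrite h2 ec_u i2.
Qed.
End EX.

(** * The majorant of the quadratic form *)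

Section QE.
Variable R : realType.
Local Notation C := R[i].

Ltac nneg := repeat first [done | assumption | exact: normr_ge0 | exact: sqr_ge0 | exact: expR_ge0 | apply: exprn_ge0 | apply: addr_ge0 | apply: mulr_ge0 | rewrite invr_ge0 | exact: ltW].

Lemma hasS_geom (x : R) : `|x| < 1 -> hasS (fun n => (x ^+ n)%:C) ((1 - x)^-1)%:C.
Proof.
move=> x1.
have b : absle (fun n => (x ^+ n)%:C) (1 - `|x|)^-1.
  apply: (absle_le (@absle_geom R `|x| _)) => [|n|//]; first by rewrite normr_ge0.
  by rewrite !cabsC !normrX normr_id.
have [s hs] := absle_hasS b; suff <- : s = ((1 - x)^-1)%:C by [].
apply: hasS_series hs _; have := cvg_geometric_series (a := 1) x1; rewrite div1r.
by rewrite (_ : geometric 1 x = fun n => x ^+ n) //; apply/funext => n; rewrite /= mul1r.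
Qed.

(** A geometric series around y0. *)
Lemma AN_inv (y0 r : R) : 0 < y0 -> 0 < r <= y0 / 2 -> AN r (2 / y0) (fun X Y => ((y0 + Y)^-1)%:C).
Proof.
move=> y00 /andP[r0 ry].
apply: (@AN_infsum R nat r _ (fun n => cabs ((- y0^-1) ^+ n / y0)%:C * mono (0, n)%N r r) (fun n X Y => ((- y0^-1) ^+ n / y0)%:C * (mono (0, n)%N X Y)%:C)) => //.
- move=> n; apply: AN_Z; have := AN_mono (0, n)%N (ltW r0) (AN_cst r 1).
  rewrite (cabsC (1 : R)) normr1 mulr1; apply: AN_ext => X Y _ _; by rewrite mulr1.
- move=> F; have := @absle_geom R (1/2) _; move=> /(_ ltac:(lra)) /(_ F) h.
  apply: (@le_trans _ _ (\sum_(n <- F) y0^-1 * cabs ((1 / 2) ^+ n)%:C)).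
    apply: ler_sum => n _; rewrite !cabsC /mono /= expr0 mul1r normrM mulrAC mulrC.
    rewrite (@ger0_norm _ y0^-1) ?invr_ge0 ?(ltW y00) // ler_wpM2l ?invr_ge0 ?(ltW y00) //.
    have -> : `|(- y0^-1) ^+ n| = y0^-1 ^+ n by rewrite normrX normrN ger0_norm ?invr_ge0 ?(ltW y00).
    have -> : `|(1 / 2 : R) ^+ n| = (1 / 2) ^+ n by rewrite ger0_norm ?exprn_ge0.
    rewrite -exprMn lerXn2r ?nnegrE ?divr_ge0 ?mulr_ge0 ?invr_ge0 ?(ltW y00) ?(ltW r0) //.
    by rewrite mulrC ler_pdivrMr //; lra.
  rewrite -mulr_sumr mulrC ler_wpM2r ?invr_ge0 ?(ltW y00) //; apply: le_trans h _.
  rewrite le_eqVlt; apply/orP; left; apply/eqP; by field.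
- move=> X Y hX hY.
  have h : `|- (Y / y0)| < 1.
    rewrite normrN normrM (@ger0_norm _ y0^-1) ?invr_ge0 ?(ltW y00) // ltr_pdivrMr // mul1r.
    apply: le_lt_trans hY _; lra.
  have yY : y0 + Y != 0.
    by apply/eqP => e; move: hY; rewrite (_ : Y = - y0); [rewrite normrN gtr0_norm //; lra|lra].
  have := hasSZ (y0^-1)%:C (hasS_geom h); rewrite -rmorphM.
  have -> : y0^-1 * (1 - - (Y / y0))^-1 = (y0 + Y)^-1.
    by rewrite opprK; field; rewrite yY gt_eqF.
  apply: hasS_ext => n; rewrite -!rmorphM /mono /= expr0 mul1r; congr (_%:C).
  by rewrite -mulNr mulrC mulrAC -exprMn; congr (_ * _); congr (_ ^+ _); rewrite mulNr mulrC mulNr.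
Qed.

(** Up to a constant, the coefficient of c in the linear form p_z. *)
Definition AR (y x : R) : R := (x ^+ 2 + y ^+ 2) / y.

(** The coefficients of p_z in the coordinates a, b, c have small norm once
    their value at the centre is subtracted. *)
Lemma base_AN (x0 y0 : R) : 0 < y0 -> exists K, 0 <= K /\ forall r, 0 < r <= Num.min 1 (y0 / 2) ->
  [/\ AN r (K * r) (fun X Y => ((y0 + Y)^-1 - y0^-1)%:C),
      AN r (K * r) (fun X Y => ((x0 + X) / (y0 + Y) - x0 / y0)%:C) &
      AN r (K * r) (fun X Y => (AR (y0 + Y) (x0 + X) - AR y0 x0)%:C)].
Proof.
move=> y00; pose K1 := 2 / y0 ^+ 2; pose K2 := `|x0| * K1 + 2 / y0.
pose K3 := x0 ^+ 2 * K1 + (2 * `|x0| + 1) * (2 / y0) + 1.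
have K10 : 0 <= K1 by rewrite divr_ge0 // exprn_ge0 // ltW.
have i0 : 0 <= 2 / y0 by rewrite divr_ge0 // ltW.
have K20 : 0 <= K2 by rewrite addr_ge0 // mulr_ge0.
have K30 : 0 <= K3 by rewrite /K3; nneg.
exists (K1 + K2 + K3); split; first by apply: addr_ge0 => //; apply: addr_ge0.
move=> r /andP[r0]; rewrite le_min => /andP[r1 ry].
have hr : 0 < r <= y0 / 2 by rewrite r0.
have yY X Y : `|X| <= r -> `|Y| <= r -> y0 + Y != 0.
  by move=> _ hY; apply/eqP => e; move: hY; rewrite (_ : Y = - y0); [rewrite normrN gtr0_norm //; lra|lra].
have aI := AN_inv y00 hr.
have aY := AN_Y (ltW r0); have aX := AN_X (ltW r0).
have aD : AN r (K1 * r) (fun X Y => ((y0 + Y)^-1 - y0^-1)%:C).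
  apply: AN_le (AN_ext _ (AN_Z (- y0^-1)%:C (AN_M r0 aY aI))).
    rewrite cabsC normrN ger0_norm ?invr_ge0 ?(ltW y00) // /K1 le_eqVlt; apply/orP; left; apply/eqP; field; rewrite gt_eqF //.
  move=> X Y hX hY; rewrite -!rmorphM /=; congr (_%:C); field; rewrite (gt_eqF y00) //=; exact: yY hX hY.
have aB : AN r (K2 * r) (fun X Y => ((x0 + X) / (y0 + Y) - x0 / y0)%:C).
  apply: AN_le (AN_ext _ (AN_D (AN_Z x0%:C aD) (AN_M r0 aX aI))).
    rewrite cabsC /K2 le_eqVlt; apply/orP; left; apply/eqP; field; rewrite gt_eqF //.
  move=> X Y hX hY; rewrite -!rmorphM -rmorphD /=; congr (_%:C); field; rewrite (gt_eqF y00) //=; exact: yY hX hY.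
have aA : AN r (K3 * r) (fun X Y => (AR (y0 + Y) (x0 + X) - AR y0 x0)%:C).
  have a1 := AN_D (AN_Z (2 * x0)%:C aX) (AN_M r0 aX aX).
  apply: AN_le (AN_ext _ (AN_D (AN_D (AN_Z (x0 ^+ 2)%:C aD) (AN_M r0 a1 aI)) aY)).
    rewrite !cabsC /K3 (normrM 2 x0) (@ger0_norm _ 2) // (@ger0_norm _ (x0 ^+ 2)) ?sqr_ge0 //.
    have -> : (x0 ^+ 2 * K1 + (2 * `|x0| + 1) * (2 / y0) + 1) * r = x0 ^+ 2 * (K1 * r) + (2 * `|x0| * r + 1 * r) * (2 / y0) + r by ring.
    by rewrite lerD2r lerD2l ler_wpM2r // lerD2l ler_wpM2r // ltW.
  move=> X Y hX hY; rewrite -!rmorphM -!rmorphD -rmorphM -!rmorphD /=; congr (_%:C); rewrite /AR; field; rewrite (gt_eqF y00) //=; exact: yY hX hY.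
have le1 (k : R) g : k <= K1 + K2 + K3 -> AN r (k * r) g -> AN r ((K1 + K2 + K3) * r) g.
  by move=> h; apply: AN_le; rewrite ler_wpM2r // ltW.
split.
- by apply: le1 aD; rewrite -addrA lerDl addr_ge0.
- by apply: le1 aB; rewrite -addrA addrCA lerDl addr_ge0.
- by apply: le1 aA; rewrite lerDr addr_ge0.
Qed.

(** The linear form p_z in the coordinates a, b, c, where n stands for the level;
    likewise for QR and qC below. *)
Definition pR (n x y a b c : R) : R := - ((c * n * (x ^+ 2 + y ^+ 2) - b * x + a) / (Num.sqrt (2 * n) * y)).
Definition QR (n a b c : R) : R := b ^+ 2 / (4 * n) - a * c.
Definition qC (n : R) (z : C) (a b c : R) : C := - ((Num.sqrt (2 * n))^-1)%:C * (c%:C * n%:C * z ^+ 2 - b%:C * z + a%:C).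

(** The majorant Q_z as a sum of squares. *)
Lemma QR_majorant (n x y a b c : R) : 0 < n -> 0 < y ->
  let P := c * n * (x ^+ 2 + y ^+ 2) - b * x + a in
  QR n a b c + pR n x y a b c ^+ 2 =
   (4 * n * y ^+ 2)^-1 * ((P - 2 * c * n * y ^+ 2) ^+ 2 + (y * (2 * c * n * x - b)) ^+ 2 + P ^+ 2).
Proof.
move=> n0 y0 P.
have s2 : Num.sqrt (2 * n) ^+ 2 = 2 * n by rewrite sqr_sqrtr // mulr_ge0 // ltW.
rewrite /pR -/P sqrrN expr_div_n exprMn s2 /QR /P; field.
by rewrite !gt_eqF.
Qed.

(** The majorant is positive definite, hence bounds the square of the l^1
    length from below. *)
Lemma quad_pos (n x y : R) : 0 < n -> 0 < y -> exists k, 0 < k /\ forall a b c,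
  k * (`|a| + `|b| + `|c|) ^+ 2 <= QR n a b c + pR n x y a b c ^+ 2.
Proof.
move=> n0 y0.
pose Kc := (n * y ^+ 2)^-1; pose Kb := 2 * n * `|x| * Kc + y^-1.
pose Ka := 1 + n * (x ^+ 2 + y ^+ 2) * Kc + `|x| * Kb.
have Kc0 : 0 <= Kc by rewrite invr_ge0 mulr_ge0 ?exprn_ge0 // ltW.
have Kb0 : 0 <= Kb by rewrite addr_ge0 ?invr_ge0 ?(ltW y0) // mulr_ge0 // mulr_ge0 // mulr_ge0 // ltW.
have Ka1 : 1 <= Ka by rewrite /Ka -addrA lerDl; nneg.
pose K := Ka + Kb + Kc; have K1 : 1 <= K by rewrite /K -addrA (le_trans Ka1) // lerDl addr_ge0.
have K0 : 0 < K by rewrite (lt_le_trans ltr01).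
have D0 : 0 < 4 * n * y ^+ 2 by rewrite !mulr_gt0 // exprn_gt0.
exists ((4 * n * y ^+ 2)^-1 / K ^+ 2); split.
  by rewrite divr_gt0 ?invr_gt0 // exprn_gt0.
move=> a b c; rewrite (QR_majorant x a b c n0 y0) -[leLHS]mulrA ler_pM2l ?invr_gt0 //.
set P := c * n * _ - _ + _; set A := P - _; set B := y * _.
rewrite ler_pdivrMl ?exprn_gt0 //.
pose S := Num.sqrt (A ^+ 2 + B ^+ 2 + P ^+ 2).
have S20 : 0 <= A ^+ 2 + B ^+ 2 + P ^+ 2 by rewrite !addr_ge0 // sqr_ge0.
have S0 : 0 <= S by rewrite sqrtr_ge0.
have S2 : S ^+ 2 = A ^+ 2 + B ^+ 2 + P ^+ 2 by rewrite sqr_sqrtr.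
have hA : `|A| <= S by rewrite -sqrtr_sqr ler_wsqrtr // -addrA lerDl addr_ge0 // sqr_ge0.
have hB : `|B| <= S by rewrite -sqrtr_sqr ler_wsqrtr // addrAC lerDr addr_ge0 // sqr_ge0.
have hP : `|P| <= S by rewrite -sqrtr_sqr ler_wsqrtr // lerDr addr_ge0 // sqr_ge0.
have hc : `|c| <= Kc * S.
  have -> : c = Kc * ((P - A) / 2) by rewrite /Kc /A; field; rewrite !gt_eqF.
  rewrite normrM (ger0_norm Kc0) ler_wpM2l //.
  have := ler_normB P A; rewrite normrM (@ger0_norm _ 2^-1) // ; lra.
have hb : `|b| <= Kb * S.
  have -> : b = 2 * n * x * c - y^-1 * B by rewrite /B; field; rewrite gt_eqF.
  apply: le_trans (ler_normB _ _) _; rewrite /Kb [leRHS]mulrDl lerD //.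
    rewrite !normrM (ger0_norm (ltW n0)) (@ger0_norm _ 2) // -[leRHS]mulrA ler_wpM2l //; nneg.
  by rewrite normrM ger0_norm ?invr_ge0 ?(ltW y0) // ler_wpM2l // invr_ge0 ltW.
have ha : `|a| <= Ka * S.
  have -> : a = P - n * (x ^+ 2 + y ^+ 2) * c + x * b by rewrite /P; ring.
  have xy0 : 0 <= n * (x ^+ 2 + y ^+ 2) by rewrite mulr_ge0 ?(ltW n0) // addr_ge0 // sqr_ge0.
  apply: le_trans (ler_normD _ _) _; rewrite /Ka [leRHS]mulrDl lerD //.
    apply: le_trans (ler_normB _ _) _; rewrite [leRHS]mulrDl mul1r lerD // normrM ger0_norm // -[leRHS]mulrA ler_wpM2l //.
  by rewrite normrM -[leRHS]mulrA ler_wpM2l.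
rewrite -S2 -exprMn lerXn2r ?nnegrE ?addr_ge0 // ?mulr_ge0 // ?(ltW K0) //.
rewrite /K [leRHS]mulrDl [X in _ <= X + _]mulrDl; lra.
Qed.

(** Near z0 the majorant varies by at most a small multiple of the square of the l^1
    length, which the positive definite majorant dominates. *)
Lemma quad_AN (n x0 y0 : R) : 0 < n -> 0 < y0 -> exists K r1, [/\ 0 <= K, 0 < r1, r1 < y0 & forall r, 0 < r <= r1 -> forall a b c,
  let l := `|a| + `|b| + `|c| in
  [/\ AN r (K * r * l ^+ 2) (fun X Y => (pR n (x0 + X) (y0 + Y) a b c ^+ 2 - pR n x0 y0 a b c ^+ 2)%:C),
      AN r (K * l) (fun X Y => (pR n (x0 + X) (y0 + Y) a b c)%:C) &
      AN r (K * l) (fun X Y => qC n ((x0 + X) +i* (y0 + Y)) a b c)]].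
Proof.
move=> n0 y00; have [K0 [K00 hK]] := base_AN x0 y00.
pose s := (Num.sqrt (2 * n))^-1.
have s0 : 0 < s by rewrite invr_gt0 sqrtr_gt0 mulr_gt0.
pose K1 := s * ((n + 1) * K0).
pose K2 := s * ((n + 1) * (`|AR y0 x0| + `|x0 / y0| + `|y0^-1|)).
pose m := 2 + `|x0| + `|y0|.
pose K3 := s * (n * m ^+ 2 + m + 1).
have n1 : 0 <= n + 1 by rewrite addr_ge0 // ltW.
have K10 : 0 <= K1 by rewrite mulr_ge0 ?(ltW s0) // mulr_ge0.
have K20 : 0 <= K2 by rewrite mulr_ge0 ?(ltW s0) // mulr_ge0 // !addr_ge0.
have m0 : 0 <= m by rewrite !addr_ge0.
have K30 : 0 <= K3 by rewrite mulr_ge0 ?(ltW s0) // !addr_ge0 // mulr_ge0 ?(ltW n0) // exprn_ge0.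
exists (K1 * (K1 + 2 * K2) + (K1 + K2) + K3), (Num.min 1 (y0 / 2)).
have r10 : 0 < Num.min 1 (y0 / 2) by rewrite lt_min ltr01 divr_gt0.
split=> //.
- by rewrite !addr_ge0 // mulr_ge0 // addr_ge0 // mulr_ge0.
- by rewrite gt_min; apply/orP; right; lra.
move=> r hr a b c l; have /andP[r0] := hr; rewrite le_min => /andP[r1 ry].
have [aD aB aA] := hK r hr.
have l0 : 0 <= l by rewrite !addr_ge0.
have la : `|a| <= l by rewrite /l -addrA lerDl addr_ge0.
have lb : `|b| <= l by rewrite /l addrAC lerDr addr_ge0.
have lc : `|c| <= l by rewrite /l lerDr addr_ge0.
have yY X Y : `|X| <= r -> `|Y| <= r -> y0 + Y != 0.
  by move=> _ hY; apply/eqP => e; move: hY; rewrite (_ : Y = - y0); [rewrite normrN gtr0_norm //; lra|lra].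
have sn : Num.sqrt (2 * n) = s^-1 by rewrite /s invrK.
have pE x y : y != 0 -> pR n x y a b c = - s * (c * n * AR y x - b * (x / y) + a / y).
  by move=> y1; rewrite /pR /AR sn; field; rewrite y1 gt_eqF.
have ad : AN r (K1 * r * l) (fun X Y => (pR n (x0 + X) (y0 + Y) a b c - pR n x0 y0 a b c)%:C).
  have h := AN_Z (- s)%:C (AN_D (AN_D (AN_Z (c * n)%:C aA) (AN_Z (- b)%:C aB)) (AN_Z a%:C aD)).
  apply: AN_le (AN_ext _ h).
    rewrite !cabsC !normrN normrM (ger0_norm (ltW s0)) (ger0_norm (ltW n0)).
    rewrite [leRHS](_ : _ = s * ((n + 1) * l * (K0 * r))); last by rewrite /K1; ring.
    rewrite ler_wpM2l ?(ltW s0) //.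
    rewrite [leLHS](_ : _ = (`|c| * n + `|b| + `|a|) * (K0 * r)); last by ring.
    rewrite ler_wpM2r ?mulr_ge0 ?(ltW r0) // mulrDl mul1r.
    have : `|c| * n <= n * l by rewrite mulrC ler_wpM2l // ltW.
    have : `|b| + `|a| <= l by rewrite /l addrC lerDl.
    lra.
  move=> X Y hX hY; rewrite !pE ?(gt_eqF y00) //; last exact: yY hX hY.
  by rewrite -!rmorphM -!rmorphD -rmorphM /=; congr (_%:C); ring.
have gen A B D : `|c * n * A - b * B + a * D| <= (n + 1) * (`|A| + `|B| + `|D|) * l.
  have n1l : l <= (n + 1) * l by rewrite ler_peMl // lerDr ltW.
  have nl : `|c| * n <= (n + 1) * l.
    by rewrite mulrDl mul1r mulrC -[X in X <= _]addr0 lerD // ler_wpM2l // ltW.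
  apply: le_trans (ler_normD _ _) _; apply: le_trans (lerD (ler_normB _ _) (lexx _)) _.
  rewrite !normrM (ger0_norm (ltW n0)).
  have i1 : `|c| * n * `|A| <= (n + 1) * l * `|A| by rewrite ler_wpM2r.
  have i2 : `|b| * `|B| <= (n + 1) * l * `|B| by rewrite ler_wpM2r // (le_trans lb).
  have i3 : `|a| * `|D| <= (n + 1) * l * `|D| by rewrite ler_wpM2r // (le_trans la).
  rewrite [leRHS](_ : _ = (n + 1) * l * `|A| + (n + 1) * l * `|B| + (n + 1) * l * `|D|); last by ring.
  lra.
have hp0 : `|pR n x0 y0 a b c| <= K2 * l.
  rewrite pE ?(gt_eqF y00) // normrM normrN (ger0_norm (ltW s0)) /K2 -[leRHS]mulrA ler_wpM2l ?(ltW s0) //.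
have ap : AN r ((K1 + K2) * l) (fun X Y => (pR n (x0 + X) (y0 + Y) a b c)%:C).
  apply: AN_le (AN_ext _ (AN_D ad (AN_cst r (pR n x0 y0 a b c)%:C))).
    rewrite cabsC mulrDl lerD // ler_wpM2r // ler_piMr //.
  by move=> X Y _ _; rewrite -rmorphD subrK.
have KK (k : R) : 0 <= k -> k * l <= k * l by [].
split.
- apply: AN_le (AN_ext _ (AN_M r0 ad (AN_D ap (AN_cst r (pR n x0 y0 a b c)%:C)))).
    rewrite cabsC.
    apply: (@le_trans _ _ (K1 * r * l * ((K1 + K2) * l + K2 * l))).
      by rewrite ler_wpM2l ?lerD2l // mulr_ge0 // mulr_ge0 // ltW.
    rewrite [leLHS](_ : _ = (K1 * (K1 + 2 * K2)) * (r * l ^+ 2)); last by ring.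
    rewrite -[leRHS]mulrA ler_wpM2r ?mulr_ge0 ?exprn_ge0 ?(ltW r0) //.
    by rewrite -addrA lerDl !addr_ge0.
  by move=> X Y _ _; rewrite -rmorphD -rmorphM; congr (_%:C); ring.
- apply: AN_le ap; rewrite ler_wpM2r // addrAC lerDr addr_ge0 // mulr_ge0 // addr_ge0 // mulr_ge0 //.
- have az : AN r m (fun X Y => (x0 + X) +i* (y0 + Y)).
    have h := AN_D (AN_D (AN_cst r (x0 +i* y0)) (AN_X (ltW r0))) (AN_Z 'i (AN_Y (ltW r0))).
    apply: AN_le (AN_ext _ h).
      have ci : cabs ('i : C) = 1 by rewrite /cabs normc_def /= expr0n expr1n add0r sqrtr1.
      rewrite ci mul1r /m; have := cabs_le_ReIm (x0 +i* y0) => /=; lra.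
    move=> X Y _ _; apply/eqP; rewrite eq_complex /= !mul0r !mul1r !addr0 subr0 /= add0r !eqxx.
    by rewrite addr0 eqxx.
  have h := AN_Z (- s)%:C (AN_D (AN_D (AN_Z (c * n)%:C (AN_exp 2 r0 az)) (AN_Z (- b)%:C az)) (AN_cst r a%:C)).
  apply: AN_le (AN_ext _ h).
    rewrite !cabsC !normrN normrM (ger0_norm (ltW s0)) (ger0_norm (ltW n0)).
    apply: (@le_trans _ _ (K3 * l)); last by rewrite ler_wpM2r // lerDr !addr_ge0 // mulr_ge0 // addr_ge0 // mulr_ge0.
    rewrite /K3 -mulrA ler_wpM2l ?(ltW s0) //.
    have i1 : `|c| * n * m ^+ 2 <= n * m ^+ 2 * l.
      by rewrite (_ : `|c| * n * m ^+ 2 = n * m ^+ 2 * `|c|); [rewrite ler_wpM2l //; nneg|ring].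
    have i2 : `|b| * m <= m * l by rewrite mulrC ler_wpM2l.
    rewrite [leRHS](_ : _ = n * m ^+ 2 * l + m * l + l); [lra|by ring].
  by move=> X Y _ _; rewrite /qC -/s !(rmorphN, rmorphM) /=; ring.
Qed.

End QE.

(** * Coordinates on the dual lattice *)

Section LAT.
Variable R : realType.
Local Notation C := R[i].
Variable N : nat.
Hypothesis hN : (0 < N)%N.
Local Notation M2 := 'M[rat]_2.

Definition ca (l : M2) : R := ratr (coef_a N l).
Definition cb (l : M2) : R := ratr (coef_b N l).
Definition cc (l : M2) : R := ratr (coef_c l).
Definition tr0 (l : M2) : Prop := l 1 1 = - l 0 0.
(** The dual lattice, described by its integral coordinates. *)
Definition Lint (l : M2) : Prop := [/\ tr0 l, coef_a N l \is a Num.int, coef_b N l \is a Num.int & coef_c l \is a Num.int].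
(** The l^1 length of the coordinates, used to measure lattice vectors. *)
Definition ell (l : M2) : R := `|ca l| + `|cb l| + `|cc l|.

Let Nq : N%:R != 0 :> rat. Proof. by rewrite pnatr_eq0 -lt0n. Qed.
Let Nr : N%:R != 0 :> R. Proof. by rewrite pnatr_eq0 -lt0n. Qed.
Let N2q : (2 * N)%:R != 0 :> rat. Proof. by rewrite pnatr_eq0 muln_eq0 -lt0n. Qed.

Lemma ord2P (i : 'I_2) : (i == 0) || (i == 1).
Proof. by case: i => -[|[|]]. Qed.

Lemma mx2_eq (T : Type) (A B : 'M[T]_2) : A 0 0 = B 0 0 -> A 0 1 = B 0 1 -> A 1 0 = B 1 0 -> A 1 1 = B 1 1 -> A = B.
Proof. by move=> *; apply/matrixP => i j; case/orP: (ord2P i) => /eqP ->; case/orP: (ord2P j) => /eqP ->. Qed.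

Lemma mx2E (T : Type) (a b c d : T) : [/\ mx2 a b c d 0 0 = a, mx2 a b c d 0 1 = b, mx2 a b c d 1 0 = c & mx2 a b c d 1 1 = d].
Proof. by split; rewrite mxE. Qed.

Lemma det_mx2 (F : comNzRingType) (A : 'M[F]_2) : \det A = A 0 0 * A 1 1 - A 0 1 * A 1 0.
Proof.
rewrite (expand_det_row _ 0) !big_ord_recl big_ord0 /= addr0 /cofactor !det_mx11 !mxE /=.
rewrite expr0 expr1 mul1r mulN1r mulrN.
congr (A _ _ * A _ _ - A _ _ * A _ _); exact/val_inj.
Qed.

Lemma tr_mx2 (F : comNzRingType) (A B : 'M[F]_2) : \tr (A *m B) = A 0 0 * B 0 0 + A 0 1 * B 1 0 + A 1 0 * B 0 1 + A 1 1 * B 1 1.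
Proof.
rewrite /mxtrace !big_ord_recl big_ord0 addr0 !mxE !big_ord_recl !big_ord0 !addr0 !addrA.
by congr (A _ _ * B _ _ + A _ _ * B _ _ + A _ _ * B _ _ + A _ _ * B _ _); exact/val_inj.
Qed.

Lemma coset_Lint r h (l : M2) : @lattice_coset N r h l -> Lint l.
Proof.
move=> [a [b [c e]]].
have E i j : l i j = (mx2 b%:~R (- a%:~R / N%:R) c%:~R (- b%:~R)) i j + r%:~R * rep h i j.
  by have /matrixP /(_ i j) := e; rewrite !mxE => <-; rewrite subrK.
have [m1 m2 m3 m4] := mx2E (b%:~R : rat) (- a%:~R / N%:R) c%:~R (- b%:~R).
have [r1 r2 r3 r4] := mx2E (h%:R / (2 * N)%:R : rat) 0 0 (- (h%:R / (2 * N)%:R)).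
split.
- by rewrite /tr0 !E m1 m4 /rep r1 r4; ring.
- rewrite /coef_a E m2 /rep r2 mulr0 addr0.
  by rewrite (_ : _ * _ = a%:~R) ?intr_int //; field.
- rewrite /coef_b E m1 /rep r1.
  have -> : (2 * N)%:R * (b%:~R + r%:~R * (h%:R / (2 * N)%:R)) = ((2 * N)%:Z * b + r * h%:Z)%:~R :> rat.
    by rewrite intrD !intrM -!pmulrn; field.
  exact: intr_int.
- by rewrite /coef_c E m3 /rep r3 mulr0 addr0 intr_int.
Qed.

Lemma p_zE (z : C) (l : M2) : tr0 l -> complex.Im z != 0 ->
  p_z N z l = pR N%:R (complex.Re z) (complex.Im z) (ca l) (cb l) (cc l).
Proof.
move=> t0 y0; rewrite /p_z /bil tr_mx2 /lambda_of.
have E i j : embed R l i j = ratr (l i j) by rewrite mxE.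
rewrite !E t0 rmorphN /=.
set x := complex.Re z; set y := complex.Im z in y0 *.
have s20 : Num.sqrt (2 * N)%:R != 0 :> R by rewrite gt_eqF // sqrtr_gt0 ltr0n muln_gt0.
have [m1 m2 m3 m4] := mx2E (- x) (x ^+ 2 + y ^+ 2) (-1) x.
rewrite !mxE /= /pR -natrM /ca /cb /cc /coef_a /coef_b /coef_c !rmorphM /= rmorphN /= !ratr_nat natrM.
by field; rewrite y0 -natrM s20.
Qed.

Lemma Q_E (l : M2) : tr0 l -> ratr (Q N l) = QR N%:R (ca l) (cb l) (cc l) :> R.
Proof.
move=> t0; rewrite /Q det_mx2 t0 /QR /ca /cb /cc /coef_a /coef_b /coef_c !(rmorphM, rmorphB, rmorphN) /= !ratr_nat.
by rewrite natrM; field.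
Qed.

Lemma ratrC (x : rat) : ratr x = (ratr x : R)%:C :> C.
Proof. by rewrite (fmorph_rat (real_complex R)). Qed.

Lemma q_zE (z : C) (l : M2) : q_z N z l = qC N%:R z (ca l) (cb l) (cc l).
Proof.
rewrite /q_z /qC -natrM /ca /cb /cc -!ratrC -(rmorph_nat (real_complex R)) rmorphV //.
by rewrite unitfE gt_eqF // sqrtr_gt0 ltr0n muln_gt0.
Qed.

Definition ofint (x : int * int * int) : M2 :=
  mx2 (x.1.2%:~R / (2 * N)%:R) (- x.1.1%:~R / N%:R) x.2%:~R (- (x.1.2%:~R / (2 * N)%:R)).

Lemma ofintE x : [/\ tr0 (ofint x), coef_a N (ofint x) = x.1.1%:~R, coef_b N (ofint x) = x.1.2%:~R & coef_c (ofint x) = x.2%:~R].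
Proof.
rewrite /tr0 /coef_a /coef_b /coef_c /ofint.
have [-> -> -> ->] := mx2E (x.1.2%:~R / (2 * N)%:R : rat) (- x.1.1%:~R / N%:R) x.2%:~R (- (x.1.2%:~R / (2 * N)%:R)).
by split=> //; field.
Qed.

Lemma ofint_inj : injective ofint.
Proof.
move=> [[a b] c] [[a' b'] c'] e.
have [_ h1 h2 h3] := ofintE (a, b, c); have [_ h1' h2' h3'] := ofintE (a', b', c').
move: h1 h2 h3; rewrite e h1' h2' h3' /= => /intr_inj -> /intr_inj -> /intr_inj -> //.
Qed.

Lemma coef_inj (l l' : M2) : tr0 l -> tr0 l' -> coef_a N l = coef_a N l' -> coef_b N l = coef_b N l' -> coef_c l = coef_c l' -> l = l'.
Proof.
move=> t t' /mulfI e1 /mulfI e2 e3.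
have {}e1 := e1 ltac:(by rewrite oppr_eq0); have {}e2 := e2 N2q.
by apply: mx2_eq => //; rewrite t t' e2.
Qed.

Lemma Lint_ofint (l : M2) : Lint l -> exists x, l = ofint x.
Proof.
move=> [t0 /intrP[a ha] /intrP[b hb] /intrP[c hc]]; exists (a, b, c).
by have [h0 h1 h2 h3] := ofintE (a, b, c); apply: coef_inj; rewrite ?h1 ?h2 ?h3.
Qed.

Lemma cabs_expR (x : R) : cabs (expR x)%:C = expR x.
Proof. by rewrite cabsC ger0_norm // expR_ge0. Qed.

(** Two geometric series. *)
Lemma absle_int (k : R) : 0 < k -> exists M, absle (fun n : int => (expR (- (k * `|n%:~R|)))%:C) M.
Proof.
move=> k0; pose q := expR (- k); have q0 : 0 <= q < 1 by rewrite expR_ge0 /= -expR0 ltr_expR oppr_lt0.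
pose M0 := (1 - q)^-1; exists (M0 + M0).
have hg := absle_geom q0.
have qn (n : nat) : expR (- (k * n%:R)) = q ^+ n by rewrite /q -expRM_natl mulrN mulrC.
pose phi (x : bool * nat) : int := if x.1 then Posz x.2 else Negz x.2.
apply: (@absle_inj _ _ _ phi).
- by move=> [[] m] [[] n] //= [->].
- by move=> [n|n] h; [case: (h (true, n))|case: (h (false, n))].
apply: (@absle_slices _ _ _ _ (fun=> M0)).
  have q00 : 0 <= q by case/andP: q0.
  have q1 : q <= 1 by case/andP: q0 => _ /ltW.
  move=> [] /=; apply: (absle_le hg) => // n; rewrite cabs_expR cabsC (ger0_norm (exprn_ge0 _ q00)) /phi /=.
    by rewrite -pmulrn ger0_norm // qn.
  rewrite NegzE mulrNz normrN -[n.+1%:~R]/(n.+1%:R) ger0_norm // qn exprS ler_piMl // exprn_ge0 //.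
have M00 : 0 <= M0 by apply: absle_ge0 hg.
move=> G; apply: (@le_trans _ _ (\sum_(i <- [fset true; false]%fset) M0)).
  by apply: (fsum_le (f := fun=> M0)) => //; apply/fsubsetP => -[] _; rewrite !inE.
by rewrite big_fsetU1 ?inE //= big_seq_fset1.
Qed.

Lemma absle_scaled_slices (I K : choiceType) (f : I -> R) (g : K -> R) A B : (forall i, 0 <= f i) -> (forall k, 0 <= g k) ->
  absle (fun i => (f i)%:C) A -> absle (fun k => (g k)%:C) B -> absle (fun x : I * K => (f x.1 * g x.2)%:C) (A * B).
Proof.
move=> f0 g0 hA hB; apply: (@absle_slices _ _ _ _ (fun i => f i * B)).
  move=> i /=; rewrite -[X in X * B]ger0_norm // -cabsC; apply: absle_le (absleZ _ hB) _ (lexx _) => k.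
  by rewrite rmorphM.
move=> G; rewrite -mulr_suml ler_wpM2r ?(absle_ge0 hB) //; apply: le_trans (hA G).
by apply: ler_sum => i _; rewrite cabsC ler_norm.
Qed.

(** Exponentials of the l^1 length factor over the three coordinates. *)
Lemma lattice_sum (k : R) : 0 < k -> exists M, absle (fun l : M2 => if `[< Lint l >] then (expR (- (k * ell l)))%:C else 0) M.
Proof.
move=> k0; have [M hM] := absle_int k0; exists (M * M * M).
apply: (@absle_inj _ _ _ ofint) => [||]; first exact: ofint_inj.
  by move=> l h; case: asboolP => // /Lint_ofint[x e]; case: (h x).
have e0 (n : int) : 0 <= expR (- (k * `|n%:~R|)) :> R by exact: expR_ge0.
have h2 := absle_scaled_slices e0 e0 hM hM.
have h3 := absle_scaled_slices _ e0 h2 hM.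
apply: absle_le (h3 _) _ (lexx _) => [x|x]; first by rewrite mulr_ge0.
have [t1 t2 t3 t4] := ofintE x.
rewrite asboolT; last by split=> //; rewrite ?t2 ?t3 ?t4 intr_int.
rewrite /ell /ca /cb /cc t2 t3 t4 !ratr_int -!expRD !cabs_expR.
by rewrite ler_expR; lra.
Qed.

Lemma absle_finite (I : choiceType) (a : I -> C) M e : absle a M -> 0 < e -> exists F0 : {fset I}, forall i, i \notin F0 -> cabs (a i) < e.
Proof.
move=> h e0; have [s hs] := absle_hasS h.
have e2 : 0 < e / 2 by rewrite divr_gt0.
have [F0 hF] := hs _ e2; exists F0 => i iF.
have := hF (i |` F0)%fset (fsubsetUr _ _); have := hF F0 (fsubset_refl _).
rewrite big_fsetU1 //=; set S := \sum_(_ <- _) _ => h1 h2.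
have -> : a i = (a i + S - s) - (S - s) by ring.
by rewrite (le_lt_trans (cabsD _ _)) // cabsN [e]splitr ltrD.
Qed.

(** A summable family has only finitely many terms above a given bound. *)
Lemma Lint_finite (B : R) : exists F : {fset M2}, forall l, Lint l -> ell l <= B -> l \in F.
Proof.
have [M hM] := lattice_sum (@ltr01 R).
have [F hF] := absle_finite hM (expR_gt0 (- B)); exists F => l hl hB.
apply: contraT => /hF; rewrite asboolT // cabsC ger0_norm ?expR_ge0 // ltr_expR mul1r ltrN2 ltNge hB //.
Qed.

End LAT.

(** * Limits and elementary estimates *)

Section PRE.
Variable R : realType.
Local Notation C := R[i].
Local Notation mu := (@lebesgue_measure R).
Local Notation mu2 := ((@lebesgue_measure R \x @lebesgue_measure R)%E : {measure set _ -> \bar R}).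

Lemma exp_pow_le (s : R) n : 0 <= s -> s ^+ n / n`!%:R <= expR s.
Proof.
move=> s0; have [_ b] := hasS_exp s; have := absle1 n b.
by rewrite cabsC !ger0_norm // divr_ge0 // exprn_ge0.
Qed.

(** s^n / n! <= exp(s) applied to s / 2: half of the exponential decay pays for the
    n-th term of the Taylor expansion of the theta kernel around z0, with a factor 2^(-n) to spare. *)
Lemma exp_pow_half (s : R) n : 0 <= s -> (s / 4) ^+ n / n`!%:R * expR (- s) <= (1 / 2) ^+ n * expR (- (s / 2)).
Proof.
move=> s0; have s20 : 0 <= s / 2 by rewrite divr_ge0.
have := exp_pow_le n s20.
have -> : expR (- s) = expR (- (s / 2)) * expR (- (s / 2)) by rewrite -expRD; congr expR; lra.
rewrite mulrA => h; rewrite ler_wpM2r ?expR_ge0 //.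
have -> : s / 4 = (1 / 2) * (s / 2) by field.
have h' : (s / 2) ^+ n / n`!%:R * expR (- (s / 2)) <= 1 by rewrite expRN ler_pdivrMr ?expR_gt0 // mul1r.
have -> : (1 / 2 * (s / 2)) ^+ n / n`!%:R * expR (- (s / 2)) = (1 / 2) ^+ n * ((s / 2) ^+ n / n`!%:R * expR (- (s / 2))).
  by rewrite exprMn; ring.
by rewrite ler_piMr ?exprn_ge0.
Qed.

(** Gaussian decay dominates polynomial growth. *)
Lemma poly_gauss (K b : R) k : 0 <= K -> 0 < b -> exists M, 0 <= M /\ forall l, 0 <= l -> (K * l) ^+ k * expR (- (b * l ^+ 2)) <= M * expR (- l).
Proof.
move=> K0 b0; exists (k`!%:R * expR ((K + 1) ^+ 2 / (4 * b))); split; first by rewrite mulr_ge0 ?expR_ge0.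
move=> l l0; have Kl : 0 <= K * l by rewrite mulr_ge0.
have h1 : (K * l) ^+ k <= k`!%:R * expR (K * l).
  by have := exp_pow_le k Kl; rewrite ler_pdivrMr ?ltr0n ?fact_gt0 // [leRHS]mulrC.
apply: le_trans (ler_wpM2r (expR_ge0 _) h1) _.
rewrite -!mulrA ler_wpM2l // -!expRD ler_expR -subr_ge0.
have -> : (K + 1) * ((K + 1) / (4 * b)) - l - (K * l - b * l ^+ 2) = ((K + 1) / (2 * b) - l) ^+ 2 * b by field; rewrite gt_eqF.
by rewrite mulr_ge0 ?sqr_ge0 // ltW.
Qed.

Lemma fsbig_fset (I : choiceType) (V : nmodType) (A : set I) (F : {fset I}) (f : I -> V) :
  (forall i, i \in F -> A i) -> (forall i, A i -> i \notin F -> f i = 0) -> \sum_(i \in A) f i = \sum_(i <- F) f i.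
Proof.
move=> h1 h2; rewrite -[in RHS](set_fsetK F) -fsbig_finite //.
by apply: esym; apply: fsbig_widen => [i /= /h1 //|i /= [Ai iF]]; apply: h2 => //; apply/negP.
Qed.

(** Limits as t tends to infinity, in terms of the real modulus. *)
Definition clim (g : R -> C) (L : C) : Prop := forall e, 0 < e -> exists T, forall t, T < t -> cabs (g t - L) < e.

Lemma clim_cvg g L : clim g L -> g t @[t --> +oo] --> L.
Proof.
move=> h; apply/cvgrPdist_lt => e e0.
have [e1 ee] : 0 < complex.Re e /\ e = (complex.Re e)%:C.
  by move: e0; case: (e) => x y; rewrite /= ltcE /= => /andP[/eqP -> ->].
have [T hT] := h _ e1; exists T; split; first exact: num_real.
by move=> t Tt; rewrite ee cabsE ltcR -cabsN opprB; exact: hT.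
Qed.

Lemma climD g g' L L' : clim g L -> clim g' L' -> clim (fun t => g t + g' t) (L + L').
Proof.
move=> h1 h2 e e0; have e2 : 0 < e / 2 by rewrite divr_gt0.
have [T1 hT1] := h1 _ e2; have [T2 hT2] := h2 _ e2; exists (Num.max T1 T2) => t.
rewrite gt_max => /andP[/hT1 a /hT2 b].
by rewrite opprD addrACA (le_lt_trans (cabsD _ _)) // [e]splitr ltrD.
Qed.

Lemma clim_cst x : clim (fun=> x) x.
Proof. by move=> e e0; exists 0 => t _; rewrite subrr cabs0. Qed.

Lemma climZ x g L : clim g L -> clim (fun t => x * g t) (x * L).
Proof.
move=> h e e0; have h0 : 0 < e / (cabs x + 1) by rewrite divr_gt0 // ltr_wpDl ?cabs_ge0.
have [T hT] := h _ h0; exists T => t /hT; rewrite ltr_pdivlMr ?ltr_wpDl ?cabs_ge0 // => hh.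
rewrite -mulrBr cabsM; apply: le_lt_trans hh; rewrite mulrC ler_wpM2l ?cabs_ge0 // lerDl //.
Qed.

Lemma clim_sum (J : Type) (s : seq J) (P : pred J) (g : J -> R -> C) (L : J -> C) : (forall j, P j -> clim (g j) (L j)) ->
  clim (fun t => \sum_(j <- s | P j) g j t) (\sum_(j <- s | P j) L j).
Proof.
move=> h; elim: s => [|j s IH].
  rewrite big_nil; have -> : (fun t => \sum_(j <- [::] | P j) g j t) = fun=> 0 by apply/funext => t; rewrite big_nil.
  exact: clim_cst.
have -> : (fun t => \sum_(j0 <- j :: s | P j0) g j0 t) = fun t => (if P j then g j t else 0) + \sum_(j0 <- s | P j0) g j0 t.
  by apply/funext => t; rewrite big_cons; case: (P j); rewrite ?add0r.
rewrite big_cons; case Pj: (P j); first by apply: climD => //; exact: h.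
rewrite -[X in clim _ X]add0r; apply: climD => //; exact: clim_cst.
Qed.

Lemma clim_eq g g' L T0 : (forall t, T0 < t -> g t = g' t) -> clim g L -> clim g' L.
Proof.
move=> h h1 e e0; have [T hT] := h1 _ e0; exists (Num.max T0 T) => t.
by rewrite gt_max => /andP[t1 t2]; rewrite -h //; exact: hT.
Qed.

Lemma clim_real (g : R -> R) (L : R) : g t @[t --> +oo] --> L -> clim (fun t => (g t)%:C) L%:C.
Proof.
move=> /cvgrPdist_lt h e e0; have [T [_ hT]] := h e e0; exists T => t /hT /=.
by rewrite -rmorphB cabsC distrC.
Qed.

Lemma clim_exp (e : R) (K : R) : 0 < e -> clim (fun t => (K * expR (- (e * t)))%:C) 0.
Proof.
move=> e0; have : K * expR (- (e * t)) @[t --> +oo] --> K * 0.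
  apply: cvgM; first exact: cvg_cst.
  apply: (cvg_comp (fun t => e * t) (fun x => expR (- x))); last exact: cvgr_expR.
  apply/cvgryPge => A; exists (A / e); split; first exact: num_real.
  by move=> t ht /=; rewrite mulrC -ler_pdivrMr // ltW.
rewrite mulr0 => /clim_real; exact.
Qed.

Lemma clim_squeeze (g : R -> C) (L : C) (b : R -> R) T0 : (forall t, T0 < t -> cabs (g t - L) <= b t) -> clim (fun t => (b t)%:C) 0 -> clim g L.
Proof.
move=> h hb e e0; have [T hT] := hb _ e0; exists (Num.max T0 T) => t.
rewrite gt_max => /andP[t1 t2]; apply: le_lt_trans (h t t1) _.
have := hT t t2; rewrite subr0 cabsC; apply: le_lt_trans; exact: ler_norm.
Qed.

(** Compactness of the rectangle. *)
Lemma cont_bounded (g : C -> C) (B : R) : (forall z, 0 < complex.Im z -> {for z, continuous g}) ->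
  exists M : R, 0 <= M /\ forall w : R * R, `|w.1| <= 1 / 2 -> 1 / 2 <= w.2 <= B -> cabs (g (w.1 +i* w.2)) <= M.
Proof.
move=> cg.
pose G (w : R * R) : R := cabs (g (w.1 +i* w.2)).
pose A : set (R * R) := `[- (1 / 2), 1 / 2] `*` `[1 / 2, B].
have cA : compact A by apply: compact_setX; exact: segment_compact.
have cG : {within A, continuous G}.
  apply: continuous_in_subspaceT => -[x y] /set_mem[/= hx]; rewrite in_itv /= => /andP[hy _].
  have y0 : 0 < complex.Im (x +i* y) by rewrite /=; lra.
  apply/cvgrPdist_lt => e e0; have /cvgrPdist_lt /(_ e%:C) H := cg _ y0.
  have /H /nbhsC_box[d d0 hd] : 0 < e%:C by rewrite ltcR.
  exists (ball x d, ball y d) => /=; first by split; exact: nbhsx_ballx.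
  move=> [x' y'] [/=]; rewrite -!ball_normE /= => h1 h2.
  have ex : x + (x' - x) = x' by rewrite addrC subrK.
  have ey : y + (y' - y) = y' by rewrite addrC subrK.
  have xd : `|x' - x| <= d by rewrite distrC ltW.
  have yd : `|y' - y| <= d by rewrite distrC ltW.
  have := hd _ _ xd yd; rewrite /= ex ey.
  rewrite cabsE ltcR; apply: le_lt_trans.
  rewrite /G /=; set a := g _; set b := g _.
  rewrite ler_norml; apply/andP; split.
    have := cabsD (b - a) a; rewrite subrK; have := cabsN (a - b); rewrite opprB; lra.
  by have := cabsD (a - b) b; rewrite subrK; lra.
have := continuous_compact cG cA => /compact_bounded[M [_ hM]].
exists (`|M| + 1); split; first by rewrite addr_ge0.
move=> w h1 h2.
have := hM (`|M| + 1); have -> : M < `|M| + 1 by rewrite (le_lt_trans (ler_norm _)) // ltrDl.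
move=> /(_ isT (G w)) /=; rewrite (ger0_norm (cabs_ge0 _)); apply.
by exists w => //; split; rewrite /= in_itv /= -?ler_norml.
Qed.

Lemma cmeas_fst (D : set (measurableTypeR R * measurableTypeR R)) (g : R -> R) : measurable_fun setT (g : measurableTypeR R -> R) -> measurable D -> measurable_fun D (fun w : R * R => g w.1).
Proof. move=> mg mD; apply: measurable_funTS; exact: (measurableT_comp mg measurable_fst). Qed.

Lemma cmeas_snd (D : set (measurableTypeR R * measurableTypeR R)) (g : R -> R) : measurable_fun setT (g : measurableTypeR R -> R) -> measurable D -> measurable_fun D (fun w : R * R => g w.2).
Proof. move=> mg mD; apply: measurable_funTS; exact: (measurableT_comp mg measurable_snd). Qed.

Lemma cmeas_ec (D : set (measurableTypeR R * measurableTypeR R)) (x : R) : measurable D -> cmeas D (fun w : R * R => ec (x * w.1)%:C).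
Proof.
move=> mD; have E : (fun w : R * R => ec (x * w.1)%:C) = (fun w => cos (2 * pi * x * w.1) +i* sin (2 * pi * x * w.1)).
  by apply/funext => w; rewrite ec_real !mulrA.
rewrite E; split => /=.
  by apply: (cmeas_fst (g := fun u => cos (2 * pi * x * u))) => //; apply: continuous_measurable_fun; exact: continuous_cosK.
by apply: (cmeas_fst (g := fun u => sin (2 * pi * x * u))) => //; apply: continuous_measurable_fun; exact: continuous_sinK.
Qed.

Lemma measurable_expK (a : R) : measurable_fun setT ((fun v : R => expR (a * v)) : measurableTypeR R -> R).
Proof.
apply: continuous_measurable_fun => v; apply: (@continuous_comp _ _ _ (fun u : R => a * u) expR); [exact: continuous_lin|exact: continuous_expR].
Qed.

Lemma measurable_invsqrt (D : set (measurableTypeR R * measurableTypeR R)) : measurable D -> (forall w, D w -> 0 < w.2) ->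
  measurable_fun D (fun w : R * R => (Num.sqrt w.2)^-1).
Proof.
move=> mD D0.
have m1 : measurable_fun D (fun w : R * R => w.2 `^ (- 2^-1)).
  by apply: (cmeas_snd (g := fun v => v `^ (- 2^-1))) => //; exact: measurable_powR.
apply: eq_measurable_fun m1 => w /set_mem /D0 w0.
by rewrite powRN powR12_sqrt // ltW.
Qed.

Lemma ec_split (x y : R) : ec (x +i* y) = (expR (- (2 * pi * y)))%:C * ec x%:C.
Proof. by rewrite ec_real /ec. Qed.

Lemma cabs_ec (x : R) : cabs (ec x%:C) = 1.
Proof. by rewrite ec_real /cabs normc_def /= cos2Dsin2 sqrtr1. Qed.

Lemma ecD (x y : R) : ec (x + y)%:C = ec x%:C * ec y%:C.
Proof.
rewrite !ec_real mulrDr; apply/eqP; rewrite eq_complex /= cosD sinD; apply/andP; split; apply/eqP; ring.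
Qed.

(** The weight v^(3/2) of the kernel against the measure du dv / v^2. *)
Lemma omegaE (v : R) : 0 < v -> v `^ (3 / 2) * v ^- 2 = (Num.sqrt v)^-1.
Proof.
move=> v0; have -> : 3 / 2 = 1 + 2^-1 :> R by field.
rewrite powRD; last by rewrite gt_eqF // implybT.
rewrite powRr1 ?(ltW v0) // powR12_sqrt ?(ltW v0) //.
have s0 : Num.sqrt v != 0 by rewrite gt_eqF // sqrtr_gt0.
rewrite -[X in X * _ * _](sqr_sqrtr (ltW v0)) -[X in _ / X ^+ 2](sqr_sqrtr (ltW v0)); field; exact: s0.
Qed.

Lemma kronecker_prime_bound (a : int) p : `|kronecker_prime a p| <= 1.
Proof. by rewrite /kronecker_prime; do !case: ifP => //. Qed.

Lemma kronecker_bound (a n : int) : `|kronecker a n| <= 1.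
Proof.
rewrite /kronecker; case: ifP => _; first by case: ifP.
rewrite normrM -[leRHS]mulr1 ler_pM //; first by case: ifP.
suff : 0 <= `|\prod_(p <- primes `|n|%N) kronecker_prime a p ^+ logn p `|n|%N| <= 1 by case/andP.
rewrite normr_prod; apply: (big_ind (fun x : int => 0 <= x <= 1)) => //.
  by move=> x y /andP[x0 x1] /andP[y0 y1]; rewrite mulr_ge0 //= -[leRHS]mulr1 ler_pM.
by move=> p _; rewrite normr_ge0 normrX exprn_ile1 // kronecker_prime_bound.
Qed.

Lemma genus_bound N Delta l : `|genus_character N Delta l| <= 1.
Proof. by rewrite /genus_character; case: ifP => // _; exact: kronecker_bound. Qed.

End PRE.

(** * The analytic part of the theta integral *)

Section LOC.
Variable R : realType.
Local Notation C := R[i].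
Local Notation mu := (@lebesgue_measure R).
Local Notation mu2 := ((@lebesgue_measure R \x @lebesgue_measure R)%E : {measure set _ -> \bar R}).
Local Notation pT := (measurableTypeR R * measurableTypeR R)%type.

Local Notation fundF := (@fundF R : set pT).
Section SETU.
Variables (D E : set pT) (mD : measurable D) (mE : measurable E).

Lemma cintbleS (g : pT -> C) : D `<=` E -> cintble mu2 E g -> cintble mu2 D g.
Proof. by move=> DE [h1 h2]; split; [apply: integrableS h1|apply: integrableS h2]. Qed.

Lemma cint_setU (g : pT -> C) : D `&` E = set0 -> cintble mu2 (D `|` E) g ->
  cint mu2 (D `|` E) g = cint mu2 D g + cint mu2 E g.
Proof.
move=> DE [h1 h2]; have dd : [disjoint D & E] by rewrite disj_set2E; apply/eqP.
rewrite /cint !Rintegral_setU //.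
Qed.
End SETU.

Lemma trunc_split (t : R) : fundF = ((@truncated_domain R t : set pT) `|` (fundF `&` [set w : R * R | t < w.2])).
Proof.
rewrite truncated_fundF; apply/seteqP; split => w /=.
  by move=> h; have [a|a] := leP w.2 t; [left|right].
by move=> [[]|[]].
Qed.

Lemma measurable_tail (t : R) : measurable ((fundF `&` [set w : R * R | t < w.2]) : set pT).
Proof.
have -> : (fundF `&` [set w : R * R | t < w.2] : set pT) = fundF `\` truncated_domain t.
  rewrite truncated_fundF; apply/seteqP; split => w /=.
    by move=> [h a]; split => // -[_]; rewrite leNgt a.
  by move=> [h a]; split => //; rewrite ltNge; apply/negP => b; apply: a.
by apply: measurableD; [exact: measurable_fundF|exact: measurable_truncated].
Qed.

(** Exponential decay in v makes the integral over the truncated domain converge to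
    the integral over the whole fundamental domain. *)
Lemma clim_trunc (g : pT -> C) (e M : R) : 0 < e -> cintble mu2 fundF g -> (forall w, fundF w -> cabs (g w) <= M * expR (- (e * w.2))) ->
  clim (fun t => cint mu2 (@truncated_domain R t : set pT) g) (cint mu2 fundF g).
Proof.
move=> e0 ig bg.
have e2 : 0 < e / 2 by rewrite divr_gt0.
have iw := integrable_expF e2.
pose I := \int[mu2]_(w in fundF) expR (- (e / 2 * w.2)).
have M0 : 0 <= M.
  have /bg : fundF ((0, 1) : R * R) by split => /=; rewrite ?normr0 ?expr0n ?expr1n ?add0r // divr_ge0.
  by move=> /(le_trans (cabs_ge0 _)); rewrite pmulr_lge0 // expR_gt0.
apply: (@clim_squeeze R _ _ (fun t => 2 * M * I * expR (- (e / 2 * t))) 0); last exact: clim_exp.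
move=> t t0.
have sF : (fundF `&` [set w : R * R | t < w.2]) `<=` fundF by move=> w [].
have tF : (@truncated_domain R t : set pT) `<=` fundF by rewrite truncated_fundF => w [].
have := ig; rewrite {1}(trunc_split t) => ig'.
rewrite [in X in _ - X](trunc_split t) cint_setU //; first last.
- by rewrite truncated_fundF; apply/seteqP; split => // w [[_ /= a] [_ /=]]; rewrite ltNge a.
- exact: measurable_tail.
- exact: measurable_truncated.
rewrite opprD addNKr cabsN.
have mF : measurable fundF := @measurable_fundF R.
have iw2 : mu2.-integrable fundF (EFin \o (fun w : pT => M * expR (- (e / 2 * t)) * expR (- (e / 2 * w.2)))).
  by have := integrableZl mF (M * expR (- (e / 2 * t))) iw; apply: eq_integrable.
apply: le_trans (cint_bound (measurable_tail t) (cintbleS (measurable_tail t) mF sF ig) (integrableS mF (measurable_tail t) sF iw2) _) _.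
  move=> w [/bg h /= tw]; apply: le_trans h _; rewrite -mulrA ler_wpM2l // -expRD ler_expR.
  rewrite -opprD lerN2 -mulrDr; have -> : e * w.2 = e / 2 * (w.2 + w.2) by field.
  by rewrite ler_wpM2l ?(ltW e2) // lerD2r ltW.
have -> : 2 * M * I * expR (- (e / 2 * t)) = 2 * (M * expR (- (e / 2 * t)) * I) by ring.
rewrite ler_wpM2l //.
rewrite /I -RintegralZl // [in leRHS](trunc_split t) Rintegral_setU //.
- by rewrite lerDr; apply: Rintegral_ge0 => w _; rewrite !mulr_ge0 ?expR_ge0.
- exact: measurable_truncated.
- exact: measurable_tail.
- by rewrite -trunc_split.
- by rewrite disj_set2E truncated_fundF; apply/eqP/seteqP; split => // w [[_ /= a] [_ /=]]; rewrite ltNge a.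
Qed.

(** The value of a sum, as a total function. *)
Definition Ssum (I : choiceType) (a : I -> C) : C := xget 0 [set s | hasS a s].
Lemma SsumP (I : choiceType) (a : I -> C) s : hasS a s -> hasS a (Ssum a).
Proof. by move=> h; rewrite /Ssum; case: xgetP => [y -> //|/(_ s)]. Qed.

Lemma Ssum_eq (I : choiceType) (a : I -> C) s : hasS a s -> Ssum a = s.
Proof. by move=> h; exact: (hasS_uniq (SsumP h) h). Qed.

Lemma hasS_sum (I : choiceType) (a : I -> C) (x s : C) : hasS (fun i => x * a i) s -> s = x * summability.sum a.
Proof.
move=> h; have [x0|x0] := eqVneq x 0.
  by rewrite x0 mul0r; apply: hasS_uniq h _; apply: hasS_ext (@hasS0 R I) => i; rewrite x0 mul0r.
have ha : hasS a (x^-1 * s) by apply: hasS_ext (hasSZ x^-1 h) => i; rewrite mulKf.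
have PF := @summability.totally_filter I.
suff -> : summability.sum a = x^-1 * s by rewrite mulVKf.
by apply: cvg_lim => //; apply/hasS_cvg.
Qed.

Section MAIN.
Variables (N : nat) (hN : (0 < N)%N) (D : R) (D0 : 0 < D) (k' : nat).
Variables (x0 y0 : R) (y00 : 0 < y0).
Variable chi : 'M[rat]_2 -> C.
Hypothesis chiL : forall l, chi l != 0 -> Lint N l.
Hypothesis chi1 : forall l, cabs (chi l) <= 1.
Local Notation M2 := 'M[rat]_2.

Let al := 2 * pi / D.
Let al0 : 0 < al. Proof. by rewrite divr_gt0 // mulr_gt0 // pi_gt0. Qed.

(** Q(lambda); then, at the point (x0 + X) + i (y0 + Y): lpz is p_z, lqz is
    q_z, and lq0 is the majorant Q_z at the centre X = Y = 0. *)
Definition lql (l : M2) : R := QR N%:R (ca R N l) (cb R N l) (cc R l).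
Definition lpz (X Y : R) (l : M2) : R := pR N%:R (x0 + X) (y0 + Y) (ca R N l) (cb R N l) (cc R l).
Definition lqz (X Y : R) (l : M2) : C := qC N%:R ((x0 + X) +i* (y0 + Y)) (ca R N l) (cb R N l) (cc R l).
Definition lq0 (l : M2) : R := lql l + lpz 0 0 l ^+ 2.
(** The term of the theta kernel at lambda, without the power of v. *)
Definition Tl (X Y : R) (w : pT) (l : M2) : C :=
  chi l * (lpz X Y l)%:C * lqz X Y l ^+ k' * ec ((lql l / D * w.1) +i* ((lql l + lpz X Y l ^+ 2) / D * w.2)).
(** The n-th term of the Taylor expansion of the kernel in the variation
    p_z^2 - p_z0^2 of the majorant is the product lE * lW. All dependence on z is
    in lW, which is a polynomial in functions with known power series, and all
    dependence on tau is in lE. *)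
Definition lW (X Y : R) (ln : M2 * nat) : C :=
  chi ln.1 * (lpz X Y ln.1)%:C * lqz X Y ln.1 ^+ k' * ((lpz X Y ln.1 ^+ 2 - lpz 0 0 ln.1 ^+ 2) ^+ ln.2)%:C.
Definition lE (w : pT) (ln : M2 * nat) : C :=
  ((Num.sqrt w.2)^-1 * ((- (al * w.2)) ^+ ln.2 / (ln.2)`!%:R * expR (- (al * w.2 * lq0 ln.1))))%:C * ec (lql ln.1 / D * w.1)%:C.

Lemma term_series X Y w l : hasS (fun n => lE w (l, n) * lW X Y (l, n)) ((Num.sqrt w.2)^-1%:C * Tl X Y w l).
Proof.
have [h _] := hasS_exp (- (al * w.2) * (lpz X Y l ^+ 2 - lpz 0 0 l ^+ 2)).
have := hasSZ ((Num.sqrt w.2)^-1%:C * (chi l * (lpz X Y l)%:C * lqz X Y l ^+ k') * (expR (- (al * w.2 * lq0 l)))%:C * ec (lql l / D * w.1)%:C) h.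
have -> : (Num.sqrt w.2)^-1%:C * (chi l * (lpz X Y l)%:C * lqz X Y l ^+ k') * (expR (- (al * w.2 * lq0 l)))%:C * ec (lql l / D * w.1)%:C *
   (expR (- (al * w.2) * (lpz X Y l ^+ 2 - lpz 0 0 l ^+ 2)))%:C = (Num.sqrt w.2)^-1%:C * Tl X Y w l.
  rewrite /Tl [ec (_ +i* (_ * w.2))]ec_split.
  have -> : expR (- (2 * pi * ((lql l + lpz X Y l ^+ 2) / D * w.2))) = expR (- (al * w.2 * lq0 l)) * expR (- (al * w.2) * (lpz X Y l ^+ 2 - lpz 0 0 l ^+ 2)).
    rewrite -expRD; congr expR; rewrite /al /lq0; field; exact: lt0r_neq0.
  by rewrite rmorphM /=; ring.
apply: hasS_ext => n; rewrite /lE /lW /= [(_ * (lpz X Y l ^+ 2 - _)) ^+ n]exprMn.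
set q := lqz X Y l ^+ k'; set E := ec _; rewrite !rmorphM /=; ring.
Qed.

Lemma cmeas_lE (ln : M2 * nat) : cmeas fundF (fun w => lE w ln).
Proof.
have mF : measurable fundF := @measurable_fundF R.
apply: cmeasM => //; last by apply: cmeas_ec.
apply: cmeas_real; apply: measurable_funM; first by apply: measurable_invsqrt => // w [].
apply: (cmeas_snd (g := fun v => (- (al * v)) ^+ ln.2 / (ln.2)`!%:R * expR (- (al * v * lq0 ln.1)))) => //.
apply: measurable_funM.
  apply: measurable_funM; last exact: measurable_cst.
  apply: measurable_funX; apply: (@eq_measurable_fun _ _ _ _ setT (fun v : measurableTypeR R => - al * v)) => [v _|]; first by rewrite mulNr.
  by apply: continuous_measurable_fun; exact: continuous_lin.
apply: (@eq_measurable_fun _ _ _ _ setT (fun v : measurableTypeR R => expR (- (al * lq0 ln.1) * v))) => [v _|]; last exact: measurable_expK.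
by congr expR; ring.
Qed.

Variables (ka K r e A : R).
Hypotheses (ka0 : 0 < ka) (K0 : 0 <= K) (r0 : 0 < r) (e0 : 0 < e) (A0 : 0 <= A).
Hypothesis hka : forall l, ka * ell R N l ^+ 2 <= lq0 l.
Hypothesis hK : forall l, [/\ AN r (lq0 l / 4) (fun X Y => (lpz X Y l ^+ 2 - lpz 0 0 l ^+ 2)%:C),
      AN r (K * ell R N l) (fun X Y => (lpz X Y l)%:C) & AN r (K * ell R N l) (fun X Y => lqz X Y l)].
Variable psi : M2 -> pT -> C.
Hypothesis mpsi : forall l, cmeas fundF (psi l).
Hypothesis bpsi : forall l w, Lint N l -> fundF w -> cabs (psi l w) * expR (- (al * w.2 * lq0 l / 4)) <= A * expR (- (e * w.2)).

Let lq00 l : 0 <= lq0 l.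
Proof. by apply: le_trans (hka l); rewrite mulr_ge0 ?sqr_ge0 // ltW. Qed.
Let ell0 l : 0 <= ell R N l.
Proof. by rewrite /ell !addr_ge0 // normr_ge0. Qed.

(** A bound for lW as a power series: the variation of the majorant is at most a quarter of its
    value lq0. *)
Definition mW (ln : M2 * nat) : R := (K * ell R N ln.1) ^+ k'.+1 * (lq0 ln.1 / 4) ^+ ln.2.

Lemma AN_lW ln : AN r (mW ln) (fun X Y => lW X Y ln).
Proof.
have [h1 h2 h3] := hK ln.1.
have h : AN r (K * ell R N ln.1 * (K * ell R N ln.1) ^+ k' * (lq0 ln.1 / 4) ^+ ln.2)
   (fun X Y => (lpz X Y ln.1)%:C * lqz X Y ln.1 ^+ k' * (lpz X Y ln.1 ^+ 2 - lpz 0 0 ln.1 ^+ 2)%:C ^+ ln.2).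
  by apply: AN_M => //; [apply: AN_M => //; exact: AN_exp|exact: AN_exp].
have := AN_Z (chi ln.1) h => h'.
have : AN r (cabs (chi ln.1) * (K * ell R N ln.1 * (K * ell R N ln.1) ^+ k' * (lq0 ln.1 / 4) ^+ ln.2)) (fun X Y => lW X Y ln).
  by apply: AN_ext h' => X Y _ _; rewrite /lW !mulrA rmorphXn.
apply: AN_le; rewrite /mW exprS -[leRHS]mul1r ler_wpM2r //.
by rewrite !mulr_ge0 ?exprn_ge0 ?mulr_ge0 ?invr_ge0.
Qed.

Lemma mW_ge0 ln : 0 <= mW ln.
Proof. by rewrite /mW mulr_ge0 // exprn_ge0 ?mulr_ge0 ?invr_ge0. Qed.

(** The hypothesis on psi uses a quarter of the Gaussian decay exp(-al v lq0); another
    quarter pays for the factor p q^(k-1), and the last half for the Taylor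
    expansion in the variation of the majorant. *)
Lemma term_majorant : exists (B : M2 * nat -> R) (M : R), [/\ forall ln, 0 <= B ln, absle (fun ln => (B ln)%:C) M &
  forall ln w, Lint N ln.1 -> fundF w -> cabs (psi ln.1 w * lE w ln) * mW ln <= B ln * expR (- (e * w.2))].
Proof.
have b0 : 0 < al * ka / 8 by rewrite divr_gt0 // mulr_gt0.
have [M1 [M10 hM1]] := poly_gauss k'.+1 K0 b0.
have [M2' hM2] := @lattice_sum R N hN 1 ltr01.
pose f (l : M2) := if `[< Lint N l >] then expR (- ell R N l) else 0.
have f0 l : 0 <= f l by rewrite /f; case: ifP; rewrite ?expR_ge0.
have hf : absle (fun l => (f l)%:C) M2'.
  by apply: absle_le hM2 _ (lexx _) => l; rewrite /f; case: ifP => // _; rewrite mul1r.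
have h12 : 0 <= (1 / 2 : R) < 1 by rewrite divr_ge0 // ltr_pdivrMr // mul1r (ltr_nat R 1 2).
have hs := absle_scaled_slices f0 (fun n => exprn_ge0 n (proj1 (andP h12))) hf (absle_geom h12).
have hB := absleZ (2 * A * M1)%:C hs.
exists (fun ln => 2 * A * M1 * (f ln.1 * (1 / 2) ^+ ln.2)), (cabs (2 * A * M1)%:C * (M2' * (1 - 1 / 2)^-1)); split.
- by move=> ln; rewrite !mulr_ge0 ?exprn_ge0 ?invr_ge0.
- by apply: absle_le hB _ (lexx _) => ln; rewrite -rmorphM.
move=> [l n] w /= Ll Fw; have w12 := fundF_ge Fw.
have w0 : 0 < w.2 by case: Fw.
have [s0 q0] : 0 <= al * w.2 * lq0 l /\ 0 <= lq0 l by split => //; apply: mulr_ge0 => //; apply: mulr_ge0; exact: ltW.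
rewrite /lE /= cabsM [cabs (_ * ec _)]cabsM cabs_ec mulr1 cabsC.
have -> : `|(Num.sqrt w.2)^-1 * ((- (al * w.2)) ^+ n / n`!%:R * expR (- (al * w.2 * lq0 l)))| =
   (Num.sqrt w.2)^-1 * ((al * w.2) ^+ n / n`!%:R * expR (- (al * w.2 * lq0 l))).
  rewrite !normrM normrX normrN (gtr0_norm (expR_gt0 _)) !ger0_norm //; last by rewrite mulr_ge0 // ltW.
have h1 : (Num.sqrt w.2)^-1 <= 2.
  have s1 : 1 / 2 <= Num.sqrt w.2.
    rewrite -[leLHS]ger0_norm ?divr_ge0 // -sqrtr_sqr ler_sqrt ?(ltW w0) //; lra.
  rewrite invf_ple ?posrE ?sqrtr_gt0 //; lra.
have h2 : (al * w.2) ^+ n / n`!%:R * expR (- (al * w.2 * lq0 l)) * (lq0 l / 4) ^+ n <= (1 / 2) ^+ n * expR (- (al * w.2 * lq0 l / 2)).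
  have := exp_pow_half n s0; apply: le_trans; rewrite le_eqVlt; apply/orP; left; apply/eqP.
  have -> : al * w.2 * lq0 l / 4 = (al * w.2) * (lq0 l / 4) by ring.
  set a := al * w.2; set b := lq0 l / 4; rewrite (_ : (a * b) ^+ n = a ^+ n * b ^+ n); last exact: exprMn.
  set E := expR _; set an := a ^+ n; set bn := b ^+ n; ring.
have h3 : (K * ell R N l) ^+ k'.+1 * expR (- (al * w.2 * lq0 l / 4)) <= M1 * expR (- ell R N l).
  apply: le_trans (hM1 _ (ell0 l)); rewrite ler_wpM2l ?exprn_ge0 ?mulr_ge0 // ler_expR lerN2.
  have -> : al * ka / 8 * ell R N l ^+ 2 = al / 8 * (ka * ell R N l ^+ 2) by ring.
  apply: (@le_trans _ _ (al / 8 * lq0 l)); first by rewrite ler_wpM2l // divr_ge0 // ltW.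
  have -> : al * w.2 * lq0 l / 4 = (w.2 / 4) * (al * lq0 l) by ring.
  have -> : al / 8 * lq0 l = 1 / 8 * (al * lq0 l) by ring.
  apply: ler_wpM2r; first by apply: mulr_ge0 => //; exact: ltW.
  by move: (w.2 : R) w12 => v v12; lra.
have h4 := bpsi Ll Fw.
rewrite /f asboolT // /mW /=.
have hE : expR (- (al * w.2 * lq0 l / 2)) = expR (- (al * w.2 * lq0 l / 4)) * expR (- (al * w.2 * lq0 l / 4)).
  by rewrite -expRD; congr expR; field.
have -> : cabs (psi l w) * ((Num.sqrt w.2)^-1 * ((al * w.2) ^+ n / n`!%:R * expR (- (al * w.2 * lq0 l)))) * ((K * ell R N l) ^+ k'.+1 * (lq0 l / 4) ^+ n)
  = (Num.sqrt w.2)^-1 * cabs (psi l w) * (K * ell R N l) ^+ k'.+1 * ((al * w.2) ^+ n / n`!%:R * expR (- (al * w.2 * lq0 l)) * (lq0 l / 4) ^+ n).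
  by ring.
have -> : 2 * A * M1 * (expR (- ell R N l) * (1 / 2) ^+ n) * expR (- (e * w.2)) =
  2 * ((A * expR (- (e * w.2))) * (M1 * expR (- ell R N l))) * (1 / 2) ^+ n by ring.
apply: (@le_trans _ _ ((Num.sqrt w.2)^-1 * cabs (psi l w) * (K * ell R N l) ^+ k'.+1 * ((1 / 2) ^+ n * expR (- (al * w.2 * lq0 l / 2))))).
  by rewrite ler_wpM2l // !mulr_ge0 ?cabs_ge0 ?exprn_ge0 ?mulr_ge0 // invr_ge0.
rewrite hE.
have -> : (Num.sqrt w.2)^-1 * cabs (psi l w) * (K * ell R N l) ^+ k'.+1 * ((1 / 2) ^+ n * (expR (- (al * w.2 * lq0 l / 4)) * expR (- (al * w.2 * lq0 l / 4))))
 = (Num.sqrt w.2)^-1 * ((cabs (psi l w) * expR (- (al * w.2 * lq0 l / 4))) * ((K * ell R N l) ^+ k'.+1 * expR (- (al * w.2 * lq0 l / 4)))) * (1 / 2) ^+ n.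
  by ring.
rewrite ler_wpM2r ?exprn_ge0 ?(proj1 (andP h12)) //.
by rewrite ler_pM // ?mulr_ge0 ?cabs_ge0 ?expR_ge0 ?exprn_ge0 ?mulr_ge0 ?invr_ge0 ?sqrtr_ge0 // ler_pM ?mulr_ge0 ?cabs_ge0 ?expR_ge0 ?exprn_ge0 ?mulr_ge0.
Qed.

(** The theta kernel paired with coefficients psi that may depend on lambda. *)
Definition Psi (X Y : R) (w : pT) : C := Ssum (fun l => psi l w * ((Num.sqrt w.2)^-1%:C * Tl X Y w l)).

(** The double series over lambda and the Taylor index can be integrated term by
    term, and each integral is a constant times a power series in X, Y with
    summable bounds. *)
Lemma smooth_part : exists M M', AN r M (fun X Y => cint mu2 fundF (Psi X Y)) /\
  forall X Y, `|X| <= r -> `|Y| <= r -> [/\ cintble mu2 fundF (Psi X Y),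
     forall w, fundF w -> cabs (Psi X Y w) <= M' * expR (- (e * w.2)) &
     forall w, fundF w -> hasS (fun l => psi l w * ((Num.sqrt w.2)^-1%:C * Tl X Y w l)) (Psi X Y w)].
Proof.
have [B [M [B0 hB bB]]] := term_majorant.
have mF : measurable fundF := @measurable_fundF R.
have iw := integrable_expF e0.
pose phi (ln : M2 * nat) w := psi ln.1 w * lE w ln.
have mphi ln : cmeas fundF (phi ln) by apply: cmeasM => //; exact: cmeas_lE.
have z0 ln X Y : ~ Lint N ln.1 -> lW X Y ln = 0.
  move=> nL; have /eqP E0 : chi ln.1 == 0 by apply/negPn/negP => /chiL.
  by rewrite /lW E0 !mul0r.
pose phi' ln w := if `[< Lint N ln.1 >] then phi ln w else 0.
have mphi' ln : cmeas fundF (phi' ln) by rewrite /phi'; case: (asboolP (Lint N ln.1)) => _ //; exact: cmeas_cst.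
have bp ln w X Y : `|X| <= r -> `|Y| <= r -> fundF w -> cabs (phi' ln w * lW X Y ln) <= B ln * expR (- (e * w.2)).
  move=> hX hY Fw; rewrite /phi'; case: asboolP => Ll; last by rewrite mul0r cabs0 mulr_ge0 ?expR_ge0.
  apply: le_trans (bB _ _ Ll Fw); rewrite cabsM ler_wpM2l ?cabs_ge0 //; exact: AN_bound (AN_lW ln) hX hY.
have hs X Y w : `|X| <= r -> `|Y| <= r -> fundF w ->
   hasS (fun ln => phi' ln w * lW X Y ln) (Psi X Y w) /\ hasS (fun l => psi l w * ((Num.sqrt w.2)^-1%:C * Tl X Y w l)) (Psi X Y w).
  move=> hX hY Fw.
  have [s hs] : exists s, hasS (fun ln => phi' ln w * lW X Y ln) s.
    apply: absle_hasS; apply: (absle_B_le (expR_ge0 _) B0 hB) => ln; exact: bp.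
  have hl l : hasS (fun n => phi' (l, n) w * lW X Y (l, n)) (psi l w * ((Num.sqrt w.2)^-1%:C * Tl X Y w l)).
    apply: hasS_ext (hasSZ (psi l w) (term_series X Y w l)) => n.
    rewrite /phi' /phi /=; case: asboolP => Ll; first by rewrite mulrA.
    by rewrite mul0r z0 // !mulr0.
  have hp := hasS_pair hl hs.
  by rewrite /Psi (Ssum_eq hp).
exists (2 * \int[mu2]_(w in fundF) expR (- (e * w.2)) * M), M.
have hI X Y : `|X| <= r -> `|Y| <= r -> [/\ cintble mu2 fundF (Psi X Y),
     forall w, fundF w -> cabs (Psi X Y w) <= M * expR (- (e * w.2)) & hasS (fun ln => cint mu2 fundF (fun w => phi' ln w * lW X Y ln)) (cint mu2 fundF (Psi X Y))].
  move=> hX hY; apply: (@cint_infsum R _ _ mu2 _ mF _ B M (fun ln w => phi' ln w * lW X Y ln) _ (fun w => expR (- (e * w.2)))) => //.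
  - by move=> ln; apply: cmeasM => //; exact: cmeas_cst.
  - by move=> ln w Fw; exact: bp.
  - by move=> w Fw; have [] := hs X Y w hX hY Fw.
have ip ln : cintble mu2 fundF (phi' ln) \/ mW ln = 0.
  have [m0|m0] := eqVneq (mW ln) 0; [by right|left].
  apply: (@dom_cintble R _ _ mu2 _ mF _ (fun w => B ln / mW ln * expR (- (e * w.2)))) => //.
    by have := integrableZl mF (B ln / mW ln) iw; apply: eq_integrable.
  move=> w Fw; have mp : 0 < mW ln by rewrite lt0r m0 mW_ge0.
  rewrite mulrAC ler_pdivlMr // /phi'; case: asboolP => Ll; first exact: bB.
  by rewrite cabs0 mul0r mulr_ge0 ?expR_ge0.
split; last first.
  by move=> X Y hX hY; have [h1 h2 _] := hI X Y hX hY; split => // w Fw; have [] := hs X Y w hX hY Fw.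
apply: (@AN_infsum R _ r _ (fun ln => 2 * \int[mu2]_(w in fundF) expR (- (e * w.2)) * B ln) (fun ln X Y => cint mu2 fundF (fun w => phi' ln w * lW X Y ln))) => //.
- move=> ln; have [ii|m0] := ip ln; last first.
    apply: (@AN_ext R r _ (fun _ _ => 0)).
      move=> X Y hX hY; have w0 : lW X Y ln = 0.
        apply/eqP; rewrite -cabs_eq0 eq_le cabs_ge0 andbT -m0; exact: AN_bound (AN_lW ln) hX hY.
      rewrite w0; apply: esym; transitivity (cint mu2 fundF (fun=> 0)); first by apply: eq_cint => w _; rewrite mulr0.
      by rewrite /cint /= Rintegral_cst // mul0r.
    apply: AN_le (AN_cst r 0); rewrite cabs0 !mulr_ge0 //.
    by apply: Rintegral_ge0 => w _; exact: expR_ge0.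
  have hb : mW ln * cabs (cint mu2 fundF (phi' ln)) <= 2 * \int[mu2]_(w in fundF) expR (- (e * w.2)) * B ln.
    have -> : mW ln * cabs (cint mu2 fundF (phi' ln)) = cabs (cint mu2 fundF (fun w => (mW ln)%:C * phi' ln w)).
      by rewrite (cintZ mF) // cabsM cabsC ger0_norm ?mW_ge0.
    have iw2 : mu2.-integrable fundF (EFin \o (fun w : pT => B ln * expR (- (e * w.2)))).
      by have := integrableZl mF (B ln) iw; apply: eq_integrable.
    apply: le_trans (cint_bound mF (cintbleZ mF (mW ln)%:C ii) iw2 _) _.
      move=> w Fw; rewrite cabsM cabsC (ger0_norm (mW_ge0 _)) mulrC /phi'; case: asboolP => Ll; first exact: bB.
      by rewrite cabs0 mul0r mulr_ge0 ?expR_ge0.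
    by rewrite RintegralZl // -mulrA [B ln * _]mulrC.
  apply: AN_le hb _; rewrite mulrC.
  apply: AN_ext (AN_Z (cint mu2 fundF (phi' ln)) (AN_lW ln)) => X Y _ _ /=.
  rewrite mulrC -(cintZ mF) //; apply: eq_cint => w _; exact: mulrC.
- move=> F; rewrite -mulr_sumr; apply: ler_wpM2l; first by rewrite mulr_ge0 //; apply: Rintegral_ge0 => w _; exact: expR_ge0.
  by have := hB F; under eq_bigr do rewrite cabsC ger0_norm //.
- by move=> X Y hX hY; have [_ _] := hI X Y hX hY.
Qed.

End MAIN.

End LOC.

(** * Local form of one component of the lift *)

Section LOCAL.
Variable R : realType.
Local Notation C := R[i].
Local Notation mu := (@lebesgue_measure R).
Local Notation mu2 := ((@lebesgue_measure R \x @lebesgue_measure R)%E : {measure set _ -> \bar R}).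
Local Notation pT := (measurableTypeR R * measurableTypeR R)%type.
Local Notation fundF := (@fundF R : set pT).
Local Notation M2 := 'M[rat]_2.

Lemma integrable_if (D E : set pT) (h : pT -> R) : measurable D -> measurable (D `&` E) -> mu2.-integrable (D `&` E) (EFin \o h) ->
  mu2.-integrable D (EFin \o (fun w => if w \in E then h w else 0)) /\
  \int[mu2]_(w in D) (if w \in E then h w else 0) = \int[mu2]_(w in D `&` E) h w.
Proof.
move=> mD mDE ih; split; last by rewrite Rintegral_mkcondr; apply: eq_Rintegral => w _; rewrite patchE.
apply/(integrable_mkcond _ mD); move: ih => /(integrable_mkcond _ mDE); congr (_.-integrable _ _).
apply/funext => w; rewrite !patchE in_setI; by case: (w \in D) => //=; case: (w \in E).
Qed.

Lemma cint_if (D E : set pT) (h : pT -> C) : measurable D -> measurable (D `&` E) -> cintble mu2 (D `&` E) h ->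
  cintble mu2 D (fun w => if w \in E then h w else 0) /\
  cint mu2 D (fun w => if w \in E then h w else 0) = cint mu2 (D `&` E) h.
Proof.
move=> mD mDE [h1 h2].
have [i1 e1] := integrable_if mD mDE h1; have [i2 e2] := integrable_if mD mDE h2.
have R1 : (fun w => complex.Re (if w \in E then h w else 0)) = (fun w => if w \in E then complex.Re (h w) else 0).
  by apply/funext => w; case: ifP.
have R2 : (fun w => complex.Im (if w \in E then h w else 0)) = (fun w => if w \in E then complex.Im (h w) else 0).
  by apply/funext => w; case: ifP.
by rewrite /cintble /cint R1 R2 e1 e2.
Qed.

(** When n = 0 the extra factor exp(-2 pi n v) is 1; when n is not 0 the
    integral over u vanishes. *)
Lemma strip_term_exp (n : int) (alpha p t : R) : 0 < alpha -> 1 < t ->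
  let g (w : pT) : C := ec (n%:~R * w.1)%:C * (expR (- (2 * pi * n%:~R * w.2)) * (p * ((Num.sqrt w.2)^-1 * expR (- (alpha * p ^+ 2 * w.2)))))%:C in
  cintble mu2 (strip t : set pT) g /\
  cint mu2 (strip t : set pT) g = (n == 0)%:R * (Jint alpha p t)%:C.
Proof.
move=> a0 t1 g; have [n0|n0] := eqVneq n 0.
  have [h1 h2] := strip_term n p a0 t1; rewrite n0 eqxx in h2 *.
  have E w : ec (n%:~R * w.1)%:C * (p * ((Num.sqrt w.2)^-1 * expR (- (alpha * p ^+ 2 * w.2))))%:C = g w.
    by rewrite /g n0 mulr0 mul0r oppr0 expR0 mul1r.
  split; first by apply: (eq_cintble _ _ h1) => [|w _]; [exact: measurable_strip|exact: E].
  by rewrite -h2; apply: eq_cint => w _; rewrite -E n0.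
have mI : measurable (`[- (1 / 2), 1 / 2] : set (measurableTypeR R)) by [].
have mB : measurable (`]1, t] : set (measurableTypeR R)) by [].
pose b v : R := expR (- (2 * pi * n%:~R * v)) * (p * ((Num.sqrt v)^-1 * expR (- (alpha * p ^+ 2 * v)))).
have ib : mu.-integrable (`]1, t] : set (measurableTypeR R)) (EFin \o b).
  have [ih _] := Jint_subst p a0 t1.
  apply: (@dom_integrable R _ _ mu _ mB _ (fun v => expR (2 * pi * `|n%:~R| * t) * `|p|)) => //.
  - apply: measurable_funM.
      apply: measurable_funTS; apply: (@eq_measurable_fun _ _ _ _ setT (fun v : measurableTypeR R => expR (- (2 * pi * n%:~R) * v))) => [v _|]; last exact: measurable_expK.
      by rewrite mulNr.
    by have /measurable_int := ih; move/measurable_EFinP.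
  - have := @cont_integrable R (fun=> expR (2 * pi * `|n%:~R| * t) * `|p|) 1 t (@cst_continuous _ _ _).
    by apply: integrableS => //; apply: subset_itvr; rewrite bnd_simp.
  move=> v; rewrite /= in_itv /= => /andP[v1 vt].
  have v0 : 0 < v by rewrite (lt_trans ltr01).
  rewrite /b normrM (gtr0_norm (expR_gt0 _)) ler_pM ?expR_ge0 //.
    rewrite ler_expR -mulNr; apply: (@le_trans _ _ (2 * pi * `|n%:~R| * v)).
      rewrite ler_wpM2r ?(ltW v0) // -mulrN ler_wpM2l ?mulr_ge0 ?pi_ge0 // -normrN; exact: ler_norm.
    by rewrite ler_wpM2l ?mulr_ge0 ?pi_ge0 // ltW.
  rewrite normrM -[leRHS]mulr1 ler_wpM2l // ger0_norm ?mulr_ge0 ?expR_ge0 ?invr_ge0 ?sqrtr_ge0 //.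
  rewrite -[leRHS]mulr1 ler_pM ?invr_ge0 ?sqrtr_ge0 ?expR_ge0 //.
    rewrite invf_le1 ?sqrtr_gt0 // -[leLHS]sqrtr1 ler_sqrt ?ltW //; exact: ltW.
  by rewrite -expR0 ler_expR oppr_le0; apply: mulr_ge0; [apply: mulr_ge0; [exact: ltW|exact: sqr_ge0]|exact: ltW].
have [h1 h2] := prod_cint_set mI mB (ec_cintble n%:~R) ib.
split; first exact: h1.
by rewrite [LHS]h2 ec_u (negPf n0) !mul0r.
Qed.

Lemma ec_ratr (m : rat) (u v : R) : ec (ratr m * (u +i* v)) = (expR (- (2 * pi * ratr m * v)))%:C * ec (ratr m * u)%:C.
Proof.
have -> : ratr m * (u +i* v) = (ratr m * u) +i* (ratr m * v) :> C.
  by rewrite ratrC; apply/eqP; rewrite eq_complex /= !mul0r subr0 addr0 !eqxx.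
by rewrite ec_split !mulrA.
Qed.

Section POL.
Variables (Ms : seq rat) (cm : rat -> C).
(** One component of the principal part of the form. *)
Definition polar (tau : C) : C := \sum_(m <- Ms) cm m * ec (ratr m * tau).
(** polC exp(polG v) bounds the principal part at height v. *)
Definition polC : R := \sum_(m <- Ms) cabs (cm m).
Definition polG : R := \sum_(m <- Ms) 2 * pi * `|ratr m|.

Lemma polG_ge0 : 0 <= polG.
Proof. by apply: sumr_ge0 => m _; rewrite !mulr_ge0 // pi_ge0. Qed.

Lemma polC_ge0 : 0 <= polC.
Proof. by apply: sumr_ge0 => m _; exact: cabs_ge0. Qed.

Lemma polar_bound (u v : R) : 0 <= v -> cabs (polar (u +i* v)) <= polC * expR (polG * v).
Proof.
move=> v0; rewrite /polar big_seq_cond (le_trans (cabs_sum _ _ _)) // /polC mulr_suml [leRHS]big_seq_cond.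
apply: ler_sum => m /andP[mM _]; rewrite ec_ratr [cabs _]cabsM ler_wpM2l ?cabs_ge0 // cabsM cabs_ec mulr1 cabs_expR ler_expR.
rewrite -mulNr ler_wpM2r // /polG (big_rem m mM) /= -[leLHS]addr0 lerD //; last by apply: sumr_ge0 => i _; rewrite !mulr_ge0 // pi_ge0.
by rewrite -mulrN ler_wpM2l ?mulr_ge0 ?pi_ge0 // -normrN ler_norm.
Qed.

Lemma cmeas_polar : cmeas fundF (fun w => polar (w.1 +i* w.2)).
Proof.
have mF : measurable fundF := @measurable_fundF R.
apply: cmeas_sum => // m.
have h1 : cmeas fundF (fun=> cm m) by exact: cmeas_cst.
have h2 : cmeas fundF (fun w => (expR (- (2 * pi * ratr m) * w.2))%:C * ec (ratr m * w.1)%:C).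
  apply: cmeasM; last exact: cmeas_ec.
  apply: cmeas_real; apply: (cmeas_snd (g := fun v => expR (- (2 * pi * ratr m) * v))) => //; exact: measurable_expK.
apply: (eq_cmeas _ (cmeasM h1 h2)) => w _; by rewrite ec_ratr mulNr.
Qed.
End POL.

Section FIX.
Variables (N : nat) (hN : (0 < N)%N) (D : R) (D0 : 0 < D) (k' : nat).
Variable chi : 'M[rat]_2 -> C.
Hypothesis chiL : forall l, chi l != 0 -> Lint N l.
Hypothesis chi1 : forall l, cabs (chi l) <= 1.
Variables (fh : C -> C) (Ms : seq rat) (cm : rat -> C) (e A0 B0 : R).
Hypothesis cf : forall z, 0 < complex.Im z -> {for z, continuous fh}.
Hypothesis e0 : 0 < e.
Hypothesis hP : forall u v, 0 < v -> B0 <= v -> cabs (fh (u +i* v) - polar Ms cm (u +i* v)) <= A0 * expR (- (e * v)).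
Hypothesis res : forall l m, chi l != 0 -> m \in Ms -> exists n : int, ratr m + lql R N l / D = n%:~R.

Let pg0 := polG_ge0 Ms.
Let pc0 := polC_ge0 Ms cm.

(** One constant serves all three estimates: below the height where the
    principal part approximates the form, everything is bounded by compactness. *)
Lemma fh_bounds : exists A, [/\ 0 <= A,
  forall w, fundF w -> cabs (fh (w.1 +i* w.2)) <= A * expR (polG Ms * w.2),
  forall w, fundF w -> w.2 <= 1 -> cabs (fh (w.1 +i* w.2)) <= A * expR (- (e * w.2)) &
  forall w, fundF w -> cabs (fh (w.1 +i* w.2) - polar Ms cm (w.1 +i* w.2)) <= A * expR (- (e * w.2))].
Proof.
pose B := Num.max B0 1; have B1 : 1 <= B by rewrite /B le_max lexx orbT.
have [M [M0 hM]] := cont_bounded B cf.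
pose X := M + polC Ms cm * expR (polG Ms * B).
have X0 : 0 <= X by rewrite addr_ge0 // mulr_ge0 ?expR_ge0.
pose A := `|A0| + polC Ms cm + X * expR (e * B).
have eB : 1 <= expR (e * B) by rewrite -expR0 ler_expR mulr_ge0 ?ltW // (lt_le_trans ltr01).
have A_0 : 0 <= A by rewrite /A !addr_ge0 ?mulr_ge0 ?expR_ge0.
have XA : X * expR (e * B) <= A by rewrite /A lerDr addr_ge0.
have XX : X <= X * expR (e * B) by rewrite -[leLHS]mulr1 ler_wpM2l.
have MX : M <= X by rewrite /X lerDl mulr_ge0 ?expR_ge0.
have h1 (w : pT) : fundF w -> w.2 <= B -> cabs (fh (w.1 +i* w.2)) <= M.
  by move=> Fw wB; apply: hM; [case: Fw|rewrite fundF_ge].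
have small (w : pT) : fundF w -> w.2 <= B -> X <= A * expR (- (e * w.2)).
  move=> Fw wB; apply: (@le_trans _ _ (X * expR (e * B) * expR (- (e * w.2)))); last by rewrite ler_wpM2r ?expR_ge0.
  rewrite -mulrA -expRD -[leLHS]mulr1 ler_wpM2l // -expR0 ler_expR -mulrBr mulr_ge0 ?(ltW e0) // subr_ge0 //.
have pb (w : pT) : fundF w -> cabs (polar Ms cm (w.1 +i* w.2)) <= polC Ms cm * expR (polG Ms * w.2).
  by move=> [_ _ w0]; apply: polar_bound; exact: ltW.
have h2 (w : pT) : fundF w -> cabs (fh (w.1 +i* w.2) - polar Ms cm (w.1 +i* w.2)) <= A * expR (- (e * w.2)).
  move=> Fw; have w0 : 0 < w.2 by case: Fw.
  have [wB|wB] := leP w.2 B.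
    apply: le_trans (small w Fw wB); apply: le_trans (cabsD _ _) _; rewrite cabsN lerD // ?h1 //.
    by apply: le_trans (pb w Fw) _; rewrite ler_wpM2l // ler_expR ler_wpM2l.
  apply: le_trans (hP _ w0 _) _; first by rewrite (le_trans _ (ltW wB)) // /B le_max lexx.
  rewrite ler_wpM2r ?expR_ge0 // (le_trans (ler_norm _)) // /A -addrA lerDl addr_ge0 // (le_trans _ XX) //.
exists A; split => //.
  move=> w Fw; have w0 : 0 < w.2 by case: Fw.
  have E1 : 1 <= expR (polG Ms * w.2) by rewrite -expR0 ler_expR mulr_ge0 // ltW.
  have [wB|wB] := leP w.2 B.
    by apply: le_trans (h1 w Fw wB) _; apply: le_trans MX _; apply: le_trans XX _; apply: le_trans XA _; rewrite -[leLHS]mulr1 ler_wpM2l.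
  rewrite -(subrK (polar Ms cm (w.1 +i* w.2)) (fh _)); apply: le_trans (cabsD _ _) _.
  have : cabs (fh (w.1 +i* w.2) - polar Ms cm (w.1 +i* w.2)) <= `|A0|.
    apply: le_trans (hP _ w0 _) _; first by rewrite (le_trans _ (ltW wB)) // /B le_max lexx.
    apply: (@le_trans _ _ (`|A0| * expR (- (e * w.2)))); first by rewrite ler_wpM2r ?expR_ge0 // ler_norm.
    by rewrite -[leRHS]mulr1 ler_wpM2l // -expR0 ler_expR oppr_le0 mulr_ge0 // ltW.
  move=> /lerD /(_ (pb w Fw)) /le_trans; apply.
  apply: (@le_trans _ _ ((`|A0| + polC Ms cm) * expR (polG Ms * w.2))).
    by rewrite mulrDl lerD2r -[leLHS]mulr1 ler_wpM2l.
  by rewrite ler_wpM2r ?expR_ge0 // /A lerDl (le_trans X0).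
move=> w Fw w1; apply: le_trans (small w Fw _); last exact: le_trans B1.
by apply: le_trans (h1 w Fw _) MX; exact: le_trans B1.
Qed.

(** The coefficients c(m) with m = -Q(lambda)/D, which survive the integration over u. *)
Definition res0 (l : M2) : C := \sum_(m <- Ms | ratr m + lql R N l / D == 0) cm m.

Definition integrand (x0 y0 X Y : R) (w : pT) : C :=
  fh (w.1 +i* w.2) * ((w.2 `^ (3 / 2))%:C * summability.sum (Tl N D k' x0 y0 chi X Y w)) * (w.2 ^- 2)%:C.

(** The coefficient psi is the form itself for large lambda and, for the
    finitely many lambda in S, the form minus its principal part on v > 1. Large
    lambda are those whose Gaussian decay beats the growth of the principal part.
    The subtracted terms are integrated explicitly, with limit given by Jint_cvg. *)
Theorem component_local_form (x0 y0 : R) : 0 < y0 -> exists r S1, [/\ 0 < r, r < y0 & forall S : {fset M2}, (S1 `<=` S)%fset ->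
  exists M A, AN r M A /\ forall X Y, `|X| <= r -> `|Y| <= r ->
    (forall t, 1 < t -> cintble mu2 (@truncated_domain R t : set pT) (integrand x0 y0 X Y)) /\
    clim (fun t => cint mu2 (@truncated_domain R t : set pT) (integrand x0 y0 X Y))
      (A X Y + (Num.sqrt (D / 2))%:C * \sum_(l <- S) res0 l * chi l * lqz N x0 y0 X Y l ^+ k' * (Num.sg (lpz N x0 y0 X Y l))%:C)].
Proof.
move=> y00; have mF : measurable fundF := @measurable_fundF R.
have n0 : 0 < N%:R :> R by rewrite ltr0n.
pose al := 2 * pi / D.
have al0 : 0 < al by rewrite divr_gt0 // mulr_gt0 // pi_gt0.
have [ka [ka0 hka]] := quad_pos x0 n0 y00.
have [K [r1 [K0 r10 r1y hK]]] := quad_AN x0 n0 y00.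
(* makes the variation of the majorant on the box at most a quarter of its value *)
pose r := Num.min r1 (ka / (4 * (K + 1))).
have K1 : 0 < K + 1 by rewrite ltr_wpDl.
have r0 : 0 < r by rewrite lt_min r10 divr_gt0 // mulr_gt0.
have rr1 : r <= r1 by rewrite ge_min lexx.
have Kr : K * r <= ka / 4.
  apply: (@le_trans _ _ ((K + 1) * (ka / (4 * (K + 1))))).
    by rewrite ler_pM // ?(ltW r0) ?lerDl // ge_min lexx orbT.
  by rewrite le_eqVlt; apply/orP; left; apply/eqP; field; rewrite gt_eqF.
have hka' l : ka * ell R N l ^+ 2 <= lq0 N x0 y0 l.
  by rewrite /lq0 /lql /lpz !addr0; exact: hka.
have q00 l : 0 <= lq0 N x0 y0 l by apply: le_trans (hka' l); rewrite mulr_ge0 ?sqr_ge0 // ltW.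
have hK' l : [/\ AN r (lq0 N x0 y0 l / 4) (fun X Y => (lpz N x0 y0 X Y l ^+ 2 - lpz N x0 y0 0 0 l ^+ 2)%:C),
      AN r (K * ell R N l) (fun X Y => (lpz N x0 y0 X Y l)%:C) & AN r (K * ell R N l) (fun X Y => lqz N x0 y0 X Y l)].
  have rr : 0 < r <= r1 by rewrite r0.
  have [h1 h2 h3] := hK r rr (ca R N l) (cb R N l) (cc R l); split => //.
  rewrite {1}/lpz {1}/lpz !addr0; apply: AN_le h1; apply: (@le_trans _ _ (ka / 4 * ell R N l ^+ 2)).
    by rewrite ler_wpM2r ?sqr_ge0.
  by rewrite mulrAC ler_wpM2r ?invr_ge0.
have [A [A_0 hA1 hA2 hA3]] := fh_bounds.
(* beyond this bound on the majorant a quarter of the Gaussian decay outweighs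
   the growth rate polG of the principal part, with exp(-e v) to spare *)
pose R0 := 4 * (polG Ms + e) / al + 1.
have R00 : 0 <= R0 by rewrite /R0 addr_ge0 // divr_ge0 ?(ltW al0) // mulr_ge0 // addr_ge0 // ltW.
have [S1 hS1] := @Lint_finite R N hN (R0 / ka + 1).
exists r, S1; split => //; first exact: le_lt_trans r1y.
move=> S SS.
have hS l : Lint N l -> l \notin S -> R0 <= lq0 N x0 y0 l.
  move=> Ll lS; have : R0 / ka + 1 < ell R N l.
    rewrite ltNge; apply/negP => /(hS1 _ Ll) /(fsubsetP SS); by rewrite (negPf lS).
  move=> h; apply: le_trans (hka' l); rewrite mulrC -ler_pdivrMr // expr2.
  have hh : 0 <= R0 / ka by rewrite divr_ge0 // ltW.
  apply: (@le_trans _ _ ((R0 / ka + 1) * 1)); first by rewrite mulr1 lerDl.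
  by rewrite ler_pM // ?(le_trans _ (ltW h)) ?addr_ge0 // lerDr.
pose E : set pT := [set w | 1 < w.2].
(* the principal part is removed only for lambda in S and v > 1 *)
pose psi l (w : pT) := fh (w.1 +i* w.2) - (if l \in S then (if w \in E then polar Ms cm (w.1 +i* w.2) else 0) else 0).
have mE : measurable (fundF `&` E) by exact: measurable_tail.
have mfh : cmeas fundF (fun w => fh (w.1 +i* w.2)) by apply: cont_cmeas => // w [].
have mpol : cmeas fundF (fun w => if w \in E then polar Ms cm (w.1 +i* w.2) else 0).
  have mind : measurable_fun fundF ((\1_E : pT -> R)).
    apply: measurable_funTS; apply: measurable_indic; have := @measurable_snd_le R 1 => /measurableC.
    by congr measurable; apply/seteqP; split => w /=; [move/negP; rewrite -ltNge|move=> h; apply/negP; rewrite -ltNge].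
  apply: eq_cmeas (cmeasM (cmeas_real mind) (cmeas_polar Ms cm)) => w _.
  by rewrite indicE; case: (w \in E); rewrite ?mul1r ?mul0r.
have mpsi l : cmeas fundF (psi l).
  rewrite /psi; case: (l \in S); last by apply: eq_cmeas mfh => w _; rewrite subr0.
  have := cmeasD mfh (cmeasM (cmeas_cst fundF (-1)) mpol); apply: eq_cmeas => w _; by rewrite mulN1r.
have bpsi l (w : pT) : Lint N l -> fundF w -> cabs (psi l w) * expR (- (al * w.2 * lq0 N x0 y0 l / 4)) <= A * expR (- (e * w.2)).
  move=> Ll Fw; have w0 : 0 < w.2 by case: Fw.
  have E1 : expR (- (al * w.2 * lq0 N x0 y0 l / 4)) <= 1.
    by rewrite -expR0 ler_expR oppr_le0 divr_ge0 // mulr_ge0 // mulr_ge0 // ltW.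
  rewrite /psi; case: ifPn => lS.
    apply: (@le_trans _ _ (A * expR (- (e * w.2)) * 1)); last by rewrite mulr1.
    rewrite ler_pM ?cabs_ge0 ?expR_ge0 //; case: ifPn => hE; first exact: hA3.
    by rewrite subr0; apply: hA2 => //; rewrite leNgt; apply/negP => h; move: hE; rewrite mem_set.
  rewrite subr0; apply: (@le_trans _ _ (A * expR (polG Ms * w.2) * expR (- (al * w.2 * lq0 N x0 y0 l / 4)))).
    by rewrite ler_wpM2r ?expR_ge0 // hA1.
  rewrite -mulrA -expRD ler_wpM2l // ler_expR.
  have h : polG Ms + e <= al * lq0 N x0 y0 l / 4.
    have := hS l Ll lS; rewrite /R0 => h.
    have -> : polG Ms + e = al * (4 * (polG Ms + e) / al) / 4 by field; rewrite gt_eqF.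
    rewrite ler_wpM2r ?invr_ge0 // ler_wpM2l ?(ltW al0) // (le_trans _ h) // lerDl //.
  have := ler_wpM2r (ltW w0) h; have -> : al * lq0 N x0 y0 l / 4 * w.2 = al * w.2 * lq0 N x0 y0 l / 4 by ring.
  by rewrite mulrDl => hh; lra.
have [M [M' [hAN hPsi]]] := @smooth_part R N hN D D0 k' x0 y0 chi chiL chi1 ka K r e A ka0 K0 r0 e0 A_0 hka' hK' psi mpsi bpsi.
have herf l : exists M', AN r M' (fun X Y => (erf_odd (lpz N x0 y0 X Y l * Num.sqrt al))%:C).
  have [_ h2 _] := hK' l; apply: (AN_erf_odd r0).
  by apply: AN_ext (AN_Z (Num.sqrt al)%:C h2) => X Y _ _; rewrite mulrC rmorphM.
(* the analytic part of the limit Jint_cvg *)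
pose corr X Y l : C := (- (2 / Num.sqrt al))%:C * res0 l * chi l * lqz N x0 y0 X Y l ^+ k' * (erf_odd (lpz N x0 y0 X Y l * Num.sqrt al))%:C.
have hcorr l : exists M', AN r M' (fun X Y => corr X Y l).
  have [M1 h1] := herf l; have [_ _ h3] := hK' l.
  have := AN_Z ((- (2 / Num.sqrt al))%:C * res0 l * chi l) (AN_M r0 (AN_exp k' r0 h3) h1) => h.
  by eexists; apply: AN_ext h => X Y _ _; rewrite /corr !mulrA.
have [Mc hMc] := choice hcorr.
exists (M + \sum_(l <- S) Mc l), (fun X Y => cint mu2 fundF (Psi N D k' x0 y0 chi psi X Y) + \sum_(l <- S) corr X Y l); split.
  by apply: AN_D => //; apply: AN_sum => l _; exact: hMc.
move=> X Y hX hY; have [iP bP sP] := hPsi X Y hX hY.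
pose rest l (w : pT) : C := (if w \in E then polar Ms cm (w.1 +i* w.2) * ((Num.sqrt w.2)^-1%:C * Tl N D k' x0 y0 chi X Y w l) else 0).
have integrandE (w : pT) : fundF w -> integrand x0 y0 X Y w = Psi N D k' x0 y0 chi psi X Y w + \sum_(l <- S) rest l w.
  move=> Fw; have w0 : 0 < w.2 by case: Fw.
  have hfin := @hasS_fin R _ (fun l => if l \in S then rest l w else 0) S (fun i iS => ifN _ _ iS).
  have := hasSD (sP w Fw) hfin.
  rewrite [X in _ + X](_ : _ = \sum_(l <- S) rest l w); last by rewrite [LHS]big_seq [RHS]big_seq; apply: eq_bigr => l ->.
  move=> h; have : hasS (fun l => (fh (w.1 +i* w.2) * (Num.sqrt w.2)^-1%:C) * Tl N D k' x0 y0 chi X Y w l) (Psi N D k' x0 y0 chi psi X Y w + \sum_(l <- S) rest l w).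
    apply: hasS_ext h => l; rewrite /psi /rest; case: (l \in S); case: (w \in E); ring.
  move=> /hasS_sum ->; rewrite /integrand -(omegaE w0) rmorphM /=; ring.
(* the integer m + Q(lambda)/D; the default 0 is for lambda outside the support of chi *)
pose nn l m : int := if `[< chi l != 0 /\ m \in Ms >] then Num.floor (ratr m + lql R N l / D : R) else 0.
have nnE l m : chi l != 0 -> m \in Ms -> (nn l m)%:~R = ratr m + lql R N l / D :> R.
  move=> h1 h2; rewrite /nn asboolT //; have [n ->] := res h1 h2; by rewrite intrKfloor.
pose gg l m (w : pT) : C := ec ((nn l m)%:~R * w.1)%:C * (expR (- (2 * pi * (nn l m)%:~R * w.2)) * (lpz N x0 y0 X Y l * ((Num.sqrt w.2)^-1 * expR (- (al * lpz N x0 y0 X Y l ^+ 2 * w.2)))))%:C.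
have restE l (w : pT) : polar Ms cm (w.1 +i* w.2) * ((Num.sqrt w.2)^-1%:C * Tl N D k' x0 y0 chi X Y w l) =
   \sum_(m <- Ms) (cm m * chi l * lqz N x0 y0 X Y l ^+ k') * gg l m w.
  rewrite /polar mulr_suml [LHS]big_seq [RHS]big_seq; apply: eq_bigr => m mM.
  have [c0|c0] := eqVneq (chi l) 0; first by rewrite /Tl c0 !(mulr0, mul0r).
  rewrite /Tl /gg ec_ratr [ec (_ +i* (_ * w.2))]ec_split.
  have -> : ec ((nn l m)%:~R * w.1)%:C = ec (ratr m * w.1)%:C * ec (lql R N l / D * w.1)%:C by rewrite -ecD nnE // mulrDl.
  have -> : expR (- (2 * pi * (nn l m)%:~R * w.2)) * (lpz N x0 y0 X Y l * ((Num.sqrt w.2)^-1 * expR (- (al * lpz N x0 y0 X Y l ^+ 2 * w.2)))) =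
     expR (- (2 * pi * ratr m * w.2)) * (lpz N x0 y0 X Y l) * (Num.sqrt w.2)^-1 * expR (- (2 * pi * ((lql R N l + lpz N x0 y0 X Y l ^+ 2) / D * w.2))).
    have -> : expR (- (2 * pi * (nn l m)%:~R * w.2)) = expR (- (2 * pi * ratr m * w.2)) * expR (- (2 * pi * (lql R N l / D) * w.2)).
      by rewrite -expRD nnE //; congr expR; ring.
    have -> : expR (- (2 * pi * ((lql R N l + lpz N x0 y0 X Y l ^+ 2) / D * w.2))) = expR (- (2 * pi * (lql R N l / D) * w.2)) * expR (- (al * lpz N x0 y0 X Y l ^+ 2 * w.2)).
      by rewrite -expRD; congr expR; rewrite /al; ring.
    set e1 := expR _; set e2 := expR _; set e3 := expR _; ring.
  set c1 := ec _; set c2 := ec _; set q := _ ^+ k'; set e1 := expR _; set e2 := expR _.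
  by rewrite !rmorphM /=; ring.
have step l t : 1 < t -> cintble mu2 (@truncated_domain R t : set pT) (rest l) /\
   cint mu2 (@truncated_domain R t : set pT) (rest l) = \sum_(m <- Ms) (cm m * chi l * lqz N x0 y0 X Y l ^+ k' * (nn l m == 0)%:R) * (Jint al (lpz N x0 y0 X Y l) t)%:C.
  move=> t1; have mS := @measurable_strip R t; have tS := truncated_strip t.
  have h m : cintble mu2 (strip t : set pT) (fun w => (cm m * chi l * lqz N x0 y0 X Y l ^+ k') * gg l m w) /\
     cint mu2 (strip t : set pT) (fun w => (cm m * chi l * lqz N x0 y0 X Y l ^+ k') * gg l m w) = (cm m * chi l * lqz N x0 y0 X Y l ^+ k' * (nn l m == 0)%:R) * (Jint al (lpz N x0 y0 X Y l) t)%:C.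
    have [h1 h2] := strip_term_exp (nn l m) (lpz N x0 y0 X Y l) al0 t1.
    split; first exact: cintbleZ.
    rewrite (cintZ mS) //; transitivity ((cm m * chi l * lqz N x0 y0 X Y l ^+ k') * ((nn l m == 0)%:R * (Jint al (lpz N x0 y0 X Y l) t)%:C)); last exact: mulrA.
    by congr (_ * _); exact: h2.
  have i1 : cintble mu2 (strip t : set pT) (fun w => polar Ms cm (w.1 +i* w.2) * ((Num.sqrt w.2)^-1%:C * Tl N D k' x0 y0 chi X Y w l)).
    have := @cintble_sum R _ _ mu2 _ mS _ Ms (fun m w => (cm m * chi l * lqz N x0 y0 X Y l ^+ k') * gg l m w) (fun m => proj1 (h m)).
    by apply: (eq_cintble mS) => w _; rewrite (restE l).
  have mt : measurable (@truncated_domain R t : set pT) := @measurable_truncated R t.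
  have mt2 : measurable ((@truncated_domain R t : set pT) `&` E) by rewrite tS.
  have i2 := i1; rewrite -tS in i2.
  have [j1 j2] := cint_if mt mt2 i2; split; first exact: j1.
  rewrite [LHS]j2 tS; transitivity (cint mu2 (strip t : set pT) (fun w => \sum_(m <- Ms) (cm m * chi l * lqz N x0 y0 X Y l ^+ k') * gg l m w)).
    by apply: eq_cint => w _; exact: restE.
  rewrite (cint_sum mS); last by move=> m; have [] := h m.
  by apply: eq_bigr => m _; have [] := h m.
have L1 := clim_trunc e0 iP bP.
have L2 l : clim (fun t => \sum_(m <- Ms) (cm m * chi l * lqz N x0 y0 X Y l ^+ k' * (nn l m == 0)%:R) * (Jint al (lpz N x0 y0 X Y l) t)%:C)
   (corr X Y l + (Num.sqrt (D / 2))%:C * (res0 l * chi l * lqz N x0 y0 X Y l ^+ k' * (Num.sg (lpz N x0 y0 X Y l))%:C)).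
  have := @clim_sum R _ Ms predT (fun m t => (cm m * chi l * lqz N x0 y0 X Y l ^+ k' * (nn l m == 0)%:R) * (Jint al (lpz N x0 y0 X Y l) t)%:C) _
     (fun m _ => climZ _ (clim_real (@Jint_cvg R al (lpz N x0 y0 X Y l) al0))).
  congr (clim _ _); rewrite -mulr_suml.
  have -> : \sum_(m <- Ms) cm m * chi l * lqz N x0 y0 X Y l ^+ k' * (nn l m == 0)%:R = res0 l * chi l * lqz N x0 y0 X Y l ^+ k'.
    have [c0|c0] := eqVneq (chi l) 0; first by rewrite big1 ?c0 ?mulr0 ?mul0r // => m _; rewrite !(mulr0, mul0r).
    rewrite /res0 !mulr_suml [RHS]big_mkcond [LHS]big_seq [RHS]big_seq; apply: eq_bigr => m mM.
    by rewrite -nnE // intr_eq0; case: (nn l m == 0); rewrite ?mulr1 ?mulr0.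
  have -> : pi / al = D / 2.
    have pn : (pi : R) != 0 by rewrite gt_eqF // pi_gt0.
    have Dn : D != 0 by rewrite gt_eqF.
    have tn : (2 : R) != 0 by [].
    rewrite /al; move: (pi : R) pn => p pn; field; by rewrite ?pn ?Dn ?tn.
  rewrite /corr; set q := _ ^+ k'; set p := erf_odd _; set s := Num.sg _.
  by rewrite rmorphB !rmorphM rmorphN /= rmorphM /=; ring.
have L3 := climD L1 (@clim_sum R _ (enum_fset S) predT _ _ (fun l _ => L2 l)).
have -> : cint mu2 fundF (Psi N D k' x0 y0 chi psi X Y) + \sum_(l <- S) corr X Y l + (Num.sqrt (D / 2))%:C *
    \sum_(l <- S) res0 l * chi l * lqz N x0 y0 X Y l ^+ k' * (Num.sg (lpz N x0 y0 X Y l))%:C =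
  cint mu2 fundF (Psi N D k' x0 y0 chi psi X Y) + \sum_(l <- S) (corr X Y l + (Num.sqrt (D / 2))%:C * (res0 l * chi l * lqz N x0 y0 X Y l ^+ k' * (Num.sg (lpz N x0 y0 X Y l))%:C)).
  by rewrite -addrA mulr_sumr -big_split.
have tF t : (@truncated_domain R t : set pT) `<=` fundF by rewrite truncated_fundF => w [].
have mT t : measurable (@truncated_domain R t : set pT) := @measurable_truncated R t.
split.
  move=> t t1; apply: (eq_cintble (mT t) (g := fun w => Psi N D k' x0 y0 chi psi X Y w + \sum_(l <- S) rest l w)).
    by move=> w /tF /integrandE.
  apply: (cintbleD (mT t)); first by apply: cintbleS iP => //; exact: tF.
  by apply: (cintble_sum (mT t)) => l; have [] := step l t t1.
apply: (@clim_eq R _ _ _ 1) L3 => t t1; have mt := mT t.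
transitivity (cint mu2 (@truncated_domain R t : set pT) (fun w => Psi N D k' x0 y0 chi psi X Y w + \sum_(l <- S) rest l w)); last first.
  by apply: eq_cint => w /tF /integrandE.
rewrite (cintD mt); first last.
- by apply: (cintble_sum mt) => l; have [] := step l t t1.
- by apply: cintbleS iP => //; exact: tF.
congr (_ + _); rewrite (cint_sum mt); last by move=> l; have [] := step l t t1.
by apply: eq_bigr => l _; have [_ ->] := step l t t1.
Qed.

End FIX.

End LOCAL.

(** * Local form of the theta lift *)

Section THL.
Variable R : realType.
Local Notation C := R[i].
Local Notation mu := (@lebesgue_measure R).
Local Notation mu2 := ((@lebesgue_measure R \x @lebesgue_measure R)%E : {measure set _ -> \bar R}).
Local Notation pT := (measurableTypeR R * measurableTypeR R)%type.
Local Notation M2 := 'M[rat]_2.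
Variables (N k : nat) (hN : (0 < N)%N) (hk : (0 < k)%N) (Delta r : int) (D0 : Delta != 0).
Variables (f : C -> 'cV[C]_(2 * N)) (c : rat -> 'I_(2 * N) -> C).
Hypothesis cf : forall h z, 0 < complex.Im z -> {for z, continuous (fun tau => f tau h 0)}.
Hypothesis hc : principal_part Delta f c.

Let Da : R := `|Delta|%:~R.
Let Da0 : 0 < Da. Proof. by rewrite /Da ltr0z normr_gt0. Qed.

(** The vectors in the h-th component of the theta kernel. *)
Definition Lam (h : 'I_(2 * N)) : set M2 := [set l | lattice_coset r h l /\
               exists n : int, Q N l - Delta%:~R * Q N (rep h) = (Delta * n)%:~R].
(** The exponents of the principal part with nonzero coefficient. *)
Definition Ms (h : 'I_(2 * N)) : {fset rat} := fset_set [set m | [/\ exponents Delta h m, m <= 0 & c m h != 0]].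
Definition chih (h : 'I_(2 * N)) (l : M2) : C := if `[< Lam h l >] then (genus_character N Delta l)%:~R else 0.
(** The coefficient c(-Q(lambda)/|Delta|, h) chi_Delta(lambda) of the jump at
    lambda. It is the product of a residue and a character value, for lambda in
    the support of the h-th component of the kernel. *)
Definition Ch (h : 'I_(2 * N)) (l : M2) : C :=
  (\sum_(m <- Ms h | m == - (Q N l / `|Delta|%:~R)) c m h) * chih h l.

Lemma in_Ms h m : (m \in Ms h) <-> [/\ exponents Delta h m, m <= 0 & c m h != 0].
Proof.
have [fs _] := hc; have := in_fset_set (fs h); rewrite /Ms => ->; split; first by move/set_mem.
by move=> H; apply/mem_set.
Qed.

Lemma Lam_Lint h l : Lam h l -> Lint N l.
Proof. by move=> [/(coset_Lint hN)]. Qed.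

Lemma chih_Lint h l : chih h l != 0 -> Lint N l.
Proof. by rewrite /chih; case: asboolP => [/Lam_Lint //|_]; rewrite eqxx. Qed.

Lemma cabs_int (n : int) : cabs (n%:~R : C) = `|n|%:~R.
Proof. by have -> : n%:~R = (n%:~R : R)%:C :> C; [rewrite rmorph_int|rewrite cabsC intr_norm]. Qed.

Lemma chih1 h l : cabs (chih h l) <= 1.
Proof.
rewrite /chih; case: asboolP => _; last by rewrite cabs0.
by rewrite cabs_int -[leRHS]/(1%:~R) ler_int; exact: genus_bound.
Qed.

Lemma lql_ratr l : tr0 l -> lql R N l = ratr (Q N l).
Proof. by move=> t; rewrite (Q_E R hN t). Qed.

Lemma ratr_div_int (m q : rat) (d : int) : ratr m + ratr q / d%:~R = ratr (m + q / d%:~R) :> R.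
Proof. by rewrite rmorphD fmorph_div /= ratr_int. Qed.

Lemma sgz_norm : (`|Delta|%:~R : rat) = (sgz Delta)%:~R * Delta%:~R /\ (sgz Delta)%:~R * (sgz Delta)%:~R = 1 :> rat.
Proof.
have [D1|D1|D1] := ltrgtP Delta 0; last by move: D0; rewrite D1.
  by rewrite (ltr0_norm D1) (ltr0_sgz D1) intrN mulN1r mulrNN mulr1.
by rewrite (gtr0_norm D1) (gtr0_sgz D1) !mul1r.
Qed.

(** This integrality makes the integral over u an integral of a character of R/Z. *)
Lemma Lam_res h l m : Lam h l -> exponents Delta h m -> exists n : int, m + Q N l / `|Delta|%:~R = n%:~R.
Proof.
move=> [_ [n hn]] /intrP[n' hn'].
exists (n' + sgz Delta * n).
have Dq : (Delta%:~R : rat) != 0 by rewrite intr_eq0.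
have [e1 e2] := sgz_norm.
have s0 : (sgz Delta)%:~R != 0 :> rat by apply/eqP => s0; move: e2; rewrite s0 mul0r => /esym/eqP; rewrite oner_eq0.
have -> : Q N l = Delta%:~R * (Q N (rep h) + n%:~R) by rewrite mulrDr -intrM -hn addrC subrK.
rewrite e1 intrD intrM -hn'.
have si : ((sgz Delta)%:~R)^-1 = (sgz Delta)%:~R :> rat by apply: (mulfI s0); rewrite e2 divff.
rewrite invfM si; set s := (sgz Delta)%:~R; move: Dq; set d := Delta%:~R => Dq; by field.
Qed.

Lemma polarE h tau : polar (Ms h) (fun m => c m h) tau = \sum_(m \in [set m | exponents Delta h m /\ m <= 0]) c m h * ec (ratr m * tau).
Proof.
rewrite /polar; apply: esym; apply: fsbig_fset => m.
  by move=> /in_Ms[].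
move=> [h1 h2] h3; have [->|c0] := eqVneq (c m h) 0; first by rewrite mul0r.
by move: h3 => /negP[]; apply/in_Ms.
Qed.

Lemma polar_hyp : exists e A B : R, 0 < e /\ forall h u v, 0 < v -> B <= v ->
  cabs (f (u +i* v) h 0 - polar (Ms h) (fun m => c m h) (u +i* v)) <= A * expR (- (e * v)).
Proof.
have [_ [e [A [B [e0 H]]]]] := hc; exists e, A, B; split => // h u v v0 Bv.
by have := H (u +i* v) v0 Bv h; rewrite -polarE cabsE lecR.
Qed.

Lemma res0E h l : res0 N Da (Ms h) (fun m => c m h) l * chih h l = Ch h l.
Proof.
rewrite /Ch; have [c0|c0] := eqVneq (chih h l) 0; first by rewrite c0 !mulr0.
congr (_ * _); apply: eq_bigl => m; have [tl _ _ _] := chih_Lint c0.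
by rewrite lql_ratr // /Da ratr_div_int fmorph_eq0 addr_eq0.
Qed.

Lemma thetaE x0 y0 X Y h (w : pT) : 0 < y0 + Y ->
  theta_kernel N Delta r k (w.1 +i* w.2) ((x0 + X) +i* (y0 + Y)) h 0 =
  (w.2 `^ (3 / 2))%:C * summability.sum (Tl N Da k.-1 x0 y0 (chih h) X Y w).
Proof.
move=> y1; rewrite /theta_kernel mxE; congr (_ * _); congr summability.sum; apply/funext => l.
rewrite patchE /Tl /chih; case: ifPn => [/set_mem hl|hl]; last first.
  rewrite asboolF ?mul0r //; by move=> hl'; move: hl; rewrite mem_set.
rewrite asboolT //; have Ll := Lam_Lint hl; have [tl _ _ _] := Ll.
by rewrite /Q_z -(lql_ratr tl) (p_zE hN tl) ?gt_eqF // q_zE.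
Qed.

Definition Phi z := theta_lift Delta r k f z.

(** The components are added up, with a common box and a common finite set. *)
Theorem theta_lift_local_form (z0 : C) : 0 < complex.Im z0 -> exists rr S1, [/\ 0 < rr, rr < complex.Im z0 & forall S : {fset M2}, (S1 `<=` S)%fset ->
  exists M A, AN rr M A /\ forall X Y, `|X| <= rr -> `|Y| <= rr ->
   Phi ((complex.Re z0 + X) +i* (complex.Im z0 + Y)) =
      A X Y + (Num.sqrt (Da / 2))%:C * \sum_h \sum_(l <- S) Ch h l * q_z N ((complex.Re z0 + X) +i* (complex.Im z0 + Y)) l ^+ k.-1
        * (Num.sg (p_z N ((complex.Re z0 + X) +i* (complex.Im z0 + Y)) l))%:C].
Proof.
case: z0 => x0 y0 /= y00.
have [e [A [B [e0 hP]]]] := polar_hyp.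
have res h l m : chih h l != 0 -> m \in enum_fset (Ms h) -> exists n : int, ratr m + lql R N l / Da = n%:~R.
  move=> c0 /in_Ms[em _ _]; have [tl _ _ _] := chih_Lint c0.
  have hl : Lam h l by move: c0; rewrite /chih; case: asboolP => //; rewrite eqxx.
  have [n hn] := Lam_res hl em; exists n.
  by rewrite lql_ratr // /Da ratr_div_int hn ratr_int.
have loc h := @component_local_form R N hN Da Da0 k.-1 (chih h) (@chih_Lint h) (chih1 h) (fun tau => f tau h 0) (enum_fset (Ms h)) (fun m => c m h) e A B (@cf h) e0 (hP h) (res h) x0 y0 y00.
have [rh hrh] := choice loc; have [Sh hSh] := choice hrh.
pose rr := \big[Num.min/y0 / 2]_h rh h.
have rr0 : 0 < rr by apply: lt_bigmin => [|h _]; [rewrite divr_gt0|have [] := hSh h].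
have rrh h : rr <= rh h by rewrite /rr; exact: bigmin_le_cond.
have rry : rr < y0.
  apply: (@le_lt_trans _ _ (y0 / 2)); first exact: bigmin_le_id.
  by rewrite ltr_pdivrMr // ltr_pMr // (ltr_nat R 1 2).
pose S1 : {fset M2} := (\bigcup_(h <- enum 'I_(2 * N)) Sh h)%fset.
exists rr, S1; split => // S SS.
have SSh h : (Sh h `<=` S)%fset.
  by apply: fsubset_trans SS; apply: bigfcup_sup => //; rewrite mem_enum.
have H h : exists MA : R * (R -> R -> C), AN rr MA.1 MA.2 /\ forall X Y, `|X| <= rr -> `|Y| <= rr ->
    (forall t, 1 < t -> cintble mu2 (@truncated_domain R t : set pT) (integrand N Da k.-1 (chih h) (fun tau => f tau h 0) x0 y0 X Y)) /\
    clim (fun t => cint mu2 (@truncated_domain R t : set pT) (integrand N Da k.-1 (chih h) (fun tau => f tau h 0) x0 y0 X Y))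
      (MA.2 X Y + (Num.sqrt (Da / 2))%:C * \sum_(l <- S) res0 N Da (Ms h) (fun m => c m h) l * chih h l * lqz N x0 y0 X Y l ^+ k.-1 * (Num.sg (lpz N x0 y0 X Y l))%:C).
  have [_ _ hh] := hSh h; have [M [A1 [hA hB]]] := hh S (SSh h).
  exists (M, A1); split; first by apply: AN_shrink hA; rewrite (ltW rr0) rrh.
  by move=> X Y hX hY; apply: hB; [exact: le_trans hX _|exact: le_trans hY _].
have [MA hMA] := choice H.
exists (\sum_h (MA h).1), (fun X Y => \sum_h (MA h).2 X Y); split.
  by apply: AN_sum => h _; have [] := hMA h.
move=> X Y hX hY.
have y1 : 0 < y0 + Y.
  have := lt_le_trans rry (lexx y0); move: hY; rewrite ler_norml => /andP[hY _]; lra.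
have L := @clim_sum R _ (index_enum 'I_(2 * N)) predT _ _ (fun h _ => proj2 ((proj2 (hMA h)) X Y hX hY)).
have mT t : measurable (@truncated_domain R t : set pT) := @measurable_truncated R t.
have E t : 1 < t -> cintegral (truncated_domain t) (fun w => let tau := w.1 +i* w.2 in
            herm (f tau) (map_mx Num.conj (theta_kernel N Delta r k tau ((x0 + X) +i* (y0 + Y))))
            * (w.2 ^- 2)%:C) = \sum_h cint mu2 (@truncated_domain R t : set pT) (integrand N Da k.-1 (chih h) (fun tau => f tau h 0) x0 y0 X Y).
  move=> t1; rewrite cintegralE.
  rewrite -(cint_sum (mT t)); last by move=> h; apply: (proj1 ((proj2 (hMA h)) X Y hX hY)).
  apply: eq_cint => w _; rewrite /herm mulr_suml; apply: eq_bigr => h _.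
  rewrite /integrand -(thetaE x0 X h w y1); congr (_ * _ * _).
  by rewrite [map_mx _ _ _ _]mxE conjCK.
rewrite /Phi /theta_lift; apply: cvg_lim => //; apply: clim_cvg.
have -> : \sum_h (MA h).2 X Y + (Num.sqrt (Da / 2))%:C * \sum_h \sum_(l <- S) Ch h l * q_z N ((x0 + X) +i* (y0 + Y)) l ^+ k.-1
        * (Num.sg (p_z N ((x0 + X) +i* (y0 + Y)) l))%:C =
   \sum_h ((MA h).2 X Y + (Num.sqrt (Da / 2))%:C * \sum_(l <- S) res0 N Da (Ms h) (fun m => c m h) l * chih h l * lqz N x0 y0 X Y l ^+ k.-1 * (Num.sg (lpz N x0 y0 X Y l))%:C).
  rewrite big_split /= mulr_sumr; congr (_ + _); apply: eq_bigr => h _; congr (_ * _); apply: eq_bigr => l _.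
  rewrite res0E; have [c0|c0] := eqVneq (chih h l) 0; first by rewrite /Ch c0 !(mulr0, mul0r).
  have [tl _ _ _] := chih_Lint c0.
  by rewrite (p_zE hN) //= ?gt_eqF // q_zE /lpz /lqz.
apply: (@clim_eq R _ _ _ 1) L => t t1; by rewrite E.
Qed.

End THL.

(** * Geodesics and chambers *)

Section GEO.
Variable R : realType.
Local Notation C := R[i].
Local Notation M2 := 'M[rat]_2.
Variables (N : nat) (hN : (0 < N)%N).

Let n0 : 0 < N%:R :> R. Proof. by rewrite ltr0n. Qed.

(** The equation of the geodesic of lambda, a negative multiple of p_z for z in
    the upper half plane. *)
Definition PP (l : M2) (z : C) : R := cc R l * N%:R * (complex.Re z ^+ 2 + complex.Im z ^+ 2) - cb R N l * complex.Re z + ca R N l.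

Lemma p_PP z l : tr0 l -> 0 < complex.Im z -> p_z N z l = - (PP l z / (Num.sqrt (2 * N%:R) * complex.Im z)).
Proof. by move=> t z0; rewrite (p_zE hN t) ?gt_eqF. Qed.

Lemma sg_p z l : tr0 l -> 0 < complex.Im z -> Num.sg (p_z N z l) = - Num.sg (PP l z).
Proof.
move=> t z0; rewrite p_PP // sgrN sgrM [X in _ * X]gtr0_sg ?mulr1 // invr_gt0 mulr_gt0 // sqrtr_gt0 mulr_gt0 //.
Qed.

Lemma PP_lip (z0 : C) : exists K, 0 < K /\ forall d X Y l, d <= 1 -> `|X| <= d -> `|Y| <= d ->
  `|PP l ((complex.Re z0 + X) +i* (complex.Im z0 + Y)) - PP l z0| <= K * d * ell R N l.
Proof.
case: z0 => x y /=; pose K := N%:R * (2 * `|x| + 2 * `|y| + 2) + 1 : R.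
have K0 : 0 < K by rewrite ltr_wpDl // mulr_ge0 // !addr_ge0 // mulr_ge0.
exists K; split => // d X Y l d1 hX hY.
have d0 : 0 <= d := le_trans (normr_ge0 _) hX.
rewrite /PP /=.
have -> : cc R l * N%:R * ((x + X) ^+ 2 + (y + Y) ^+ 2) - cb R N l * (x + X) + ca R N l -
   (cc R l * N%:R * (x ^+ 2 + y ^+ 2) - cb R N l * x + ca R N l) =
   cc R l * (N%:R * ((2 * x + X) * X + (2 * y + Y) * Y)) - cb R N l * X by ring.
apply: le_trans (ler_normB _ _) _; rewrite (normrM (cc R l)) (normrM (cb R N l)).
have h1 : `|N%:R * ((2 * x + X) * X + (2 * y + Y) * Y)| <= K * d.
  apply: (@le_trans _ _ (N%:R * (2 * `|x| + 2 * `|y| + 2) * d)); last by rewrite ler_wpM2r // /K lerDl.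
  rewrite normrM ger0_norm // -mulrA ler_wpM2l //.
  apply: le_trans (ler_normD _ _) _; rewrite !normrM.
  have a1 : `|2 * x + X| <= 2 * `|x| + 1 by rewrite (le_trans (ler_normD _ _)) // normrM ger0_norm // lerD2l (le_trans hX).
  have a2 : `|2 * y + Y| <= 2 * `|y| + 1 by rewrite (le_trans (ler_normD _ _)) // normrM ger0_norm // lerD2l (le_trans hY).
  have -> : (2 * `|x| + 2 * `|y| + 2) * d = (2 * `|x| + 1) * d + (2 * `|y| + 1) * d by ring.
  by rewrite lerD // ler_pM.
have h2 : d <= K * d by rewrite -[leLHS]mul1r ler_wpM2r // /K lerDr mulr_ge0 // !addr_ge0 // mulr_ge0.
apply: (@le_trans _ _ (`|cc R l| * (K * d) + `|cb R N l| * (K * d))).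
  by rewrite lerD // ler_wpM2l // (le_trans hX).
have -> : K * d * ell R N l = `|ca R N l| * (K * d) + (`|cc R l| * (K * d) + `|cb R N l| * (K * d)) by rewrite /ell; ring.
by rewrite lerDr mulr_ge0 // mulr_ge0 // ltW.
Qed.

Lemma same_sign (a b : R) : `|a - b| < `|b| -> 0 < a * b.
Proof.
move=> h; have b0 : b != 0 by apply/eqP => b0; move: h; rewrite b0 normr0 ltNge normr_ge0.
have [bp|bn|/eqP] := ltrgtP 0 b; last by rewrite eq_sym (negPf b0).
  move: h; rewrite (gtr0_norm bp) ltr_norml => /andP[h _]; rewrite mulr_gt0 //; lra.
move: h; rewrite (ltr0_norm bn) ltr_norml => /andP[_ h]; rewrite nmulr_lgt0 //; lra.
Qed.

(** PP is Lipschitz in z. *)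
Lemma PP_open z0 l : PP l z0 != 0 -> exists2 d : R, 0 < d & forall X Y, `|X| <= d -> `|Y| <= d ->
  0 < PP l ((complex.Re z0 + X) +i* (complex.Im z0 + Y)) * PP l z0.
Proof.
move=> h; have [K [K0 hK]] := PP_lip z0.
have l0 : 0 <= ell R N l by rewrite /ell !addr_ge0.
have E0 : 0 < K * (ell R N l + 1) by rewrite mulr_gt0 // ltr_wpDl.
pose d := Num.min 1 (`|PP l z0| / (K * (ell R N l + 1)) / 2).
have d0 : 0 < d by rewrite lt_min ltr01 !divr_gt0 // normr_gt0.
exists d => // X Y hX hY; apply: same_sign; apply: le_lt_trans (hK d X Y l _ hX hY) _; first by rewrite ge_min lexx.
apply: (@le_lt_trans _ _ (d * (K * (ell R N l + 1)))).
  have -> : K * d * ell R N l = d * (K * ell R N l) by ring.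
  by rewrite ler_wpM2l ?(ltW d0) // ler_wpM2l ?(ltW K0) // lerDl.
rewrite -ltr_pdivlMr // (@le_lt_trans _ _ (`|PP l z0| / (K * (ell R N l + 1)) / 2)) ?ge_min ?lexx ?orbT //.
by rewrite ltr_pdivrMr // ltr_pMr ?divr_gt0 ?normr_gt0 // (ltr_nat R 1 2).
Qed.

Lemma PP_continuous l : continuous (PP l : C -> R).
Proof.
move=> z0 P /nbhs_ballP[e /= e0 he]; change (\forall z \near z0, P (PP l z)); apply/nbhsC_box.
have [K [K0 hK]] := PP_lip z0.
have l0 : 0 <= ell R N l by rewrite /ell !addr_ge0.
have E0 : 0 < K * (ell R N l + 1) by rewrite mulr_gt0 // ltr_wpDl.
pose d := Num.min 1 (e / (K * (ell R N l + 1)) / 2).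
have d0 : 0 < d by rewrite lt_min ltr01 !divr_gt0.
exists d => // X Y hX hY; apply: he; rewrite -ball_normE /= distrC; apply: le_lt_trans (hK d X Y l _ hX hY) _; first by rewrite ge_min lexx.
apply: (@le_lt_trans _ _ (d * (K * (ell R N l + 1)))).
  have -> : K * d * ell R N l = d * (K * ell R N l) by ring.
  by rewrite ler_wpM2l ?(ltW d0) // ler_wpM2l ?(ltW K0) // lerDl.
rewrite -ltr_pdivlMr // (@le_lt_trans _ _ (e / (K * (ell R N l + 1)) / 2)) ?ge_min ?lexx ?orbT //.
by rewrite ltr_pdivrMr // ltr_pMr ?divr_gt0 // (ltr_nat R 1 2).
Qed.

(** If Q is bounded and lambda is long, positivity of the majorant forces |PP|
    to be at least a constant times the length of lambda at z0, while PP varies by less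
    than that near z0. Hence only finitely many walls come near z0. *)
Lemma local_finite (z0 : C) (Qm : R) : 0 < complex.Im z0 -> exists (d : R) (F : {fset M2}), [/\ 0 < d, d < complex.Im z0 &
  forall l, Lint N l -> QR N%:R (ca R N l) (cb R N l) (cc R l) <= Qm -> l \notin F ->
   forall X Y, `|X| <= d -> `|Y| <= d -> 0 < PP l ((complex.Re z0 + X) +i* (complex.Im z0 + Y)) * PP l z0].
Proof.
move=> y0; have [ka [ka0 hka]] := quad_pos (complex.Re z0) n0 y0.
have [K [K0 hK]] := PP_lip z0.
pose v := N%:R * complex.Im z0 ^+ 2 * ka; have v0 : 0 < v by rewrite !mulr_gt0 // exprn_gt0.
pose g := Num.min 1 v; have g0 : 0 < g by rewrite lt_min ltr01.
have gv : g ^+ 2 <= v.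
  rewrite expr2 -[leRHS]mul1r ler_pM ?(ltW g0) // ge_min lexx ?orbT //.
have [F hF] := @Lint_finite R N hN (2 * `|Qm| / ka + 1).
(* g is the lower bound for |PP l z0| / ell l, and K the Lipschitz constant of PP / ell *)
pose d := Num.min (complex.Im z0 / 2) (Num.min 1 (g / K / 2)).
have d0 : 0 < d by rewrite !lt_min ltr01 !divr_gt0.
exists d, F; split => //.
  by rewrite (@le_lt_trans _ _ (complex.Im z0 / 2)) ?ge_min ?lexx // ltr_pdivrMr // ltr_pMr // (ltr_nat R 1 2).
move=> l Ll hQ lF X Y hX hY.
have el : 2 * `|Qm| / ka + 1 < ell R N l by rewrite ltNge; apply/negP => /(hF _ Ll); rewrite (negPf lF).
have q0 : 0 <= 2 * `|Qm| / ka by rewrite divr_ge0 ?(ltW ka0) // mulr_ge0.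
have el0 : 0 < ell R N l by apply: le_lt_trans el; rewrite addr_ge0.
have el2 : 2 * `|Qm| <= ka * ell R N l ^+ 2.
  rewrite [leRHS]mulrC -ler_pdivrMr // expr2; apply: (@le_trans _ _ ((2 * `|Qm| / ka + 1) * 1)); first by rewrite mulr1 lerDl.
  by rewrite ler_pM ?(ltW el) ?addr_ge0 // (le_trans _ (ltW el)) // lerDr.
have P2 : g ^+ 2 * ell R N l ^+ 2 <= PP l z0 ^+ 2.
  have := hka (ca R N l) (cb R N l) (cc R l); rewrite -/(ell R N l) => h.
  have s2 : Num.sqrt (2 * N%:R) ^+ 2 = 2 * N%:R :> R by rewrite sqr_sqrtr // mulr_ge0.
  have : pR N%:R (complex.Re z0) (complex.Im z0) (ca R N l) (cb R N l) (cc R l) ^+ 2 = PP l z0 ^+ 2 / (2 * N%:R * complex.Im z0 ^+ 2).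
    by rewrite /pR sqrrN expr_div_n exprMn s2.
  move=> e; rewrite e in h.
  have h2 : ka * ell R N l ^+ 2 / 2 <= PP l z0 ^+ 2 / (2 * N%:R * complex.Im z0 ^+ 2).
    have := ler_norm Qm; lra.
  have w0 : 0 < 2 * N%:R * complex.Im z0 ^+ 2 by rewrite !mulr_gt0 // exprn_gt0.
  move: h2; rewrite ler_pdivlMr // => h2; apply: le_trans h2.
  have -> : ka * ell R N l ^+ 2 / 2 * (2 * N%:R * complex.Im z0 ^+ 2) = v * ell R N l ^+ 2 by rewrite /v; field.
  by rewrite ler_wpM2r ?sqr_ge0.
have Pl : g * ell R N l <= `|PP l z0|.
  have ge0 : 0 <= g * ell R N l by rewrite mulr_ge0 ?(ltW g0) ?(ltW el0).
  have : (g * ell R N l) ^+ 2 <= `|PP l z0| ^+ 2 by rewrite exprMn real_normK ?num_real.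
  by rewrite ler_pXn2r ?nnegrE.
apply: same_sign; apply: le_lt_trans (hK d X Y l _ hX hY) _; first by rewrite !ge_min lexx orbT.
apply: lt_le_trans Pl; rewrite ltr_pM2r // mulrC -ltr_pdivlMr //.
apply: (@le_lt_trans _ _ (g / K / 2)); first by rewrite !ge_min lexx !orbT.
by rewrite ltr_pdivrMr // ltr_pMr ?divr_gt0 // (ltr_nat R 1 2).
Qed.

Lemma cont_mkC (a b : R -> R) (t : R) : {for t, continuous a} -> {for t, continuous b} -> {for t, continuous (fun s => a s +i* b s : C)}.
Proof.
move=> ca cb P /nbhsC_box[d d0 hd].
have /cvgrPdist_lt/(_ d d0) h1 := ca; have /cvgrPdist_lt/(_ d d0) h2 := cb.
apply: filterS2 h1 h2 => s h1 h2.
have h1' : `|a s - a t| <= d by rewrite distrC ltW.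
have h2' : `|b s - b t| <= d by rewrite distrC ltW.
have := hd _ _ h1' h2'; rewrite /=.
have -> : a t + (a s - a t) = a s by rewrite addrC subrK.
by have -> : b t + (b s - b t) = b s by rewrite addrC subrK.
Qed.

(** In the coordinates (x, |z|^2) of the Klein model geodesics are straight lines:
    PP is affine in them. The path klein_path is the segment from z to w in
    these coordinates. *)
Definition klein_x (z w : C) (t : R) : R := (1 - t) * complex.Re z + t * complex.Re w.
Definition klein_n (z w : C) (t : R) : R := (1 - t) * (complex.Re z ^+ 2 + complex.Im z ^+ 2) + t * (complex.Re w ^+ 2 + complex.Im w ^+ 2).
Definition klein_path (z w : C) (t : R) : C := klein_x z w t +i* Num.sqrt (klein_n z w t - klein_x z w t ^+ 2).

(** The region n > x^2 is convex. *)
Lemma klein_path_pos z w t : 0 < complex.Im z -> 0 < complex.Im w -> 0 <= t <= 1 -> 0 < klein_n z w t - klein_x z w t ^+ 2.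
Proof.
move=> hz hw /andP[t0 t1].
have -> : klein_n z w t - klein_x z w t ^+ 2 = (1 - t) * complex.Im z ^+ 2 + t * complex.Im w ^+ 2 + t * (1 - t) * (complex.Re z - complex.Re w) ^+ 2.
  rewrite /klein_n /klein_x; ring.
have t1' : 0 <= 1 - t by rewrite subr_ge0.
apply: ltr_wpDr; first by rewrite mulr_ge0 ?sqr_ge0 // mulr_ge0.
have [->|tn] := eqVneq t 0; first by rewrite subr0 mul1r mul0r addr0 exprn_gt0.
by apply: ltr_wpDl; [rewrite mulr_ge0 ?sqr_ge0|rewrite mulr_gt0 ?exprn_gt0 // lt0r tn].
Qed.

Lemma klein_path_H z w t : 0 < complex.Im z -> 0 < complex.Im w -> 0 <= t <= 1 -> 0 < complex.Im (klein_path z w t).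
Proof. by move=> hz hw ht; rewrite /= sqrtr_gt0 klein_path_pos. Qed.

Lemma PP_klein_path z w t l : 0 < complex.Im z -> 0 < complex.Im w -> 0 <= t <= 1 -> PP l (klein_path z w t) = (1 - t) * PP l z + t * PP l w.
Proof.
move=> hz hw ht; rewrite /PP /klein_path /= sqr_sqrtr; last by rewrite ltW // klein_path_pos.
by rewrite /klein_n /klein_x; ring.
Qed.

Lemma klein_path0 z w : 0 < complex.Im z -> klein_path z w 0 = z.
Proof.
move=> hz; rewrite /klein_path /klein_x /klein_n subr0 !mul1r !mul0r !addr0 addrC addKr sqrtr_sqr gtr0_norm //; by case: z hz.
Qed.

Lemma klein_path1 z w : 0 < complex.Im w -> klein_path z w 1 = w.
Proof.
move=> hz; rewrite /klein_path /klein_x /klein_n subrr !mul1r !mul0r !add0r addrC addKr sqrtr_sqr gtr0_norm //; by case: w hz.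
Qed.

Lemma klein_path_continuous z w : continuous (klein_path z w : R -> C).
Proof.
move=> t; have cx : continuous (klein_x z w).
  move=> s; apply: cvgD; apply: cvgM; [|exact: cvg_cst|exact: cvg_id|exact: cvg_cst].
  by apply: cvgB; [exact: cvg_cst|exact: cvg_id].
have cn : continuous (klein_n z w).
  move=> s; apply: cvgD; apply: cvgM; [|exact: cvg_cst|exact: cvg_id|exact: cvg_cst].
  by apply: cvgB; [exact: cvg_cst|exact: cvg_id].
apply: cont_mkC; first exact: cx.
apply: (@continuous_comp _ _ _ (fun s => klein_n z w s - klein_x z w s ^+ 2) Num.sqrt); last exact: sqrt_continuous.
by apply: cvgB; [exact: cn|apply: cvgM; exact: cx].
Qed.

(** A sign change would produce a zero on the segment from z to w. *)
Lemma PP_const_sign l z w : (forall z, 0 < complex.Im z -> PP l z != 0) -> 0 < complex.Im z -> 0 < complex.Im w -> 0 < PP l z * PP l w.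
Proof.
move=> h hz hw; have nz := h z hz; have nw := h w hw.
have : PP l z * PP l w != 0 by rewrite mulf_neq0.
rewrite neq_lt => /orP[hlt|//].
have dn : PP l z - PP l w != 0.
  by apply/eqP => /eqP; rewrite subr_eq0 => /eqP e; move: hlt; rewrite e ltNge sqr_ge0.
pose t := PP l z / (PP l z - PP l w).
have ht : 0 <= t <= 1.
  rewrite /t; have [p|p] := ltP 0 (PP l z).
    have wn : PP l w < 0 by move: hlt; rewrite pmulr_rlt0.
    have d0 : 0 < PP l z - PP l w by lra.
    by apply/andP; split; [rewrite divr_ge0 // ltW|rewrite ler_pdivrMr // mul1r; lra].
  have zn : PP l z < 0 by rewrite lt_neqAle nz.
  have wn : 0 < PP l w by move: hlt; rewrite nmulr_rlt0.
  have d0 : PP l z - PP l w < 0 by lra.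
  apply/andP; split; first by rewrite -mulrNN -invrN divr_ge0 //; lra.
  by rewrite ler_ndivrMr // mul1r; lra.
have := h _ (klein_path_H hz hw ht); rewrite PP_klein_path //.
have -> : (1 - t) * PP l z + t * PP l w = 0 by rewrite /t; field.
by rewrite eqxx.
Qed.

Section CHAMBERS.
Variable Wl : set M2.
Variable Qm : R.
Hypothesis WlL : forall l, Wl l -> Lint N l.
Hypothesis WlQ : forall l, Wl l -> QR N%:R (ca R N l) (cb R N l) (cc R l) <= Qm.
Hypothesis WlQ0 : forall l, Wl l -> 0 < QR N%:R (ca R N l) (cb R N l) (cc R l).

(** The complement of the walls of the vectors in Wl. *)
Definition regular : set C := [set z | 0 < complex.Im z /\ forall l, Wl l -> PP l z != 0].
Definition chamber (z : C) : set C := connected_component regular z.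

Lemma chamber_sub z w : chamber z w -> regular w.
Proof. exact: connected_component_sub. Qed.

(** Intermediate value theorem on a connected set. *)
Lemma chamber_sign z w l : regular z -> chamber z w -> Wl l -> 0 < PP l w * PP l z.
Proof.
move=> Xz Ww Wll.
have cW : connected (chamber z) by exact: component_connected.
have cI : connected (PP l @` chamber z).
  apply: connected_continuous_connected => //.
  by apply: continuous_subspaceT; exact: PP_continuous.
have /connected_intervalP iI := cI.
have Wz : chamber z z by exact: connected_component_refl.
have nw : PP l w != 0 by have [_ ->] := chamber_sub Ww.
have nz : PP l z != 0 by have [_ ->] := Xz.
have : PP l w * PP l z != 0 by rewrite mulf_neq0.
rewrite neq_lt => /orP[hlt|//]; exfalso.
have iw : (PP l @` chamber z) (PP l w) by exists w.
have iz : (PP l @` chamber z) (PP l z) by exists z.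
have [u Wu u0] : (PP l @` chamber z) 0.
  have [p|p] := ltP 0 (PP l z).
    have wn : PP l w < 0 by move: hlt; rewrite pmulr_llt0.
    by apply: (iI _ _ iw iz); rewrite !ltW.
  have zn : PP l z < 0 by rewrite lt_neqAle nz.
  have wn : 0 < PP l w by move: hlt; rewrite nmulr_llt0.
  by apply: (iI _ _ iz iw); rewrite !ltW.
by have [_ /(_ _ Wll)] := chamber_sub Wu; rewrite u0 eqxx.
Qed.

(** The segment between two points with the same signs stays in the complement of the walls, because each
    PP is affine on it. *)
Lemma chamber_conv z w : regular z -> regular w -> (forall l, Wl l -> 0 < PP l w * PP l z) -> chamber z w.
Proof.
move=> Xz Xw h; have [hz nz] := Xz; have [hw nw] := Xw.
have cK : connected (klein_path z w @` `[0, 1]%classic).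
  apply: connected_continuous_connected; first exact: segment_connected.
  by apply: continuous_subspaceT; exact: klein_path_continuous.
apply: (connected_component_max _ _ cK).
- by exists 0; [rewrite /= in_itv /= lexx ler01|rewrite klein_path0].
- move=> _ [t ht0 <-]; have ht : 0 <= t <= 1 by move: ht0; rewrite /= in_itv.
  split; first exact: klein_path_H.
  move=> l Wll; rewrite PP_klein_path //; have [t0 t1] := andP ht.
  have := h l Wll; have [p|p] := ltP 0 (PP l z).
    rewrite pmulr_lgt0 // => wp; rewrite gt_eqF //.
    have [->|tn] := eqVneq t 0; first by rewrite subr0 mul1r mul0r addr0.
    by apply: ltr_wpDl; [rewrite mulr_ge0 ?(ltW p) // subr_ge0|rewrite mulr_gt0 // lt0r tn].
  have zn : PP l z < 0 by rewrite lt_neqAle nz.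
  rewrite nmulr_lgt0 // => wp; rewrite lt_eqF //.
  have [->|tn] := eqVneq t 0; first by rewrite subr0 mul1r mul0r addr0.
  by apply: ltr_wnDl; [rewrite mulr_ge0_le0 ?(ltW zn) // subr_ge0|rewrite pmulr_rlt0 // lt0r tn].
- by exists 1; [rewrite /= in_itv /= lexx ler01|rewrite klein_path1].
Qed.

(** Local finiteness leaves finitely many walls to stay away from. *)
Lemma comp_open z : regular z -> exists2 d : R, 0 < d & forall X Y, `|X| <= d -> `|Y| <= d ->
  regular ((complex.Re z + X) +i* (complex.Im z + Y)) /\ forall l, Wl l -> 0 < PP l ((complex.Re z + X) +i* (complex.Im z + Y)) * PP l z.
Proof.
move=> [hz nz]; have [d [F [d0 dz hF]]] := local_finite Qm hz.
have [d' [d'0 hd']] : exists d' : R, 0 < d' /\ forall l, l \in F -> Wl l -> forall X Y, `|X| <= d' -> `|Y| <= d' ->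
    0 < PP l ((complex.Re z + X) +i* (complex.Im z + Y)) * PP l z.
  suff : forall s : seq M2, exists d' : R, 0 < d' /\ forall l, l \in s -> Wl l -> forall X Y, `|X| <= d' -> `|Y| <= d' ->
    0 < PP l ((complex.Re z + X) +i* (complex.Im z + Y)) * PP l z by move=> /(_ (enum_fset F)).
  elim => [|l s [d1 [d10 hd1]]]; first by exists 1; split.
  have [Wll|nWl] := pselect (Wl l); last first.
    by exists d1; split => // l'; rewrite inE => /orP[/eqP -> //|/hd1].
  have [d2 d20 hd2] := PP_open (nz l Wll).
  exists (Num.min d1 d2); split; first by rewrite lt_min d10.
  move=> l'; rewrite inE => /orP[/eqP -> _|/hd1 h Wl'] X Y; rewrite !le_min => /andP[a1 a2] /andP[b1 b2]; [exact: hd2|exact: h].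
exists (Num.min d d'); first by rewrite lt_min d0.
move=> X Y; rewrite !le_min => /andP[a1 a2] /andP[b1 b2].
have S l : Wl l -> 0 < PP l ((complex.Re z + X) +i* (complex.Im z + Y)) * PP l z.
  move=> Wll; have [lF|lF] := boolP (l \in F); first exact: hd'.
  by apply: hF => //; [exact: WlL|exact: WlQ].
split=> //; split; first by move: b1; rewrite ler_norml /= => /andP[b1 _]; lra.
by move=> l /S h; apply/eqP => e; move: h; rewrite e mul0r ltxx.
Qed.

Lemma chamber_open z w : regular z -> chamber z w -> exists2 d : R, 0 < d & forall X Y, `|X| <= d -> `|Y| <= d ->
  chamber z ((complex.Re w + X) +i* (complex.Im w + Y)).
Proof.
move=> Xz Ww; have [d d0 hd] := comp_open (chamber_sub Ww); exists d => // X Y hX hY.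
have [Xv hv] := hd X Y hX hY; apply: chamber_conv => // l Wll.
have a := hv l Wll; have b := chamber_sign Xz Ww Wll.
have : 0 < (PP l ((complex.Re w + X) +i* (complex.Im w + Y)) * PP l w) * (PP l w * PP l z) by rewrite mulr_gt0.
have -> : (PP l ((complex.Re w + X) +i* (complex.Im w + Y)) * PP l w) * (PP l w * PP l z) = (PP l ((complex.Re w + X) +i* (complex.Im w + Y)) * PP l z) * PP l w ^+ 2 by ring.
by rewrite pmulr_lgt0 // exprn_even_gt0 //=; have [_ ->] := chamber_sub Ww.
Qed.

Lemma closure_box (W : set C) z : closure W z -> forall d : R, 0 < d -> exists X Y, [/\ `|X| <= d, `|Y| <= d & W ((complex.Re z + X) +i* (complex.Im z + Y))].
Proof.
move=> cz d d0; have : nbhs z [set z' | exists X Y, [/\ `|X| <= d, `|Y| <= d & z' = (complex.Re z + X) +i* (complex.Im z + Y)]].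
  by apply/nbhsC_box; exists d => // X Y hX hY; exists X, Y.
by move=> /cz [w [Ww [X [Y [hX hY e]]]]]; exists X, Y; split => //; rewrite -e.
Qed.

Lemma closure_sign z w l : regular z -> closure (chamber z) w -> Wl l -> 0 <= PP l w * PP l z.
Proof.
move=> Xz cw Wll; have [->|nw] := eqVneq (PP l w) 0; first by rewrite mul0r.
have [d d0 hd] := PP_open nw; have [X [Y [hX hY Wv]]] := closure_box cw d0.
have a := hd X Y hX hY; have b := chamber_sign Xz Wv Wll.
set v := PP l (_ +i* _) in a b.
have v0 : v != 0 by apply/eqP => e; move: a; rewrite e mul0r ltxx.
have : 0 < (PP l w * PP l z) * v ^+ 2.
  have -> : (PP l w * PP l z) * v ^+ 2 = (v * PP l w) * (v * PP l z) by ring.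
  exact: mulr_gt0.
by rewrite pmulr_lgt0 ?exprn_even_gt0 // => /ltW.
Qed.

(** The vectors are proportional, expressed through the equations of their geodesics. *)
Definition same_wall (l l0 : M2) : Prop := exists s : R, forall z, PP l z = s * PP l0 z.

Section ARC.
Variables (l0 : M2) (z0 : C).
Hypotheses (Q0 : 0 < QR N%:R (ca R N l0) (cb R N l0) (cc R l0)) (hz0 : 0 < complex.Im z0) (Pz0 : PP l0 z0 = 0).

(** If b = c = 0 then Q = 0. *)
Lemma dir_neq0 : 0 < (cc R l0 * N%:R) ^+ 2 + cb R N l0 ^+ 2.
Proof.
rewrite lt0r addr_ge0 ?sqr_ge0 // andbT paddr_eq0 ?sqr_ge0 // !sqrf_eq0; apply/negP => /andP[/eqP c0 /eqP b0].
move: Q0; rewrite /QR b0; have -> : cc R l0 = 0 by apply/eqP; move/eqP: c0; rewrite mulf_eq0 (gt_eqF n0) orbF.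
by rewrite mulr0 expr0n mul0r subr0 ltxx.
Qed.

(** A point of the geodesic of l0 near z0: move by t along the line in the
    coordinates (x, |z|^2), whose direction is (cN, b), and solve for y. *)
Lemma arc_point (d : R) : 0 < d -> exists X Y (t : R), [/\ `|X| <= d, `|Y| <= d, 0 < complex.Im z0 + Y &
  [/\ t != 0, X = t * (cc R l0 * N%:R),
   (complex.Re z0 + X) ^+ 2 + (complex.Im z0 + Y) ^+ 2 = complex.Re z0 ^+ 2 + complex.Im z0 ^+ 2 + t * cb R N l0 &
   PP l0 ((complex.Re z0 + X) +i* (complex.Im z0 + Y)) = 0]].
Proof.
move=> d0; move: Pz0 hz0; case: z0 => x y; rewrite /PP /= => Pz y0.
pose cn := cc R l0 * N%:R; pose b := cb R N l0.
pose M1 := `|b| + `|2 * x * cn| + cn ^+ 2 + `|cn|.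
have M10 : 0 <= M1 by rewrite !addr_ge0 ?sqr_ge0.
pose m := Num.min d (Num.min (d * y) (y ^+ 2 / 2)).
have m0 : 0 < m by rewrite !lt_min d0 mulr_gt0 // divr_gt0 // exprn_gt0.
pose t := Num.min 1 (m / (M1 + 1)).
have t0 : 0 < t by rewrite lt_min ltr01 divr_gt0 // ltr_wpDl.
have t1 : t <= 1 by rewrite ge_min lexx.
have tM : t * M1 <= m.
  apply: (@le_trans _ _ (m / (M1 + 1) * (M1 + 1))); last by rewrite divfK // gt_eqF // ltr_wpDl.
  by rewrite ler_pM ?(ltW t0) // ?lerDl // ge_min lexx orbT.
(* u is the square of the new imaginary part *)
pose u := y ^+ 2 + t * b - 2 * x * (t * cn) - (t * cn) ^+ 2.
have hu : `|u - y ^+ 2| <= m.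
  apply: le_trans tM; have -> : u - y ^+ 2 = t * b - t * (2 * x * cn) - t * (t * cn ^+ 2) by rewrite /u; ring.
  apply: le_trans (ler_normB _ _) _; apply: le_trans (lerD (ler_normB _ _) (lexx _)) _.
  have e1 : `|t * b| = t * `|b| by rewrite normrM gtr0_norm.
  have e2 : `|t * (2 * x * cn)| = t * `|2 * x * cn| by rewrite normrM gtr0_norm.
  have e3 : `|t * (t * cn ^+ 2)| <= t * cn ^+ 2.
    have c2 : 0 <= cn ^+ 2 by exact: sqr_ge0.
    have tc : t * cn ^+ 2 <= cn ^+ 2 by rewrite -[leRHS]mul1r ler_wpM2r.
    have tc0 : 0 <= t * cn ^+ 2 by apply: mulr_ge0 => //; exact: ltW.
    rewrite ger0_norm; last by apply: mulr_ge0 => //; exact: ltW.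
    by apply: ler_wpM2l => //; exact: ltW.
  have e4 : 0 <= t * `|cn| by rewrite mulr_ge0 // ltW.
  have -> : t * M1 = t * `|b| + t * `|2 * x * cn| + t * cn ^+ 2 + t * `|cn| by rewrite /M1; ring.
  lra.
have u0 : 0 < u.
  move: hu; rewrite ler_norml => /andP[hu _]; have : m <= y ^+ 2 / 2 by rewrite !ge_min lexx !orbT.
  have : 0 < y ^+ 2 by rewrite exprn_gt0.
  lra.
have s0 : 0 < Num.sqrt u by rewrite sqrtr_gt0.
have su : Num.sqrt u ^+ 2 = u by rewrite sqr_sqrtr // ltW.
exists (t * cn), (Num.sqrt u - y), t; split.
- rewrite normrM (gtr0_norm t0); apply: (@le_trans _ _ m); last by rewrite ge_min lexx.
  by apply: le_trans tM; rewrite ler_wpM2l ?(ltW t0) // /M1 lerDr !addr_ge0 ?sqr_ge0.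
- have sy : 0 < Num.sqrt u + y by rewrite addr_gt0.
  have e : (Num.sqrt u - y) * (Num.sqrt u + y) = u - y ^+ 2 by rewrite -subr_sqr su.
  have : `|Num.sqrt u - y| * (Num.sqrt u + y) <= d * y.
    rewrite -[X in _ * X](gtr0_norm sy) -normrM e (le_trans hu) // !ge_min lexx ?orbT //.
  move=> h; have h2 : `|Num.sqrt u - y| * y <= d * y.
    by apply: le_trans h; rewrite ler_wpM2l // lerDr ltW.
  by move: h2; rewrite ler_pM2r.
- by rewrite addrC subrK.
split => //; first by rewrite gt_eqF.
- rewrite [y + _]addrC subrK su /u -/cn -/b; ring.
- rewrite [y + _]addrC subrK su /u -/cn -/b.
  have -> : cn * ((x + t * cn) ^+ 2 + (y ^+ 2 + t * b - 2 * x * (t * cn) - (t * cn) ^+ 2)) - b * (x + t * cn) + ca R N l0 =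
    cn * (x ^+ 2 + y ^+ 2) - b * x + ca R N l0 by ring.
  exact: Pz.
Qed.

(** A line is determined by two points. For t nonzero the two points on the
    geodesic of l0 differ by a nonzero multiple of its direction. *)
Lemma two_points X Y t l : t != 0 -> X = t * (cc R l0 * N%:R) ->
   (complex.Re z0 + X) ^+ 2 + (complex.Im z0 + Y) ^+ 2 = complex.Re z0 ^+ 2 + complex.Im z0 ^+ 2 + t * cb R N l0 ->
   PP l z0 = 0 -> PP l ((complex.Re z0 + X) +i* (complex.Im z0 + Y)) = 0 -> same_wall l l0.
Proof.
move=> t0 eX eN P1; rewrite {1}/PP [complex.Re (_ +i* _)]/= [complex.Im (_ +i* _)]/= eN => P2.
pose cn := cc R l0 * N%:R; pose b := cb R N l0; pose c1 := cc R l * N%:R; pose b1 := cb R N l.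
have D0 := dir_neq0; rewrite -/cn -/b in D0.
have e1 : c1 * b = b1 * cn.
  apply: (mulfI t0); move: P1 P2; rewrite /PP -/c1 -/b1 -/b eX -/cn => P1 P2.
  apply/eqP; rewrite -subr_eq0; apply/eqP.
  rewrite -[RHS](subrr 0) -{1}P2 -P1; ring.
pose s := (c1 * cn + b1 * b) / (cn ^+ 2 + b ^+ 2).
have D0' : cn ^+ 2 + b ^+ 2 != 0 by rewrite gt_eqF.
have eD : s * (cn ^+ 2 + b ^+ 2) = c1 * cn + b1 * b by rewrite /s divfK.
have ec : c1 = s * cn.
  apply: (mulfI D0'); have -> : (cn ^+ 2 + b ^+ 2) * (s * cn) = (s * (cn ^+ 2 + b ^+ 2)) * cn by ring.
  rewrite eD; have -> : (cn ^+ 2 + b ^+ 2) * c1 = c1 * cn * cn + b * (c1 * b) by ring.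
  by rewrite e1; ring.
have eb : b1 = s * b.
  apply: (mulfI D0'); have -> : (cn ^+ 2 + b ^+ 2) * (s * b) = (s * (cn ^+ 2 + b ^+ 2)) * b by ring.
  rewrite eD; have -> : (cn ^+ 2 + b ^+ 2) * b1 = b1 * b * b + cn * (b1 * cn) by ring.
  by rewrite -e1; ring.
have ea : ca R N l = s * ca R N l0.
  have q1 : ca R N l = - (c1 * (complex.Re z0 ^+ 2 + complex.Im z0 ^+ 2) - b1 * complex.Re z0).
    by apply/eqP; rewrite -addr_eq0 addrC; apply/eqP; exact: P1.
  have q2 : ca R N l0 = - (cn * (complex.Re z0 ^+ 2 + complex.Im z0 ^+ 2) - b * complex.Re z0).
    by apply/eqP; rewrite -addr_eq0 addrC; apply/eqP; exact: Pz0.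
  by rewrite q1 q2 ec eb; ring.
by exists s => z; rewrite /PP -/c1 -/b1 -/cn -/b ea ec eb; ring.
Qed.
End ARC.

Section ADJ.
Variables (z1 z2 : C) (l0 : M2) (z0 : C).
Hypotheses (X1 : regular z1) (X2 : regular z2) (W12 : chamber z1 <> chamber z2) (Wl0 : Wl l0).
Hypotheses (hz0 : 0 < complex.Im z0) (Pz0 : PP l0 z0 = 0).
Hypothesis arc : \forall z \near z0, 0 < complex.Im z -> PP l0 z = 0 -> closure (chamber z1) z /\ closure (chamber z2) z.

Lemma arc_z0 : closure (chamber z1) z0 /\ closure (chamber z2) z0.
Proof. exact: (nbhs_singleton arc). Qed.

(** The common boundary contains an arc, hence two distinct points of the wall. *)
Lemma vanish_same_wall l : (forall z, 0 < complex.Im z -> closure (chamber z1) z -> closure (chamber z2) z -> PP l z = 0) -> same_wall l l0.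
Proof.
move=> h; have /nbhsC_box[d d0 hd] := arc.
have [X [Y [t [hX hY yp [t0 eX eN P0]]]]] := arc_point hz0 Pz0 d0.
have [c1 c2] := hd X Y hX hY yp P0; have [a1 a2] := arc_z0.
have v1 : PP l z0 = 0 by apply: h.
have v2 : PP l ((complex.Re z0 + X) +i* (complex.Im z0 + Y)) = 0 by apply: h.
exact: (two_points (WlQ0 Wl0) Pz0 t0 eX eN v1 v2).
Qed.

(** PP is weakly of one sign on the first closure and weakly of the other on the second. *)
Lemma closure_opp l z : Wl l -> PP l z1 * PP l z2 < 0 -> closure (chamber z1) z -> closure (chamber z2) z -> PP l z = 0.
Proof.
move=> Wll hlt c1 c2; have a := closure_sign X1 c1 Wll; have b := closure_sign X2 c2 Wll.
apply/eqP; rewrite -sqrf_eq0 eq_le sqr_ge0 andbT leNgt; apply/negP => h.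
have : 0 <= (PP l z * PP l z1) * (PP l z * PP l z2) by rewrite mulr_ge0.
have -> : (PP l z * PP l z1) * (PP l z * PP l z2) = PP l z ^+ 2 * (PP l z1 * PP l z2) by ring.
by rewrite pmulr_rge0 // leNgt hlt.
Qed.

Lemma sep_same_wall l : Wl l -> PP l z1 * PP l z2 < 0 -> same_wall l l0.
Proof. by move=> Wll hlt; apply: vanish_same_wall => z _; exact: closure_opp. Qed.

(** Distinct chambers differ in some sign, and any vector that separates them
    spans the same wall as l0. *)
Lemma wall_separates : PP l0 z1 * PP l0 z2 < 0.
Proof.
have [[l [Wll hl]]|hn] := pselect (exists l, Wl l /\ PP l z1 * PP l z2 < 0).
  have [s hs] := sep_same_wall Wll hl; move: hl; rewrite !hs.
  have -> : s * PP l0 z1 * (s * PP l0 z2) = s ^+ 2 * (PP l0 z1 * PP l0 z2) by ring.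
  have [->|s0] := eqVneq s 0; first by rewrite expr0n mul0r ltxx.
  by rewrite pmulr_rlt0 // exprn_even_gt0.
exfalso; apply: W12.
have h : chamber z1 z2.
  apply: chamber_conv => // l Wll; have [[_ n1] [_ n2]] := (X1, X2).
  have : PP l z2 * PP l z1 != 0 by rewrite mulf_neq0 ?n1 ?n2.
  by rewrite neq_lt => /orP[h|//]; case: hn; exists l; split => //; rewrite mulrC.
exact: same_connected_component.
Qed.

Lemma same_wall_sep l : Wl l -> same_wall l l0 -> PP l z1 * PP l z2 < 0.
Proof.
move=> Wll [s hs]; rewrite !hs.
have -> : s * PP l0 z1 * (s * PP l0 z2) = s ^+ 2 * (PP l0 z1 * PP l0 z2) by ring.
rewrite pmulr_rlt0 ?wall_separates // exprn_even_gt0 //=; apply/eqP => s0.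
have [_ /(_ l Wll)] := X1; by rewrite hs s0 mul0r eqxx.
Qed.

Lemma same_wall_vanish l z : same_wall l l0 -> closure (chamber z1) z -> closure (chamber z2) z -> PP l z = 0.
Proof. by move=> [s hs] c1 c2; rewrite hs (closure_opp Wl0 wall_separates c1 c2) mulr0. Qed.

End ADJ.
End CHAMBERS.
End GEO.

(** * Analytic extension across a wall *)

Section ASM.
Variable R : realType.
Local Notation C := R[i].
Local Notation M2 := 'M[rat]_2.

Section SPREAD.
Variable d : C -> C.
(** Analyticity at a point. *)
Definition ANat (z : C) : Prop := exists r M : R, 0 < r /\ AN r M (fun X Y => d ((complex.Re z + X) +i* (complex.Im z + Y))).

(** Recentre the power series at a nearby point where the function vanishes, and
    apply the identity theorem on the box around it, which contains the
    original point. *)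
Lemma zero_spread z : ANat z -> (forall e : R, 0 < e -> exists X Y, [/\ `|X| <= e, `|Y| <= e &
    \forall w \near ((complex.Re z + X) +i* (complex.Im z + Y)), d w = 0]) -> \forall w \near z, d w = 0.
Proof.
move=> [r [M [r0 hA]]] h; have r4 : 0 < r / 4 by rewrite divr_gt0.
have [X [Y [hX hY /nbhsC_box[e e0 he]]]] := h _ r4.
have r42 : r / 4 <= r / 2 by rewrite ler_wpM2l ?(ltW r0) // lef_pV2 ?posrE // ler_nat.
have A2 := AN_shift r0 hA (le_trans hX r42) (le_trans hY r42).
have r2 : 0 < r / 2 by rewrite divr_gt0.
have Z : forall U V, `|U| <= r / 2 -> `|V| <= r / 2 -> d ((complex.Re z + (X + U)) +i* (complex.Im z + (Y + V))) = 0.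
  apply: (@AN_zero R (r / 2) M _ (Num.min e (r / 2))) A2 _; first by rewrite lt_min e0 r2 ge_min lexx orbT.
  move=> U V; rewrite !le_min => /andP[u1 _] /andP[v1 _].
  by have := he U V u1 v1; rewrite /= !addrA.
apply/nbhsC_box; exists (r / 4) => // U V hU hV.
have e4 : r / 2 = r / 4 + r / 4 by field.
have := Z (U - X) (V - Y); rewrite ![X + _]addrC ![Y + _]addrC !subrK; apply.
  by rewrite e4 (le_trans (ler_normB _ _)) // lerD.
by rewrite e4 (le_trans (ler_normB _ _)) // lerD.
Qed.

Lemma zero_closure (W : set C) z : (forall w, W w -> \forall v \near w, d v = 0) -> ANat z -> closure W z -> \forall w \near z, d w = 0.
Proof.
move=> hW hz cz; apply: zero_spread => // e e0.
by have [X [Y [hX hY Ww]]] := closure_box cz e0; exists X, Y; split => //; exact: hW.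
Qed.

(** The points near which the function vanishes form an open and relatively closed
    subset. *)
Lemma zero_connected (W : set C) : connected W -> (forall w, W w -> ANat w) -> (exists2 w, W w & \forall v \near w, d v = 0) ->
  forall w, W w -> \forall v \near w, d v = 0.
Proof.
move=> cW hA [w0 Ww0 hw0].
pose B : set C := W `&` interior [set z | d z = 0].
have key : closure B `&` W `<=` B.
  move=> w [cw Ww].
  have hB v : B v -> \forall u \near v, d u = 0 by move=> [_ hv]; exact: hv.
  have hw := hA w Ww.
  have h : \forall v \near w, d v = 0.
    exact: (@zero_closure B w hB hw cw).
  by split; [exact: Ww|exact: h].
have BW : B = W.
  apply: cW; first by exists w0.
  - by exists (interior [set z | d z = 0]) => //; exact: open_interior.
  - exists (closure B); first exact: closed_closure.
    apply/seteqP; split => w; first by move=> Bw; split; [case: Bw|exact: subset_closure].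
    by move=> [Ww cw]; apply: key; split.
by move=> w; rewrite -{1}BW => -[].
Qed.
End SPREAD.

Variables (N k : nat) (hN : (0 < N)%N) (hk : (0 < k)%N) (Delta r : int) (D0 : Delta != 0).
Variables (f : C -> 'cV[C]_(2 * N)) (c : rat -> 'I_(2 * N) -> C).
Hypothesis cf : forall h z, 0 < complex.Im z -> {for z, continuous (fun tau => f tau h 0)}.
Hypothesis hc : principal_part Delta f c.
Variable opp : 'I_(2 * N) -> 'I_(2 * N).
Hypothesis oppK : involutive opp.
Local Notation Ch := (Ch Delta r c).
Hypothesis Csym : forall h l, Ch (opp h) (- l) = (-1) ^+ k * Ch h l.
Local Notation wl := (@wall_vectors R N Delta r c).
Local Notation Phi := (Phi k Delta r f).
Local Notation PP := (@PP R N).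
Let Da : R := `|Delta|%:~R.
Let Dq : (`|Delta|%:~R : rat) != 0. Proof. by rewrite intr_eq0 normr_eq0. Qed.
Let Dqp : 0 < (`|Delta|%:~R : rat). Proof. by rewrite ltr0z normr_gt0. Qed.

Definition QRl (l : M2) : R := QR N%:R (ca R N l) (cb R N l) (cc R l).

Lemma QRl_ratr l : tr0 l -> QRl l = ratr (Q N l).
Proof. by move=> t; rewrite (Q_E R hN t). Qed.

Lemma exp_Lam (h : 'I_(2 * N)) l m : lattice_coset r h l -> Q N l = - (`|Delta|%:~R * m) -> exponents Delta h m -> Lam Delta r h l.
Proof.
move=> hl hQ /intrP[n hn]; split => //; have [e1 e2] := sgz_norm D0.
exists (- (sgz Delta * n)); rewrite hQ e1 mulrN intrN !intrM -hn.
set s := (sgz Delta)%:~R in e2 *; set D := Delta%:~R.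
have -> : - (D * (s * (m + s * Q N (rep h)))) = - (D * (s * m) + D * (s * s) * Q N (rep h)) by ring.
by rewrite e2 mulr1 opprD; congr (_ + _); ring.
Qed.

Lemma wl_Ch l : wl l -> 0 < Q N l /\ exists h, Ch h l != 0.
Proof.
move=> [h [m [hl hQ em m0 /andP[c0 x0]]]]; split.
  by rewrite hQ oppr_gt0 pmulr_rlt0.
exists h; have mE : - (Q N l / `|Delta|%:~R) = m by rewrite hQ mulNr opprK mulrC mulKf.
rewrite /Ch mE mulf_neq0 //; last first.
  by rewrite /chih asboolT ?intr_eq0 //; exact: exp_Lam hl hQ em.
have mM : m \in Ms Delta c h by apply/(in_Ms hc); split => //; exact: ltW.
rewrite (big_rem m mM) /= eqxx big_seq_cond big1 ?addr0 // => m' /andP[h1 /eqP h2].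
by move: h1; rewrite mem_rem_uniq ?fset_uniq // inE h2 eqxx.
Qed.

Lemma Ch_facts h l : Ch h l != 0 -> [/\ Lint N l, lattice_coset r h l & exists m, [/\ m \in Ms Delta c h, Q N l = - (`|Delta|%:~R * m) & genus_character N Delta l != 0]].
Proof.
rewrite /Ch mulf_eq0 negb_or => /andP[h1 h2].
have hl : Lam Delta r h l by move: h2; rewrite /chih; case: asboolP => //; rewrite eqxx.
split; [exact: (Lam_Lint hN hl)|by case: hl|].
have [m mM me] : exists2 m, m \in Ms Delta c h & m = - (Q N l / `|Delta|%:~R).
  apply: contrapT => hn; move: h1; rewrite big_seq_cond big1 ?eqxx // => m /andP[mM /eqP e].
  by exfalso; apply: hn; exists m.
exists m; split => //; first by rewrite me mulrN opprK mulrC divfK.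
by move: h2; rewrite /chih asboolT // intr_eq0.
Qed.

Lemma Ch_wl h l : Ch h l != 0 -> Q N l != 0 -> wl l.
Proof.
move=> c0 q0; have [Ll hl [m [mM hQ x0]]] := Ch_facts c0.
have [em m0 cm0] := (in_Ms hc h m).1 mM.
exists h, m; split => //; last by rewrite cm0.
by rewrite lt_neqAle m0 andbT; apply/eqP => e; move: q0; rewrite hQ e mulr0 oppr0 eqxx.
Qed.

Lemma wl_Lint l : wl l -> Lint N l.
Proof. by move=> /wl_Ch[_ [h /Ch_facts[]]]. Qed.

(** The symmetry of the coefficients makes the set of walls stable under negation. *)
Lemma wl_opp l : wl l -> wl (- l).
Proof.
move=> wll; have [q0 [h c0]] := wl_Ch wll; apply: (@Ch_wl (opp h)).
  by rewrite Csym mulf_neq0 // signr_eq0.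
have -> : Q N (- l) = Q N l by rewrite /Q !det_mx2 !mxE !mulrNN.
by rewrite gt_eqF.
Qed.

Lemma wl_Q0 l : wl l -> 0 < QRl l.
Proof. by move=> wll; have [tl _ _ _] := wl_Lint wll; rewrite QRl_ratr // ltr0q; have [] := wl_Ch wll. Qed.

(** The principal part has finitely many exponents. *)
Lemma wl_Qm : exists Qm, forall l, wl l -> QRl l <= Qm.
Proof.
exists (\sum_h \sum_(m <- Ms Delta c h) `|ratr (`|Delta|%:~R * m) : R|) => l wll.
have [tl _ _ _] := wl_Lint wll; have [_ [h /Ch_facts[_ _ [m [mM hQ _]]]]] := wl_Ch wll.
rewrite QRl_ratr // hQ (bigD1 h) //= (big_rem m mM) /= rmorphN.
apply: le_trans (ler_norm _) _; rewrite normrN -!addrA lerDl addr_ge0 //; first by apply: sumr_ge0.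
by apply: sumr_ge0 => h' _; apply: sumr_ge0.
Qed.

Lemma regularE : @upper_half_plane R `\` exceptional_set Delta r c = regular N wl.
Proof.
apply/seteqP; split => z.
  move=> [hz nz]; split => // l wll; apply/eqP => P0; apply: nz; exists l => //; split => //.
move=> [hz nz]; split => // -[l wll [_ P0]]; by move: (nz l wll); rewrite /PP P0 eqxx.
Qed.

Lemma ell0_PP l : ell R N l = 0 -> forall z, PP l z = 0.
Proof.
move=> h z; have : `|ca R N l| + `|cb R N l| + `|cc R l| == 0 by apply/eqP.
rewrite !paddr_eq0 ?addr_ge0 // !normr_eq0 => /andP[/andP[/eqP a0 /eqP b0] /eqP c0].
by rewrite /PP a0 b0 c0 !mul0r subr0 addr0.
Qed.

(** The linear form of an isotropic vector has no zero in the upper half plane,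
    by positivity of the majorant. So vectors with Q = 0, which occur for m = 0, produce no jump. *)
Lemma isotropic_sign l z w : Q N l = 0 -> Lint N l -> 0 < complex.Im z -> 0 < complex.Im w -> Num.sg (PP l z) = Num.sg (PP l w).
Proof.
move=> q0 Ll hz hw; have [tl _ _ _] := Ll.
have [e0|e0] := eqVneq (ell R N l) 0; first by rewrite !ell0_PP.
have nz v : 0 < complex.Im v -> PP l v != 0.
  move=> hv; apply/eqP => P0; have n0 : 0 < N%:R :> R by rewrite ltr0n.
  have [ka [ka0 hka]] := quad_pos (complex.Re v) n0 hv.
  have := hka (ca R N l) (cb R N l) (cc R l); rewrite -/(QRl l) QRl_ratr // q0 rmorph0 add0r.
  have -> : pR N%:R (complex.Re v) (complex.Im v) (ca R N l) (cb R N l) (cc R l) = 0.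
    by rewrite /pR -/(PP l v) P0 mul0r oppr0.
  rewrite expr0n pmulr_rle0 // => h; have := exprn_even_gt0 (ell R N l) (erefl : ~~ odd 2).
  by rewrite e0 /= => h2; move: h; rewrite -/(ell R N l) leNgt h2.
have := PP_const_sign nz hz hw.
have [p|p|p] := ltrgtP (PP l z) 0; last by move: (nz z hz); rewrite p eqxx.
  by rewrite nmulr_rgt0 // => p2; rewrite !ltr0_sg.
by rewrite pmulr_rgt0 // => p2; rewrite !gtr0_sg.
Qed.

Definition sp (z : C) (l : M2) : C := (Num.sg (p_z N z l))%:C.
(** Phi with every sgn p_z(lambda) in its local form replaced by the sign on the
    chamber of z1. *)
Definition chamber_ext (z1 z : C) : C := Phi z + (Num.sqrt (Da / 2))%:C * \sum_h Ssum (fun l => Ch h l * q_z N z l ^+ k.-1 * (sp z1 l - sp z l)).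

Lemma sp_eq z w l : tr0 l -> 0 < complex.Im z -> 0 < complex.Im w -> Num.sg (PP l z) = Num.sg (PP l w) -> sp z l = sp w l.
Proof. by move=> tl hz hw e; rewrite /sp !(sg_p hN tl) // e. Qed.

Lemma sg_mul_gt0 (a b : R) : 0 < a * b -> Num.sg a = Num.sg b.
Proof.
have [p|p|->] := ltrgtP a 0; last by rewrite mul0r ltxx.
  by rewrite nmulr_rgt0 // => p2; rewrite !ltr0_sg.
by rewrite pmulr_rgt0 // => p2; rewrite !gtr0_sg.
Qed.

(** Only vectors that span walls contribute to a change of signs. *)
Lemma Ch_term0 h l z w (x : C) : 0 < complex.Im z -> 0 < complex.Im w -> (wl l -> Num.sg (PP l w) = Num.sg (PP l z)) -> Ch h l * x * (sp z l - sp w l) = 0.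
Proof.
move=> hz hw hs; have [->|c0] := eqVneq (Ch h l) 0; first by rewrite !mul0r.
have [Ll _ _] := Ch_facts c0; have [tl _ _ _] := Ll.
have e : Num.sg (PP l z) = Num.sg (PP l w).
  have [q0|q0] := eqVneq (Q N l) 0; first exact: isotropic_sign.
  by rewrite hs //; exact: Ch_wl c0 q0.
by rewrite (sp_eq tl hz hw e) subrr mulr0.
Qed.

Lemma chamber_ext_in z1 w : regular N wl z1 -> chamber N wl z1 w -> chamber_ext z1 w = Phi w.
Proof.
move=> X1 W1; have [hz1 _] := X1; have [hw _] := chamber_sub W1.
rewrite /chamber_ext big1 ?mulr0 ?addr0 // => h _; apply: Ssum_eq; apply: hasS_ext (@hasS0 R _) => l.
apply: esym; apply: Ch_term0 => // wll; apply: sg_mul_gt0; exact: chamber_sign X1 W1 wll.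
Qed.

Lemma chamber_ext_fsum z1 z (F : {fset M2}) : 0 < complex.Im z1 -> 0 < complex.Im z -> (forall l, wl l -> l \notin F -> Num.sg (PP l z) = Num.sg (PP l z1)) ->
  chamber_ext z1 z = Phi z + (Num.sqrt (Da / 2))%:C * \sum_h \sum_(l <- F) Ch h l * q_z N z l ^+ k.-1 * (sp z1 l - sp z l).
Proof.
move=> h1 hz hF; rewrite /chamber_ext; congr (_ + _ * _); apply: eq_bigr => h _; apply: Ssum_eq; apply: hasS_fin => l lF.
by apply: Ch_term0 => // wll; exact: hF.
Qed.

(** The local form of Phi has the jumps sgn p_z(lambda); adding the correction
    turns them into the constants sgn p_z1(lambda) for the finitely many lambda in
    question. *)
Lemma chamber_ext_AN z1 z0 (d : R) (F : {fset M2}) : 0 < complex.Im z1 -> 0 < complex.Im z0 -> 0 < d ->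
  (forall l, wl l -> l \notin F -> forall X Y, `|X| <= d -> `|Y| <= d -> Num.sg (PP l ((complex.Re z0 + X) +i* (complex.Im z0 + Y))) = Num.sg (PP l z1)) ->
  ANat (chamber_ext z1) z0.
Proof.
move=> h1 hz d0 hF.
have [rr [S1 [rr0 rrz hS]]] := @theta_lift_local_form R N k hN Delta r D0 f c cf hc z0 hz.
have [M [A [hA hPhi]]] := hS (S1 `|` F)%fset (fsubsetUl _ _); set S := (S1 `|` F)%fset in hPhi.
have n0 : 0 < N%:R :> R by rewrite ltr0n.
have [K [r1 [K0 r10 r1y hK]]] := quad_AN (complex.Re z0) n0 hz.
pose ro := Num.min (Num.min rr d) r1.
have ro0 : 0 < ro by rewrite !lt_min rr0 d0.
have [ror rod ro1] : [/\ ro <= rr, ro <= d & ro <= r1] by rewrite /ro !ge_min !lexx !orbT.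
have hq l : exists M', AN ro M' (fun X Y => q_z N ((complex.Re z0 + X) +i* (complex.Im z0 + Y)) l ^+ k.-1).
  have rr1 : 0 < ro <= r1 by rewrite ro0.
  have [_ _ h3] := hK ro rr1 (ca R N l) (cb R N l) (cc R l).
  exists ((K * ell R N l) ^+ k.-1); apply: AN_exp => //.
  by apply: AN_ext h3 => X Y _ _; rewrite q_zE.
have [Mq hMq] := choice hq.
exists ro, (M + cabs (Num.sqrt (Da / 2))%:C * \sum_h \sum_(l <- S) cabs (Ch h l * sp z1 l) * Mq l); split => //.
have H : AN ro (M + cabs (Num.sqrt (Da / 2))%:C * \sum_h \sum_(l <- S) cabs (Ch h l * sp z1 l) * Mq l)
    (fun X Y => A X Y + (Num.sqrt (Da / 2))%:C * \sum_h \sum_(l <- S) (Ch h l * sp z1 l) * q_z N ((complex.Re z0 + X) +i* (complex.Im z0 + Y)) l ^+ k.-1).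
  apply: AN_D; first by apply: AN_shrink hA; rewrite (ltW ro0).
  by apply: AN_Z; apply: AN_sum => h _; apply: AN_sum => l _; apply: AN_Z; exact: hMq.
apply: AN_ext H => X Y hX hY.
have [X1 Y1] : `|X| <= rr /\ `|Y| <= rr by split; [exact: le_trans hX _|exact: le_trans hY _].
have hzz : 0 < complex.Im ((complex.Re z0 + X) +i* (complex.Im z0 + Y)).
  by move: Y1; rewrite /= ler_norml => /andP[Y1 _]; move: (complex.Im z0) rrz Y1 => y; lra.
rewrite (@chamber_ext_fsum z1 _ S) //; last first.
  move=> l wll; rewrite in_fsetU negb_or => /andP[_ lF]; apply: hF => //; [exact: le_trans hX _|exact: le_trans hY _].
rewrite (hPhi X Y X1 Y1) -addrA -mulrDr; congr (_ + _ * _); rewrite -big_split /=; apply: eq_bigr => h _.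
rewrite -big_split /=; apply: eq_bigr => l _; rewrite /sp; set q := _ ^+ k.-1; ring.
Qed.

Section PAIR.
Variables (z1 z2 : C) (l0 : M2) (zs : C).
Hypotheses (X1 : regular N wl z1) (X2 : regular N wl z2) (W12 : chamber N wl z1 <> chamber N wl z2) (Wl0 : wl l0).
Hypotheses (hzs : 0 < complex.Im zs) (Pzs : PP l0 zs = 0).
Hypothesis arc : \forall z \near zs, 0 < complex.Im z -> PP l0 z = 0 -> closure (chamber N wl z1) z /\ closure (chamber N wl z2) z.
Local Notation W1 := (chamber N wl z1).
Local Notation W2 := (chamber N wl z2).
Local Notation UU := (closure_H W1 `|` closure_H W2).

(** Vectors not proportional to l0 have the same sign on both chambers. *)
Lemma sep_sign l : wl l -> ~ same_wall R N l l0 -> Num.sg (PP l z1) = Num.sg (PP l z2).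
Proof.
move=> wll np; apply: sg_mul_gt0; have [[_ n1] [_ n2]] := (X1, X2).
have : PP l z1 * PP l z2 != 0 by rewrite mulf_neq0 ?n1 ?n2.
rewrite neq_lt => /orP[h|//]; exfalso; apply: np.
exact: (sep_same_wall hN wl_Q0 X1 X2 Wl0 hzs Pzs arc wll h).
Qed.

Lemma same_wall_finite : exists F : {fset M2}, forall l, wl l -> same_wall R N l l0 -> l \in F.
Proof.
have [Qm hQm] := wl_Qm.
have [d [F [d0 _ hF]]] := local_finite hN Qm hzs; exists F => l wll [s hs].
apply/negPn/negP => lF; have := hF l (wl_Lint wll) (hQm l wll) lF 0 0.
by rewrite normr0 (hs zs) Pzs mulr0 mulr0 ltxx => /(_ (ltW d0) (ltW d0)).
Qed.

(** At a point of either closure a wall vector outside a finite set is nonzero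
    nearby, with the sign it has on both chambers. *)
Lemma sgn_near z : UU z -> exists (d : R) (F : {fset M2}), 0 < d /\ forall l, wl l -> l \notin F -> forall X Y, `|X| <= d -> `|Y| <= d ->
   Num.sg (PP l ((complex.Re z + X) +i* (complex.Im z + Y))) = Num.sg (PP l z1) /\
   Num.sg (PP l ((complex.Re z + X) +i* (complex.Im z + Y))) = Num.sg (PP l z2).
Proof.
move=> Uz; have [Qm hQm] := wl_Qm; have hz : 0 < complex.Im z by case: Uz => -[].
have [d [F [d0 _ hF]]] := local_finite hN Qm hz; have [F' hF'] := same_wall_finite.
exists d, (F `|` F')%fset; split => // l wll; rewrite in_fsetU negb_or => /andP[lF lF'] X Y hX hY.
have e12 : Num.sg (PP l z1) = Num.sg (PP l z2).
  by apply: sep_sign => // hp; move: lF'; rewrite (hF' l wll hp).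
have h := hF l (wl_Lint wll) (hQm l wll) lF X Y hX hY.
rewrite (sg_mul_gt0 h); have n0 : PP l z != 0 by apply/eqP => e; move: h; rewrite e mulr0 ltxx.
suff e : Num.sg (PP l z) = Num.sg (PP l z1) by rewrite e.
case: Uz => -[cz _].
  have := closure_sign X1 cz wll; rewrite le_eqVlt eq_sym mulf_eq0 (negPf n0) /=.
  by have [_ /(_ l wll)/negPf ->] := X1; move=> /= /sg_mul_gt0.
have := closure_sign X2 cz wll; rewrite le_eqVlt eq_sym mulf_eq0 (negPf n0) /=.
by have [_ /(_ l wll)/negPf ->] := X2; move=> /= /sg_mul_gt0 ->; rewrite e12.
Qed.

Lemma chamber_ext_AN_closure z : UU z -> ANat (chamber_ext z1) z.
Proof.
move=> Uz; have [d [F [d0 h]]] := sgn_near Uz; have hz : 0 < complex.Im z by case: Uz => -[].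
have [h1 _] := X1.
by apply: (@chamber_ext_AN z1 z d F) => // l wll lF X Y hX hY; have [] := h l wll lF X Y hX hY.
Qed.

Lemma chamber_nbhs w : regular N wl z1 -> W1 w -> nbhs w W1.
Proof.
move=> _ Ww; have [Qm hQm] := wl_Qm.
have [d d0 hd] := chamber_open hN wl_Lint hQm X1 Ww; apply/nbhsC_box; exists d => // X Y hX hY; exact: hd.
Qed.

(** The difference of two extensions vanishes on the first chamber, hence on its closure,
    hence near a point of the common wall, hence on the second chamber and its closure. *)
Lemma ext_unique (g : C -> C) : (forall z, W1 z -> g z = Phi z) -> (forall z, UU z -> real_analytic_at g z) -> forall z, UU z -> g z = chamber_ext z1 z.
Proof.
move=> gW gA; have [d dE] : {d | forall z, d z = g z - chamber_ext z1 z} by exists (fun z => g z - chamber_ext z1 z).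
have dA z : UU z -> ANat d z.
  move=> Uz; have [r1 [M1 [r10 h1]]] := real_analytic_AN (gA z Uz).
  have [r2 [M2' [r20 h2]]] := chamber_ext_AN_closure Uz.
  pose ro := Num.min r1 r2; have ro0 : 0 < ro by rewrite lt_min r10.
  exists ro, (M1 + cabs (-1) * M2'); split => //.
  have H : AN ro (M1 + cabs (-1) * M2') (fun X Y => g ((complex.Re z + X) +i* (complex.Im z + Y)) + (-1) * chamber_ext z1 ((complex.Re z + X) +i* (complex.Im z + Y))).
    apply: AN_D; first by apply: AN_shrink h1; rewrite (ltW ro0) ge_min lexx.
    by apply: AN_Z; apply: AN_shrink h2; rewrite (ltW ro0) ge_min lexx orbT.
  by apply: AN_ext H => X Y _ _; rewrite mulN1r dE.
have d1 w : W1 w -> \forall v \near w, d v = 0.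
  move=> Ww; have := chamber_nbhs X1 Ww; apply: filterS => v Wv; by rewrite dE gW // chamber_ext_in // subrr.
have d1c w : closure_H W1 w -> \forall v \near w, d v = 0.
  by move=> [cw hw]; exact: (zero_closure d1 (dA w (or_introl (conj cw hw))) cw).
have [c1 c2] := arc_z0 hzs Pzs arc.
have hs : \forall v \near zs, d v = 0 by apply: d1c; split.
have d2 w : W2 w -> \forall v \near w, d v = 0.
  apply: zero_connected.
  - exact: component_connected.
  - by move=> v Wv; apply: dA; right; split; [exact: subset_closure|have [] := chamber_sub Wv].
  - have [e e0 he] := (nbhsC_box _ _).1 hs; have e2 : 0 < e / 2 by rewrite divr_gt0.
    have [X [Y [hX hY Ww]]] := closure_box c2 e2; exists ((complex.Re zs + X) +i* (complex.Im zs + Y)); first exact: Ww.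
    apply/nbhsC_box; exists (e / 2) => // U V hU hV; rewrite /= -!addrA; apply: he.
      by rewrite [e]splitr (le_trans (ler_normD _ _)) // lerD.
    by rewrite [e]splitr (le_trans (ler_normD _ _)) // lerD.
have d2c w : closure_H W2 w -> \forall v \near w, d v = 0.
  by move=> [cw hw]; exact: (zero_closure d2 (dA w (or_intror (conj cw hw))) cw).
move=> z Uz; apply/eqP; rewrite -subr_eq0; rewrite -dE.
apply/eqP; case: Uz => [/d1c|/d2c] hz; exact: nbhs_singleton hz.
Qed.

Lemma fset_filter_sum (I : choiceType) (V : nmodType) (A : {fset I}) (P : pred I) (g : I -> V) :
  \sum_(i <- [fset i in A | P i]%fset) g i = \sum_(i <- A | P i) g i.
Proof.
rewrite -[RHS]big_filter; apply: perm_big; apply: uniq_perm; first exact: fset_uniq.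
  by rewrite filter_uniq // fset_uniq.
by move=> i; rewrite mem_filter -[_ \in enum_fset _]/(i \in [fset i in A | P i]%fset) !inE andbC.
Qed.

Lemma z_eta (z : C) : (complex.Re z + 0) +i* (complex.Im z + 0) = z.
Proof. by case: z => a b; rewrite /= !addr0. Qed.

Lemma p_zN (z : C) l : p_z N z (- l) = - p_z N z l.
Proof.
rewrite /p_z /bil /embed; have -> : map_mx ratr (- l) = - map_mx ratr l :> 'M[R]_2 by apply/matrixP => i j; rewrite !mxE rmorphN.
by rewrite mulNmx raddfN /= mulrN.
Qed.

Lemma q_zN (z : C) l : q_z N z (- l) = - q_z N z l.
Proof.
rewrite /q_z; have -> : ratr (coef_a N (- l)) = - ratr (coef_a N l) :> C by rewrite /coef_a !mxE mulrN rmorphN.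
have -> : ratr (coef_b N (- l)) = - ratr (coef_b N l) :> C by rewrite /coef_b !mxE mulrN rmorphN.
have -> : ratr (coef_c (- l)) = - ratr (coef_c l) :> C by rewrite /coef_c !mxE rmorphN.
by move: (ratr (coef_a N l) : C) (ratr (coef_b N l) : C) (ratr (coef_c l) : C) => a' b' d'; ring.
Qed.

Lemma bil_p (z : C) l : bil N (embed R l) (lambda_of N z) = - p_z N z l.
Proof. by rewrite /p_z opprK. Qed.

Lemma p_gt0 (z : C) l : tr0 l -> 0 < complex.Im z -> (0 < p_z N z l) = (PP l z < 0).
Proof. by move=> tl hz; rewrite -sgr_gt0 (sg_p hN tl hz) oppr_gt0 sgr_lt0. Qed.

Lemma p_eq0 (z : C) l : tr0 l -> 0 < complex.Im z -> (p_z N z l == 0) = (PP l z == 0).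
Proof. by move=> tl hz; rewrite -sgr_eq0 (sg_p hN tl hz) oppr_eq0 sgr_eq0. Qed.

(** The index set of the inner sum in the wall-crossing formula. *)
Definition jump_vectors (h : 'I_(2 * N)) (m : rat) : set M2 := [set l | [/\ lattice_coset r h l, Q N l = - (`|Delta|%:~R * m),
   orthogonal_to N l (closure_H W1 `&` closure_H W2) & negative_on N l W1]].

(** Being orthogonal to an arc of the wall means being proportional to l0, and
    the sign on a chamber can be read off at one point. *)
Lemma jump_vectorsP h m l : m \in Ms Delta c h -> m < 0 -> genus_character N Delta l != 0 ->
  jump_vectors h m l <-> [/\ wl l /\ same_wall R N l l0, 0 < p_z N z1 l, lattice_coset r h l & Q N l = - (`|Delta|%:~R * m)].
Proof.
move=> mM m0 x0; have [em _ c0] := (in_Ms hc h m).1 mM; have [hz1 _] := X1.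
split.
  move=> [hl hQ ho hneg]; have wll : wl l by exists h, m; split => //; rewrite c0.
  have [tl _ _ _] := wl_Lint wll; split => //.
    split => //; apply: (vanish_same_wall hN wl_Q0 Wl0 hzs Pzs arc) => z hz c1 c2.
    have := ho z (conj (conj c1 hz) (conj c2 hz)); rewrite bil_p => /eqP; rewrite oppr_eq0 (p_eq0 tl hz) => /eqP //.
  have := hneg z1 (connected_component_refl X1); by rewrite bil_p oppr_lt0.
move=> [[wll hp] p0 hl hQ]; have [tl _ _ _] := wl_Lint wll; split => //.
  move=> z [[c1 hz] [c2 _]]; rewrite bil_p; apply/eqP; rewrite oppr_eq0 (p_eq0 tl hz).
  by apply/eqP; apply: (same_wall_vanish hN wl_Q0 X1 X2 W12 Wl0 hzs Pzs arc hp c1 c2).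
move=> w Ww; have [hw _] := chamber_sub Ww; rewrite bil_p oppr_lt0 (p_gt0 tl hw).
move: p0; rewrite (p_gt0 tl hz1) => p0.
by have := chamber_sign X1 Ww wll; rewrite nmulr_lgt0.
Qed.

(** The finite sums for the two chambers differ only in the vectors proportional
    to l0, whose signs are opposite on the two chambers. Pairing lambda with -lambda by the symmetry
    of the coefficients replaces the signed sum over all of them by twice the sum
    over those with positive p on the first chamber. *)
Lemma extension_jump z : UU z -> chamber_ext z1 z - chamber_ext z2 z = (2 * Num.sqrt (2 * `|Delta|%:~R) : R)%:C
  * \sum_h \sum_(m \in [set m | exponents Delta h m /\ m < 0]) c m h * \sum_(l \in jump_vectors h m) (genus_character N Delta l)%:~R * q_z N z l ^+ k.-1.
Proof.
move=> Uz; have hz : 0 < complex.Im z by case: Uz => -[].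
have [[hz1 nz1] [hz2 nz2]] := (X1, X2).
have [F hF] := same_wall_finite; pose F0 : {fset M2} := [fset l in F | `[< wl l /\ same_wall R N l l0 >]]%fset.
have inF0 l : (l \in F0) <-> (wl l /\ same_wall R N l l0).
  rewrite !inE; split; first by move=> /andP[_ /asboolP].
  by move=> h; apply/andP; split; [have [a b] := h; exact: hF|apply/asboolP].
have [d [F' [d0 hF']]] := sgn_near Uz.
have hF2 l : wl l -> l \notin F' -> Num.sg (PP l z) = Num.sg (PP l z1) /\ Num.sg (PP l z) = Num.sg (PP l z2).
  by move=> wll lF; have := hF' l wll lF 0 0; rewrite normr0 z_eta; apply; exact: ltW.
rewrite (@chamber_ext_fsum z1 z F') //; last by move=> l wll lF; have [] := hF2 l wll lF.
rewrite (@chamber_ext_fsum z2 z F') //; last by move=> l wll lF; have [] := hF2 l wll lF.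
rewrite opprD addrACA subrr add0r -mulrBr -sumrB.
pose q l := q_z N z l ^+ k.-1.
have E1 h : \sum_(l <- F') Ch h l * q_z N z l ^+ k.-1 * (sp z1 l - sp z l) - \sum_(l <- F') Ch h l * q_z N z l ^+ k.-1 * (sp z2 l - sp z l) =
   \sum_(l <- F0) 2 * (Ch h l * q l * sp z1 l).
  rewrite -sumrB.
  transitivity (\sum_(l <- F0) Ch h l * q l * (sp z1 l - sp z2 l)); last first.
    rewrite [LHS]big_seq [RHS]big_seq; apply: eq_bigr => l /inF0[wll hp]; have [tl _ _ _] := wl_Lint wll.
    have hlt := same_wall_sep hN wl_Q0 X1 X2 W12 Wl0 hzs Pzs arc wll hp.
    have -> : sp z2 l = - sp z1 l.
      rewrite /sp !(sg_p hN tl) // -rmorphN opprK; congr (_%:C); apply/eqP; rewrite eqr_oppLR; apply/eqP.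
      have [p|p|p] := ltrgtP (PP l z1) 0; last by move: hlt; rewrite p mul0r ltxx.
        by move: hlt; rewrite nmulr_rlt0 // => p2; rewrite (ltr0_sg p) (gtr0_sg p2) opprK.
      by move: hlt; rewrite pmulr_rlt0 // => p2; rewrite (gtr0_sg p) (ltr0_sg p2).
    by rewrite opprK; ring.
  transitivity (\sum_(l <- F') Ch h l * q l * (sp z1 l - sp z2 l)); first by apply: eq_bigr => l _; rewrite /q; set x := _ ^+ _; ring.
  apply: (@hasS_uniq R _ (fun l => Ch h l * q l * (sp z1 l - sp z2 l))); apply: hasS_fin => l lF; apply: Ch_term0 => // wll.
    by have [<- <-] := hF2 l wll lF.
  by apply: esym; apply: sep_sign => // hp; move: lF; rewrite (inF0 l).2.
under eq_bigr do rewrite E1 -mulr_sumr.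
rewrite -mulr_sumr.
pose SP := \sum_h \sum_(l <- F0 | 0 < p_z N z1 l) Ch h l * q l.
have pn l : l \in F0 -> p_z N z1 l != 0.
  by move=> /inF0[wll _]; have [tl _ _ _] := wl_Lint wll; rewrite p_eq0 // nz1.
have propN l : same_wall R N l l0 -> same_wall R N (- l) l0.
  move=> [s hs]; exists (- s) => w; rewrite mulNr -hs /PP /ca /cb /cc /coef_a /coef_b /coef_c !mxE !mulrN !rmorphN /=.
  by move: (ratr _) (ratr _) (ratr _) => a b e; ring.
have F0N l : (- l \in F0) = (l \in F0).
  apply/idP/idP => /inF0[w1 w2]; apply/inF0; last by split; [exact: wl_opp|exact: propN].
  by rewrite -[l]opprK; split; [exact: wl_opp|exact: propN].
have E2 : \sum_h \sum_(l <- F0) Ch h l * q l * sp z1 l = 2 * SP.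
  have Ep h : \sum_(l <- F0) Ch h l * q l * sp z1 l = \sum_(l <- F0 | 0 < p_z N z1 l) Ch h l * q l - \sum_(l <- F0 | ~~ (0 < p_z N z1 l)) Ch h l * q l.
    rewrite (bigID (fun l => 0 < p_z N z1 l)) /= -sumrN; congr (_ + _).
      by apply: eq_bigr => l p; rewrite /sp gtr0_sg // mulr1.
    rewrite [LHS]big_seq_cond [RHS]big_seq_cond; apply: eq_bigr => l /andP[/pn n0]; rewrite -leNgt => p.
    by rewrite /sp ltr0_sg ?lt_neqAle ?n0 // rmorphN1 mulrN1.
  have En h : \sum_(l <- F0 | ~~ (0 < p_z N z1 l)) Ch (opp h) l * q l = - \sum_(l <- F0 | 0 < p_z N z1 l) Ch h l * q l.
    have pm : perm_eq (enum_fset F0) [seq - l | l <- enum_fset F0].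
      apply: uniq_perm; first exact: fset_uniq.
        by rewrite map_inj_uniq ?fset_uniq //; exact: oppr_inj.
      move=> l; apply/idP/mapP => [lF|[l' lF ->]]; last by rewrite -[_ \in enum_fset _]/(- l' \in F0) F0N.
      by exists (- l); rewrite ?opprK // -[_ \in enum_fset _]/(- l \in F0) F0N.
    rewrite (perm_big _ pm) big_map -sumrN [LHS]big_seq_cond [RHS]big_seq_cond.
    apply: eq_big => [l|l /andP[lF _]].
      apply: andb_id2l => lF; rewrite p_zN oppr_gt0 -leNgt le_eqVlt eq_sym (negPf (pn l lF)) //.
    rewrite Csym /q q_zN [(- q_z N z l) ^+ _]exprNn; set x := q_z N z l ^+ k.-1.
    have sk : ((-1) ^+ k : C) = - (-1) ^+ k.-1 by rewrite -{1}(prednK hk) exprS mulN1r.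
    have s2 : ((-1) ^+ k.-1 : C) * (-1) ^+ k.-1 = 1 by rewrite -exprD addnn -signr_odd odd_double.
    transitivity (- (Ch h l * x) * ((-1) ^+ k.-1 * (-1) ^+ k.-1)); last by rewrite s2 mulr1.
    rewrite sk; move: ((-1) ^+ k.-1 : C) (Ch h l) => y u; ring.
  under eq_bigr do rewrite Ep.
  rewrite sumrB -/SP.
  have -> : \sum_h \sum_(l <- F0 | ~~ (0 < p_z N z1 l)) Ch h l * q l = - SP.
    rewrite (reindex_inj (can_inj oppK)) /= /SP -sumrN; apply: eq_bigr => h _; exact: En.
  by rewrite opprK mulr_natl mulr2n.
rewrite E2.
have E3 : \sum_h \sum_(m \in [set m | exponents Delta h m /\ m < 0]) c m h * (\sum_(l \in jump_vectors h m) (genus_character N Delta l)%:~R * q_z N z l ^+ k.-1) = SP.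
  rewrite /SP; apply: eq_bigr => h _.
  rewrite (@fsbig_fset _ _ _ [fset m in Ms Delta c h | m < 0]%fset); first last.
  - move=> m [em m0] mF; suff -> : c m h = 0 by rewrite mul0r.
    apply/eqP/negPn/negP => c0; move: mF; rewrite !inE m0 andbT => /negP; apply.
    by apply/(in_Ms hc); split => //; exact: ltW.
  - by move=> m; rewrite !inE => /andP[/(in_Ms hc)[] a b d1 m0].
  rewrite fset_filter_sum.
  have E4 m : m \in Ms Delta c h -> m < 0 -> c m h * (\sum_(l \in jump_vectors h m) (genus_character N Delta l)%:~R * q_z N z l ^+ k.-1) =
     \sum_(l <- F0 | 0 < p_z N z1 l) (if `[< lattice_coset r h l /\ Q N l = - (`|Delta|%:~R * m) >] then c m h * ((genus_character N Delta l)%:~R * q l) else 0).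
    move=> mM m0; pose PL l := [&& 0 < p_z N z1 l, `[< lattice_coset r h l /\ Q N l = - (`|Delta|%:~R * m) >] & genus_character N Delta l != 0].
    rewrite (@fsbig_fset _ _ _ [fset l in F0 | PL l]%fset); first last.
    - move=> l Tl lF; have [->|x0] := eqVneq (genus_character N Delta l) 0; first by rewrite mul0r.
      exfalso; move: lF => /negP; apply; have [hp p0 hl hQ] := (jump_vectorsP mM m0 x0).1 Tl.
      by rewrite in_fset /=; apply/andP; split; [exact/inF0|rewrite /PL p0 x0 asboolT].
    - move=> l; rewrite in_fset /= => /andP[lF /and3P[p0 /asboolP[hl hQ] x0]].
      by apply/(jump_vectorsP mM m0 x0); split => //; exact/inF0.
    rewrite fset_filter_sum mulr_sumr [LHS]big_mkcond [RHS]big_mkcond; apply: eq_bigr => l _; rewrite /PL.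
    case: (0 < p_z N z1 l) => //=; case: asboolP => //= _; rewrite /q.
    by have [->|] := eqVneq (genus_character N Delta l) 0; rewrite //= mul0r mulr0.
  rewrite big_seq_cond (eq_bigr _ (fun m hm => E4 m (proj1 (andP hm)) (proj2 (andP hm)))) -big_seq_cond exchange_big /=.
  rewrite [LHS]big_seq_cond [RHS]big_seq_cond; apply: eq_bigr => l /andP[/inF0[wll _] _].
  have [Q0 _] := wl_Ch wll.
  rewrite /Ch !mulr_suml [LHS]big_mkcond [RHS]big_mkcond [LHS]big_seq [RHS]big_seq; apply: eq_bigr => m mM.
  have [em _ cm0] := (in_Ms hc h m).1 mM.
  have [me|me] := eqVneq m (- (Q N l / `|Delta|%:~R)).
    have hQ : Q N l = - (`|Delta|%:~R * m) by rewrite me mulrN opprK mulrC divfK.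
    have m0 : m < 0 by rewrite me oppr_lt0 divr_gt0.
    rewrite m0; case: asboolP => [[hl _]|hn].
      by rewrite /chih asboolT ?mulrA //; exact: exp_Lam hl hQ em.
    by rewrite /chih asboolF ?mulr0 ?mul0r // => -[hl _]; apply: hn.
  case: ifP => // m0; case: asboolP => // -[_ hQ]; move: me; rewrite hQ mulNr opprK mulrC mulKf // eqxx //.
have -> : Num.sqrt (2 * `|Delta|%:~R) = 2 * Num.sqrt (Da / 2) :> R.
  have -> : 2 * `|Delta|%:~R = 2 ^+ 2 * (Da / 2) :> R by rewrite /Da; field.
  by rewrite sqrtrM ?sqr_ge0 // sqrtr_sqr ger0_norm.
rewrite [X in _ = _ * X]E3 !rmorphM /=.
by have -> : (2 : R)%:C = 2 :> C; [rewrite rmorph_nat|ring].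
Qed.

End PAIR.
End ASM.

(** * Wall crossing, given the symmetry of the coefficients *)

Section FINAL.
Variable R : realType.
Local Notation C := R[i].
Local Notation M2 := 'M[rat]_2.
Variables (N k : nat) (hN : (0 < N)%N) (hk : (0 < k)%N) (Delta r : int) (D0 : Delta != 0).
Variables (f : C -> 'cV[C]_(2 * N)) (c : rat -> 'I_(2 * N) -> C).
Hypothesis cf : forall h z, 0 < complex.Im z -> {for z, continuous (fun tau => f tau h 0)}.
Hypothesis hc : principal_part Delta f c.
Variable opp : 'I_(2 * N) -> 'I_(2 * N).
Hypothesis oppK : involutive opp.
Hypothesis Csym : forall h l, Ch Delta r c (opp h) (- l) = (-1) ^+ k * Ch Delta r c h l.

(** The symmetry of the coefficients under (h, lambda) -> (opp h, -lambda)
    is the only arithmetic input. *)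
Theorem wall_crossing_of_symmetry (W1 W2 : set C)
  (hW1 : weyl_chamber Delta r c W1) (hW2 : weyl_chamber Delta r c W2)
  (hadj : adjacent_chambers Delta r c W1 W2) :
  let W12 := closure_H W1 `&` closure_H W2 in
  let U := closure_H W1 `|` closure_H W2 in
  let Phi := theta_lift Delta r k f in
  [/\ exists G, real_analytic_extension Phi W1 U G,
      exists G, real_analytic_extension Phi W2 U G &
      forall Phi1 Phi2 : C -> C,
        real_analytic_extension Phi W1 U Phi1 ->
        real_analytic_extension Phi W2 U Phi2 ->
        forall z, U z ->
          Phi1 z - Phi2 z
          = (2 * Num.sqrt (2 * `|Delta|%:~R) : R)%:C
            * \sum_(h < 2 * N)
                \sum_(m \in [set m | exponents Delta h m /\ m < 0])
                  c m h
                  * \sum_(l \in [set l | [/\ lattice_coset r h l,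
                                             Q N l = - (`|Delta|%:~R * m),
                                             orthogonal_to N l W12 &
                                             negative_on N l W1]])
                      (genus_character N Delta l)%:~R * q_z N z l ^+ k.-1].
Proof.
move: hW1 hW2 => [z1 X1 E1] [z2 X2 E2].
have eC := @regularE R N Delta r c.
rewrite eC in X1 X2 E1 E2.
have {}E1 : W1 = chamber N (wall_vectors Delta r c) z1 by [].
have {}E2 : W2 = chamber N (wall_vectors Delta r c) z2 by [].
move: hadj => [W12n [l0 Wl0 [z0 [hz0 Pz0] arc]]].
have Pz0' : PP N l0 z0 = 0 by [].
have arc1 : \forall z \near z0, 0 < complex.Im z -> PP N l0 z = 0 -> closure (chamber N (wall_vectors Delta r c) z1) z /\ closure (chamber N (wall_vectors Delta r c) z2) z.
  apply: filterS arc => z hz h1 h2; rewrite -E1 -E2.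
  by have [[c1 _] [c2 _]] := hz (conj h1 h2).
have arc2 : \forall z \near z0, 0 < complex.Im z -> PP N l0 z = 0 -> closure (chamber N (wall_vectors Delta r c) z2) z /\ closure (chamber N (wall_vectors Delta r c) z1) z.
  by apply: filterS arc1 => z hz h1 h2; have [] := hz h1 h2.
have n12 : chamber N (wall_vectors Delta r c) z1 <> chamber N (wall_vectors Delta r c) z2 by rewrite -E1 -E2.
have n21 : chamber N (wall_vectors Delta r c) z2 <> chamber N (wall_vectors Delta r c) z1 by move=> e; apply: n12.
rewrite {}E1 {}E2 => W12 U Phi.
have U2 z : U z -> (closure_H (chamber N (wall_vectors Delta r c) z2) `|` closure_H (chamber N (wall_vectors Delta r c) z1)) z.
  by move=> [h|h]; [right|left].
split.
- exists (chamber_ext k Delta r f c z1); split.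
    by move=> z Wz; exact: (chamber_ext_in k hN D0 hc (f := f) X1 Wz).
  move=> z Uz; have [rr [M [rr0 hA]]] := chamber_ext_AN_closure k hN D0 cf hc X1 X2 Wl0 hz0 Pz0' arc1 Uz.
  exact: AN_real_analytic rr0 hA.
- exists (chamber_ext k Delta r f c z2); split.
    by move=> z Wz; exact: (chamber_ext_in k hN D0 hc (f := f) X2 Wz).
  move=> z Uz; have [rr [M [rr0 hA]]] := chamber_ext_AN_closure k hN D0 cf hc X2 X1 Wl0 hz0 Pz0' arc2 (U2 z Uz).
  exact: AN_real_analytic rr0 hA.
move=> Phi1 Phi2 [e1 a1] [e2 a2] z Uz.
rewrite (ext_unique hN D0 cf hc X1 X2 Wl0 hz0 Pz0' arc1 e1 a1 Uz).
have a2' w : (closure_H (chamber N (wall_vectors Delta r c) z2) `|` closure_H (chamber N (wall_vectors Delta r c) z1)) w -> real_analytic_at Phi2 w.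
  by move=> [h|h]; apply: a2; [right|left].
rewrite (ext_unique hN D0 cf hc X2 X1 Wl0 hz0 Pz0' arc2 e2 a2' (U2 z Uz)).
exact: (extension_jump hN hk D0 hc oppK Csym X1 X2 n12 Wl0 hz0 Pz0' arc1 Uz).
Qed.
End FINAL.

(** * The action of the square of S *)

Section SYM.
Variable R : realType.
Local Notation C := R[i].
Local Notation M2 := 'M[rat]_2.
Local Notation mu := (@lebesgue_measure R).

(** The principal root of a point of the upper half plane lies in the open first quadrant. *)
Lemma sqrtC_quadrant (tau : C) : 0 < complex.Im tau -> 0 < complex.Re (sqrtC tau) /\ 0 < complex.Im (sqrtC tau).
Proof.
move=> h; have e := sqrtCK tau.
have : 0 <= complex.Im (sqrtC tau).
  by have := @Im_rootC_ge0 C 2 tau isT; rewrite -complexIm lecR.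
have : complex.Im (sqrtC tau ^+ 2) = complex.Im tau by rewrite e.
rewrite expr2 cImM; move: (complex.Re (sqrtC tau)) (complex.Im (sqrtC tau)) => a b E b0.
have ab : 0 < a * b by move: h; rewrite -E; lra.
have bp : 0 < b by rewrite lt0r b0 andbT; apply/eqP => bz; move: ab; rewrite bz mulr0 ltxx.
by split => //; move: ab; rewrite pmulr_lgt0.
Qed.

(** With t, s the roots at tau + h and tau, the difference quotient is 1/(t + s), and
    |t + s| is bounded below because both lie in the first quadrant. *)
Lemma sqrtC_derivable (tau : C) : upper_half_plane tau -> derivable (fun z : C => sqrtC z) tau 1.
Proof.
move=> htau; have [a0 b0] := sqrtC_quadrant htau.
set s := sqrtC tau in a0 b0; have s2 : s ^+ 2 = tau by exact: sqrtCK.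
have sn : s != 0 by apply/eqP => e; move: a0; rewrite e ltxx.
have cs : 0 < cabs s by apply: lt_le_trans a0 (le_trans (ler_norm _) (Re_le_cabs _)).
apply/cvg_ex; exists (2 * s)^-1; apply/cvgrPdist_lt => e e0.
have [e1 ee] : 0 < complex.Re e /\ e = (complex.Re e)%:C.
  by move: e0; case: (e) => x y; rewrite /= ltcE /= => /andP[/eqP -> ->].
pose a := complex.Re s; pose K := (2 * cabs s * a ^+ 2)^-1.
have K0 : 0 < K by rewrite invr_gt0 !mulr_gt0 // exprn_gt0.
pose d := Num.min (complex.Im tau / 2) (complex.Re e / K / 2).
have d0 : 0 < d by rewrite lt_min !divr_gt0.
have dC : 0 < d%:C by rewrite ltcR.
near=> h.
have hn : h != 0 by near: h; exact: nbhs_dnbhs_neq.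
have hd : cabs h < d.
  suff : `|h| < d%:C by rewrite cabsE ltcR.
  near: h; apply: dnbhs0_lt => //.
have Eh : h *: (1 : C) + tau = tau + h by rewrite addrC; congr (_ + _); exact: mulr1.
rewrite /= Eh ee cabsE ltcR.
have hI : 0 < complex.Im (tau + h).
  rewrite cImD; have := le_lt_trans (Im_le_cabs h) hd; rewrite lt_min => /andP[h1 _].
  have h2 := htau; move: h1; rewrite ltr_norml => /andP[h1 _]; rewrite /upper_half_plane /= in h2; lra.
have [c0 d0'] := sqrtC_quadrant hI; set t := sqrtC (tau + h) in c0 d0' *.
have t2 : t ^+ 2 = tau + h by exact: sqrtCK.
have ts : (t - s) * (t + s) = h by rewrite -subr_sqr t2 s2 addrC addKr.
have ra : a <= cabs (t + s).
  by apply: le_trans (le_trans (ler_norm _) (Re_le_cabs _)); rewrite cReD /a lerDr ltW.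
have tsn : t + s != 0.
  by apply/eqP => z; move: ra; rewrite z cabs0 leNgt /a a0.
have -> : (2 * s)^-1 - h^-1 *: (t - s) = h / (2 * s * (t + s) ^+ 2).
  have -> : h^-1 *: (t - s) = (t + s)^-1.
    have dn : t - s != 0 by apply/eqP => z; move: hn; rewrite -ts z mul0r eqxx.
    change (h^-1 * (t - s) = (t + s)^-1).
    by rewrite -ts invfM mulrAC mulVf // mul1r.
  rewrite -ts; have tn : (2 : C) != 0 by rewrite pnatr_eq0.
  by field; rewrite ?tn ?sn ?tsn.
rewrite cabsM; have -> : cabs (2 * s * (t + s) ^+ 2)^-1 = (2 * cabs s * cabs (t + s) ^+ 2)^-1.
  have cV (x : C) : x != 0 -> cabs x^-1 = (cabs x)^-1.
    move=> xn; have cn : cabs x != 0 by rewrite cabs_eq0.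
    apply: (mulfI cn); rewrite -cabsM !divff //.
    by have -> : (1 : C) = (1 : R)%:C by []; rewrite cabsC normr1.
  rewrite cV ?mulf_neq0 ?expf_neq0 ?pnatr_eq0 //; congr (_^-1); rewrite cabsM cabsX cabsM; congr (_ * _ * _).
  have -> : (2 : C) = (2 : R)%:C by rewrite rmorph_nat.
  by rewrite cabsC ger0_norm.
apply: (@le_lt_trans _ _ (cabs h * K)).
  rewrite ler_wpM2l ?cabs_ge0 // /K lef_pV2 ?posrE ?mulr_gt0 ?exprn_gt0 ?(lt_le_trans a0 ra) //.
  by rewrite ler_wpM2l ?mulr_ge0 ?cabs_ge0 // ler_pXn2r ?nnegrE ?cabs_ge0 // ltW.
rewrite -ltr_pdivlMr //; apply: lt_le_trans hd _; rewrite /d ge_min; apply/orP; right.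
by rewrite ler_pdivrMr // ler_peMr // ?ltW ?divr_gt0 // (ltr_nat R 1 2).
Unshelve. all: by end_near. Qed.

Definition Smx : 'M[int]_2 := mx2 0 (-1) 1 0.

Lemma S_metaplectic : metaplectic Smx (fun z : C => sqrtC z).
Proof.
have [e1 e2 e3 e4] := mx2E (0 : int) (-1) 1 0; split.
- by rewrite det_mx2 e1 e2 e3 e4 mul0r sub0r mulN1r opprK.
- by move=> tau htau; exact: sqrtC_derivable.
by move=> tau _; rewrite sqrtCK /automorphy e3 e4 /= mul1r addr0.
Qed.

Lemma S_moebius (tau : C) : moebius Smx tau = - tau^-1.
Proof.
have [e1 e2 e3 e4] := mx2E (0 : int) (-1) 1 0.
by rewrite /moebius /automorphy e1 e2 e3 e4 !mulr0z mulrN1z mulr1z mul0r add0r mul1r addr0 mulN1r.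
Qed.

Lemma Im_inv (tau : C) : 0 < complex.Im tau -> 0 < complex.Im (- tau^-1).
Proof.
move=> h; have tn : tau != 0 by apply/eqP => z; move: h; rewrite z ltxx.
have e : tau * tau^-1 = 1 by rewrite divff.
have e1 := congr1 (@complex.Re R) e; have e2 := congr1 (@complex.Im R) e.
rewrite cReM /= in e1; rewrite cImM /= in e2; rewrite cImN oppr_gt0.
move: (complex.Re tau) (complex.Im tau) (complex.Re tau^-1) (complex.Im tau^-1) h e1 e2 => u v a b v0 e1 e2.
have E : b * (u ^+ 2 + v ^+ 2) = - v.
  have -> : b * (u ^+ 2 + v ^+ 2) = u * (u * b + v * a) - v * (u * a - v * b) by ring.
  by rewrite e1 e2; ring.
have p : 0 < u ^+ 2 + v ^+ 2 by apply: ltr_wpDl; [exact: sqr_ge0|exact: exprn_gt0].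
by move: v0; rewrite -oppr_lt0 -E pmulr_llt0.
Qed.

(** The product squares to -1 and has positive imaginary part. *)
Lemma S_cocycle (tau : C) : 0 < complex.Im tau -> sqrtC (- tau^-1) * sqrtC tau = 'i%C.
Proof.
move=> h; have h2 := Im_inv h.
have [a1 b1] := sqrtC_quadrant h; have [a2 b2] := sqrtC_quadrant h2.
have e : (sqrtC (- tau^-1) * sqrtC tau) ^+ 2 = ('i%C : C) ^+ 2.
  rewrite exprMn !sqrtCK sqr_i mulNr mulVf //; apply/eqP => z; by move: h; rewrite z ltxx.
move/eqP: e; rewrite eqf_sqr => /orP[/eqP //|/eqP e].
have := congr1 (@complex.Im R) e; rewrite cImM cImN /= => E.
have : 0 < complex.Re (sqrtC (- tau^-1)) * complex.Im (sqrtC tau) + complex.Im (sqrtC (- tau^-1)) * complex.Re (sqrtC tau).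
  by rewrite addr_gt0 // mulr_gt0.
by move=> p; exfalso; move: p E; move: (complex.Re _) (complex.Im _) (complex.Im _) (complex.Re _) => *; lra.
Qed.

Lemma ecn (x : R) n : ec (x * n%:R)%:C = ec x%:C ^+ n.
Proof.
elim: n => [|n IH]; first by rewrite mulr0 expr0 ec_real mulr0 cos0 sin0.
by rewrite exprS -IH -ecD; congr (ec _%:C); rewrite -natr1; ring.
Qed.

Lemma ec1 : ec (1 : R)%:C = 1.
Proof.
rewrite ec_real mulr1 mulr_natl sin_mulr2n cos_mulr2n cospi sinpi; apply/eqP; rewrite eq_complex /=.
by rewrite mulr0 mul0rn sqrrN expr1n mulr2n addrK !eqxx.
Qed.

Lemma ecN1 : ec (- (1 : R))%:C = 1.
Proof. have := ecD 1 (- (1 : R)); rewrite subrr ec1 mul1r => <-; by rewrite ec_real mulr0 cos0 sin0. Qed.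

Lemma ec_neq1 (x : R) : 0 < x < 1 -> ec (- x)%:C != 1.
Proof.
move=> /andP[x0 x1]; apply/eqP => e; have := congr1 (@complex.Re R) e; rewrite ec_real /= mulrN cosN.
have -> : 2 * pi * x = (pi * x) *+ 2 by rewrite mulr2n; ring.
rewrite cos_mulr2n cos2sin2 => h.
have : 0 < sin (pi * x) by apply: sin_gt0_pi; rewrite mulr_gt0 ?pi_gt0 //= gtr_pMr // pi_gt0.
move=> s0; have : 0 < sin (pi * x) ^+ 2 by rewrite exprn_gt0.
move: h; rewrite mulr2n; lra.
Qed.

Variables (N k : nat) (hN : (0 < N)%N) (Delta r : int) (D0 : Delta != 0).
Local Notation n := (2 * N)%N.
Let n0 : (0 < n)%N. Proof. by rewrite muln_gt0. Qed.

(** The class -h. *)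
Definition opp_idx (h : 'I_n) : 'I_n := Ordinal (ltn_pmod (n - h) n0).

Lemma opp_idx_val (h : 'I_n) : (h = 0 :> nat /\ opp_idx h = 0 :> nat) \/ ((0 < h)%N /\ (h + opp_idx h = n)%N).
Proof.
case: h => m mn /=; case: m mn => [|m] mn; first by left; rewrite subn0 modnn.
by right; split => //; rewrite modn_small ?subnKC // ?(ltnW mn) // ltn_subrL n0.
Qed.

Lemma opp_idx_iff (h h' : 'I_n) : ((h + h') %% n == 0)%N = (h' == opp_idx h).
Proof.
apply/idP/eqP => [e|->]; last first.
  by have [[-> ->]|[_ ->]] := opp_idx_val h; rewrite ?mod0n ?modnn.
apply: val_inj => /=; have hn := ltn_ord h; have hn' := ltn_ord h'.
have [h0|hp] := posnP h.
  by move: e; rewrite h0 add0n modn_small // => /eqP ->; rewrite subn0 modnn.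
have [lt|ge] := ltnP (h + h') n; first by move: e; rewrite modn_small // addn_eq0 (gtn_eqF hp).
have e2 : (h + h' - n < n)%N by rewrite -(ltn_add2r n) subnK // -addSn leq_add // ltnW.
move: e; rewrite -(subnK ge) modnDr modn_small // => /eqP e3.
have e4 : (h + h' = n)%N by apply/eqP; rewrite eqn_leq ge andbT -subn_eq0 e3.
have e5 : (n - h)%N = h' by apply/eqP; rewrite -(eqn_add2l h) subnKC ?e4 // ltnW.
by rewrite e5 modn_small.
Qed.

Lemma opp_idxK : involutive opp_idx.
Proof. by move=> h; apply/esym/eqP; rewrite -opp_idx_iff addnC opp_idx_iff. Qed.

Lemma bil_rep (h h' : 'I_n) : (ratr (bil N (rep h) (rep h')) : R) = h%:R * h'%:R / n%:R.
Proof.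
have Nn : (N%:R : rat) != 0 by rewrite pnatr_eq0 -lt0n.
have -> : bil N (rep h) (rep h') = h%:R * h'%:R / n%:R.
  rewrite /bil tr_mx2 /rep.
  have [-> -> -> ->] := mx2E (h%:R / n%:R : rat) 0 0 (- (h%:R / n%:R)).
  have [-> -> -> ->] := mx2E (h'%:R / n%:R : rat) 0 0 (- (h'%:R / n%:R)).
  by rewrite natrM; field.
by rewrite fmorph_div rmorphM /= !ratr_nat.
Qed.

Lemma Q_rep (h : 'I_n) : Q N (rep h) = h%:R ^+ 2 / (4 * N)%:R.
Proof.
have Nn : (N%:R : rat) != 0 by rewrite pnatr_eq0 -lt0n.
rewrite /Q det_mx2 /rep; have [-> -> -> ->] := mx2E (h%:R / n%:R : rat) 0 0 (- (h%:R / n%:R)).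
by rewrite !natrM; field.
Qed.

(** Orthogonality of the characters of Z/2NZ. *)
Lemma ec_sum (j : nat) : (j < 2 * n)%N -> \sum_(h < n) ec (- (h%:R * j%:R / n%:R))%:C = (if (j %% n == 0)%N then n%:R else 0) :> C.
Proof.
move=> jn; have nr : (n%:R : R) != 0 by rewrite pnatr_eq0 -lt0n.
pose w : C := ec (- (j%:R / n%:R))%:C.
have E h : ec (- (h%:R * j%:R / n%:R))%:C = w ^+ h by rewrite /w -ecn; congr (ec _%:C); ring.
under eq_bigr do rewrite E.
have wn : w ^+ n = 1.
  rewrite /w -ecn; have -> : - (j%:R / n%:R) * n%:R = (- 1) * j%:R :> R by move: (j%:R : R) (n%:R : R) nr => a b nb; rewrite mulN1r mulNr divfK.
  by rewrite ecn ecN1 expr1n.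
have w1 : w = 1 <-> (j %% n == 0)%N.
  have key i : (i < n)%N -> ec (- (i%:R / n%:R))%:C = 1 :> C -> i = 0%N.
    move=> lin e; apply/eqP/negPn/negP; rewrite -lt0n => ip.
    have : 0 < (i%:R / n%:R : R) < 1 by rewrite divr_gt0 ?ltr0n //= ltr_pdivrMr ?ltr0n // mul1r ltr_nat.
    by move=> /ec_neq1; rewrite e eqxx.
  have red : w = ec (- ((j %% n)%:R / n%:R))%:C.
    rewrite /w {1}(divn_eq j n) natrD natrM mulrDl mulfK // opprD ecD -mulN1r ecn ecN1 expr1n mul1r //.
  split; first by rewrite red => /key ->; rewrite // ltn_pmod.
  by rewrite red => /eqP ->; rewrite mul0r oppr0 ec_real mulr0 cos0 sin0.
case: ifP => hj.
  by rewrite (w1.2 hj); under eq_bigr do rewrite expr1n; rewrite sumr_const card_ord.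
have wm : w - 1 != 0 by rewrite subr_eq0; apply/eqP => /w1; rewrite hj.
by apply: (mulfI wm); rewrite mulr0 -subrX1 wn subrr.
Qed.

Variable rhoL : 'M[int]_2 -> (C -> C) -> 'M[C]_n.
Hypothesis hrhoL : weil_representation rhoL.
Local Notation RS := (rhoL Smx (fun z : C => sqrtC z)).

Lemma weil_S_entry (h' h : 'I_n) : RS h' h = ec (- (1 / 8)) / (Num.sqrt n%:R : R)%:C * ec (- (h%:R * h'%:R / n%:R))%:C.
Proof.
have [_ _ _ /(_ h) H] := hrhoL.
have := congr1 (fun A : 'cV[C]_n => A h' 0) H.
rewrite mxE (bigD1 h) //= big1 ?addr0; last first.
  by move=> i hi; rewrite /basis_vector !mxE (negPf hi) mulr0.
rewrite /basis_vector [delta_mx _ _ _ _]mxE !eqxx mulr1 => ->.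
rewrite mxE summxE (bigD1 h') //= big1 ?addr0; last first.
  by move=> i hi; rewrite !mxE eq_sym (negPf hi) mulr0.
rewrite !mxE !eqxx mulr1; congr (_ * ec _).
by rewrite ratrC bil_rep rmorphN.
Qed.

Lemma ec_quarter : ec (- (1 / 8) : C) ^+ 2 = - 'i%C.
Proof.
have -> : - (1 / 8) = (- (1 / 8) : R)%:C :> C by rewrite rmorphN rmorphM fmorphV /= !rmorph_nat.
rewrite -ecn; have -> : - (1 / 8) * 2%:R = - (1 / 4) :> R by field.
rewrite ec_real mulrN cosN sinN; have -> : 2 * pi * (1 / 4) = pi / 2 :> R by field.
by rewrite cos_pihalf sin_pihalf; apply/eqP; rewrite eq_complex /= oppr0 !eqxx.
Qed.

(** The discrete Fourier transform squares to a multiple of the reflection h -> -h. *)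
Lemma weil_S_sqr : RS *m RS = \matrix_(i, j) (if j == opp_idx i then - 'i%C else 0).
Proof.
apply/matrixP => i j; rewrite !mxE.
have -> : \sum_h RS i h * RS h j = (ec (- (1 / 8)) / (Num.sqrt n%:R : R)%:C) ^+ 2 * \sum_(h < n) ec (- (h%:R * (i + j)%:R / n%:R))%:C.
  rewrite mulr_sumr; apply: eq_bigr => h _; rewrite !weil_S_entry.
  have -> : ec (- (h%:R * (i + j)%:R / n%:R))%:C = ec (- (h%:R * i%:R / n%:R))%:C * ec (- (j%:R * h%:R / n%:R))%:C :> C.
    by rewrite -ecD; congr (ec _%:C); rewrite natrD; ring.
  by set x := ec _; set y := ec _; set z := ec _; ring.
have ij : (i + j < 2 * n)%N.
  rewrite (_ : (2 * n = n + n)%N); last by rewrite mul2n addnn.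
  by rewrite -addSn leq_add // ltnW // ltn_ord.
rewrite (ec_sum ij).
rewrite opp_idx_iff; case: (j == opp_idx i); last by rewrite mulr0.
rewrite expr_div_n ec_quarter -rmorphXn /= sqr_sqrtr // ?ler0n //.
by rewrite rmorph_nat divfK // pnatr_eq0 -lt0n.
Qed.

Variable f : C -> 'cV[C]_n.
Hypothesis hmod : forall g phi, metaplectic g phi -> forall tau, upper_half_plane tau ->
        f (moebius g tau) = phi tau ^ (3 - 2 * k%:Z) *: (map_mx Num.conj (rho_Delta Delta rhoL g phi) *m f tau).

(** The sign by which the square of S acts on the components of f. *)
Definition sym_sign : C := (sgz Delta)%:~R * (-1) ^+ k.

Lemma conj_rho_S_sqr : map_mx Num.conj (rho_Delta Delta rhoL Smx (fun z : C => sqrtC z)) *m map_mx Num.conj (rho_Delta Delta rhoL Smx (fun z : C => sqrtC z))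
  = \matrix_(i, j) (if j == opp_idx i then (sgz Delta)%:~R * 'i%C else 0).
Proof.
rewrite /rho_Delta; case: ifP => hD.
  rewrite -map_mxM weil_S_sqr (gtr0_sgz hD); apply/matrixP => i j; rewrite !mxE mul1r.
  by case: ifP => _; rewrite ?rmorph0 // rmorphN /= conjCi opprK.
have D1 : Delta < 0 by rewrite lt_neqAle D0 leNgt hD.
have -> : map_mx Num.conj (map_mx Num.conj RS) = RS by apply/matrixP => i j; rewrite !mxE conjCK.
rewrite weil_S_sqr (ltr0_sgz D1); apply/matrixP => i j; rewrite !mxE; by case: ifP => _; rewrite ?mulN1r.
Qed.

(** The automorphy factor of the square of S is i^(3-2k). *)
Lemma i_pow : ('i%C : C) ^ (3 - 2 * k%:Z) * 'i%C = (-1) ^+ k.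
Proof.
have i0 : ('i%C : C) != 0 by apply/eqP => /(congr1 (@complex.Im R)) /= /eqP; rewrite oner_eq0.
have -> : ('i%C : C) ^ (3 - 2 * k%:Z) * 'i%C = 'i%C ^ (3 - 2 * k%:Z + 1) by rewrite [in RHS]expfzDr // expr1z.
have -> : 3 - 2 * k%:Z + 1 = 4 + - (2 * k)%N%:Z by rewrite PoszM; ring.
have h4 : ('i%C : C) ^+ 4 = 1 by rewrite (exprM _ 2 2) sqr_i sqrrN expr1n.
rewrite expfzDr //; have -> : ('i%C : C) ^ 4 = 1 by exact: h4.
rewrite mul1r -exprnN exprM sqr_i.
by rewrite -signr_odd; case: (odd k); rewrite ?expr1 ?expr0 ?invrN ?invr1.
Qed.

(** The transformation law is applied twice with abstract terms in place of S. *)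
Lemma slash_twice (m : int) (x y z : C) (A : 'M[C]_n) (F0 F1 F2 : 'cV[C]_n) :
  F2 = x ^ m *: (A *m F1) -> F1 = y ^ m *: (A *m F0) -> x * y = z -> F2 = z ^ m *: ((A *m A) *m F0).
Proof. by move=> -> -> <-; rewrite -scalemxAr scalerA mulmxA -expfzMl. Qed.

(** S^2 acts trivially on the upper half plane. *)
Lemma form_symmetry (tau : C) h : 0 < complex.Im tau -> f tau h 0 = sym_sign * f tau (opp_idx h) 0.
Proof.
move=> ht; have hs := Im_inv ht.
have S1 := hmod S_metaplectic ht; have S2 := hmod S_metaplectic hs.
rewrite !S_moebius in S1 S2.
have tn : tau != 0 by apply/eqP => z; move: ht; rewrite z ltxx.
have E : f tau = ('i%C ^ (3 - 2 * k%:Z)) *: (\matrix_(i, j) (if j == opp_idx i then (sgz Delta)%:~R * 'i%C else 0) *m f tau).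
  transitivity (f (- (- tau^-1)^-1)); first by rewrite invrN opprK invrK.
  rewrite -conj_rho_S_sqr; exact: (slash_twice S2 S1 (S_cocycle ht)).
rewrite {1}E !mxE (bigD1 (opp_idx h)) //= big1 ?addr0; last by move=> j hj; rewrite !mxE (negPf hj) mul0r.
rewrite !mxE eqxx !mulrA /sym_sign; congr (_ * _).
by rewrite -i_pow; move: ('i%C ^ (3 - 2 * k%:Z) : C) ('i%C : C) ((sgz Delta)%:~R : C) => x y z; ring.
Qed.

Variable c : rat -> 'I_n -> C.
Hypothesis hc : principal_part Delta f c.

(** Q is well defined modulo 1 on classes. *)
Lemma Q_rep_opp (h : 'I_n) : exists z : int, Q N (rep (opp_idx h)) = Q N (rep h) + z%:~R.
Proof.
rewrite !Q_rep; have [[-> ->]|[hp e]] := opp_idx_val h; first by exists 0; rewrite addr0.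
exists (N%:Z - h%:Z); have Nn : (N%:R : rat) != 0 by rewrite pnatr_eq0 -lt0n.
have -> : (opp_idx h)%:R = n%:R - h%:R :> rat by have := congr1 (fun m : nat => m%:R : rat) e; rewrite natrD => <-; rewrite addrC addKr.
by rewrite intrB -!pmulrn !natrM; field.
Qed.

Lemma exponents_opp h m : exponents Delta (opp_idx h) m <-> exponents Delta h m.
Proof.
have [z hz] := Q_rep_opp h; rewrite /exponents /= hz mulrDr addrA -intrM.
by split => H; [rewrite -(rpredDr _ (intr_int _ (sgz Delta * z)))|rewrite rpredD // intr_int].
Qed.

(** The difference of the two principal parts decays exponentially, and its
    coefficient at m is recovered from the integral over a period of u at height
    v, after multiplication by e(-mu). For m <= 0 it is bounded by a decaying function of v. *)
Lemma coef_symmetry h m : exponents Delta h m -> m <= 0 -> c m h = sym_sign * c m (opp_idx h).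
Proof.
move=> em m0.
have [e [A [B [e0 hP]]]] := polar_hyp hc.
pose M : {fset rat} := (m |` (Ms Delta c h `|` Ms Delta c (opp_idx h)))%fset.
(* the coefficients of the difference of the two principal parts *)
pose dd m := c m h - sym_sign * c m (opp_idx h).
have inM m' : m' \in M -> exponents Delta h m' /\ m' <= 0.
  rewrite !inE => /orP[/eqP -> //|/orP[/(in_Ms hc)[]//|/(in_Ms hc)[/exponents_opp]//]].
have polM h' tau : (Ms Delta c h' `<=` M)%fset -> (forall m', m' \in M -> exponents Delta h' m' /\ m' <= 0) ->
   polar (Ms Delta c h') (fun m => c m h') tau = \sum_(m' <- M) c m' h' * ec (ratr m' * tau).
  move=> sM hM; rewrite /polar (fsum_split _ sM) [X in _ = _ + X]big_seq [X in _ = _ + X]big1 ?addr0 // => m'.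
  rewrite in_fsetD => /andP[nM /hM[a b]]; suff -> : c m' h' = 0 by rewrite mul0r.
  by apply/eqP/negPn/negP => c0; move: nM => /negP; apply; apply/(in_Ms hc).
have p1 tau : polar (Ms Delta c h) (fun m => c m h) tau = \sum_(m' <- M) c m' h * ec (ratr m' * tau).
  by apply: polM => //; apply/fsubsetP => x xM; rewrite !inE xM orbT.
have p2 tau : polar (Ms Delta c (opp_idx h)) (fun m => c m (opp_idx h)) tau = \sum_(m' <- M) c m' (opp_idx h) * ec (ratr m' * tau).
  apply: polM; first by apply/fsubsetP => x xM; rewrite !inE xM !orbT.
  by move=> m' /inM[a b]; split => //; apply/exponents_opp.
pose Dp tau := \sum_(m' <- M) dd m' * ec (ratr m' * tau).
have ce : cabs sym_sign = 1.
  rewrite /sym_sign cabsM cabsX (cabsN 1) (cabsC (1 : R)) normr1 expr1n mulr1 cabs_int.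
  by rewrite normr_sgz D0.
have bD u v : 0 < v -> B <= v -> cabs (Dp (u +i* v)) <= 2 * A * expR (- (e * v)).
  move=> v0 Bv; have ht : 0 < complex.Im (u +i* v) by [].
  have -> : Dp (u +i* v) = sym_sign * (f (u +i* v) (opp_idx h) 0 - polar (Ms Delta c (opp_idx h)) (fun m => c m (opp_idx h)) (u +i* v)) - (f (u +i* v) h 0 - polar (Ms Delta c h) (fun m => c m h) (u +i* v)).
    rewrite mulrBr -(form_symmetry h ht) opprB addrC addrA subrK p1 p2 mulr_sumr -sumrB /Dp; apply: eq_bigr => m' _.
    by rewrite /dd; set x := ec _; ring.
  rewrite (le_trans (cabsD _ _)) // cabsN cabsM ce mul1r.
  have -> : 2 * A * expR (- (e * v)) = A * expR (- (e * v)) + A * expR (- (e * v)) by ring.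
  by rewrite lerD // hP.
have mI : measurable (`[- (1 / 2), 1 / 2] : set (measurableTypeR R)) by [].
have coef v : 0 < v -> B <= v -> cabs (dd m) <= 4 * A * expR (- (e * v)).
  move=> v0 Bv.
  pose g u := ec (- (ratr m * u))%:C * Dp (u +i* v).
  have nn m' : m' \in M -> exists z : int, ratr m' - ratr m = z%:~R :> R.
    move=> /inM[/intrP[z1 h1] _]; move/intrP: (em) => [z2 h2]; exists (z1 - z2).
    rewrite intrB -(ratr_int R z1) -(ratr_int R z2) -h1 -h2 -!rmorphB; congr ratr; ring.
  pose zz m' : int := if m' \in M then Num.floor (ratr m' - ratr m : R) else 0.
  have zzE m' : m' \in M -> (zz m')%:~R = ratr m' - ratr m :> R.
    by move=> mM; rewrite /zz mM; have [z ->] := nn m' mM; rewrite intrKfloor.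
  have gE u : g u = \sum_(m' <- M) (dd m' * (expR (- (2 * pi * ratr m' * v)))%:C) * ec ((zz m')%:~R * u)%:C.
    rewrite /g /Dp mulr_sumr [LHS]big_seq [RHS]big_seq; apply: eq_bigr => m' mM.
    rewrite ec_ratr zzE //; have -> : (ratr m' - ratr m) * u = - (ratr m * u) + ratr m' * u by ring.
    by rewrite ecD; set x := ec _; set y := ec _; ring.
  have ig m' : cintble mu (`[- (1 / 2), 1 / 2] : set (measurableTypeR R)) (fun u => (dd m' * (expR (- (2 * pi * ratr m' * v)))%:C) * ec ((zz m')%:~R * u)%:C).
    by apply: (cintbleZ mI); exact: ec_cintble.
  have I1 : cint mu (`[- (1 / 2), 1 / 2] : set (measurableTypeR R)) g = dd m * (expR (- (2 * pi * ratr m * v)))%:C.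
    transitivity (cint mu (`[- (1 / 2), 1 / 2] : set (measurableTypeR R)) (fun u => \sum_(m' <- M) (dd m' * (expR (- (2 * pi * ratr m' * v)))%:C) * ec ((zz m')%:~R * u)%:C)); first by apply: eq_cint => u _; exact: gE.
    rewrite (cint_sum mI) //.
    have mM : m \in M by rewrite !inE eqxx.
    rewrite (big_rem m mM) /= (cintZ mI); last exact: ec_cintble.
    have zm : zz m = 0 by apply/eqP; rewrite -(intr_eq0 R) zzE // subrr.
    rewrite ec_u zm eqxx mulr1 big_seq big1 ?addr0 // => m'.
    rewrite mem_rem_uniq ?fset_uniq // inE => /andP[mm' m'M].
    rewrite (cintZ mI); last exact: ec_cintble.
    rewrite ec_u; have -> : (zz m' == 0) = false; last by rewrite mulr0.
    by rewrite -(intr_eq0 R) zzE // subr_eq0 (inj_eq (fmorph_inj _)) (negPf mm').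
  have ig2 : cintble mu (`[- (1 / 2), 1 / 2] : set (measurableTypeR R)) g.
    have := cintble_sum mI (enum_fset M) ig; apply: (eq_cintble mI) => u _; by rewrite gE.
  have iw : mu.-integrable (`[- (1 / 2), 1 / 2] : set (measurableTypeR R)) (EFin \o (fun=> 2 * A * expR (- (e * v)))).
    by apply: cont_integrable; exact: cst_continuous.
  have := cint_bound mI ig2 iw (fun u _ => _).
  rewrite I1 cabsM cabs_expR => H.
  have gb u : cabs (g u) <= 2 * A * expR (- (e * v)) by rewrite /g cabsM cabs_ec mul1r bD.
  have {H} := H gb.
  rewrite Rintegral_cst //= lebesgue_measure_itv /= lte_fin.
  have -> : (- (1 / 2) < 1 / 2 :> R) by lra.
  rewrite -EFinD /=; have -> : 1 / 2 - - (1 / 2) = 1 :> R by field.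
  have -> : 2 * (2 * A * expR (- (e * v)) * 1) = 4 * A * expR (- (e * v)) by ring.
  apply: le_trans.
  rewrite -[leLHS]mulr1 ler_wpM2l ?cabs_ge0 // -[leLHS]expR0 ler_expR oppr_ge0 mulr_le0_ge0 ?(ltW v0) //.
  by rewrite mulr_ge0_le0 ?mulr_ge0 ?pi_ge0 // lerq0.
have d0 : dd m = 0.
  apply/eqP; rewrite -cabs_eq0 eq_le cabs_ge0 andbT.
  apply/ler_addgt0Pl => x x0; rewrite addr0.
  have [T hT] := clim_exp (4 * A) e0 x0.
  pose v := Num.max (Num.max B 1) (T + 1).
  have v0 : 0 < v by rewrite lt_max lt_max ltr01 orbT.
  have Bv : B <= v by rewrite /v !le_max lexx.
  have Tv : T < v by rewrite /v lt_max ltrDl ltr01 orbT.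
  have := hT v Tv; rewrite subr0 cabsC => h1.
  exact: le_trans (coef v v0 Bv) (le_trans (ler_norm _) (ltW h1)).
by apply/eqP; rewrite -subr_eq0; apply/eqP.
Qed.

End SYM.

(** * The symmetry of the coefficients and the wall-crossing formula *)

Section CSYM.
Variable R : realType.
Local Notation C := R[i].
Local Notation M2 := 'M[rat]_2.
Local Notation K := kronecker.

Variables (N : nat) (hN : (0 < N)%N) (Delta r : int) (fD : fundamental_discriminant Delta)
  (hr : (Delta = r ^+ 2 %[mod (4 * N)%:Z])%Z).

Lemma fund_neq0 : Delta != 0.
Proof.
case: fD => [[h _]|[m [-> h _]]]; apply/eqP => e; first by move: h; rewrite e.
by move: h; have -> : m = 0; [move: e => /eqP; rewrite mulf_eq0 => /orP[//|/eqP]|case].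
Qed.

Lemma coef_opp (l : M2) : [/\ coef_a N (- l) = - coef_a N l, coef_b N (- l) = - coef_b N l, coef_c (- l) = - coef_c l & Q N (- l) = Q N l].
Proof.
split; rewrite /coef_a /coef_b /coef_c /Q ?mxE ?mulrN //.
by rewrite !det_mx2 !mxE; ring.
Qed.

(** Negate the form. *)
Lemma represented_opp (a b c n : int) : genus_represented N (- a) (- b) (- c) (- n) <-> genus_represented N a b c n.
Proof.
split=> -[N1 [N2 [X [Y [h1 h2 h3 h4]]]]]; exists N1, N2, X, Y; split => //.
  by rewrite -[n]opprK h4; ring.
by rewrite h4; ring.
Qed.

(** The discriminant b^2 - 4Nac of the form attached to lambda. *)
Lemma Q_int (l : M2) : Lint N l -> (4 * N)%:R * Q N l =
  (numq (coef_b N l) ^+ 2 - 4 * N%:Z * numq (coef_a N l) * numq (coef_c l))%:~R.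
Proof.
move=> [t /numqK ha /numqK hb /numqK hc]; have Nn : (N%:R : rat) != 0 by rewrite pnatr_eq0 -lt0n.
have e4 : (4 : int)%:~R = 4%:R :> rat by [].
rewrite rmorphB rmorphXn !rmorphM /= ha hb hc e4 -pmulrn /coef_a /coef_b /coef_c /Q det_mx2 t !natrM; ring.
Qed.

(** The forms of -lambda represent the negatives of the integers represented by those of
    lambda, and (Delta/-1) = sgn Delta. The choice of n is immaterial by
    genus_value_uniq; if there is no admissible n, both sides are 0 (for Delta = 1 the symbol is constantly 1). *)
Lemma genus_character_opp (l : M2) : Lint N l -> genus_character N Delta (- l) = sgz Delta * genus_character N Delta l.
Proof.
move=> hl; have [ea eb ec eQ] := coef_opp l.
rewrite /genus_character ea eb ec eQ !numqN.
have -> : gcdz (gcdz (gcdz (- numq (coef_a N l)) (- numq (coef_b N l))) (- numq (coef_c l))) Delta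
   = gcdz (gcdz (gcdz (numq (coef_a N l)) (numq (coef_b N l))) (numq (coef_c l))) Delta.
  by rewrite !gcdNz !gcdzN.
case: asboolP => [[[m [s [hm hs]]] _]|_]; last by rewrite mulr0.
have D0 := fund_neq0; have hQ := Q_int hl.
move: (numq (coef_a N l)) (numq (coef_b N l)) (numq (coef_c l)) hQ => a b c hQ.
have disc : b ^+ 2 - 4 * N%:Z * a * c = Delta * m.
  apply/eqP; rewrite -(eqr_int rat) -hQ intrM -hm [X in _ == X]mulrC divfK ?intr_eq0 //.
have [D1|D1] := eqVneq Delta 1; first by rewrite D1 !kronecker_l1.
have u1 : `|Delta|%N == 1%N = false by apply/eqP => h; move/eqP: D1; apply; apply: fund_unit => //; rewrite h.
have neq0 n : coprimez n Delta -> n != 0.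
  by apply: contraTneq => ->; rewrite /coprimez gcd0z eqz_nat u1.
set S' := [set n | _ /\ genus_represented N (- a) _ _ n].
set S := [set n | _ /\ genus_represented N a _ _ n].
have SS n : S' n <-> S (- n).
  rewrite /S' /S /= -[in X in X <-> _](opprK n) represented_opp; split=> -[h1 h2]; split => //.
    by move: h1; rewrite !coprimezE !abszN.
  by move: h1; rewrite !coprimezE !abszN.
have [[n Sn]|nS] := pselect (exists n, S n); last first.
  rewrite !xgetPN; first by rewrite /kronecker /= u1 mulr0.
    by move=> n Sn; apply: nS; exists n.
  by move=> n /SS Sn; apply: nS; exists (- n).
have [c1 r1] : S (xget 0 S) by exact: (xgetPex 0 (ex_intro _ n Sn)).
have S'n : S' (- n) by apply/SS; rewrite opprK.
have S2 : S' (xget 0 S') by exact: (xgetPex 0 (ex_intro _ (- n) S'n)).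
have [c2 r2] := (SS _).1 S2.
rewrite (genus_value_uniq hN fD (dvdz_modE hr) (dvdz_modE hs) disc c1 c2 r1 r2).
have n0 := neq0 _ c2.
have -> : xget 0 S' = -1 * - xget 0 S' by rewrite mulN1r opprK.
rewrite kroneckerMr //; congr (_ * _); last by rewrite mulN1r opprK.
rewrite kronecker_rN1; have [h|h|h] := ltrgtP Delta 0; first by rewrite ltr0_sgz.
  by rewrite gtr0_sgz.
by rewrite h eqxx in D0.
Qed.

Variable k : nat.

Lemma coset_opp h (l : M2) : @lattice_coset N r h l -> lattice_coset r (opp_idx hN h) (- l).
Proof.
move=> [a [b [c e]]].
have N2 : (2 * N)%:R != 0 :> rat by rewrite pnatr_eq0 muln_eq0 -lt0n.
have Nn : (N%:R : rat) != 0 by rewrite pnatr_eq0 -lt0n.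
have [d hd] : exists d : int, h%:R / (2 * N)%:R + (opp_idx hN h)%:R / (2 * N)%:R = d%:~R :> rat.
  have [[-> ->]|[_ eh]] := opp_idx_val hN h; first by exists 0; rewrite mul0r addr0.
  by exists 1; rewrite -mulrDl -natrD eh divff.
have El : l = mx2 b%:~R (- a%:~R / N%:R) c%:~R (- b%:~R) + r%:~R *: rep h by rewrite -e subrK.
have [m1 m2 m3 m4] := mx2E (b%:~R : rat) (- a%:~R / N%:R) c%:~R (- b%:~R).
exists (- a), (- b - r * d), (- c).
have [p1 p2 p3 p4] := mx2E ((- b - r * d)%:~R : rat) (- (- a)%:~R / N%:R) (- c)%:~R (- (- b - r * d)%:~R).
have [r1 r2 r3 r4] := mx2E (h%:R / (2 * N)%:R : rat) 0 0 (- (h%:R / (2 * N)%:R)).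
have [s1 s2 s3 s4] := mx2E ((opp_idx hN h)%:R / (2 * N)%:R : rat) 0 0 (- ((opp_idx hN h)%:R / (2 * N)%:R)).
have eD : (- b - r * d)%:~R = - b%:~R - r%:~R * (h%:R / (2 * N)%:R + (opp_idx hN h)%:R / (2 * N)%:R) :> rat.
  by rewrite hd rmorphB rmorphN rmorphM.
have E i j : (- l - r%:~R *: rep (opp_idx hN h)) i j = - (mx2 b%:~R (- a%:~R / N%:R) c%:~R (- b%:~R)) i j - r%:~R * rep h i j - r%:~R * rep (opp_idx hN h) i j.
  by rewrite El !mxE; ring.
apply: mx2_eq; rewrite E /rep.
- by rewrite m1 r1 s1 p1 eD; ring.
- by rewrite m2 r2 s2 p2 rmorphN /=; ring.
- by rewrite m3 r3 s3 p3 rmorphN /=; ring.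
- by rewrite m4 r4 s4 p4 eD; ring.
Qed.

Lemma Lam_opp h (l : M2) : @Lam N Delta r h l -> @Lam N Delta r (opp_idx hN h) (- l).
Proof.
move=> [h1 [n hn]]; split; first exact: coset_opp.
have [z hz] := Q_rep_opp hN h; have [_ _ _ ->] := coef_opp l; exists (n - z).
by rewrite hz mulrDr opprD addrA hn mulrBr intrB [(Delta * z)%:~R]intrM.
Qed.

Lemma Lam_oppE h (l : M2) : @Lam N Delta r (opp_idx hN h) (- l) <-> @Lam N Delta r h l.
Proof. by split; [move/Lam_opp; rewrite opp_idxK opprK|exact: Lam_opp]. Qed.

Lemma chih_opp h (l : M2) : @chih R N Delta r (opp_idx hN h) (- l) = (sgz Delta)%:~R * @chih R N Delta r h l.
Proof.
rewrite /chih; have [hl|hl] := pselect (@Lam N Delta r h l).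
  rewrite (asboolT hl) asboolT; last exact: Lam_opp.
  by rewrite genus_character_opp ?intrM //; exact: (Lam_Lint hN hl).
by rewrite (asboolF hl) asboolF ?mulr0 // => /Lam_oppE.
Qed.

Variables (f : C -> 'cV[C]_(2 * N)) (c : rat -> 'I_(2 * N) -> C) (hc : principal_part Delta f c).
Variable rhoL : 'M[int]_2 -> (C -> C) -> 'M[C]_(2 * N).
Hypothesis hrhoL : weil_representation rhoL.
Hypothesis hmod : forall g phi, metaplectic g phi -> forall tau, upper_half_plane tau ->
        f (moebius g tau) = phi tau ^ (3 - 2 * k%:Z) *: (map_mx Num.conj (rho_Delta Delta rhoL g phi) *m f tau).

(** The residue is the coefficient itself, since the exponents are distinct. *)
Lemma sum_Ms h (q : rat) : \sum_(m <- Ms Delta c h | m == q) c m h = if `[< exponents Delta h q /\ q <= 0 >] then c q h else 0.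
Proof.
rewrite -big_filter; have [qM|qM] := boolP (q \in Ms Delta c h).
  rewrite filter_pred1_uniq ?fset_uniq // big_seq1 asboolT //.
  by have [] := (in_Ms hc h q).1 qM.
rewrite big_filter big_seq_cond big1; last by move=> m /andP[mM /eqP e]; move: qM; rewrite -e mM.
case: asboolP => // -[h1 h2]; apply/esym/eqP/negPn/negP => c0; move/negP: qM; apply; exact/(in_Ms hc h q).
Qed.

(** Both factors of the coefficient change by a sign, by coef_symmetry and by
    genus_character_opp; the two signs of Delta cancel. *)
Lemma Ch_symmetry h (l : M2) : Ch Delta r c (opp_idx hN h) (- l) = (-1) ^+ k * Ch Delta r c h l.
Proof.
rewrite /Ch chih_opp !sum_Ms; have [_ _ _ ->] := coef_opp l.
set q := - (Q N l / _).
have ss : (sgz Delta)%:~R * (sgz Delta)%:~R = 1 :> C.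
  by rewrite -intrM; have D0 := fund_neq0; have [h'|h'|h'] := ltrgtP Delta 0;
    [rewrite ltr0_sgz|rewrite gtr0_sgz|rewrite h' eqxx in D0].
have [H|H] := pselect (exponents Delta h q /\ q <= 0); last first.
  rewrite (asboolF H) asboolF ?mul0r ?mulr0 // => -[/exponents_opp h1 h2]; exact: H.
rewrite (asboolT H) asboolT; last by case: H => h1 h2; split => //; apply/exponents_opp.
have [h1 h2] := H; rewrite [in RHS](coef_symmetry hN fund_neq0 hrhoL hmod hc h1 h2) /sym_sign.
have kk : (-1) ^+ k * (-1) ^+ k = 1 :> C by rewrite -exprMn mulrNN mulr1 expr1n.
move: (c q (opp_idx hN h)) (chih _ _ _ _ _) ss kk => u v; set s := (sgz Delta)%:~R; set e := (-1) ^+ k => _ kk.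
transitivity (e * e * (u * (s * v))); first by rewrite kk mul1r.
ring.
Qed.

End CSYM.

Theorem theorem4p4 (R : realType) (N k : nat) (hN : (0 < N)%N) (hk : (0 < k)%N)
  (Delta r : int) (hDelta : fundamental_discriminant Delta)
  (hr : (Delta = r ^+ 2 %[mod (4 * N)%:Z])%Z)
  (rhoL : 'M[int]_2 -> (R[i] -> R[i]) -> 'M[R[i]]_(2 * N))
  (hrhoL : weil_representation rhoL)
  (f : R[i] -> 'cV[R[i]]_(2 * N))
  (hf : harmonic_maass_form Delta rhoL (3 - 2 * k%:Z) f)
  (c : rat -> 'I_(2 * N) -> R[i]) (hc : principal_part Delta f c)
  (W1 W2 : set R[i])
  (hW1 : weyl_chamber Delta r c W1) (hW2 : weyl_chamber Delta r c W2)
  (hadj : adjacent_chambers Delta r c W1 W2) :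
  let W12 := closure_H W1 `&` closure_H W2 in
  let U := closure_H W1 `|` closure_H W2 in
  let Phi := theta_lift Delta r k f in
  [/\ exists G, real_analytic_extension Phi W1 U G,
      exists G, real_analytic_extension Phi W2 U G &
      forall Phi1 Phi2 : R[i] -> R[i],
        real_analytic_extension Phi W1 U Phi1 ->
        real_analytic_extension Phi W2 U Phi2 ->
        forall z, U z ->
          Phi1 z - Phi2 z
          = (2 * Num.sqrt (2 * `|Delta|%:~R) : R)%:C
            * \sum_(h < 2 * N)
                \sum_(m \in [set m | exponents Delta h m /\ m < 0])
                  c m h
                  * \sum_(l \in [set l | [/\ lattice_coset r h l,
                                             Q N l = - (`|Delta|%:~R * m),
                                             orthogonal_to N l W12 &
                                             negative_on N l W1]])
                      (genus_character N Delta l)%:~R * q_z N z l ^+ k.-1].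
Proof.
have [hsm hmod _ _ _] := hf.
have cf h z : 0 < complex.Im z -> {for z, continuous (fun tau => f tau h 0)}.
  by move=> hz; have [cont _] := hsm h 0%N; exact: cont.
exact: (wall_crossing_of_symmetry hN hk (fund_neq0 hDelta) cf hc (@opp_idxK N hN)
  (Ch_symmetry hN hDelta hr hc hrhoL hmod) hW1 hW2 hadj).
Qed.
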